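(* There exists $\epsilon>0$ such that for every fixed $G\in(-\epsilon,\epsilon)$ and all sufficiently large $H$ there exists a continuous curve of solutions of the finite-depth water wave problem $$\Delta\psi=-\Omega \ \text{ in } D,\qquad \psi=0\ \text{ on } S,\qquad \tfrac12|\nabla\psi|^2+Gy=B\ \text{ on } S,\qquad \psi=Q\ \text{ on } \{y=-H\},$$ which starts at a laminar flow and ends at a touching wave (with $G$ and $H$ the same along the whole curve, while $\Omega$, $B$, $Q$, $D$, $S$, $\psi$ vary along it).
   Context: Here $G,\Omega,B,Q$ are real constants (dimensionless gravity, constant vorticity, Bernoulli constant, and an a priori unknown constant value of $\psi$ on the bottom), and $H>0$. Solutions. For $0<d<\infty$ let $\mathbb S_d=\{\alpha+i\beta\in\mathbb C:-d<\beta<0\}$ and identify $\mathbb R^2$ with $\mathbb C$. A solution consists of $\Omega,B,Q\in\mathbb R$, a domain $D\subset\mathbb R^2$ which is $2\pi$-periodic in $x$, bounded below by the line $\{y=-H\}$ and bounded above by a free surface $S$, and a stream function $\psi$ on $\overline D$, such that the displayed equations hold. $D$ and $\psi$ are $2\pi$-periodic in $x$ and symmetric under reflection in the vertical lines beneath the crest and the trough. The domain is described by a unique $d\in(0,\infty)$ and a conformal bijection $z=x+iy:\mathbb S_d\to D$ that extends continuously to $\{\beta=-d\}$, mapping it onto $\{y=-H\}$, and extends in a $C^1$ fashion to $\{\beta=0\}$ with $z_\alpha\ne0$ there, such that $x-\alpha$ and $y$ are $2\pi$-periodic in $\alpha$ and $S$ is the curve $\alpha\mapsto z(\alpha+i0)$.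 $S$ need not be a graph over the $x$-axis. The curve $\alpha\mapsto z(\alpha+i0)$ is injective, except for touching waves as defined below. Values of $\nabla\psi$ on $S$ are limits from inside $D$ along the corresponding part of $S$. Laminar flow: a solution for which $S$ is a horizontal line and $\psi$ depends only on $y$. Touching wave: a solution whose profile touches itself tangentially: modulo the period, there is exactly one pair $\alpha_1<\alpha_2$ with $z(\alpha_1+i0)=z(\alpha_2+i0)$, the tangent lines of $S$ there coincide, and the closed loop $z([\alpha_1,\alpha_2])$ encloses a bounded region (a bubble of air) not belonging to $D$. Continuous curve of solutions: a family of solutions indexed by $t\in[0,1]$ such that $\Omega_t$, $B_t$ and the conformal depth $d_t$ are continuous in $t$ and the boundary trace $\alpha\mapsto y_t(\alpha+i0)$ depends continuously on $t$ in the Hölder space $C^{3+\theta}(\mathbb R/2\pi\mathbb Z)$ for a fixed $\theta\in(0,1)$. *)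

(* Defs.v *)
From Stdlib Require Import Reals.
From Coquelicot Require Import Coquelicot.
Open Scope R_scope.

(* The plane R^2 is identified with Coquelicot's C = R * R, p = (Re p, Im p). *)

Definition closure (U : C -> Prop) (p : C) : Prop :=
  forall V : C -> Prop, locally p V -> exists q, V q /\ U q.

Definition boundary (U : C -> Prop) (p : C) : Prop :=
  closure U p /\ closure (fun q => ~ U q) p.

Definition connected (U : C -> Prop) : Prop :=
  forall V W : C -> Prop, open V -> open W ->
    (forall p, U p -> V p \/ W p) ->
    (forall p, U p -> V p -> W p -> False) ->
    (forall p, U p -> V p) \/ (forall p, U p -> W p).

Definition is_domain (U : C -> Prop) : Prop :=
  (exists p, U p) /\ open U /\ connected U.

Definition sup_norm (f : R -> R) : Rbar :=
  Lub_Rbar (fun r => exists a, r = Rabs (f a)).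

(* For a 2 PI-periodic f the supremum over all real a <> b equals the one taken
   with the distance of the circle, since larger distances only decrease the
   quotient. *)
Definition holder_seminorm (theta : R) (f : R -> R) : Rbar :=
  Lub_Rbar (fun r => exists a b, a <> b /\
    r = Rabs (f a - f b) / Rpower (Rabs (a - b)) theta).

Fixpoint Ck_norm (k : nat) (f : R -> R) : Rbar :=
  match k with
  | O => sup_norm f
  | S j => Rbar_plus (Ck_norm j f) (sup_norm (Derive_n f k))
  end.

Definition holder_norm (k : nat) (theta : R) (f : R -> R) : Rbar :=
  Rbar_plus (Ck_norm k f) (holder_seminorm theta (Derive_n f k)).

(* C^{k+theta}(R / 2 PI Z); continuity of the k-th derivative follows from the
   finiteness of its seminorm. *)
Definition holder_space (k : nat) (theta : R) (f : R -> R) : Prop :=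
  (forall a, f (a + 2 * PI) = f a) /\
  (forall j a, (j <= k)%nat -> ex_derive_n f j a) /\
  Rbar_lt (holder_norm k theta f) p_infty.

Definition strip (d : R) (a : C) : Prop := - d < Im a < 0.

Definition closed_strip (d : R) (a : C) : Prop := - d <= Im a <= 0.

(* Raw data.  Only the values of [conf] on the closed strip and those of
   [stream] on the closure of [domain] are meaningful. *)
Record wave : Type := Wave {
  vorticity : R;
  bernoulli : R;
  bottom_value : R;
  depth : R;
  domain : C -> Prop;
  stream : R -> R -> R;
  conf : C -> C
}.

Definition psi (w : wave) (p : C) : R := stream w (Re p) (Im p).

Definition trace (w : wave) (alpha : R) : C := conf w (alpha, 0).

Definition free_surface (w : wave) (p : C) : Prop :=
  exists alpha, trace w alpha = p.

Definition conformal_description (H : R) (w : wave) : Prop :=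
  let d := depth w in
  let z := conf w in
  0 < d /\
  (forall a, strip d a -> ex_derive z a) /\
  (forall a b, strip d a -> strip d b -> z a = z b -> a = b) /\
  (forall p, domain w p <-> exists a, strip d a /\ z a = p) /\
  (forall a, Im a = - d ->
     filterlim z (within (strip d) (locally a)) (locally (z a))) /\
  (forall p, Im p = - H <-> exists a, Im a = - d /\ z a = p) /\
  (forall alpha,
     filterlim z (within (strip d) (locally ((alpha, 0) : C)))
       (locally (trace w alpha)) /\
     exists z_alpha : C,
       z_alpha <> 0%C /\
       is_derive (trace w) alpha z_alpha /\
       filterlim (C_derive z) (within (strip d) (locally ((alpha, 0) : C)))
         (locally z_alpha)) /\
  (forall a, closed_strip d a ->
     z (Cplus a (RtoC (2 * PI))) = Cplus (z a) (RtoC (2 * PI))).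

Definition fluid_domain (H : R) (w : wave) : Prop :=
  is_domain (domain w) /\
  (forall p, domain w p -> - H < Im p) /\
  (forall p, boundary (domain w) p <-> free_surface w p \/ Im p = - H).

Definition periodic_x (w : wave) : Prop :=
  (forall p, domain w (Cplus p (RtoC (2 * PI))) <-> domain w p) /\
  (forall p, closure (domain w) p -> psi w (Cplus p (RtoC (2 * PI))) = psi w p).

Definition reflect (c : R) (p : C) : C := (2 * c - Re p, Im p).

Definition symmetric_about (c : R) (w : wave) : Prop :=
  (forall p, domain w (reflect c p) <-> domain w p) /\
  (forall p, closure (domain w) p -> psi w (reflect c p) = psi w p).

Definition is_crest (w : wave) (alpha : R) : Prop :=
  forall b, Im (trace w b) <= Im (trace w alpha).

Definition is_trough (w : wave) (alpha : R) : Prop :=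
  forall b, Im (trace w alpha) <= Im (trace w b).

Definition reflection_symmetric (w : wave) : Prop :=
  forall alpha, is_crest w alpha \/ is_trough w alpha ->
    symmetric_about (Re (trace w alpha)) w.

(* The gradient of psi on the surface is the limit of (grad psi) o z at the
   boundary point alpha of the strip, so that at a self-contact point each of
   the two branches carries its own value. *)
Definition water_wave_equations (G H : R) (w : wave) : Prop :=
  let psi_x (p : C) := partial_derive 1 0 (stream w) (Re p) (Im p) in
  let psi_y (p : C) := partial_derive 0 1 (stream w) (Re p) (Im p) in
  (forall p, closure (domain w) p ->
     filterlim (psi w) (within (closure (domain w)) (locally p))
       (locally (psi w p))) /\
  (forall p, domain w p ->
     ex_diff_n (stream w) 2 (Re p) (Im p) /\
     partial_derive 2 0 (stream w) (Re p) (Im p)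
       + partial_derive 0 2 (stream w) (Re p) (Im p) = - vorticity w) /\
  (forall alpha, psi w (trace w alpha) = 0) /\
  (forall alpha, exists gx gy : R,
     filterlim (fun a => psi_x (conf w a))
       (within (strip (depth w)) (locally ((alpha, 0) : C))) (locally gx) /\
     filterlim (fun a => psi_y (conf w a))
       (within (strip (depth w)) (locally ((alpha, 0) : C))) (locally gy) /\
     / 2 * (gx ^ 2 + gy ^ 2) + G * Im (trace w alpha) = bernoulli w) /\
  (forall p, Im p = - H -> psi w p = bottom_value w).

(* The loop is a Jordan curve, so a bounded domain whose boundary is the loop
   is exactly the region it encloses. *)
Definition touching_profile (w : wave) : Prop :=
  exists alpha1 alpha2 : R,
    alpha1 < alpha2 /\
    trace w alpha1 = trace w alpha2 /\
    (forall b1 b2, b1 < b2 -> trace w b1 = trace w b2 ->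
       exists k : Z, b1 = alpha1 + 2 * PI * IZR k /\
                     b2 = alpha2 + 2 * PI * IZR k) /\
    (exists (v1 v2 : C) (c : R),
       is_derive (trace w) alpha1 v1 /\ is_derive (trace w) alpha2 v2 /\
       c <> 0 /\ v2 = Cmult (RtoC c) v1) /\
    (exists U : C -> Prop,
       is_domain U /\
       (exists M, forall p, U p -> Cmod p <= M) /\
       (forall p, boundary U p <->
          exists b, alpha1 <= b <= alpha2 /\ trace w b = p) /\
       (forall p, U p -> ~ domain w p)).

Definition injective_profile (w : wave) : Prop :=
  forall a b, trace w a = trace w b -> a = b.

Definition solution (G H : R) (w : wave) : Prop :=
  conformal_description H w /\
  fluid_domain H w /\
  periodic_x w /\
  reflection_symmetric w /\
  water_wave_equations G H w /\
  (injective_profile w \/ touching_profile w).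

Definition laminar_flow (G H : R) (w : wave) : Prop :=
  solution G H w /\
  (exists h, forall p, free_surface w p <-> Im p = h) /\
  (forall p q, closure (domain w) p -> closure (domain w) q ->
     Im p = Im q -> psi w p = psi w q).

Definition touching_wave (G H : R) (w : wave) : Prop :=
  solution G H w /\ touching_profile w.

Definition unit_interval (t : R) : Prop := 0 <= t <= 1.

Definition continuous_on_unit (f : R -> R) : Prop :=
  forall t, unit_interval t ->
    filterlim f (within unit_interval (locally t)) (locally (f t)).

Definition elevation (w : wave) (alpha : R) : R := Im (trace w alpha).

Definition continuous_curve (theta G H : R) (w : R -> wave) : Prop :=
  (forall t, unit_interval t ->
     solution G H (w t) /\ holder_space 3 theta (elevation (w t))) /\
  continuous_on_unit (fun t => vorticity (w t)) /\
  continuous_on_unit (fun t => bernoulli (w t)) /\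
  continuous_on_unit (fun t => depth (w t)) /\
  (forall t, unit_interval t -> forall eps : posreal,
     within unit_interval (locally t) (fun s =>
       Rbar_lt
         (holder_norm 3 theta
            (fun alpha => elevation (w s) alpha - elevation (w t) alpha))
         eps)).

(* Main.v *)
(* The waves are found near the explicit family with [G = 0] and infinite depth whose profile is that of Crapper's
   capillary waves: with [zeta = exp (- i alpha)] and amplitude [A] the map satisfies
   [z' = ((1 - A zeta) / (1 + A zeta))^2], and the profile crosses itself before [A = 23/50].  Laurent coefficients are
   continuous functions of [A], measured in an l^1 norm with weights [(3/2)^|k|].  The linearization of the surface
   equations at the explicit wave has a bounded right inverse, so for small [G] and [exp (-2 H)] a contraction argument
   yields solutions for all [A] in [0, 23/50], close to the explicit ones.  In the half strip [0 < alpha < PI] one has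
   [Im z' > 0]; by the Noshiro-Warschawski argument [z] is injective there and points at equal height are ordered
   horizontally.  Hence overlap can only occur on the axis through the trough, at the first amplitude at which the
   half profile meets this axis.  There strict convexity gives a single, tangential contact, and the region between the
   half profile and its mirror image is the bubble.  The stream function is [- Om y^2 / 2 + Im J + const], transported by
   the inverse of [z]. *)
From Stdlib Require Import Reals Lra Lia ZArith List Permutation Classical ClassicalEpsilon FunctionalExtensionality ProofIrrelevance.
From Coquelicot Require Import Coquelicot.
Require Import Defs.
Open Scope R_scope.

(** * Unordered sums *)

(** Every deviation from the uniform flow carries a factor A ([z' = 1 + A H], velocity [1 + A U]),
    and both surface equations are divided by A. Undivided, they degenerate at A = 0, where the
    branch leaves the laminar flow; divided, A = 0 is a regular parameter value, and a single
    contraction in a space of functions of A gives the whole curve together with its continuity. The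
    perturbation of the profile has no mode 1, which pins the meaning of A; the vorticity is the
    unknown that compensates for the missing mode. Decay of the Laurent coefficients continues the
    flow past the surface, so surface points are interior points of a strip of holomorphy. The
    obstacle in the shape analysis is that [Im z'] vanishes on the bottom and at both ends of the
    half period; errors are therefore measured relative to [sin alpha] and to the distance of a mode
    from its reflection. The amplitude 23/50 is just past the contact of the explicit profile and
    still small enough for the recursion of the right inverse to contract. The elevation has zero
    mean in the conformal variable, so H is the conformal depth; this depth and the Bernoulli
    constant 1/2 stay fixed along the curve. *)

Definition sumL {I : Type} (f : I -> R) (l : list I) : R :=
  fold_right (fun i a => f i + a) 0 l.

(** Convergence of the net of finite partial sums. No enumeration of the index set enters, so
    rearrangements, the shear of [Z * Z] behind products of Laurent series, and Fubini need no
    separate limit arguments. *)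
Definition has_sum {I : Type} (f : I -> R) (s : R) : Prop :=
  forall e, 0 < e -> exists l0, forall l, NoDup l -> incl l0 l ->
    Rabs (sumL f l - s) < e.

Definition summ {I : Type} (f : I -> R) (M : R) : Prop :=
  forall l, NoDup l -> sumL (fun i => Rabs (f i)) l <= M.

(** An arbitrary real when the family is not summable; its value is read off only through [tsum_eq]
    and [tsum_has]. *)
Definition tsum {I : Type} (f : I -> R) : R := epsilon (inhabits 0) (has_sum f).

Definition cdec {I : Type} (x y : I) : {x = y} + {x <> y} :=
  excluded_middle_informative (x = y).

Lemma sumL_app {I} (f : I -> R) l l' : sumL f (l ++ l') = sumL f l + sumL f l'.
Proof. induction l as [|a l IH]; simpl; [lra|]. unfold sumL in *; simpl. rewrite IH. lra. Qed.

Lemma sumL_plus {I} (f g : I -> R) l :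
  sumL (fun i => f i + g i) l = sumL f l + sumL g l.
Proof. induction l as [|a l IH]; simpl; [lra|]. unfold sumL in *; simpl. rewrite IH. lra. Qed.

Lemma sumL_scal {I} (c : R) (f : I -> R) l : sumL (fun i => c * f i) l = c * sumL f l.
Proof. induction l as [|a l IH]; simpl; [lra|]. unfold sumL in *; simpl. rewrite IH. lra. Qed.

Lemma sumL_ext_in {I} (f g : I -> R) l :
  (forall i, In i l -> f i = g i) -> sumL f l = sumL g l.
Proof.
  induction l as [|a l IH]; intros H; [reflexivity|].
  unfold sumL in *; simpl. rewrite H by (left; reflexivity).
  rewrite IH by (intros; apply H; right; assumption). reflexivity.
Qed.

Lemma sumL_le_in {I} (f g : I -> R) l :
  (forall i, In i l -> f i <= g i) -> sumL f l <= sumL g l.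
Proof.
  induction l as [|a l IH]; intros H; [unfold sumL; simpl; lra|].
  unfold sumL in *; simpl.
  assert (f a <= g a) by (apply H; left; reflexivity).
  assert (fold_right (fun i b => f i + b) 0 l <= fold_right (fun i b => g i + b) 0 l)
    by (apply IH; intros; apply H; right; assumption). lra.
Qed.

Lemma sumL_nonneg {I} (f : I -> R) l : (forall i, 0 <= f i) -> 0 <= sumL f l.
Proof.
  intros H. induction l as [|a l IH]; unfold sumL in *; simpl; [lra|].
  specialize (H a). lra.
Qed.

Lemma sumL_abs {I} (f : I -> R) l : Rabs (sumL f l) <= sumL (fun i => Rabs (f i)) l.
Proof.
  induction l as [|a l IH]; unfold sumL in *; simpl; [rewrite Rabs_R0; lra|].
  eapply Rle_trans; [apply Rabs_triang|]. lra.
Qed.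

Lemma sumL_perm {I} (f : I -> R) l l' : Permutation l l' -> sumL f l = sumL f l'.
Proof. induction 1; unfold sumL in *; simpl; lra. Qed.

Lemma sumL_map {I J} (b : J -> I) (f : I -> R) l : sumL f (map b l) = sumL (fun j => f (b j)) l.
Proof. induction l as [|a l IH]; unfold sumL in *; simpl; [|rewrite IH]; reflexivity. Qed.

Lemma incl_perm {I} (l l' : list I) : NoDup l -> incl l l' ->
  exists l2, Permutation l' (l ++ l2).
Proof.
  revert l'. induction l as [|a l IH]; intros l' Hn Hi.
  - exists l'. apply Permutation_refl.
  - inversion Hn; subst.
    destruct (in_split a l') as [l1 [l2 E]]; [apply Hi; left; reflexivity|].
    destruct (IH (l1 ++ l2)) as [l3 H3]; [assumption| |].
    + intros x Hx. assert (In x l') as Hx' by (apply Hi; right; exact Hx).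
      subst l'. apply in_app_iff in Hx'. apply in_app_iff.
      destruct Hx' as [?|[?|?]]; auto. subst; contradiction.
    + exists l3. subst l'. simpl.
      eapply Permutation_trans; [apply Permutation_sym, Permutation_middle|].
      apply perm_skip. exact H3.
Qed.

Lemma sumL_incl_le {I} (f : I -> R) l l' : (forall i, 0 <= f i) ->
  NoDup l -> incl l l' -> sumL f l <= sumL f l'.
Proof.
  intros H Hn Hi. destruct (incl_perm l l' Hn Hi) as [l2 H2].
  rewrite (sumL_perm f _ _ H2), sumL_app. generalize (sumL_nonneg f l2 H). lra.
Qed.

Definition lunion {I} (l l' : list I) := nodup cdec (l ++ l').

Lemma lunion_nodup {I} (l l' : list I) : NoDup (lunion l l').
Proof. apply NoDup_nodup. Qed.
Lemma lunion_l {I} (l l' : list I) : incl l (lunion l l').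
Proof. intros x Hx. apply nodup_In, in_app_iff; auto. Qed.
Lemma lunion_r {I} (l l' : list I) : incl l' (lunion l l').
Proof. intros x Hx. apply nodup_In, in_app_iff; auto. Qed.

Lemma has_sum_unique {I} (f : I -> R) s s' : has_sum f s -> has_sum f s' -> s = s'.
Proof.
  intros H H'. destruct (Req_dec s s') as [|N]; [assumption|exfalso].
  set (e := Rabs (s - s') / 2).
  assert (0 < e) by (unfold e; assert (0 < Rabs (s - s')) by (apply Rabs_pos_lt; lra); lra).
  destruct (H e) as [l1 H1]; [assumption|]. destruct (H' e) as [l2 H2]; [assumption|].
  specialize (H1 _ (lunion_nodup l1 l2) (lunion_l l1 l2)).
  specialize (H2 _ (lunion_nodup l1 l2) (lunion_r l1 l2)).
  set (x := sumL f (lunion l1 l2)) in *.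
  assert (Rabs (s - s') <= Rabs (x - s) + Rabs (x - s')).
  { replace (s - s') with ((x - s') - (x - s)) by ring.
    unfold Rminus at 1. eapply Rle_trans; [apply Rabs_triang|]. rewrite Rabs_Ropp. lra. }
  unfold e in *. lra.
Qed.

Lemma tsum_eq {I} (f : I -> R) s : has_sum f s -> tsum f = s.
Proof.
  intros H. apply (has_sum_unique f); [|assumption].
  unfold tsum. apply epsilon_spec. exists s; assumption.
Qed.

Lemma has_sum_ext {I} (f g : I -> R) s : (forall i, f i = g i) -> has_sum f s -> has_sum g s.
Proof. intros H. replace g with f; [auto|]. apply functional_extensionality; auto. Qed.

Lemma has_sum_plus {I} (f g : I -> R) s t :
  has_sum f s -> has_sum g t -> has_sum (fun i => f i + g i) (s + t).
Proof.
  intros H H' e He. destruct (H (e/2)) as [l1 H1]; [lra|]. destruct (H' (e/2)) as [l2 H2]; [lra|].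
  exists (l1 ++ l2). intros l Hl Hi. rewrite sumL_plus.
  assert (A : incl l1 l) by (intros x Hx; apply Hi, in_app_iff; auto).
  assert (B : incl l2 l) by (intros x Hx; apply Hi, in_app_iff; auto).
  specialize (H1 l Hl A). specialize (H2 l Hl B).
  replace (sumL f l + sumL g l - (s + t)) with ((sumL f l - s) + (sumL g l - t)) by ring.
  eapply Rle_lt_trans; [apply Rabs_triang|]. lra.
Qed.

Lemma has_sum_scal {I} (c : R) (f : I -> R) s :
  has_sum f s -> has_sum (fun i => c * f i) (c * s).
Proof.
  intros H e He. destruct (H (e / (Rabs c + 1))) as [l1 H1].
  { apply Rdiv_lt_0_compat; [lra|]. generalize (Rabs_pos c); lra. }
  exists l1. intros l Hl Hi. rewrite sumL_scal. specialize (H1 l Hl Hi).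
  replace (c * sumL f l - c * s) with (c * (sumL f l - s)) by ring. rewrite Rabs_mult.
  assert (0 <= Rabs c) by apply Rabs_pos.
  apply Rmult_lt_compat_r with (r := Rabs c + 1) in H1; [|lra].
  unfold Rdiv in H1. rewrite Rmult_assoc, Rinv_l, Rmult_1_r in H1 by lra.
  generalize (Rabs_pos (sumL f l - s)). nra.
Qed.

Lemma has_sum_0 {I} : has_sum (fun _ : I => 0) 0.
Proof.
  intros e He. exists nil. intros l _ _.
  replace (sumL (fun _ : I => 0) l) with 0; [rewrite Rminus_0_r, Rabs_R0; assumption|].
  induction l as [|a l IH]; unfold sumL in *; simpl; [|rewrite <- IH]; lra.
Qed.

Lemma has_sum_bij {I J} (b : J -> I) (b' : I -> J) (f : I -> R) s :
  (forall j, b' (b j) = j) -> (forall i, b (b' i) = i) ->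
  has_sum f s -> has_sum (fun j => f (b j)) s.
Proof.
  intros E E' H e He. destruct (H e He) as [l0 H0]. exists (map b' l0).
  intros l Hl Hi. rewrite <- sumL_map. apply H0.
  - apply FinFun.Injective_map_NoDup; [|assumption].
    intros x y Hxy. rewrite <- (E x), <- (E y), Hxy. reflexivity.
  - intros x Hx. rewrite <- (E' x). apply in_map, Hi, in_map, Hx.
Qed.

Lemma summ_has_sum {I} (f : I -> R) M : summ f M -> exists s, has_sum f s.
Proof.
  assert (P : forall g : I -> R, (forall i, 0 <= g i) -> summ g M -> exists s, has_sum g s).
  { intros g Hg Hs.
    destruct (completeness (fun x => exists l, NoDup l /\ x = sumL g l)) as [s [Hu Hl]].
    - exists M. intros x [l [Hl ->]]. eapply Rle_trans; [|apply (Hs l Hl)].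
      apply sumL_le_in. intros i _. apply Rle_abs.
    - exists 0, nil. split; [constructor|reflexivity].
    - exists s. intros e He.
      destruct (classic (exists l0, NoDup l0 /\ s - e < sumL g l0)) as [[l0 [N0 H0]]|N].
      + exists l0. intros l Nl Il.
        assert (sumL g l0 <= sumL g l) by (apply sumL_incl_le; assumption).
        assert (sumL g l <= s) by (apply Hu; exists l; auto).
        apply Rabs_def1; lra.
      + exfalso. assert (s <= s - e); [|lra]. apply Hl. intros x [l [Nl ->]].
        apply Rnot_lt_le. intro. apply N. exists l; auto. }
  intros H.
  destruct (P (fun i => Rmax (f i) 0)) as [s Hs].
  { intros; apply Rmax_r. }
  { intros l Hl. eapply Rle_trans; [|apply (H l Hl)]. apply sumL_le_in. intros i _.
    unfold Rmax. destruct Rle_dec; unfold Rabs; repeat destruct Rcase_abs; lra. }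
  destruct (P (fun i => Rmax (- f i) 0)) as [t Ht].
  { intros; apply Rmax_r. }
  { intros l Hl. eapply Rle_trans; [|apply (H l Hl)]. apply sumL_le_in. intros i _.
    unfold Rmax. destruct Rle_dec; unfold Rabs; repeat destruct Rcase_abs; lra. }
  exists (s + -1 * t). apply has_sum_scal with (c := -1) in Ht.
  eapply has_sum_ext; [|apply (has_sum_plus _ _ _ _ Hs Ht)].
  intros i. simpl. unfold Rmax. repeat destruct Rle_dec; lra.
Qed.

Lemma tsum_has {I} (f : I -> R) M : summ f M -> has_sum f (tsum f).
Proof. intros H. destruct (summ_has_sum f M H) as [s Hs]. rewrite (tsum_eq f s Hs). exact Hs. Qed.

Lemma has_sum_le {I} (f g : I -> R) s M : has_sum f s -> (forall i, Rabs (f i) <= g i) ->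
  (forall l, NoDup l -> sumL g l <= M) -> Rabs s <= M.
Proof.
  intros H Hg HM. apply le_epsilon. intros e He. destruct (H e He) as [l0 H0].
  specialize (H0 (nodup cdec l0) (NoDup_nodup _ _)).
  assert (Rabs (sumL f (nodup cdec l0) - s) < e) as H1.
  { apply H0. intros x Hx. apply nodup_In; assumption. }
  assert (Rabs (sumL f (nodup cdec l0)) <= M).
  { eapply Rle_trans; [apply sumL_abs|]. eapply Rle_trans; [|apply (HM (nodup cdec l0)), NoDup_nodup].
    apply sumL_le_in; auto. }
  replace s with (sumL f (nodup cdec l0) - (sumL f (nodup cdec l0) - s)) by ring.
  unfold Rminus at 1. eapply Rle_trans; [apply Rabs_triang|]. rewrite Rabs_Ropp. lra.
Qed.

Lemma has_sum_ge {I} (f : I -> R) s l : has_sum f s -> (forall i, 0 <= f i) -> NoDup l -> sumL f l <= s.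
Proof.
  intros HS F0 Nl. apply Rnot_lt_le. intros Hlt.
  destruct (HS (sumL f l - s)) as [l1 H1]; [lra|].
  specialize (H1 _ (lunion_nodup l1 l) (lunion_l _ _)).
  assert (sumL f l <= sumL f (lunion l1 l)) by (apply sumL_incl_le; [|assumption|apply lunion_r]; assumption).
  apply Rabs_def2 in H1. lra.
Qed.

(** Above each index of the outer list the inner sum is replaced by a finite one, enlarged to
    contain every point of [l0] in that fibre. The union of these fibres is then an admissible
    finite set for the double sum. *)
Lemma has_sum_fubini {I J} (f : I * J -> R) (g : I -> R) s : has_sum f s ->
  (forall i, has_sum (fun j => f (i, j)) (g i)) -> has_sum g s.
Proof.
  intros H Hg e He. destruct (H (e/2)) as [l0 H0]; [lra|].
  exists (map fst l0). intros l Nl Il.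
  assert (K : forall d, 0 < d -> forall l1 : list I, NoDup l1 ->
    exists L : list (I * J), NoDup L /\ (forall p, In p L -> In (fst p) l1) /\
      (forall p, In p l0 -> In (fst p) l1 -> In p L) /\
      Rabs (sumL f L - sumL g l1) <= INR (length l1) * d).
  { intros d Hd l1. induction l1 as [|a l1 IH]; intros N1.
    - exists nil. repeat split; [constructor|intros p []|intros p _ []|].
      unfold sumL; simpl. rewrite Rminus_0_r, Rabs_R0. lra.
    - inversion N1; subst. destruct IH as [L [NL [A [B C]]]]; [assumption|].
      destruct (Hg a d Hd) as [la Ha].
      set (la' := lunion la (map snd (filter (fun p => if cdec (fst p) a then true else false) l0))).
      specialize (Ha la' (lunion_nodup _ _) (lunion_l _ _)).
      exists (map (fun j => (a, j)) la' ++ L). repeat split.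
      + apply NoDup_app.
        * apply FinFun.Injective_map_NoDup; [|apply lunion_nodup]. intros x y E; congruence.
        * assumption.
        * intros p Hp HL. apply in_map_iff in Hp. destruct Hp as [j [<- _]].
          apply A in HL. contradiction.
      + intros p Hp. apply in_app_iff in Hp. destruct Hp as [Hp|Hp].
        * apply in_map_iff in Hp. destruct Hp as [j [<- _]]. left; reflexivity.
        * right. apply A; assumption.
      + intros p Hp [E|Hin].
        * apply in_app_iff. left. apply in_map_iff. exists (snd p).
          split; [destruct p; simpl in *; congruence|].
          apply (lunion_r la). apply in_map_iff. exists p. split; [reflexivity|].
          apply filter_In. split; [assumption|]. destruct cdec; congruence.
        * apply in_app_iff. right. apply B; assumption.
      + rewrite sumL_app, sumL_map.
        replace (sumL g (a :: l1)) with (g a + sumL g l1) by reflexivity.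
        replace (INR (length (a :: l1))) with (INR (length l1) + 1) by (simpl length; rewrite S_INR; ring).
        replace (sumL (fun j => f (a, j)) la' + sumL f L - (g a + sumL g l1)) with
          ((sumL (fun j => f (a, j)) la' - g a) + (sumL f L - sumL g l1)) by ring.
        eapply Rle_trans; [apply Rabs_triang|]. nra. }
  destruct (K (e / 2 / (INR (length l) + 1))) with (l1 := l) as [L [NL [A [B C]]]].
  { apply Rdiv_lt_0_compat; [lra|]. generalize (pos_INR (length l)); lra. }
  { assumption. }
  assert (Rabs (sumL f L - s) < e / 2) as H1.
  { apply H0; [assumption|]. intros p Hp. apply B; [assumption|]. apply Il, in_map, Hp. }
  assert (INR (length l) * (e / 2 / (INR (length l) + 1)) <= e / 2).
  { generalize (pos_INR (length l)); intros. set (n := INR (length l)) in *.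
    replace (n * (e / 2 / (n + 1))) with (e / 2 * (n / (n + 1))) by (field; lra).
    rewrite <- (Rmult_1_r (e/2)) at 2. apply Rmult_le_compat_l; [lra|].
    apply Rle_div_l; lra. }
  replace (sumL g l - s) with ((sumL f L - s) - (sumL f L - sumL g l)) by ring.
  unfold Rminus at 1. eapply Rle_lt_trans; [apply Rabs_triang|]. rewrite Rabs_Ropp. lra.
Qed.

Lemma sumL_list_prod {I J} (f : I -> R) (g : J -> R) l l' :
  sumL (fun p => f (fst p) * g (snd p)) (list_prod l l') = sumL f l * sumL g l'.
Proof.
  induction l as [|a l IH]; [unfold sumL; simpl; ring|].
  simpl list_prod. rewrite sumL_app, IH, sumL_map. simpl. rewrite sumL_scal.
  replace (sumL f (a :: l)) with (f a + sumL f l) by reflexivity. ring.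
Qed.

Lemma sumL_prod_le {I J} (f : I -> R) (g : J -> R) M N (L : list (I * J)) :
  (forall i, 0 <= f i) -> (forall j, 0 <= g j) ->
  (forall l, NoDup l -> sumL f l <= M) -> (forall l, NoDup l -> sumL g l <= N) -> NoDup L ->
  sumL (fun p => f (fst p) * g (snd p)) L <= M * N.
Proof.
  intros Hf Hg HM HN NL.
  set (l1 := nodup cdec (map fst L)). set (l2 := nodup cdec (map snd L)).
  apply Rle_trans with (sumL (fun p => f (fst p) * g (snd p)) (list_prod l1 l2)).
  - apply sumL_incl_le; [|assumption|].
    + intros p. apply Rmult_le_pos; auto.
    + intros [i j] Hp. apply in_prod; apply nodup_In; [apply (in_map fst _ _ Hp)|apply (in_map snd _ _ Hp)].
  - rewrite sumL_list_prod. apply Rmult_le_compat; try (apply sumL_nonneg; assumption).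
    + apply HM, NoDup_nodup.
    + apply HN, NoDup_nodup.
Qed.

Lemma has_sum_prod {I J} (f : I -> R) (g : J -> R) M N s t : summ f M -> summ g N ->
  has_sum f s -> has_sum g t -> has_sum (fun p => f (fst p) * g (snd p)) (s * t).
Proof.
  intros HM HN Hs Ht.
  destruct (summ_has_sum (fun p : I * J => f (fst p) * g (snd p)) (M * N)) as [x Hx].
  { intros L NL. erewrite sumL_ext_in; [|intros i _; apply Rabs_mult].
    apply (sumL_prod_le (fun i => Rabs (f i)) (fun j => Rabs (g j))); auto; intros; apply Rabs_pos. }
  assert (has_sum (fun i => t * f i) x).
  { apply (has_sum_fubini _ _ _ Hx). intros i. simpl.
    apply has_sum_ext with (fun j => f i * g j); [reflexivity|].
    rewrite Rmult_comm. apply has_sum_scal. assumption. }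
  replace (s * t) with x; [assumption|].
  rewrite Rmult_comm. apply (has_sum_unique _ _ _ H). apply has_sum_scal. assumption.
Qed.

(** The finite set depends on the majorant alone, so it serves all dominated families at once; this
    uniformity turns termwise continuity into continuity of the sum in [continuous_tsum]. *)
Lemma tsum_tail {I} (m : I -> R) M e : 0 < e -> summ m M ->
  exists l0, NoDup l0 /\ forall f s, has_sum f s -> (forall i, Rabs (f i) <= m i) ->
    Rabs (s - sumL f l0) <= e.
Proof.
  intros He Hm. destruct (summ_has_sum m M Hm) as [S HS].
  destruct (HS (e/4)) as [l1 H1]; [lra|].
  set (l0 := nodup cdec l1). exists l0. split; [apply NoDup_nodup|].
  assert (I1 : incl l1 l0) by (intros x Hx; apply nodup_In; assumption).
  intros f s Hf Hfm. destruct (Hf (e/4)) as [l2 H2]; [lra|].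
  set (l := lunion l0 l2).
  specialize (H2 l (lunion_nodup _ _) (lunion_r _ _)).
  assert (H3 := H1 l (lunion_nodup _ _) (fun x Hx => lunion_l l0 l2 x (I1 x Hx))).
  assert (H4 := H1 l0 (NoDup_nodup _ _) I1).
  destruct (incl_perm l0 l (NoDup_nodup _ _) (lunion_l _ _)) as [l3 P3].
  assert (Rabs (sumL f l3) <= sumL m l3).
  { eapply Rle_trans; [apply sumL_abs|]. apply sumL_le_in; auto. }
  rewrite (sumL_perm f _ _ P3), sumL_app in H2. rewrite (sumL_perm m _ _ P3), sumL_app in H3.
  apply Rabs_def2 in H3. apply Rabs_def2 in H4.
  replace (s - sumL f l0) with (sumL f l3 - (sumL f l0 + sumL f l3 - s)) by ring.
  unfold Rminus at 1. eapply Rle_trans; [apply Rabs_triang|]. rewrite Rabs_Ropp. lra.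
Qed.

Lemma continuous_sumL {I} (f : I -> R -> R) l x : (forall i, continuous (f i) x) ->
  continuous (fun s => sumL (fun i => f i s) l) x.
Proof.
  intros H. induction l as [|a l IH]; [apply continuous_const|].
  apply (continuous_plus (f a) (fun s => sumL (fun i => f i s) l)); auto.
Qed.

Lemma continuous_tsum {I} (f : I -> R -> R) (m : I -> R) M x : summ m M ->
  (forall i s, Rabs (f i s) <= m i) -> (forall i, continuous (f i) x) ->
  continuous (fun s => tsum (fun i => f i s)) x.
Proof.
  intros Hm Hf Hc. apply filterlim_locally. intros eps.
  destruct (tsum_tail m M (eps/3)) as [l0 [N0 H0]]; [destruct eps; simpl; lra|assumption|].
  assert (HS : forall s, has_sum (fun i => f i s) (tsum (fun i => f i s))).
  { intros s. apply (tsum_has _ M). intros l Nl. eapply Rle_trans; [|apply (Hm l Nl)].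
    apply sumL_le_in. intros i _. eapply Rle_trans; [apply Hf|apply Rle_abs]. }
  assert (Hl := continuous_sumL f l0 x Hc).
  assert (E3 : 0 < eps/3) by (destruct eps; simpl; lra).
  apply filterlim_locally with (eps := mkposreal _ E3) in Hl.
  revert Hl. apply filter_imp. intros s Hs.
  assert (A := H0 _ _ (HS s) (fun i => Hf i s)). assert (B := H0 _ _ (HS x) (fun i => Hf i x)).
  change (Rabs (sumL (fun i => f i s) l0 - sumL (fun i => f i x) l0) < eps / 3) in Hs.
  change (Rabs (tsum (fun i => f i s) - tsum (fun i => f i x)) < eps).
  apply Rabs_def2 in Hs. apply Rabs_le_between in A. apply Rabs_le_between in B.
  apply Rabs_def1; lra.
Qed.

(** * Sums over the integers as series over the natural numbers *)

Definition zfold (f : Z -> R) (n : nat) : R :=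
  match n with O => f 0%Z | S _ => f (Z.of_nat n) + f (- Z.of_nat n)%Z end.

Fixpoint zball (n : nat) : list Z :=
  match n with O => 0%Z :: nil | S m => Z.of_nat n :: (- Z.of_nat n)%Z :: zball m end.

Lemma in_zball n k : In k (zball n) <-> (Z.abs k <= Z.of_nat n)%Z.
Proof.
  induction n as [|n IH]; [simpl; lia|].
  change (zball (S n)) with (Z.of_nat (S n) :: (- Z.of_nat (S n))%Z :: zball n).
  simpl In. rewrite IH. lia.
Qed.

Lemma nodup_zball n : NoDup (zball n).
Proof.
  induction n as [|n IH]; [constructor; [intros []|constructor]|].
  change (zball (S n)) with (Z.of_nat (S n) :: (- Z.of_nat (S n))%Z :: zball n).
  constructor; [|constructor; [|assumption]]; simpl In; rewrite ?in_zball; lia.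
Qed.

Lemma zball_covers (l : list Z) : exists n, incl l (zball n).
Proof.
  induction l as [|a l [n IH]]; [exists O; intros x []|].
  exists (max n (Z.to_nat (Z.abs a))). intros x [->|Hx]; apply in_zball; [lia|].
  apply IH, in_zball in Hx. lia.
Qed.

Lemma has_sum_series (f : Z -> R) s : has_sum f s -> is_series (zfold f) s.
Proof.
  intros H. cut (is_lim_seq (sum_n (zfold f)) s); [intros K; exact K|].
  apply is_lim_seq_spec. intros eps.
  destruct (H eps (cond_pos eps)) as [l0 H0]. destruct (zball_covers l0) as [N HN].
  exists N. intros n Hn.
  replace (sum_n (zfold f) n) with (sumL f (zball n)).
  - apply H0; [apply nodup_zball|]. intros x Hx. apply HN, in_zball in Hx. apply in_zball. lia.
  - clear. induction n as [|n IH]; [rewrite sum_O; unfold sumL; simpl; ring|].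
    rewrite sum_Sn, <- IH.
    change (sumL f (zball (S n))) with (f (Z.of_nat (S n)) + (f (- Z.of_nat (S n))%Z + sumL f (zball n))).
    unfold plus; simpl zfold; simpl. ring.
Qed.

(** * Laurent series with coefficients depending on the amplitude *)

(** Any base between 69/50 and 50/23 is suitable: below 50/23 the inverses of [1 + A zeta] and
    [1 - A zeta] have finite norm for [A <= 23/50], and above 69/50 the operator [Bop] of the right
    inverse contracts. *)
Definition wt (k : Z) : R := (3/2) ^ (Z.abs_nat k).

(** The majorant does not depend on [s], so this is a weighted l^1 norm of sup norms. Limits in it
    are uniform in the amplitude, which preserves continuity of the coefficients. *)
Definition nb (c : Z -> R -> R) (M : R) : Prop :=
  exists m : Z -> R, (forall k s, Rabs (c k s) <= m k) /\
    (forall l, NoDup l -> sumL (fun k => m k * wt k) l <= M).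

Definition valid (c : Z -> R -> R) : Prop :=
  (forall k s, continuous (c k) s) /\ exists M, nb c M.

Record lau : Type := Lau { cf : Z -> R -> R; cf_valid : valid cf }.

Definition nrm (a : lau) (M : R) : Prop := nb (cf a) M.

Lemma lau_ext (a b : lau) : (forall k s, cf a k s = cf b k s) -> a = b.
Proof.
  destruct a as [a Ha], b as [b Hb]; simpl; intros H.
  assert (a = b) by (apply functional_extensionality; intros k; apply functional_extensionality; auto).
  subst b. f_equal. apply proof_irrelevance.
Qed.

Lemma wt_pos k : 0 < wt k.
Proof. apply pow_lt; lra. Qed.
Lemma wt_ge1 k : 1 <= wt k.
Proof. apply pow_R1_Rle; lra. Qed.
Lemma wt_add j k : wt (j + k) <= wt j * wt k.
Proof.
  unfold wt. rewrite <- pow_add. apply Rle_pow; [lra|]. lia.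
Qed.

Lemma has_sum_single {I} (f : I -> R) i0 : (forall i, i <> i0 -> f i = 0) -> has_sum f (f i0).
Proof.
  intros H e He. exists (i0 :: nil). intros l Nl Il.
  destruct (incl_perm (i0 :: nil) l) as [l2 P]; [constructor; [intros []|constructor]|assumption|].
  assert (N2 := Permutation_NoDup P Nl).
  rewrite (sumL_perm _ _ _ P), sumL_app.
  rewrite (sumL_ext_in f (fun _ => 0 * 0) l2).
  - rewrite (sumL_scal 0 (fun _ => 0)). unfold sumL at 1; simpl.
    match goal with |- Rabs ?x < _ => replace x with 0 by ring end. rewrite Rabs_R0; assumption.
  - intros i Hi. rewrite Rmult_0_l. apply H. intros ->. inversion N2; contradiction.
Qed.

Lemma nb_valid0 : valid (fun _ _ => 0).
Proof.
  split; [intros; apply continuous_const|]. exists 0, (fun _ => 0). split.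
  - intros. rewrite Rabs_R0. lra.
  - intros l _. rewrite (sumL_scal 0). lra.
Qed.

Definition lzero : lau := Lau _ nb_valid0.

(* Coefficients that do not define an element are replaced by [0]. *)
Definition mk (c : Z -> R -> R) : lau :=
  match excluded_middle_informative (valid c) with
  | left H => Lau c H
  | right _ => lzero
  end.

Lemma cf_mk c : valid c -> cf (mk c) = c.
Proof. intros H. unfold mk. destruct excluded_middle_informative; [reflexivity|contradiction]. Qed.

Lemma nb_m_pos (c : Z -> R -> R) m k : (forall k s, Rabs (c k s) <= m k) -> 0 <= m k.
Proof. intros H. eapply Rle_trans; [apply Rabs_pos|apply (H k 0)]. Qed.

Lemma nb_le c M N : nb c M -> M <= N -> nb c N.
Proof. intros [m [H1 H2]] H. exists m. split; [assumption|]. intros l Hl. specialize (H2 l Hl). lra. Qed.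

Lemma nb_pos c M : nb c M -> 0 <= M.
Proof. intros [m [_ H]]. specialize (H nil (NoDup_nil _)). exact H. Qed.

Lemma nb_term c M : nb c M -> exists m, (forall k s, Rabs (c k s) <= m k) /\
  (forall l, NoDup l -> sumL (fun k => m k * wt k) l <= M) /\ (forall k, 0 <= m k) /\
  (forall k, m k * wt k <= M) /\ (forall k, m k <= M) /\ (forall l, NoDup l -> sumL m l <= M).
Proof.
  intros [m [H1 H2]]. exists m.
  assert (P : forall k, 0 <= m k) by (intros; apply (nb_m_pos c m k H1)).
  assert (Q : forall k, m k * wt k <= M).
  { intros k. specialize (H2 (k :: nil)). unfold sumL in H2; simpl in H2. rewrite Rplus_0_r in H2.
    apply H2. constructor; [intros []|constructor]. }
  repeat split; try assumption.
  - intros k. eapply Rle_trans; [|apply (Q k)]. generalize (P k) (wt_ge1 k). nra.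
  - intros l Hl. eapply Rle_trans; [|apply (H2 l Hl)]. apply sumL_le_in. intros k _.
    generalize (P k) (wt_ge1 k). nra.
Qed.

Lemma nb_add c d M N : nb c M -> nb d N -> nb (fun k s => c k s + d k s) (M + N).
Proof.
  intros [m [H1 H2]] [n [H3 H4]]. exists (fun k => m k + n k). split.
  - intros. eapply Rle_trans; [apply Rabs_triang|]. generalize (H1 k s) (H3 k s); lra.
  - intros l Hl. rewrite (sumL_ext_in _ (fun k => m k * wt k + n k * wt k)) by (intros; ring).
    rewrite sumL_plus. generalize (H2 l Hl) (H4 l Hl); lra.
Qed.

Lemma nb_diag (d : Z -> R -> R) c M C : 0 <= C -> (forall k s, Rabs (d k s) <= C) -> nb c M ->
  nb (fun k s => d k s * c k s) (C * M).
Proof.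
  intros HC Hd [m [H1 H2]]. exists (fun k => C * m k). split.
  - intros. rewrite Rabs_mult. apply Rmult_le_compat; auto using Rabs_pos.
  - intros l Hl. rewrite (sumL_ext_in _ (fun k => C * (m k * wt k))) by (intros; ring).
    rewrite sumL_scal. apply Rmult_le_compat_l; auto.
Qed.

Lemma continuous_Rmult (f g : R -> R) x : continuous f x -> continuous g x -> continuous (fun s => f s * g s) x.
Proof. intros. apply (continuous_mult f g); assumption. Qed.
Lemma continuous_Rplus (f g : R -> R) x : continuous f x -> continuous g x -> continuous (fun s => f s + g s) x.
Proof. intros. apply (continuous_plus f g); assumption. Qed.

Lemma valid_add c d : valid c -> valid d -> valid (fun k s => c k s + d k s).
Proof.
  intros [H1 [M H2]] [H3 [N H4]]. split.
  - intros. apply continuous_Rplus; auto.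
  - exists (M + N). apply nb_add; assumption.
Qed.

Lemma valid_diag (d : Z -> R -> R) c C : 0 <= C -> (forall k s, Rabs (d k s) <= C) ->
  (forall k s, continuous (d k) s) -> valid c -> valid (fun k s => d k s * c k s).
Proof.
  intros HC Hd Hc [H1 [M H2]]. split.
  - intros. apply continuous_Rmult; auto.
  - exists (C * M). apply nb_diag; assumption.
Qed.

Definition conv (c d : Z -> R -> R) (k : Z) (s : R) : R := tsum (fun j => c j s * d (k - j)%Z s).

Lemma conv_summ m n M N k :
  (forall k, 0 <= m k) -> (forall k, 0 <= n k) ->
  (forall l, NoDup l -> sumL m l <= M) -> (forall k, n k <= N) ->
  summ (fun j => m j * n (k - j)%Z) (M * N).
Proof.
  intros Hm Hn HM HN l Hl. apply Rle_trans with (sumL (fun j => N * m j) l).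
  - apply sumL_le_in. intros j _. rewrite Rabs_pos_eq by (apply Rmult_le_pos; auto).
    rewrite Rmult_comm. apply Rmult_le_compat_r; auto.
  - rewrite sumL_scal. assert (0 <= N) by (apply Rle_trans with (n 0%Z); auto).
    rewrite Rmult_comm. apply Rmult_le_compat_r; auto.
Qed.

Lemma conv_has c d M N k s : nb c M -> nb d N ->
  has_sum (fun j => c j s * d (k - j)%Z s) (conv c d k s).
Proof.
  intros Hc Hd. destruct (nb_term _ _ Hc) as [m [m1 [_ [m3 [_ [_ m6]]]]]].
  destruct (nb_term _ _ Hd) as [n [n1 [_ [n3 [_ [n5 _]]]]]].
  apply tsum_has with (M * N). intros l Hl.
  eapply Rle_trans; [|apply (conv_summ m n M N k m3 n3 m6 n5 l Hl)].
  apply sumL_le_in. intros j _. rewrite Rabs_mult.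
  rewrite (Rabs_pos_eq (m j * _)) by (apply Rmult_le_pos; auto).
  apply Rmult_le_compat; auto using Rabs_pos.
Qed.

Lemma has_sum_sumL {I J} (f : J -> I -> R) (g : J -> R) l :
  (forall j, has_sum (f j) (g j)) -> has_sum (fun i => sumL (fun j => f j i) l) (sumL g l).
Proof.
  intros H. induction l as [|a l IH]; [apply has_sum_0|].
  apply (has_sum_plus (f a) (fun i => sumL (fun j => f j i) l)); auto.
Qed.

(** Young's inequality in l^1: [wt_add] splits the weight of [k] between [j] and [k - j], and the
    sum over a finite list of [k] is taken inside the sum over [j]. *)
Lemma nb_conv c d M N : nb c M -> nb d N -> nb (conv c d) (M * N).
Proof.
  intros Hc Hd. destruct (nb_term _ _ Hc) as [m [m1 [m2 [m3 [_ [m5 m6]]]]]].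
  destruct (nb_term _ _ Hd) as [n [n1 [n2 [n3 [_ [n5 _]]]]]].
  exists (fun k => tsum (fun j => m j * n (k - j)%Z)).
  assert (HS : forall k, has_sum (fun j => m j * n (k - j)%Z) (tsum (fun j => m j * n (k - j)%Z))).
  { intros k. apply tsum_has with (M * N). apply conv_summ; auto. }
  split.
  - intros k s. apply has_sum_le with (g := fun j => m j * n (k - j)%Z) (1 := conv_has c d M N k s Hc Hd).
    + intros j. rewrite Rabs_mult. apply Rmult_le_compat; auto using Rabs_pos.
    + intros l Hl. apply has_sum_ge; [apply HS| |assumption]. intros; apply Rmult_le_pos; auto.
  - intros l Hl.
    assert (H := has_sum_sumL (fun k j => wt k * (m j * n (k - j)%Z)) (fun k => wt k * tsum (fun j => m j * n (k - j)%Z)) l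
      (fun k => has_sum_scal (wt k) _ _ (HS k))).
    rewrite (sumL_ext_in _ (fun k => wt k * tsum (fun j => m j * n (k - j)%Z))) by (intros; ring).
    eapply Rle_trans; [apply Rle_abs|].
    eapply has_sum_le; [apply H|intros j; apply Req_le, Rabs_pos_eq, sumL_nonneg|].
    { intros k. apply Rmult_le_pos; [apply Rlt_le, wt_pos|apply Rmult_le_pos; auto]. }
    intros L HL. apply Rle_trans with (sumL (fun j => N * (m j * wt j)) L).
    + apply sumL_le_in. intros j _.
      apply Rle_trans with (m j * wt j * sumL (fun i => n i * wt i) (map (fun k => (k - j)%Z) l)).
      * rewrite sumL_map, <- sumL_scal. apply sumL_le_in. intros k _.
        assert (wt k <= wt j * wt (k - j)%Z) by (replace k with (j + (k - j))%Z at 1 by lia; apply wt_add).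
        assert (0 <= m j * n (k - j)%Z) by (apply Rmult_le_pos; auto). nra.
      * rewrite Rmult_comm. apply Rmult_le_compat_r.
        -- apply Rmult_le_pos; [auto|apply Rlt_le, wt_pos].
        -- apply n2. apply FinFun.Injective_map_NoDup; [intros x y; lia|assumption].
    + rewrite sumL_scal, Rmult_comm. apply Rmult_le_compat_r; [apply (nb_pos _ _ Hd)|auto].
Qed.

Lemma valid_conv c d : valid c -> valid d -> valid (conv c d).
Proof.
  intros [H1 [M Hc]] [H3 [N Hd]]. split; [|exists (M * N); apply nb_conv; assumption].
  intros k s. destruct (nb_term _ _ Hc) as [m [m1 [_ [m3 [_ [_ m6]]]]]].
  destruct (nb_term _ _ Hd) as [n [n1 [_ [n3 [_ [n5 _]]]]]].
  apply continuous_tsum with (m := fun j => m j * n (k - j)%Z) (M := M * N).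
  - apply conv_summ; auto.
  - intros j t. rewrite Rabs_mult. apply Rmult_le_compat; auto using Rabs_pos.
  - intros j. apply continuous_Rmult; auto.
Qed.

Definition ladd (a b : lau) : lau := mk (fun k s => cf a k s + cf b k s).
Definition lopp (a : lau) : lau := mk (fun k s => -1 * cf a k s).
Definition lsub (a b : lau) : lau := ladd a (lopp b).
Definition lmul (a b : lau) : lau := mk (conv (cf a) (cf b)).
Definition cst (f : R -> R) : lau := mk (fun k s => if Z.eq_dec k 0 then f s else 0).
Definition mono (n : Z) : lau := mk (fun k s => if Z.eq_dec k n then 1 else 0).
Definition lone : lau := mono 0.
Definition ltil (a : lau) : lau := mk (fun k s => cf a (- k)%Z s).
Definition ldiag (d : Z -> R -> R) (a : lau) : lau := mk (fun k s => d k s * cf a k s).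
Definition bcont (f : R -> R) : Prop := (forall s, continuous f s) /\ exists C, forall s, Rabs (f s) <= C.
Definition bcd (d : Z -> R -> R) : Prop :=
  (forall k s, continuous (d k) s) /\ exists C, forall k s, Rabs (d k s) <= C.

Declare Scope lau_scope.
Delimit Scope lau_scope with L.
Infix "+" := ladd : lau_scope.
Infix "-" := lsub : lau_scope.
Infix "*" := lmul : lau_scope.
Notation "- x" := (lopp x) : lau_scope.

Lemma cf_add a b k s : cf (a + b)%L k s = cf a k s + cf b k s.
Proof. unfold ladd. rewrite cf_mk; [reflexivity|]. apply valid_add; apply cf_valid. Qed.

Lemma cf_opp a k s : cf (- a)%L k s = - cf a k s.
Proof.
  unfold lopp. rewrite cf_mk; [ring|]. apply (valid_diag (fun _ _ => -1) _ 1); [lra| | |apply cf_valid].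
  - intros. unfold Rabs; destruct Rcase_abs; lra.
  - intros; apply continuous_const.
Qed.

Lemma cf_sub a b k s : cf (a - b)%L k s = cf a k s - cf b k s.
Proof. unfold lsub. rewrite cf_add, cf_opp. ring. Qed.

Lemma cf_mul a b : cf (a * b)%L = conv (cf a) (cf b).
Proof. unfold lmul. apply cf_mk, valid_conv; apply cf_valid. Qed.

Lemma cf_zero k s : cf lzero k s = 0.
Proof. reflexivity. Qed.

Lemma mul_has a b k s : has_sum (fun j => cf a j s * cf b (k - j)%Z s) (cf (a * b)%L k s).
Proof.
  rewrite cf_mul. destruct (cf_valid a) as [_ [M HM]], (cf_valid b) as [_ [N HN]].
  apply (conv_has _ _ M N); assumption.
Qed.

Lemma cst_nb f n C : (forall s, Rabs (f s) <= C) -> nb (fun k s => if Z.eq_dec k n then f s else 0) (C * wt n).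
Proof.
  intros Hf. assert (0 <= C) by (eapply Rle_trans; [apply Rabs_pos|apply (Hf 0)]).
  exists (fun k => if Z.eq_dec k n then C else 0). split.
  - intros k s. destruct Z.eq_dec; [auto|]. rewrite Rabs_R0. lra.
  - intros l Hl. generalize (has_sum_single (fun k => (if Z.eq_dec k n then C else 0) * wt k) n).
    intros HS. destruct (Z.eq_dec n n) as [_|N0]; [|exfalso; apply N0; reflexivity].
    assert (HS' := HS ltac:(intros i Hi; destruct (Z.eq_dec i n); [exfalso; auto|ring])). clear HS.
    apply has_sum_ge; [assumption| |assumption].
    intros k. apply Rmult_le_pos; [destruct Z.eq_dec; lra|apply Rlt_le, wt_pos].
Qed.

Lemma valid_cst f n : bcont f -> valid (fun k s => if Z.eq_dec k n then f s else 0).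
Proof.
  intros [Hc [C HC]]. split.
  - intros k s. destruct Z.eq_dec; [apply Hc|apply continuous_const].
  - exists (C * wt n). apply cst_nb; assumption.
Qed.

Lemma bcont_1 : bcont (fun _ => 1).
Proof. split; [intros; apply continuous_const|]. exists 1. intros; rewrite Rabs_R1; lra. Qed.

Lemma cf_cst f k s : bcont f -> cf (cst f) k s = if Z.eq_dec k 0 then f s else 0.
Proof. intros H. unfold cst. rewrite cf_mk; [reflexivity|apply valid_cst, H]. Qed.

Lemma cf_mono n k s : cf (mono n) k s = if Z.eq_dec k n then 1 else 0.
Proof. unfold mono. rewrite cf_mk; [reflexivity|apply (valid_cst (fun _ => 1)), bcont_1]. Qed.

Lemma valid_til a : valid (fun k s => cf a (- k)%Z s).
Proof.
  destruct (cf_valid a) as [H1 [M [m [H2 H3]]]]. split; [intros; apply H1|].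
  exists M, (fun k => m (- k)%Z). split; [intros; apply H2|].
  intros l Hl. specialize (H3 (map Z.opp l)). rewrite sumL_map in H3.
  rewrite (sumL_ext_in _ (fun k => m (- k)%Z * wt (- k)%Z)).
  - apply H3. apply FinFun.Injective_map_NoDup; [intros x y; lia|assumption].
  - intros. f_equal. unfold wt. f_equal. lia.
Qed.

Lemma cf_til a k s : cf (ltil a) k s = cf a (- k)%Z s.
Proof. unfold ltil. rewrite cf_mk; [reflexivity|apply valid_til]. Qed.

Lemma valid_ldiag d a : bcd d -> valid (fun k s => d k s * cf a k s).
Proof.
  intros [Hc [C HC]]. apply (valid_diag d _ C); auto; [|apply cf_valid].
  eapply Rle_trans; [apply Rabs_pos|apply (HC 0%Z 0)].
Qed.

Lemma cf_diag d a k s : bcd d -> cf (ldiag d a) k s = d k s * cf a k s.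
Proof. intros H. unfold ldiag. rewrite cf_mk; [reflexivity|]. apply valid_ldiag, H. Qed.

Lemma has_sum_refl k (f : Z -> R) s : has_sum f s -> has_sum (fun j => f (k - j)%Z) s.
Proof. apply (has_sum_bij (fun j => (k - j)%Z) (fun j => (k - j)%Z)); intros; lia. Qed.

Lemma has_sum_opp (f : Z -> R) s : has_sum f s -> has_sum (fun j => f (- j)%Z) s.
Proof. apply (has_sum_bij Z.opp Z.opp); intros; lia. Qed.

Lemma has_sum_shear (f : Z * Z -> R) s : has_sum f s ->
  has_sum (fun p => f (snd p, (fst p - snd p)%Z)) s.
Proof.
  apply (has_sum_bij (fun p : Z * Z => (snd p, (fst p - snd p)%Z))
    (fun p : Z * Z => ((fst p + snd p)%Z, fst p))); intros [u v]; simpl; f_equal; lia.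
Qed.

Lemma lmul_comm a b : (a * b)%L = (b * a)%L.
Proof.
  apply lau_ext. intros k s. apply (has_sum_unique _ _ _ (mul_has a b k s)).
  assert (H := has_sum_refl k _ _ (mul_has b a k s)).
  eapply has_sum_ext; [|apply H]. intros j. simpl. replace (k - (k - j))%Z with j by lia. ring.
Qed.

Lemma lmul_mono_l n a k s : cf (mono n * a)%L k s = cf a (k - n)%Z s.
Proof.
  apply (has_sum_unique _ _ _ (mul_has (mono n) a k s)).
  assert (H := has_sum_single (fun j => cf (mono n) j s * cf a (k - j)%Z s) n).
  simpl in H. rewrite cf_mono in H. destruct (Z.eq_dec n n) as [_|]; [|contradiction].
  rewrite Rmult_1_l in H. apply H. intros i Hi. rewrite cf_mono. destruct Z.eq_dec; [contradiction|ring].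
Qed.

Lemma lmul_1_l a : (lone * a)%L = a.
Proof. apply lau_ext. intros k s. unfold lone. rewrite lmul_mono_l. f_equal. lia. Qed.

Lemma cst_mul_l f a k s : bcont f -> cf (cst f * a)%L k s = f s * cf a k s.
Proof.
  intros Hf. apply (has_sum_unique _ _ _ (mul_has (cst f) a k s)).
  assert (H := has_sum_single (fun j => cf (cst f) j s * cf a (k - j)%Z s) 0%Z).
  simpl in H. rewrite cf_cst in H by assumption. destruct (Z.eq_dec 0 0) as [_|]; [|contradiction].
  replace (k - 0)%Z with k in H by lia.
  apply H. intros i Hi. rewrite cf_cst by assumption. destruct Z.eq_dec; [contradiction|ring].
Qed.

Lemma lmul_plus_distr_l a b c : ((a + b) * c)%L = (a * c + b * c)%L.
Proof.
  apply lau_ext. intros k s. rewrite cf_add. apply (has_sum_unique _ _ _ (mul_has (a + b)%L c k s)).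
  eapply has_sum_ext; [|apply (has_sum_plus _ _ _ _ (mul_has a c k s) (mul_has b c k s))].
  intros j. simpl. rewrite cf_add. ring.
Qed.

(** Both sides are iterated sums of one absolutely summable family on [Z * Z], the right-hand one
    after the shear that replaces [(k, j)] by [(j, k - j)]. *)
Lemma lmul_assoc a b c : (a * (b * c))%L = ((a * b) * c)%L.
Proof.
  apply lau_ext. intros n s.
  destruct (cf_valid a) as [_ [Ma Ha]], (cf_valid b) as [_ [Mb Hb]], (cf_valid c) as [_ [Mc Hc]].
  destruct (nb_term _ _ Ha) as [ma [a1 [_ [a3 [_ [_ a6]]]]]].
  destruct (nb_term _ _ Hb) as [mb [b1 [_ [b3 [_ [_ b6]]]]]].
  destruct (nb_term _ _ Hc) as [mc [c1 [_ [c3 [_ [c5 _]]]]]].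
  set (F := fun p : Z * Z => cf a (fst p) s * cf b (snd p) s * cf c (n - fst p - snd p)%Z s).
  destruct (summ_has_sum F (Mc * (Ma * Mb))) as [x Hx].
  { intros L HL. apply Rle_trans with (sumL (fun p => Mc * (ma (fst p) * mb (snd p))) L).
    - apply sumL_le_in. intros [i j] _. unfold F; simpl. rewrite !Rabs_mult, Rmult_comm.
      apply Rmult_le_compat; auto using Rabs_pos.
      + apply Rmult_le_pos; apply Rabs_pos.
      + eapply Rle_trans; [apply c1|apply c5].
      + apply Rmult_le_compat; auto using Rabs_pos.
    - rewrite sumL_scal. apply Rmult_le_compat_l.
      + apply Rle_trans with (mc 0%Z); auto.
      + apply (sumL_prod_le ma mb); auto. }
  transitivity x.
  - apply (has_sum_unique _ _ _ (mul_has a (b * c)%L n s)).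
    apply (has_sum_fubini _ _ _ Hx). intros i.
    eapply has_sum_ext; [|apply (has_sum_scal (cf a i s) _ _ (mul_has b c (n - i) s))].
    intros j. unfold F; simpl. ring.
  - apply (has_sum_unique (fun j => cf (a * b)%L j s * cf c (n - j)%Z s)); [|apply mul_has].
    assert (Hx' := has_sum_shear F x Hx).
    apply (has_sum_fubini _ _ _ Hx'). intros k. rewrite Rmult_comm.
    eapply has_sum_ext; [|apply (has_sum_scal (cf c (n - k)%Z s) _ _ (mul_has a b k s))].
    intros j. unfold F; simpl. replace (n - j - (k - j))%Z with (n - k)%Z by lia. ring.
Qed.

Lemma lau_ring : ring_theory lzero lone ladd lmul lsub lopp (@eq lau).
Proof.
  constructor.
  - intros a. apply lau_ext. intros. rewrite cf_add, cf_zero. ring.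
  - intros a b. apply lau_ext. intros. rewrite !cf_add. ring.
  - intros a b c. apply lau_ext. intros. rewrite !cf_add. ring.
  - apply lmul_1_l.
  - apply lmul_comm.
  - apply lmul_assoc.
  - apply lmul_plus_distr_l.
  - reflexivity.
  - intros a. apply lau_ext. intros. rewrite cf_add, cf_opp, cf_zero. ring.
Qed.

Add Ring lau_ring_inst : lau_ring.

Lemma nrm_add a b M N : nrm a M -> nrm b N -> nrm (a + b)%L (M + N).
Proof.
  intros H1 H2. unfold nrm, ladd. rewrite cf_mk; [apply nb_add; assumption|].
  apply valid_add; apply cf_valid.
Qed.

Lemma nrm_mul a b M N : nrm a M -> nrm b N -> nrm (a * b)%L (M * N).
Proof. intros H1 H2. unfold nrm. rewrite cf_mul. apply nb_conv; assumption. Qed.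

Lemma nrm_ext a M (c : Z -> R -> R) : (forall k s, cf a k s = c k s) -> nb c M -> nrm a M.
Proof.
  intros H Hc. unfold nrm. replace (cf a) with c; [assumption|].
  apply functional_extensionality; intros; apply functional_extensionality; intros; auto.
Qed.

Lemma nrm_opp a M : nrm a M -> nrm (- a)%L M.
Proof.
  intros H. eapply nrm_ext; [intros; apply cf_opp|].
  destruct H as [m [H1 H2]]. exists m. split; [intros; rewrite Rabs_Ropp; auto|assumption].
Qed.

Lemma nrm_le a M N : nrm a M -> M <= N -> nrm a N.
Proof. apply nb_le. Qed.

Lemma nrm_ge0 a M : nrm a M -> 0 <= M.
Proof. apply nb_pos. Qed.

Lemma nrm_zero : nrm lzero 0.
Proof.
  exists (fun _ => 0). split; [intros; rewrite cf_zero, Rabs_R0; lra|].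
  intros l _. rewrite (sumL_scal 0). lra.
Qed.

Lemma nrm_ex a : exists M, 0 <= M /\ nrm a M.
Proof. destruct (cf_valid a) as [_ [M H]]. exists M. split; [apply (nb_pos _ _ H)|exact H]. Qed.

Lemma nrm_til a M : nrm a M -> nrm (ltil a) M.
Proof.
  intros [m [H1 H2]]. eapply nrm_ext; [intros; apply cf_til|]. exists (fun k => m (- k)%Z).
  split; [intros; apply H1|].
  intros l Hl. specialize (H2 (map Z.opp l)). rewrite sumL_map in H2.
  rewrite (sumL_ext_in _ (fun k => m (- k)%Z * wt (- k)%Z)).
  - apply H2. apply FinFun.Injective_map_NoDup; [intros x y; lia|assumption].
  - intros. f_equal. unfold wt. f_equal. lia.
Qed.

Lemma nrm_diag d a M C : bcd d -> 0 <= C -> (forall k s, Rabs (d k s) <= C) -> nrm a M -> nrm (ldiag d a) (C * M).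
Proof. intros Hd HC H Ha. eapply nrm_ext; [intros; apply cf_diag, Hd|]. apply nb_diag; assumption. Qed.

Lemma nrm_coef a M k s : nrm a M -> Rabs (cf a k s) * wt k <= M.
Proof.
  intros H. destruct (nb_term _ _ H) as [m [m1 [_ [_ [m4 _]]]]].
  eapply Rle_trans; [|apply (m4 k)]. apply Rmult_le_compat_r; [apply Rlt_le, wt_pos|apply m1].
Qed.

Lemma til_add a b : ltil (a + b)%L = (ltil a + ltil b)%L.
Proof. apply lau_ext. intros. rewrite !cf_til, !cf_add, !cf_til. reflexivity. Qed.
Lemma til_opp a : ltil (- a)%L = (- ltil a)%L.
Proof. apply lau_ext. intros. rewrite !cf_til, !cf_opp, !cf_til. reflexivity. Qed.
Lemma til_sub a b : ltil (a - b)%L = (ltil a - ltil b)%L.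
Proof. unfold lsub. rewrite til_add, til_opp. reflexivity. Qed.
Lemma til_til a : ltil (ltil a) = a.
Proof. apply lau_ext. intros. rewrite !cf_til. f_equal. lia. Qed.
Lemma til_mul a b : ltil (a * b)%L = (ltil a * ltil b)%L.
Proof.
  apply lau_ext. intros k s. rewrite cf_til.
  apply (has_sum_unique _ _ _ (mul_has a b (- k) s)).
  assert (H := has_sum_opp _ _ (mul_has (ltil a) (ltil b) k s)).
  eapply has_sum_ext; [|apply H]. intros j. simpl. rewrite !cf_til. f_equal; f_equal; lia.
Qed.
Lemma til_cst f : bcont f -> ltil (cst f) = cst f.
Proof. intros H. apply lau_ext. intros. rewrite cf_til, !cf_cst by assumption. repeat destruct Z.eq_dec; try lia; reflexivity. Qed.
Lemma til_mono n : ltil (mono n) = mono (- n).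
Proof. apply lau_ext. intros. rewrite cf_til, !cf_mono. repeat destruct Z.eq_dec; try lia; reflexivity. Qed.
Lemma til_zero : ltil lzero = lzero.
Proof. apply lau_ext. intros. rewrite cf_til, !cf_zero. reflexivity. Qed.
Lemma til_one : ltil lone = lone.
Proof. unfold lone. rewrite til_mono. reflexivity. Qed.

Lemma diag_add d a b : bcd d -> ldiag d (a + b)%L = (ldiag d a + ldiag d b)%L.
Proof. intros H. apply lau_ext. intros. rewrite cf_diag, !cf_add, !cf_diag by assumption. ring. Qed.
Lemma diag_opp d a : bcd d -> ldiag d (- a)%L = (- ldiag d a)%L.
Proof. intros H. apply lau_ext. intros. rewrite cf_diag, !cf_opp, !cf_diag by assumption. ring. Qed.
Lemma diag_sub d a b : bcd d -> ldiag d (a - b)%L = (ldiag d a - ldiag d b)%L.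
Proof. intros H. unfold lsub. rewrite diag_add, diag_opp by assumption. reflexivity. Qed.
Lemma diag_zero d : bcd d -> ldiag d lzero = lzero.
Proof. intros H. apply lau_ext. intros. rewrite cf_diag, !cf_zero by assumption. ring. Qed.

Lemma cst_add f g : bcont f -> bcont g -> cst (fun s => f s + g s) = (cst f + cst g)%L.
Proof.
  intros Hf Hg. assert (bcont (fun s => f s + g s)).
  { destruct Hf as [F1 [C F2]], Hg as [G1 [D G2]]. split; [intros; apply continuous_Rplus; auto|].
    exists (C + D). intros. eapply Rle_trans; [apply Rabs_triang|]. generalize (F2 s) (G2 s); lra. }
  apply lau_ext. intros. rewrite cf_add, !cf_cst by assumption. destruct Z.eq_dec; ring.
Qed.

Lemma bcont_mult f g : bcont f -> bcont g -> bcont (fun s => f s * g s).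
Proof.
  intros [F1 [C F2]] [G1 [D G2]]. split; [intros; apply continuous_Rmult; auto|].
  exists (C * D). intros. rewrite Rabs_mult. apply Rmult_le_compat; auto using Rabs_pos.
Qed.

Lemma cst_mul f g : bcont f -> bcont g -> cst (fun s => f s * g s) = (cst f * cst g)%L.
Proof.
  intros Hf Hg. assert (H := bcont_mult f g Hf Hg).
  apply lau_ext. intros. rewrite cst_mul_l, !cf_cst by assumption. destruct Z.eq_dec; ring.
Qed.

Lemma mono_mul m n : (mono m * mono n)%L = mono (m + n).
Proof. apply lau_ext. intros. rewrite lmul_mono_l, !cf_mono. repeat destruct Z.eq_dec; try lia; reflexivity. Qed.

Global Opaque ladd lopp lmul cst mono ltil ldiag.

(** * Geometric bounds, completeness and the contraction principle *)

Lemma geo_zball q n : 0 <= q < 1 -> sumL (fun k => q ^ Z.abs_nat k) (zball n) <= 2 / (1 - q) - 2 * q ^ S n / (1 - q).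
Proof.
  intros Hq. induction n as [|n IH].
  - unfold sumL; simpl. replace (2 / (1 - q) - 2 * (q * 1) / (1 - q)) with 2 by (field; lra). lra.
  - change (sumL (fun k => q ^ Z.abs_nat k) (zball (S n))) with
      (q ^ Z.abs_nat (Z.of_nat (S n)) + (q ^ Z.abs_nat (- Z.of_nat (S n))%Z + sumL (fun k => q ^ Z.abs_nat k) (zball n))).
    replace (Z.abs_nat (Z.of_nat (S n))) with (S n) by lia.
    replace (Z.abs_nat (- Z.of_nat (S n))%Z) with (S n) by lia.
    eapply Rle_trans; [apply Rplus_le_compat_l, Rplus_le_compat_l, IH|].
    apply Req_le. simpl. field. lra.
Qed.

Lemma geo_list q l : 0 <= q < 1 -> NoDup l -> sumL (fun k => q ^ Z.abs_nat k) l <= 2 / (1 - q).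
Proof.
  intros Hq Hl. destruct (zball_covers l) as [n Hn].
  eapply Rle_trans; [apply sumL_incl_le; [|exact Hl|exact Hn]|].
  - intros. apply pow_le; lra.
  - eapply Rle_trans; [apply geo_zball; assumption|].
    assert (0 <= 2 * q ^ S n / (1 - q)); [|lra].
    apply Rmult_le_pos; [generalize (pow_le q (S n)); lra|apply Rlt_le, Rinv_0_lt_compat; lra].
Qed.

Lemma geo_seq q n m : 0 <= q < 1 -> sumL (fun k => q ^ k) (seq n m) <= q ^ n / (1 - q).
Proof.
  intros Hq. revert n. induction m as [|m IH]; intros n.
  - unfold sumL; simpl. apply Rmult_le_pos; [apply pow_le; lra|apply Rlt_le, Rinv_0_lt_compat; lra].
  - change (sumL (fun k => q ^ k) (seq n (S m))) with (q ^ n + sumL (fun k => q ^ k) (seq (S n) m)).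
    eapply Rle_trans; [apply Rplus_le_compat_l, IH|]. apply Req_le. simpl. field. lra.
Qed.

Lemma geo_nat q N l : 0 <= q < 1 -> NoDup l ->
  sumL (fun k => if le_dec N k then q ^ k else 0) l <= q ^ N / (1 - q).
Proof.
  intros Hq Hl.
  assert (P : forall k, 0 <= q ^ k) by (intros; apply pow_le; lra).
  apply Rle_trans with (sumL (fun k => if le_dec N k then q ^ k else 0) (seq 0 (N + S (list_max l)))).
  - apply sumL_incl_le; [intros; destruct le_dec; auto; lra|assumption|].
    intros x Hx. apply in_seq. assert (x <= list_max l)%nat; [|lia].
    assert (K := proj1 (list_max_le l (list_max l)) (le_n _)). rewrite Forall_forall in K. auto.
  - rewrite seq_app, sumL_app. simpl (0 + N)%nat.
    rewrite (sumL_ext_in _ (fun _ => 0 * 0) (seq 0 N)), (sumL_scal 0 (fun _ => 0)).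
    + rewrite (sumL_ext_in _ (fun k => q ^ k) (seq N _)); [generalize (geo_seq q N (S (list_max l)) Hq); lra|].
      intros k Hk. apply in_seq in Hk. destruct le_dec; [reflexivity|lia].
    + intros k Hk. apply in_seq in Hk. destruct le_dec; [lia|ring].
Qed.

(** The limit is [x O] plus the sum of the successive differences, coefficient by coefficient. The
    majorant [m'] of the differences from [N] on bounds the distance to [x N] in norm; for [N = 0]
    it also shows that the limit is a valid element. *)
Lemma lau_complete (x : nat -> lau) M q : 0 <= q < 1 ->
  (forall n, nrm (x (S n) - x n)%L (M * q ^ n)) ->
  exists l, forall n, nrm (x n - l)%L (M * (q ^ n / (1 - q))).
Proof.
  intros Hq H.
  set (mm n := proj1_sig (constructive_indefinite_description _ (nb_term _ _ (H n)))).
  assert (Hm : forall n, (forall k s, Rabs (cf (x (S n)) k s - cf (x n) k s) <= mm n k) /\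
    (forall l, NoDup l -> sumL (fun k => mm n k * wt k) l <= M * q ^ n) /\
    (forall k, 0 <= mm n k) /\ (forall k, mm n k <= M * q ^ n)).
  { intros n. unfold mm. destruct constructive_indefinite_description as [m Hm']. simpl. destruct Hm' as [m1 [m2 [m3 [_ [m5 _]]]]]. repeat split; auto. intros. rewrite <- cf_sub. apply m1. }
  clearbody mm.
  assert (HM : 0 <= M) by (specialize (H O); apply nrm_ge0 in H; simpl in H; lra).
  assert (Sm : forall k l, NoDup l -> sumL (fun n => mm n k) l <= M * (q ^ 0 / (1 - q))).
  { intros k l Hl. apply Rle_trans with (sumL (fun n => M * (if le_dec 0 n then q ^ n else 0)) l).
    - apply sumL_le_in. intros n _. destruct le_dec; [apply Hm|lia].
    - rewrite sumL_scal. apply Rmult_le_compat_l; [assumption|apply geo_nat; assumption]. }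
  set (d n k s := cf (x (S n)) k s - cf (x n) k s).
  assert (Hd : forall k s, has_sum (fun n => d n k s) (tsum (fun n => d n k s))).
  { intros k s. apply tsum_has with (M * (q ^ 0 / (1 - q))). intros l Hl.
    eapply Rle_trans; [|apply (Sm k l Hl)]. apply sumL_le_in. intros n _. apply Hm. }
  assert (Hf : forall N k s, has_sum (fun n => if le_dec N n then 0 else d n k s) (cf (x N) k s - cf (x O) k s)).
  { intros N k s. induction N as [|N IH].
    - rewrite Rminus_diag_eq by reflexivity. apply has_sum_ext with (fun _ => 0); [|apply has_sum_0].
      intros i. destruct le_dec; [reflexivity|lia].
    - replace (cf (x (S N)) k s - cf (x O) k s) with ((cf (x N) k s - cf (x O) k s) + d N k s) by (unfold d; ring).
      assert (K := has_sum_single (fun n => if Nat.eq_dec n N then d n k s else 0) N).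
      simpl in K. destruct (Nat.eq_dec N N) as [_|]; [|lia].
      eapply has_sum_ext; [|apply (has_sum_plus _ _ _ _ IH (K ltac:(intros i Hi; destruct Nat.eq_dec; [lia|reflexivity])))].
      intros i. simpl. destruct (le_dec (S N) i), (le_dec N i), (Nat.eq_dec i N); try lia; ring. }
  set (L := fun k s => cf (x O) k s + tsum (fun n => d n k s)).
  assert (HL : forall N, nb (fun k s => L k s - cf (x N) k s) (M * (q ^ N / (1 - q)))).
  { intros N. set (m' k n := if le_dec N n then mm n k else 0).
    assert (m'0 : forall k n, 0 <= m' k n) by (intros; unfold m'; destruct le_dec; [apply Hm|lra]).
    assert (m's : forall k, has_sum (m' k) (tsum (m' k))).
    { intros k. apply tsum_has with (M * (q ^ 0 / (1 - q))). intros l Hl.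
      eapply Rle_trans; [|apply (Sm k l Hl)]. apply sumL_le_in. intros n _.
      rewrite Rabs_pos_eq by auto. unfold m'. destruct le_dec; [lra|apply Hm]. }
    exists (fun k => tsum (m' k)). split.
    - intros k s. apply has_sum_le with (f := fun n => if le_dec N n then d n k s else 0) (g := m' k).
      + assert (K := has_sum_plus _ _ _ _ (Hd k s) (has_sum_scal (-1) _ _ (Hf N k s))).
        replace (L k s - cf (x N) k s) with (tsum (fun n => d n k s) + -1 * (cf (x N) k s - cf (x O) k s)) by (unfold L; ring).
        eapply has_sum_ext; [|apply K]. intros n. simpl. destruct le_dec; ring.
      + intros n. unfold m'. destruct le_dec; [apply Hm|rewrite Rabs_R0; lra].
      + intros l Hl. apply has_sum_ge; auto.
    - intros l Hl. rewrite (sumL_ext_in _ (fun k => wt k * tsum (m' k))) by (intros; ring).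
      assert (K := has_sum_sumL (fun k n => wt k * m' k n) (fun k => wt k * tsum (m' k)) l
        (fun k => has_sum_scal (wt k) _ _ (m's k))).
      eapply Rle_trans; [apply Rle_abs|].
      apply has_sum_le with (1 := K) (g := fun n => M * (if le_dec N n then q ^ n else 0)).
      + intros n. rewrite Rabs_pos_eq.
        2: { apply sumL_nonneg. intros k. apply Rmult_le_pos; [apply Rlt_le, wt_pos|auto]. }
        unfold m'. destruct le_dec.
        * rewrite (sumL_ext_in _ (fun k => mm n k * wt k)) by (intros; ring). apply Hm; assumption.
        * rewrite (sumL_ext_in _ (fun k => 0 * 0)) by (intros; ring). rewrite (sumL_scal 0 (fun _ => 0)). lra.
      + intros l' Hl'. rewrite sumL_scal. apply Rmult_le_compat_l; [assumption|apply geo_nat; assumption]. }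
  assert (VL : valid L).
  { split.
    - intros k s. unfold L. apply continuous_Rplus; [apply cf_valid|].
      apply continuous_tsum with (m := fun n => mm n k) (M := M * (q ^ 0 / (1 - q))).
      + intros l Hl. rewrite (sumL_ext_in _ (fun n => mm n k)); [auto|]. intros. apply Rabs_pos_eq, Hm.
      + intros n t. apply Hm.
      + intros n. unfold d. apply (continuous_minus (cf (x (S n)) k) (cf (x n) k)); apply cf_valid.
    - destruct (cf_valid (x O)) as [_ [M0 HM0]]. exists (M * (q ^ 0 / (1 - q)) + M0).
      replace L with (fun k s => (L k s - cf (x O) k s) + cf (x O) k s).
      + apply nb_add; [apply HL|assumption].
      + apply functional_extensionality; intros k; apply functional_extensionality; intros s; ring. }
  exists (Lau L VL). intros N. destruct (HL N) as [m [m1 m2]]. exists m. split; [|assumption].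
  intros k s. rewrite cf_sub. simpl. rewrite <- Rabs_Ropp, Ropp_minus_distr. apply m1.
Qed.

Lemma nrm_small_zero a M q : 0 <= q < 1 -> (forall n, nrm a (M * q ^ n)) -> a = lzero.
Proof.
  intros Hq H. apply lau_ext. intros k s. rewrite cf_zero.
  destruct (Req_dec (cf a k s) 0) as [|N]; [assumption|exfalso].
  assert (0 < Rabs (cf a k s)) by (apply Rabs_pos_lt; assumption).
  assert (HM : 0 <= M) by (specialize (H O); apply nrm_ge0 in H; simpl in H; lra).
  destruct (pow_lt_1_zero q) with (y := Rabs (cf a k s) / (M + 1)) as [n Hn].
  { rewrite Rabs_pos_eq; lra. }
  { apply Rdiv_lt_0_compat; lra. }
  specialize (Hn n (le_n _)). rewrite Rabs_pos_eq in Hn by (apply pow_le; lra).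
  assert (K := nrm_coef _ _ k s (H n)). generalize (wt_ge1 k). intros.
  apply (Rmult_lt_compat_r (M + 1)) in Hn; [|lra].
  unfold Rdiv in Hn. rewrite Rmult_assoc, Rinv_l, Rmult_1_r in Hn by lra.
  assert (0 <= q ^ n) by (apply pow_le; lra). nra.
Qed.

(** Banach's principle on the ball of radius [rho], iterated from zero: the bound on [K lzero]
    leaves exactly the room [q * rho] for the contraction, so the iterates never leave the ball. *)
Lemma lau_fixpoint (K : lau -> lau) q rho : 0 <= q < 1 -> nrm (K lzero) ((1 - q) * rho) ->
  (forall a b M, nrm a rho -> nrm b rho -> nrm (a - b)%L M -> nrm (K a - K b)%L (q * M)) ->
  exists x, nrm x rho /\ K x = x.
Proof.
  intros Hq H0 HK.
  assert (Hr : 0 <= rho) by (apply nrm_ge0 in H0; nra).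
  set (x := fix x n := match n with O => lzero | S n => K (x n) end).
  assert (Z0 : nrm lzero rho) by (eapply nrm_le; [apply nrm_zero|assumption]).
  assert (B : forall n, nrm (x n) rho).
  { induction n as [|n IH]; [assumption|]. simpl.
    replace (K (x n)) with ((K (x n) - K lzero) + K lzero)%L by ring.
    eapply nrm_le; [apply nrm_add; [apply HK; [assumption|assumption|]|exact H0]|].
    - replace (x n - lzero)%L with (x n) by ring. exact IH.
    - apply Req_le; ring. }
  assert (S1 : forall n, nrm (x (S n) - x n)%L ((1 - q) * rho * q ^ n)).
  { induction n as [|n IH].
    - simpl. replace (K lzero - lzero)%L with (K lzero) by ring. rewrite Rmult_1_r. assumption.
    - change (nrm (K (x (S n)) - K (x n))%L ((1 - q) * rho * q ^ S n)).
      eapply nrm_le; [apply HK; [apply B|apply B|exact IH]|]. apply Req_le. simpl. ring. }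
  destruct (lau_complete x _ q Hq S1) as [l Hl].
  assert (Bl : nrm l rho).
  { assert (K0 := nrm_opp _ _ (Hl O)). simpl in K0.
    replace (- (lzero - l))%L with l in K0 by ring. eapply nrm_le; [exact K0|].
    apply Req_le. field. lra. }
  exists l. split; [assumption|].
  replace (K l) with (l + (K l - l))%L by ring.
  replace (K l - l)%L with lzero; [ring|]. symmetry.
  apply nrm_small_zero with (M := 2 * q * rho) (q := q); [assumption|]. intros n.
  replace (K l - l)%L with ((x (S n) - l) + - (K (x n) - K l))%L by (simpl; ring).
  eapply nrm_le; [apply nrm_add; [apply Hl|apply nrm_opp, HK; [apply B|assumption|apply Hl]]|].
  apply Req_le. simpl. field. lra.
Qed.

(* Evaluation on the unit circle at [zeta = exp (- i alpha)]. *)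
Definition ev (a : lau) (s alpha : R) : C :=
  (tsum (fun k => cf a k s * cos (IZR k * alpha)), tsum (fun k => - (cf a k s * sin (IZR k * alpha)))).

Lemma ev_summ a s (g : Z -> R) : (forall k, Rabs (g k) <= 1) -> exists M, summ (fun k => cf a k s * g k) M.
Proof.
  intros Hg. destruct (cf_valid a) as [_ [M HM]]. destruct (nb_term _ _ HM) as [m [m1 [_ [m3 [_ [_ m6]]]]]].
  exists M. intros l Hl. eapply Rle_trans; [|apply (m6 l Hl)]. apply sumL_le_in. intros k _.
  rewrite Rabs_mult. rewrite <- (Rmult_1_r (m k)). apply Rmult_le_compat; auto using Rabs_pos.
Qed.

Lemma ev_has_re a s alpha : has_sum (fun k => cf a k s * cos (IZR k * alpha)) (fst (ev a s alpha)).
Proof.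
  destruct (ev_summ a s (fun k => cos (IZR k * alpha))) as [M HM]; [|apply (tsum_has _ M HM)].
  intros k. apply Rabs_le, COS_bound.
Qed.

Lemma ev_has_im a s alpha : has_sum (fun k => - (cf a k s * sin (IZR k * alpha))) (snd (ev a s alpha)).
Proof.
  destruct (ev_summ a s (fun k => - sin (IZR k * alpha))) as [M HM].
  { intros k. rewrite Rabs_Ropp. apply Rabs_le, SIN_bound. }
  apply (tsum_has _ M). intros l Hl. rewrite <- (sumL_ext_in (fun k => Rabs (cf a k s * - sin (IZR k * alpha)))); [auto|].
  intros. f_equal. ring.
Qed.

Lemma ev_eq a s alpha x y : has_sum (fun k => cf a k s * cos (IZR k * alpha)) x ->
  has_sum (fun k => - (cf a k s * sin (IZR k * alpha))) y -> ev a s alpha = (x, y).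
Proof. intros H1 H2. unfold ev. rewrite (tsum_eq _ _ H1), (tsum_eq _ _ H2). reflexivity. Qed.

Lemma ev_add a b s alpha : ev (a + b)%L s alpha = Cplus (ev a s alpha) (ev b s alpha).
Proof.
  apply ev_eq.
  - eapply has_sum_ext; [|apply (has_sum_plus _ _ _ _ (ev_has_re a s alpha) (ev_has_re b s alpha))].
    intros; simpl; rewrite cf_add; ring.
  - eapply has_sum_ext; [|apply (has_sum_plus _ _ _ _ (ev_has_im a s alpha) (ev_has_im b s alpha))].
    intros; simpl; rewrite cf_add; ring.
Qed.

Lemma ev_opp a s alpha : ev (- a)%L s alpha = Copp (ev a s alpha).
Proof.
  unfold Copp. apply ev_eq.
  - replace (- fst (ev a s alpha)) with (-1 * fst (ev a s alpha)) by ring.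
    eapply has_sum_ext; [|apply (has_sum_scal (-1) _ _ (ev_has_re a s alpha))]. intros i; simpl. rewrite cf_opp; ring.
  - replace (- snd (ev a s alpha)) with (-1 * snd (ev a s alpha)) by ring.
    eapply has_sum_ext; [|apply (has_sum_scal (-1) _ _ (ev_has_im a s alpha))]. intros; simpl; rewrite cf_opp; ring.
Qed.

Lemma ev_sub a b s alpha : ev (a - b)%L s alpha = Cminus (ev a s alpha) (ev b s alpha).
Proof. unfold lsub. rewrite ev_add, ev_opp. reflexivity. Qed.

Lemma ev_til a s alpha : ev (ltil a) s alpha = Cconj (ev a s alpha).
Proof.
  unfold Cconj. apply ev_eq.
  - eapply has_sum_ext; [|apply (has_sum_opp _ _ (ev_has_re a s alpha))]. intros k; simpl.
    rewrite cf_til, opp_IZR, Ropp_mult_distr_l_reverse, cos_neg. reflexivity.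
  - replace (- snd (ev a s alpha)) with (-1 * snd (ev a s alpha)) by ring.
    eapply has_sum_ext; [|apply (has_sum_scal (-1) _ _ (has_sum_opp _ _ (ev_has_im a s alpha)))]. intros k; simpl.
    rewrite cf_til, opp_IZR, Ropp_mult_distr_l_reverse, sin_neg. ring.
Qed.

(** The products of the real and imaginary sums are families on [Z * Z]; after the shear, the
    addition formulas collapse each fibre to one coefficient of the convolution. *)
Lemma ev_mul a b s alpha : ev (a * b)%L s alpha = Cmult (ev a s alpha) (ev b s alpha).
Proof.
  assert (Sc : forall (c : lau) (g : Z -> R), (forall k, Rabs (g k) <= 1) -> exists M, summ (fun k => cf c k s * g k) M)
    by (intros; apply ev_summ; assumption).
  assert (Bc : forall k : Z, Rabs (cos (IZR k * alpha)) <= 1) by (intros; apply Rabs_le, COS_bound).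
  assert (Bs : forall k : Z, Rabs (- sin (IZR k * alpha)) <= 1)
    by (intros; rewrite Rabs_Ropp; apply Rabs_le, SIN_bound).
  destruct (Sc a _ Bc) as [Mac Hac], (Sc a _ Bs) as [Mas Has], (Sc b _ Bc) as [Mbc Hbc], (Sc b _ Bs) as [Mbs Hbs].
  assert (Ri : forall c, has_sum (fun k => cf c k s * - sin (IZR k * alpha)) (snd (ev c s alpha))).
  { intros c. eapply has_sum_ext; [|apply ev_has_im]. intros; simpl; ring. }
  assert (CC := has_sum_prod _ _ _ _ _ _ Hac Hbc (ev_has_re a s alpha) (ev_has_re b s alpha)).
  assert (SS := has_sum_prod _ _ _ _ _ _ Has Hbs (Ri a) (Ri b)).
  assert (CS := has_sum_prod _ _ _ _ _ _ Hac Hbs (ev_has_re a s alpha) (Ri b)).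
  assert (SC := has_sum_prod _ _ _ _ _ _ Has Hbc (Ri a) (ev_has_re b s alpha)).
  unfold Cmult. apply ev_eq.
  - assert (H := has_sum_shear _ _ (has_sum_plus _ _ _ _ CC (has_sum_scal (-1) _ _ SS))).
    replace (fst (ev a s alpha) * fst (ev b s alpha) - snd (ev a s alpha) * snd (ev b s alpha))
      with (fst (ev a s alpha) * fst (ev b s alpha) + -1 * (snd (ev a s alpha) * snd (ev b s alpha))) by ring.
    apply (has_sum_fubini _ _ _ H). intros k. rewrite Rmult_comm.
    eapply has_sum_ext; [|apply (has_sum_scal (cos (IZR k * alpha)) _ _ (mul_has a b k s))].
    intros j; simpl. replace (IZR k * alpha) with (IZR j * alpha + IZR (k - j) * alpha)
      by (rewrite minus_IZR; ring). rewrite cos_plus. ring.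
  - assert (H := has_sum_shear _ _ (has_sum_plus _ _ _ _ CS SC)).
    apply (has_sum_fubini _ _ _ H). intros k.
    replace (- (cf (a * b)%L k s * sin (IZR k * alpha))) with (- sin (IZR k * alpha) * cf (a * b)%L k s) by ring.
    eapply has_sum_ext; [|apply (has_sum_scal (- sin (IZR k * alpha)) _ _ (mul_has a b k s))].
    intros j; simpl. replace (IZR k * alpha) with (IZR j * alpha + IZR (k - j) * alpha)
      by (rewrite minus_IZR; ring). rewrite sin_plus. ring.
Qed.

Lemma ev_mono n s alpha : ev (mono n) s alpha = (cos (IZR n * alpha), - sin (IZR n * alpha)).
Proof.
  apply ev_eq.
  - assert (H := has_sum_single (fun k => cf (mono n) k s * cos (IZR k * alpha)) n). simpl in H.
    rewrite cf_mono in H. destruct (Z.eq_dec n n) as [_|N]; [|exfalso; auto]. rewrite Rmult_1_l in H.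
    apply H. intros k Hk. rewrite cf_mono. destruct Z.eq_dec; [exfalso; auto|ring].
  - assert (H := has_sum_single (fun k => - (cf (mono n) k s * sin (IZR k * alpha))) n). simpl in H.
    rewrite cf_mono in H. destruct (Z.eq_dec n n) as [_|N]; [|exfalso; auto]. rewrite Rmult_1_l in H.
    apply H. intros k Hk. rewrite cf_mono. destruct Z.eq_dec; [exfalso; auto|ring].
Qed.

Lemma ev_cst f s alpha : bcont f -> ev (cst f) s alpha = RtoC (f s).
Proof.
  intros Hf. apply ev_eq.
  - assert (H := has_sum_single (fun k => cf (cst f) k s * cos (IZR k * alpha)) 0%Z). simpl in H.
    rewrite cf_cst in H by assumption. destruct (Z.eq_dec 0 0) as [_|N]; [|exfalso; auto].
    rewrite Rmult_0_l, cos_0, Rmult_1_r in H.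
    apply H. intros k Hk. rewrite cf_cst by assumption. destruct Z.eq_dec; [exfalso; auto|ring].
  - assert (H := has_sum_single (fun k => - (cf (cst f) k s * sin (IZR k * alpha))) 0%Z). simpl in H.
    rewrite Rmult_0_l, sin_0, Rmult_0_r, Ropp_0 in H.
    apply H. intros k Hk. rewrite cf_cst by assumption. destruct Z.eq_dec; [exfalso; auto|ring].
Qed.

Lemma ev_one s alpha : ev lone s alpha = RtoC 1.
Proof. unfold lone. rewrite ev_mono, Rmult_0_l, cos_0, sin_0, Ropp_0. reflexivity. Qed.

(** * The Crapper-type wave *)

Lemma bcont_const c : bcont (fun _ => c).
Proof. split; [intros; apply continuous_const|]. exists (Rabs c). intros; lra. Qed.
Lemma bcont_plus f g : bcont f -> bcont g -> bcont (fun s => f s + g s).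
Proof.
  intros [F1 [C F2]] [G1 [D G2]]. split; [intros; apply continuous_Rplus; auto|].
  exists (C + D). intros. eapply Rle_trans; [apply Rabs_triang|]. generalize (F2 s) (G2 s); lra.
Qed.
Lemma bcont_opp f : bcont f -> bcont (fun s => - f s).
Proof.
  intros [F1 [C F2]]. split; [intros; apply (continuous_opp f); auto|].
  exists C. intros. rewrite Rabs_Ropp. auto.
Qed.
Lemma bcont_inv f c : 0 < c -> (forall s, c <= f s) -> bcont f -> bcont (fun s => / f s).
Proof.
  intros Hc Hf [F1 _]. split.
  - intros s. apply (continuous_comp f Rinv); [apply F1|]. apply continuous_Rinv. specialize (Hf s). lra.
  - exists (/ c). intros s. specialize (Hf s). rewrite Rabs_pos_eq.
    + apply Rinv_le_contravar; assumption.
    + apply Rlt_le, Rinv_0_lt_compat. lra.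
Qed.

(* [s] clamped to [0, 23/50], so that every coefficient is a bounded function on [R]. *)
Definition amp (s : R) : R := (23/50 + Rabs s + - Rabs (s + - (23/50))) * (1/2).

Lemma amp_range s : 0 <= amp s <= 23/50.
Proof. unfold amp, Rabs. repeat destruct Rcase_abs; lra. Qed.
Lemma amp_id s : 0 <= s <= 23/50 -> amp s = s.
Proof. intros H. unfold amp, Rabs. repeat destruct Rcase_abs; lra. Qed.
Lemma amp_bcont : bcont amp.
Proof.
  split.
  - intros s. unfold amp.
    apply continuous_Rmult; [|apply continuous_const].
    apply continuous_Rplus; [apply continuous_Rplus; [apply continuous_const|apply continuous_Rabs]|].
    apply (continuous_opp (fun s => Rabs (s + - (23/50)))), continuous_Rabs_comp.
    apply continuous_Rplus; [apply continuous_id|apply continuous_const].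
  - exists (23/50). intros s. generalize (amp_range s). intros. rewrite Rabs_pos_eq; lra.
Qed.

Definition fi (s : R) : R := / (1 + amp s * amp s).
Definition fs (s : R) : R := (1 + - (amp s * amp s)) * fi s.

Lemma fA2 s : 0 <= amp s * amp s <= 529/2500.
Proof. generalize (amp_range s). nra. Qed.
Lemma fi_bcont : bcont fi.
Proof.
  apply bcont_inv with (f := fun s => 1 + amp s * amp s) (c := 1); [lra| |].
  - intros s. generalize (fA2 s); lra.
  - apply bcont_plus; [apply bcont_const|apply bcont_mult; apply amp_bcont].
Qed.
Lemma fs_bcont : bcont fs.
Proof. apply bcont_mult; [apply bcont_plus; [apply bcont_const|apply bcont_opp, bcont_mult; apply amp_bcont]|apply fi_bcont]. Qed.
Lemma fi_eq s : fi s * (1 + amp s * amp s) = 1.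
Proof. unfold fi. generalize (fA2 s). intros. field. lra. Qed.
(** The lower bound keeps the divisors [k - 2 + fs s] of the linearized problem at least 1/2 for
    [k >= 2]. The value 1 is attained at amplitude zero, where the divisor of mode 1 vanishes: this
    is the resonance at the laminar flow. *)
Lemma fs_bounds s : 1/2 <= fs s <= 1.
Proof.
  generalize (fA2 s) (fi_eq s). unfold fs. intros.
  assert (0 < fi s) by (apply Rinv_0_lt_compat; lra). nra.
Qed.
Definition fsi (s : R) : R := / fs s.
Lemma fsi_bcont : bcont fsi.
Proof. apply bcont_inv with (f := fs) (c := 1/2); [lra|apply fs_bounds|apply fs_bcont]. Qed.

(* The factor of [nu] in the solvability condition at the resonant mode 2 of [tnu]. *)
Definition fN0 (s : R) : R := 4 * (1 + amp s * amp s) * (1 + amp s * amp s * ((2 + fs s) * fsi s)).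
Definition fN (s : R) : R := / fN0 s.
Lemma fN0_ge s : 4 <= fN0 s.
Proof.
  unfold fN0. generalize (fA2 s) (fs_bounds s). intros.
  assert (0 < fsi s) by (apply Rinv_0_lt_compat; lra).
  assert (0 <= amp s * amp s * ((2 + fs s) * fsi s)).
  { apply Rmult_le_pos; [lra|]. apply Rmult_le_pos; lra. }
  nra.
Qed.
Lemma fN_bcont : bcont fN.
Proof.
  apply bcont_inv with (f := fN0) (c := 4); [lra|apply fN0_ge|].
  unfold fN0.
  assert (bcont (fun s => amp s * amp s)) by (apply bcont_mult; apply amp_bcont).
  apply bcont_mult; [apply bcont_mult; [apply bcont_const|apply bcont_plus; [apply bcont_const|assumption]]|].
  apply bcont_plus; [apply bcont_const|]. apply bcont_mult; [assumption|].
  apply bcont_mult; [apply bcont_plus; [apply bcont_const|apply fs_bcont]|apply fsi_bcont].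
Qed.

Definition LA := cst amp.
Definition Li := cst fi.
Definition Ls := cst fs.
Definition Lsi := cst fsi.
Definition LN := cst fN.
Definition half := cst (fun _ => 1/2).
Definition z1 := mono 1.
Definition z_1 := mono (-1).
Notation "1" := lone : lau_scope.
Notation "0" := lzero : lau_scope.
Notation "2" := (lone + lone)%L : lau_scope.
Notation "4" := ((lone + lone) * (lone + lone))%L : lau_scope.

Lemma half2 : (half * 2)%L = 1%L.
Proof.
  apply lau_ext. intros k s. unfold half. rewrite cst_mul_l by apply bcont_const.
  rewrite cf_add. unfold lone. rewrite cf_mono. destruct Z.eq_dec; field.
Qed.
Lemma cst1 : cst (fun _ => 1) = lone.
Proof. apply lau_ext. intros. unfold lone. rewrite cf_cst, cf_mono by apply bcont_1. reflexivity. Qed.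
Lemma cst_ext f g : (forall s, f s = g s) -> cst f = cst g.
Proof. intros H. replace g with f; [reflexivity|]. apply functional_extensionality; assumption. Qed.
Lemma zz : (z1 * z_1)%L = 1%L.
Proof. unfold z1, z_1. rewrite mono_mul. reflexivity. Qed.
Lemma Li_eq : (Li * (1 + LA * LA))%L = 1%L.
Proof.
  unfold Li, LA. rewrite <- cst1.
  assert (bcont (fun s => amp s * amp s)) by (apply bcont_mult; apply amp_bcont).
  rewrite <- cst_mul by apply amp_bcont.
  rewrite <- cst_add by (try apply bcont_const; assumption).
  rewrite <- cst_mul; [|apply fi_bcont|apply bcont_plus; [apply bcont_const|assumption]].
  apply cst_ext, fi_eq.
Qed.
Lemma Ls_eq : Ls = ((1 - LA * LA) * Li)%L.
Proof.
  assert (H : bcont (fun s => amp s * amp s)) by (apply bcont_mult; apply amp_bcont).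
  unfold Ls, LA, Li. apply lau_ext. intros k s.
  rewrite lmul_comm, cst_mul_l by apply fi_bcont.
  rewrite cf_sub. unfold lone. rewrite cf_mono. rewrite cst_mul_l, !cf_cst by (apply amp_bcont || apply fs_bcont).
  unfold fs. destruct Z.eq_dec; ring.
Qed.
Lemma Lsi_eq : (Ls * Lsi)%L = 1%L.
Proof.
  unfold Ls, Lsi. rewrite <- cst_mul, <- cst1 by (apply fs_bcont || apply fsi_bcont).
  apply cst_ext. intros s. unfold fsi. generalize (fs_bounds s). intros. field. lra.
Qed.
Lemma LN_eq : (LN * (4 * (1 + LA * LA) * (1 + LA * LA * ((2 + Ls) * Lsi))))%L = 1%L.
Proof.
  apply lau_ext. intros k s. unfold LN. rewrite cst_mul_l by apply fN_bcont.
  assert (B2 : bcont (fun s => amp s * amp s)) by (apply bcont_mult; apply amp_bcont).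
  replace (4 * (1 + LA * LA) * (1 + LA * LA * ((2 + Ls) * Lsi)))%L with (cst fN0).
  - rewrite cf_cst; [|].
    + unfold lone. rewrite cf_mono. destruct Z.eq_dec; [|ring]. unfold fN. generalize (fN0_ge s). intros; field; lra.
    + destruct fN_bcont as [_ _]. unfold fN0.
      apply bcont_mult; [apply bcont_mult; [apply bcont_const|apply bcont_plus; [apply bcont_const|assumption]]|].
      apply bcont_plus; [apply bcont_const|]. apply bcont_mult; [assumption|].
      apply bcont_mult; [apply bcont_plus; [apply bcont_const|apply fs_bcont]|apply fsi_bcont].
  - assert (B4 : bcont (fun s => (2 + fs s) * fsi s)).
    { apply bcont_mult; [apply bcont_plus; [apply bcont_const|apply fs_bcont]|apply fsi_bcont]. }
    unfold fN0, LA, Ls, Lsi. rewrite <- cst1.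
    rewrite <- cst_mul by apply amp_bcont.
    rewrite <- (cst_add (fun _ => 1) (fun _ => 1)) by apply bcont_const.
    rewrite <- (cst_mul (fun _ => 1 + 1) (fun _ => 1 + 1)) by apply bcont_const.
    rewrite <- (cst_add (fun _ => 1 + 1) fs) by (apply bcont_const || apply fs_bcont).
    rewrite <- (cst_mul (fun s => 1 + 1 + fs s) fsi); [|apply bcont_plus; [apply bcont_const|apply fs_bcont]|apply fsi_bcont].
    rewrite <- (cst_mul (fun s => amp s * amp s)); [|assumption|].
    2: { apply bcont_mult; [apply bcont_plus; [apply bcont_const|apply fs_bcont]|apply fsi_bcont]. }
    assert (B5 : bcont (fun s => amp s * amp s * ((1 + 1 + fs s) * fsi s))).
    { apply bcont_mult; [assumption|]. apply bcont_mult; [apply bcont_plus; [apply bcont_const|apply fs_bcont]|apply fsi_bcont]. }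
    rewrite <- !(cst_add (fun _ => 1)) by (try apply bcont_const; assumption).
    rewrite <- (cst_mul (fun _ => (1 + 1) * (1 + 1))); [|apply bcont_const|apply bcont_plus; [apply bcont_const|assumption]].
    rewrite <- cst_mul.
    + apply cst_ext. intros t. ring.
    + apply bcont_mult; [apply bcont_const|apply bcont_plus; [apply bcont_const|assumption]].
    + apply bcont_plus; [apply bcont_const|assumption].
Qed.

Definition geoc (f : R -> R) (k : Z) (s : R) : R := if Z_le_dec 0 k then f s ^ Z.to_nat k else 0.
Definition geo (f : R -> R) : lau := mk (geoc f).

Lemma continuous_Rpow (f : R -> R) n x : continuous f x -> continuous (fun s => f s ^ n) x.
Proof.
  intros H. induction n as [|n IH]; [apply continuous_const|].
  apply (continuous_Rmult f (fun s => f s ^ n)); assumption.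
Qed.

Lemma cf_geo f : bcont f -> (forall s, Rabs (f s) <= 23/50) -> cf (geo f) = geoc f.
Proof.
  intros [Hf _] Hb. apply cf_mk. split.
  - intros k s. unfold geoc. destruct Z_le_dec; [apply continuous_Rpow, Hf|apply continuous_const].
  (* 69/100 is the largest amplitude 23/50 times the base 3/2 of the weight. *)
  - exists (2 / (1 - 69/100)), (fun k => (23/50) ^ Z.abs_nat k). split.
    + intros k s. unfold geoc. destruct Z_le_dec.
      * rewrite <- RPow_abs. replace (Z.to_nat k) with (Z.abs_nat k) by lia.
        apply pow_incr. split; [apply Rabs_pos|apply Hb].
      * rewrite Rabs_R0. apply pow_le; lra.
    + intros l Hl. rewrite (sumL_ext_in _ (fun k => (69/100) ^ Z.abs_nat k)).
      * apply geo_list; [lra|assumption].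
      * intros k _. unfold wt. rewrite <- Rpow_mult_distr. f_equal. lra.
Qed.

Lemma geo_inv f : bcont f -> (forall s, Rabs (f s) <= 23/50) -> ((1 - cst f * z1) * geo f)%L = 1%L.
Proof.
  intros Hf Hb. replace ((1 - cst f * z1) * geo f)%L with (geo f - cst f * (z1 * geo f))%L by ring.
  apply lau_ext. intros k s. rewrite cf_sub, cst_mul_l by assumption. unfold z1. rewrite lmul_mono_l.
  unfold lone. rewrite cf_mono, cf_geo by assumption. unfold geoc.
  destruct (Z_le_dec 0 k), (Z_le_dec 0 (k - 1)), (Z.eq_dec k 0); try lia; try ring.
  - replace (Z.to_nat k) with (S (Z.to_nat (k - 1))) by lia. simpl. ring.
  - subst. simpl. ring.
Qed.

Lemma fAm_bcont : bcont (fun s => - amp s).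
Proof. apply bcont_opp, amp_bcont. Qed.
Lemma fA_abs s : Rabs (amp s) <= 23/50.
Proof. generalize (amp_range s). intros. rewrite Rabs_pos_eq; lra. Qed.
Lemma fAm_abs s : Rabs (- amp s) <= 23/50.
Proof. rewrite Rabs_Ropp. apply fA_abs. Qed.

(* With [zeta = z1] and the amplitude [A = LA], a prime or [ltil] is complex conjugation on the unit circle and the
   letter [i] marks an inverse. *)
Definition p := (1 + LA * z1)%L.
Definition m := (1 - LA * z1)%L.
Definition p' := (1 + LA * z_1)%L.
Definition m' := (1 - LA * z_1)%L.
Definition ip := geo (fun s => - amp s).
Definition im := geo amp.
Definition ip' := ltil ip.
Definition im' := ltil im.

Lemma pip : (p * ip)%L = 1%L.
Proof.
  unfold ip. rewrite <- (geo_inv _ fAm_bcont fAm_abs). f_equal. unfold p, lsub. f_equal.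
  apply lau_ext. intros. rewrite cf_opp. unfold LA. rewrite !cst_mul_l by (apply amp_bcont || apply fAm_bcont). ring.
Qed.
Lemma mim : (m * im)%L = 1%L.
Proof. apply (geo_inv amp amp_bcont fA_abs). Qed.
Lemma tz1 : ltil z1 = z_1.
Proof. unfold z1, z_1. rewrite til_mono. reflexivity. Qed.
Lemma tz_1 : ltil z_1 = z1.
Proof. unfold z1, z_1. rewrite til_mono. reflexivity. Qed.
Lemma tLA : ltil LA = LA.
Proof. apply til_cst, amp_bcont. Qed.
Lemma tLs : ltil Ls = Ls.
Proof. apply til_cst, fs_bcont. Qed.
Lemma thalf : ltil half = half.
Proof. apply til_cst, bcont_const. Qed.
Lemma tp : ltil p = p'.
Proof. unfold p, p'. rewrite til_add, til_mul, til_one, tLA, tz1. reflexivity. Qed.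
Lemma tm : ltil m = m'.
Proof. unfold m, m'. rewrite til_sub, til_mul, til_one, tLA, tz1. reflexivity. Qed.
Lemma tp' : ltil p' = p.
Proof. rewrite <- tp. apply til_til. Qed.
Lemma tm' : ltil m' = m.
Proof. rewrite <- tm. apply til_til. Qed.
Lemma tip : ltil ip = ip'.
Proof. reflexivity. Qed.
Lemma tim : ltil im = im'.
Proof. reflexivity. Qed.
Lemma tip' : ltil ip' = ip.
Proof. apply til_til. Qed.
Lemma tim' : ltil im' = im.
Proof. apply til_til. Qed.
Lemma pip' : (p' * ip')%L = 1%L.
Proof. unfold ip'. rewrite <- tp, <- til_mul, pip. apply til_one. Qed.
Lemma mim' : (m' * im')%L = 1%L.
Proof. unfold im'. rewrite <- tm, <- til_mul, mim. apply til_one. Qed.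

Ltac til := repeat (rewrite ?til_add, ?til_sub, ?til_opp, ?til_mul, ?til_one, ?til_zero, ?tLA, ?tLs, ?thalf,
  ?tz1, ?tz_1, ?tp, ?tm, ?tp', ?tm', ?tip, ?tim, ?tip', ?tim', ?til_til).

(** [ring] knows no inverses; identities between rational expressions are proved by clearing one
    denominator after the other with this lemma. *)
Lemma cancel a b x y : (a * b)%L = 1%L -> (a * x)%L = (a * y)%L -> x = y.
Proof.
  intros H E. replace x with (b * (a * x))%L; [rewrite E|].
  - replace (b * (a * y))%L with ((a * b) * y)%L by ring. rewrite H. ring.
  - replace (b * (a * x))%L with ((a * b) * x)%L by ring. rewrite H. ring.
Qed.

(* The wave with [G = 0] in infinite depth: [z' = crZ = 1 + A crH = (m/p)^2], [crV = 1 + A crU = p m' / (m p')] is the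
   velocity, [A cr_eta] the elevation and [-Ls] the vorticity. *)
Definition crY := (- (4 * z1 * ip))%L.
Definition crH := (- (4 * z1 * ip * ip))%L.
Definition crU := (2 * (z1 - z_1) * im * ip')%L.
Definition crZ := (m * m * ip * ip)%L.
Definition crV := (p * im * m' * ip')%L.
Definition cr_eta := (half * (crY + ltil crY))%L.
Definition cr_g := (2 * (z1 - 2 * LA * Li) * im + 2 * Ls * z1 * ip)%L.
Definition QQ := (p * im * p' * im')%L.
Definition SS := (m * ip * m' * ip')%L.

Lemma crZ_eq : crZ = (1 + LA * crH)%L.
Proof.
  unfold crZ, crH. replace (m * m * ip * ip)%L with ((p * ip) * (p * ip) - 4 * LA * z1 * ip * ip)%L
    by (unfold p, m; ring). rewrite pip. ring.
Qed.
Lemma crV_eq : crV = (1 + LA * crU)%L.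
Proof.
  unfold crV, crU. replace (p * im * m' * ip')%L with ((m * im) * (p' * ip') + LA * (2 * (z1 - z_1) * im * ip'))%L
    by (unfold p, m, p', m'; ring). rewrite mim, pip'. ring.
Qed.
Lemma SQ : (SS * QQ)%L = 1%L.
Proof.
  unfold SS, QQ. replace (m * ip * m' * ip' * (p * im * p' * im'))%L with
    ((p * ip) * (m * im) * (p' * ip') * (m' * im'))%L by ring.
  rewrite pip, mim, pip', mim'. ring.
Qed.
Lemma VZ0 : (crV * crZ)%L = SS.
Proof.
  unfold crV, crZ, SS. replace (p * im * m' * ip' * (m * m * ip * ip))%L with
    ((p * ip) * (m * im) * (m * ip * m' * ip'))%L by ring. rewrite pip, mim. ring.
Qed.
Lemma VV0 : (crV * ltil crV)%L = 1%L.
Proof.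
  unfold crV. til. replace (p * im * m' * ip' * (p' * im' * m * ip))%L with
    ((p * ip) * (m * im) * (p' * ip') * (m' * im'))%L by ring.
  rewrite pip, mim, pip', mim'. ring.
Qed.
Lemma tSS : ltil SS = SS.
Proof. unfold SS. til. ring. Qed.
Lemma tQQ : ltil QQ = QQ.
Proof. unfold QQ. til. ring. Qed.
Lemma eta0_eq : cr_eta = (- (2 * (z1 * ip + z_1 * ip')))%L.
Proof.
  unfold cr_eta, crY. til. replace (half * (- (4 * z1 * ip) + - (4 * z_1 * ip')))%L with
    ((half * 2) * - (2 * (z1 * ip + z_1 * ip')))%L by ring. rewrite half2. ring.
Qed.
(** This fixes the vorticity of the explicit wave: subtracting [Ls] times the elevation removes all
    negative powers of [zeta] from the velocity, so that the remaining part [cr_g] continues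
    holomorphically into the fluid. *)
Lemma crU_eq : crU = (cr_g + Ls * cr_eta)%L.
Proof.
  rewrite eta0_eq. unfold crU, cr_g.
  replace (2 * (z1 - 2 * LA * Li) * im + 2 * Ls * z1 * ip + Ls * - (2 * (z1 * ip + z_1 * ip')))%L with
    (2 * (z1 - 2 * LA * Li) * im - 2 * Ls * z_1 * ip')%L by ring.
  apply (cancel m im _ _ mim). apply (cancel p' ip' _ _ pip').
  replace (p' * (m * (2 * (z1 - z_1) * im * ip')))%L with (2 * (z1 - z_1) * (m * im) * (p' * ip'))%L by ring.
  replace (p' * (m * (2 * (z1 - 2 * LA * Li) * im - 2 * Ls * z_1 * ip')))%L with
    (2 * (z1 - 2 * LA * Li) * (m * im) * p' - 2 * Ls * z_1 * m * (p' * ip'))%L by ring.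
  rewrite mim, pip', Ls_eq. unfold p', m.
  replace (2 * (z1 - 2 * LA * Li) * 1 * (1 + LA * z_1) - 2 * ((1 - LA * LA) * Li) * z_1 * (1 - LA * z1) * 1)%L
   with (2 * (z1 + LA * (z1 * z_1) - LA * Li * (2 + 2 * LA * z_1) - (1 - LA * LA) * Li * z_1 + LA * (1 - LA * LA) * Li * (z1 * z_1)))%L by ring.
  rewrite zz.
  replace (2 * (z1 + LA * 1 - LA * Li * (2 + 2 * LA * z_1) - (1 - LA * LA) * Li * z_1 + LA * (1 - LA * LA) * Li * 1))%L
   with (2 * (z1 + LA - LA * (Li * (1 + LA * LA)) - (Li * (1 + LA * LA)) * z_1))%L by ring.
  rewrite Li_eq. ring.
Qed.

(** For [V = 1 + A U] and [Z = 1 + A H] the product is [V Z = 1 + A * nfun U H], so the reality of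
    [V Z] becomes the symmetry of [nfun U H] with the factor A divided out. *)
Definition nfun (U H : lau) : lau := (U + H + LA * U * H)%L.

(** The kinematic condition of the explicit wave. The closed form
    [- 2 (zeta + 1 / zeta) / |1 + A zeta|^2] is visibly real on the unit circle. *)
Lemma crapper_E1 : nfun crU crH = ltil (nfun crU crH).
Proof.
  assert (E : nfun crU crH = (- (2 * (z1 + z_1) * ip * ip'))%L).
  { unfold nfun. replace (crU + crH + LA * crU * crH)%L with (crU * (1 + LA * crH) + crH)%L by ring.
    rewrite <- crZ_eq. unfold crU, crZ, crH.
    replace (2 * (z1 - z_1) * im * ip' * (m * m * ip * ip) + - (4 * z1 * ip * ip))%L with
      (ip * ip * (2 * (z1 - z_1) * (m * im) * m * ip' - 4 * z1))%L by ring.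
    rewrite mim. apply (cancel p' ip' _ _ pip').
    replace (p' * (ip * ip * (2 * (z1 - z_1) * 1 * m * ip' - 4 * z1)))%L with
      (ip * ip * (2 * (z1 - z_1) * m * (p' * ip') - 4 * z1 * p'))%L by ring.
    replace (p' * - (2 * (z1 + z_1) * ip * ip'))%L with (- (2 * (z1 + z_1) * ip * (p' * ip')))%L by ring.
    rewrite pip'. apply (cancel p ip _ _ pip).
    replace (p * (ip * ip * (2 * (z1 - z_1) * m * 1 - 4 * z1 * p')))%L with
      ((p * ip) * ip * (2 * (z1 - z_1) * m - 4 * z1 * p'))%L by ring. rewrite pip.
    unfold m, p'.
    replace (1 * ip * (2 * (z1 - z_1) * (1 - LA * z1) - 4 * z1 * (1 + LA * z_1)))%L with
      (- (2 * ip * (z1 + z_1 + LA * z1 * z1 + LA * (z1 * z_1))))%L by ring.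
    unfold p. replace ((1 + LA * z1) * - (2 * (z1 + z_1) * ip * 1))%L with
      (- (2 * ip * (z1 + z_1 + LA * z1 * z1 + LA * (z1 * z_1))))%L by ring. reflexivity. }
  rewrite E. til. ring.
Qed.

(** The Bernoulli condition with [G = 0], divided by A. [VV0] yields it only after multiplication by
    [LA], which has no inverse at amplitude zero, hence the direct computation. *)
Lemma crapper_E2 : (crU + ltil crU + LA * crU * ltil crU)%L = 0%L.
Proof.
  unfold crU. til.
  replace (2 * (z1 - z_1) * im * ip' + 2 * (z_1 - z1) * im' * ip + LA * (2 * (z1 - z_1) * im * ip') * (2 * (z_1 - z1) * im' * ip))%L
    with (2 * (z1 - z_1) * (im * ip' - im' * ip - 2 * LA * (z1 - z_1) * im * ip' * im' * ip))%L by ring.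
  replace (im * ip' - im' * ip - 2 * LA * (z1 - z_1) * im * ip' * im' * ip)%L with 0%L; [ring|].
  apply (cancel p ip _ _ pip). apply (cancel m im _ _ mim).
  apply (cancel p' ip' _ _ pip'). apply (cancel m' im' _ _ mim').
  replace (m' * (p' * (m * (p * (im * ip' - im' * ip - 2 * LA * (z1 - z_1) * im * ip' * im' * ip)))))%L with
   ((m * im) * (p' * ip') * p * m' - (m' * im') * (p * ip) * p' * m - 2 * LA * (z1 - z_1) * (m * im) * (p' * ip') * (m' * im') * (p * ip))%L by ring.
  rewrite pip, mim, pip', mim'. unfold p, m, p', m'. ring.
Qed.

(** * The right inverse of the linearization *)

Definition supp (n : Z) (a : lau) : Prop := forall k s, (k < n)%Z -> cf a k s = 0.
Definition is_const (a : lau) : Prop := forall k s, k <> 0%Z -> cf a k s = 0.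
(** [b = zeta da/dzeta], kept as a relation: the operator is unbounded in the weighted norm, and
    only derivatives that are constructed independently occur. *)
Definition is_theta (a b : lau) : Prop := forall k s, cf b k s = IZR k * cf a k s.

Lemma supp_add n a b : supp n a -> supp n b -> supp n (a + b)%L.
Proof. intros H1 H2 k s H. rewrite cf_add, H1, H2 by assumption. ring. Qed.
Lemma supp_opp n a : supp n a -> supp n (- a)%L.
Proof. intros H1 k s H. rewrite cf_opp, H1 by assumption. ring. Qed.
Lemma supp_sub n a b : supp n a -> supp n b -> supp n (a - b)%L.
Proof. intros. apply supp_add; [|apply supp_opp]; assumption. Qed.
Lemma supp_mul m n a b : supp m a -> supp n b -> supp (m + n) (a * b)%L.
Proof.
  intros H1 H2 k s H. apply (has_sum_unique _ _ _ (mul_has a b k s)).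
  eapply has_sum_ext; [|apply has_sum_0]. intros j. simpl.
  destruct (Z_lt_dec j m) as [L|L]; [rewrite (H1 j s L)|rewrite (H2 (k - j)%Z s)]; try lia; ring.
Qed.
Lemma supp_le n m a : supp n a -> (m <= n)%Z -> supp m a.
Proof. intros H L k s Hk. apply H. lia. Qed.
Lemma supp_mono n : supp n (mono n).
Proof. intros k s H. rewrite cf_mono. destruct Z.eq_dec; [lia|reflexivity]. Qed.
Lemma supp_cst f : bcont f -> supp 0 (cst f).
Proof. intros Hf k s H. rewrite cf_cst by assumption. destruct Z.eq_dec; [lia|reflexivity]. Qed.
Lemma supp_geo f : bcont f -> (forall s, Rabs (f s) <= 23/50) -> supp 0 (geo f).
Proof. intros H1 H2 k s H. rewrite cf_geo by assumption. unfold geoc. destruct Z_le_dec; [lia|reflexivity]. Qed.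
Lemma supp_is_const a : is_const a -> supp 0 a.
Proof. intros H k s Hk. apply H. lia. Qed.
Lemma supp_one : supp 0 lone.
Proof. apply supp_mono. Qed.
Lemma supp_ip : supp 0 ip.
Proof. apply supp_geo; [apply fAm_bcont|apply fAm_abs]. Qed.
Lemma supp_im : supp 0 im.
Proof. apply supp_geo; [apply amp_bcont|apply fA_abs]. Qed.
Lemma supp_LA : supp 0 LA.
Proof. apply supp_cst, amp_bcont. Qed.
Lemma supp_Ls : supp 0 Ls.
Proof. apply supp_cst, fs_bcont. Qed.
Lemma supp_Lsi : supp 0 Lsi.
Proof. apply supp_cst, fsi_bcont. Qed.
Lemma supp_Li : supp 0 Li.
Proof. apply supp_cst, fi_bcont. Qed.
Lemma supp_half : supp 0 half.
Proof. apply supp_cst, bcont_const. Qed.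
Lemma supp_z1 : supp 1 z1.
Proof. apply supp_mono. Qed.
Lemma supp_zero n : supp n lzero.
Proof. intros k s _. apply cf_zero. Qed.
Lemma supp_mul0 a b : supp 0 a -> supp 0 b -> supp 0 (a * b)%L.
Proof. apply (supp_mul 0 0). Qed.

Ltac solve_supp := repeat match goal with
  | H : supp ?n ?a |- supp ?n ?a => exact H
  | |- supp _ lzero => apply supp_zero
  | |- supp _ lone => apply supp_one
  | |- supp _ ip => apply supp_ip
  | |- supp _ im => apply supp_im
  | |- supp _ LA => apply supp_LA
  | |- supp _ Ls => apply supp_Ls
  | |- supp _ Lsi => apply supp_Lsi
  | |- supp _ Li => apply supp_Li
  | |- supp _ half => apply supp_half
  | |- supp 0 z1 => apply (supp_le 1 0); [apply supp_z1|lia]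
  | |- supp _ (ladd _ _) => apply supp_add
  | |- supp _ (lsub _ _) => apply supp_sub
  | |- supp _ (lopp _) => apply supp_opp
  | |- supp _ (lmul _ _) => apply supp_mul0
  end.

Lemma supp_p : supp 0 p.
Proof. unfold p. solve_supp. Qed.
Lemma supp_m : supp 0 m.
Proof. unfold m. solve_supp. Qed.

Lemma is_const_mul_l c a k s : is_const c -> cf (c * a)%L k s = cf c 0 s * cf a k s.
Proof.
  intros Hc. apply (has_sum_unique _ _ _ (mul_has c a k s)).
  assert (H := has_sum_single (fun j => cf c j s * cf a (k - j)%Z s) 0%Z).
  simpl in H. replace (k - 0)%Z with k in H by lia. apply H. intros i Hi. rewrite Hc by assumption. ring.
Qed.
Lemma is_const_cst f : bcont f -> is_const (cst f).
Proof. intros Hf k s H. rewrite cf_cst by assumption. destruct Z.eq_dec; [contradiction|reflexivity]. Qed.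
Lemma is_const_mul a b : is_const a -> is_const b -> is_const (a * b)%L.
Proof. intros H1 H2 k s H. rewrite is_const_mul_l, H2 by assumption. ring. Qed.
Lemma is_const_add a b : is_const a -> is_const b -> is_const (a + b)%L.
Proof. intros H1 H2 k s H. rewrite cf_add, H1, H2 by assumption. ring. Qed.
Lemma is_const_opp a : is_const a -> is_const (- a)%L.
Proof. intros H1 k s H. rewrite cf_opp, H1 by assumption. ring. Qed.
Lemma is_const_sub a b : is_const a -> is_const b -> is_const (a - b)%L.
Proof. intros. apply is_const_add; [|apply is_const_opp]; assumption. Qed.
Lemma is_const_one : is_const lone.
Proof. intros k s H. unfold lone. rewrite cf_mono. destruct Z.eq_dec; [contradiction|reflexivity]. Qed.
Lemma is_const_til a : is_const a -> ltil a = a.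
Proof.
  intros H. apply lau_ext. intros k s. rewrite cf_til. destruct (Z.eq_dec k 0) as [->|N]; [reflexivity|].
  rewrite !H by lia. reflexivity.
Qed.

Definition dind (b : Z -> bool) (k : Z) (s : R) : R := if b k then 1 else 0.
Lemma dind_bcd b : bcd (dind b).
Proof.
  split; [intros; apply continuous_const|]. exists 1. intros k s. unfold dind.
  destruct (b k); rewrite ?Rabs_R1, ?Rabs_R0; lra.
Qed.
(** With [zeta = exp (- i alpha)], powers at least 0 are the part that continues into the lower
    half-plane. Applied with [n = 1] to a conjugate, this projection isolates the modes that must
    vanish. *)
Definition pge (n : Z) (a : lau) : lau := ldiag (dind (fun k => (n <=? k)%Z)) a.
Definition mean (a : lau) : lau := ldiag (dind (fun k => (k =? 0)%Z)) a.

Lemma cf_pge n a k s : cf (pge n a) k s = if Z_le_dec n k then cf a k s else 0.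
Proof.
  unfold pge. rewrite cf_diag by apply dind_bcd. unfold dind.
  destruct (Z.leb_spec n k), (Z_le_dec n k); try lia; ring.
Qed.
Lemma cf_P0 a k s : cf (mean a) k s = if Z.eq_dec k 0 then cf a k s else 0.
Proof.
  unfold mean. rewrite cf_diag by apply dind_bcd. unfold dind.
  destruct (Z.eqb_spec k 0), (Z.eq_dec k 0); try lia; ring.
Qed.
Lemma is_const_P0 a : is_const (mean a).
Proof. intros k s H. rewrite cf_P0. destruct Z.eq_dec; [contradiction|reflexivity]. Qed.
Lemma supp_pge n a : supp n (pge n a).
Proof. intros k s H. rewrite cf_pge. destruct Z_le_dec; [lia|reflexivity]. Qed.
Lemma pge_id n a : supp n a -> pge n a = a.
Proof. intros H. apply lau_ext. intros k s. rewrite cf_pge. destruct Z_le_dec; [reflexivity|]. rewrite H by lia. reflexivity. Qed.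
Lemma pge_til0 a : supp 0 a -> pge 1 (ltil a) = lzero.
Proof.
  intros H. apply lau_ext. intros k s. rewrite cf_pge, cf_zero, cf_til.
  destruct Z_le_dec; [apply H; lia|reflexivity].
Qed.
Lemma pge_add n a b : pge n (a + b)%L = (pge n a + pge n b)%L.
Proof. apply diag_add, dind_bcd. Qed.
Lemma pge_sub n a b : pge n (a - b)%L = (pge n a - pge n b)%L.
Proof. apply diag_sub, dind_bcd. Qed.
Lemma pge_isc_mul n c a : is_const c -> pge n (c * a)%L = (c * pge n a)%L.
Proof.
  intros H. apply lau_ext. intros k s. rewrite is_const_mul_l by assumption. rewrite !cf_pge, is_const_mul_l by assumption.
  destruct Z_le_dec; ring.
Qed.
Lemma pge_is_const a : is_const a -> pge 1 a = lzero.
Proof. intros H. apply lau_ext. intros k s. rewrite cf_pge, cf_zero. destruct Z_le_dec; [apply H; lia|reflexivity]. Qed.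

Lemma is_theta_add a b a' b' : is_theta a a' -> is_theta b b' -> is_theta (a + b)%L (a' + b')%L.
Proof. intros H1 H2 k s. rewrite !cf_add, H1, H2. ring. Qed.
Lemma is_theta_mul a b a' b' : is_theta a a' -> is_theta b b' -> is_theta (a * b)%L (a' * b + a * b')%L.
Proof.
  intros H1 H2 k s. rewrite cf_add.
  apply (has_sum_unique (fun j => IZR k * (cf a j s * cf b (k - j)%Z s))); [|apply has_sum_scal, mul_has].
  eapply has_sum_ext; [|apply (has_sum_plus _ _ _ _ (mul_has a' b k s) (mul_has a b' k s))].
  intros j. simpl. rewrite H1, H2, minus_IZR. ring.
Qed.
Lemma is_theta_is_const c : is_const c -> is_theta c lzero.
Proof. intros H k s. rewrite cf_zero. destruct (Z.eq_dec k 0) as [->|N]; [simpl; ring|]. rewrite H by assumption. ring. Qed.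
Lemma is_theta_z1 : is_theta z1 z1.
Proof. intros k s. unfold z1. rewrite cf_mono. destruct Z.eq_dec; [subst; simpl; ring|ring]. Qed.
(** The candidate [X] satisfies [p X = ip - 1], a first-order recursion in the coefficients, and
    [IZR k * cf ip k s] solves the same recursion with the same start. *)
Lemma is_theta_ip : is_theta ip (- (LA * z1 * ip * ip))%L.
Proof.
  set (X := (- (LA * z1 * ip * ip))%L).
  assert (SX : supp 1 X).
  { unfold X. apply supp_opp. replace (LA * z1 * ip * ip)%L with (z1 * (LA * ip * ip))%L by ring.
    apply (supp_mul 1 0); [apply supp_z1|solve_supp]. }
  assert (E : (p * X = ip - 1)%L).
  { unfold X. replace (p * - (LA * z1 * ip * ip))%L with (- ((p * ip) * LA * z1 * ip))%L by ring. rewrite pip.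
    replace (- (1 * LA * z1 * ip))%L with (ip - (p * ip))%L by (unfold p; ring). rewrite pip. reflexivity. }
  assert (Rec : forall k s, cf X k s = - amp s * cf X (k - 1)%Z s + cf (ip - 1)%L k s).
  { intros k s. rewrite <- E. unfold p.
    replace ((1 + LA * z1) * X)%L with (X + LA * (z1 * X))%L by ring.
    rewrite cf_add. unfold LA. rewrite cst_mul_l by apply amp_bcont. unfold z1. rewrite lmul_mono_l. ring. }
  assert (C : forall k s, cf ip k s = geoc (fun s => - amp s) k s).
  { intros. unfold ip. rewrite cf_geo; [reflexivity|apply fAm_bcont|apply fAm_abs]. }
  intros k s. rewrite C. unfold geoc. destruct Z_le_dec as [L|L].
  - replace k with (Z.of_nat (Z.to_nat k)) at 1 2 by lia. generalize (Z.to_nat k). clear L k. intros n.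
    induction n as [|n IH].
    + rewrite SX by lia. simpl. ring.
    + rewrite Rec. replace (Z.of_nat (S n) - 1)%Z with (Z.of_nat n) by lia. rewrite IH.
      rewrite cf_sub, C. unfold lone. rewrite cf_mono. destruct (Z.eq_dec (Z.of_nat (S n)) 0); [lia|].
      unfold geoc. destruct Z_le_dec; [|lia]. replace (Z.to_nat (Z.of_nat (S n))) with (S n) by lia.
      rewrite Nat2Z.inj_succ, succ_IZR. simpl. ring.
  - rewrite SX by lia. ring.
Qed.

(** Plays the role of a bounded linear operator, in a form stable under the combinators that build
    the right inverse. *)
Definition lip0 (F : lau -> lau) : Prop :=
  F lzero = lzero /\ exists C, 0 <= C /\ forall a b M, nrm (a - b)%L M -> nrm (F a - F b)%L (C * M).

Lemma lip0_id : lip0 (fun a => a).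
Proof. split; [reflexivity|]. exists 1. split; [lra|]. intros a b M H. rewrite Rmult_1_l. exact H. Qed.
Lemma lip0_add F G : lip0 F -> lip0 G -> lip0 (fun a => F a + G a)%L.
Proof.
  intros [F0 [C [C0 HF]]] [G0 [D [D0 HG]]]. split; [rewrite F0, G0; ring|]. exists (C + D). split; [lra|].
  intros a b M H. replace ((F a + G a) - (F b + G b))%L with ((F a - F b) + (G a - G b))%L by ring.
  rewrite Rmult_plus_distr_r. apply nrm_add; auto.
Qed.
Lemma lip0_opp F : lip0 F -> lip0 (fun a => - F a)%L.
Proof.
  intros [F0 [C [C0 HF]]]. split; [rewrite F0; ring|]. exists C. split; [lra|].
  intros a b M H. replace (- F a - - F b)%L with (- (F a - F b))%L by ring. apply nrm_opp; auto.
Qed.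
Lemma lip0_sub F G : lip0 F -> lip0 G -> lip0 (fun a => F a - G a)%L.
Proof. intros. apply (lip0_add F (fun a => - G a)%L); [|apply lip0_opp]; assumption. Qed.
Lemma lip0_mul c F : lip0 F -> lip0 (fun a => c * F a)%L.
Proof.
  intros [F0 [C [C0 HF]]]. split; [rewrite F0; ring|]. destruct (nrm_ex c) as [N [N0 HN]].
  exists (N * C). split; [apply Rmult_le_pos; assumption|].
  intros a b M H. replace (c * F a - c * F b)%L with (c * (F a - F b))%L by ring.
  rewrite Rmult_assoc. apply nrm_mul; auto.
Qed.
Lemma lip0_til F : lip0 F -> lip0 (fun a => ltil (F a)).
Proof.
  intros [F0 [C [C0 HF]]]. split; [rewrite F0; apply til_zero|]. exists C. split; [lra|].
  intros a b M H. rewrite <- til_sub. apply nrm_til; auto.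
Qed.
Lemma lip0_diag d F : bcd d -> lip0 F -> lip0 (fun a => ldiag d (F a)).
Proof.
  intros Hd [F0 [C [C0 HF]]]. split; [rewrite F0; apply diag_zero, Hd|].
  assert (exists D, 0 <= D /\ forall k s, Rabs (d k s) <= D) as [D [D0 HD]].
  { destruct Hd as [_ [D HD]]. exists D. split; [|exact HD]. eapply Rle_trans; [apply Rabs_pos|apply (HD 0%Z 0)]. }
  exists (D * C). split; [apply Rmult_le_pos; assumption|].
  intros a b M H. rewrite <- diag_sub by assumption. rewrite Rmult_assoc. apply nrm_diag; auto.
Qed.
Lemma lip0_comp F G : lip0 F -> lip0 G -> lip0 (fun a => F (G a)).
Proof.
  intros [F0 [C [C0 HF]]] [G0 [D [D0 HG]]]. split; [rewrite G0; assumption|].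
  exists (C * D). split; [apply Rmult_le_pos; assumption|]. intros a b M H. rewrite Rmult_assoc. auto.
Qed.
Lemma lip0_mulr F c : lip0 F -> lip0 (fun a => F a * c)%L.
Proof.
  intros [F0 [C [C0 HF]]]. split; [rewrite F0; ring|]. destruct (nrm_ex c) as [N [N0 HN]].
  exists (C * N). split; [apply Rmult_le_pos; assumption|].
  intros a b M H. replace (F a * c - F b * c)%L with ((F a - F b) * c)%L by ring.
  replace (C * N * M) with (C * M * N) by ring. apply nrm_mul; auto.
Qed.

(* The recursion v_n + A (n+1+sg)/(n-1+sg) v_(n+1) = g_n for n >= 2. *)
Definition dB (k : Z) (s : R) : R := if Z_le_dec 2 k then amp s * ((IZR k + 1 + fs s) * / (IZR k - 1 + fs s)) else 0.

Lemma IZR_ge n k : (n <= k)%Z -> IZR n <= IZR k.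
Proof. apply IZR_le. Qed.

Lemma dB_le k s : Rabs (dB k s) <= 69/50.
Proof.
  unfold dB. destruct Z_le_dec as [L|L]; [|rewrite Rabs_R0; lra].
  apply IZR_ge in L. generalize (amp_range s) (fs_bounds s). intros.
  assert (0 <= (IZR k + 1 + fs s) * / (IZR k - 1 + fs s) <= 3).
  { split; [apply Rmult_le_pos; [|apply Rlt_le, Rinv_0_lt_compat]; lra|].
    apply Rle_div_l; lra. }
  rewrite Rabs_pos_eq by (apply Rmult_le_pos; lra). nra.
Qed.

Lemma continuous_rat (a b : R) s : (forall t, 0 < b + fs t) -> continuous (fun t => (a + fs t) * / (b + fs t)) s.
Proof.
  intros H. apply continuous_Rmult.
  - apply continuous_Rplus; [apply continuous_const|apply fs_bcont].
  - apply continuous_Rinv_comp; [|specialize (H s); lra].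
    apply continuous_Rplus; [apply continuous_const|apply fs_bcont].
Qed.

Lemma dB_bcd : bcd dB.
Proof.
  split; [|exists (69/50); apply dB_le]. intros k s. unfold dB. destruct Z_le_dec as [L|L]; [|apply continuous_const].
  apply IZR_ge in L. apply continuous_Rmult; [apply amp_bcont|].
  apply (continuous_rat (IZR k + 1) (IZR k - 1)). intros t. generalize (fs_bounds t). lra.
Qed.

Definition Bop (v : lau) : lau := ldiag dB (z_1 * v)%L.

Lemma cf_Bop v k s : cf (Bop v) k s = dB k s * cf v (k + 1)%Z s.
Proof. unfold Bop. rewrite cf_diag by apply dB_bcd. unfold z_1. rewrite lmul_mono_l. f_equal; try f_equal; lia. Qed.

(** The multiplier is bounded only by 69/50 = 3 * 23/50, which exceeds 1. Passing from index [k + 1]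
    to [k] gains the ratio 2/3 of the weights, and 69/50 * 2/3 = 23/25. *)
Lemma nrm_Bop v M : nrm v M -> nrm (Bop v) (23/25 * M).
Proof.
  intros H. destruct (nb_term _ _ H) as [m [m1 [m2 [m3 _]]]].
  eapply nrm_ext; [intros; apply cf_Bop|].
  exists (fun k => if Z_le_dec 2 k then 69/50 * m (k + 1)%Z else 0). split.
  - intros k s. rewrite Rabs_mult. unfold dB at 1. destruct Z_le_dec as [L|L].
    + replace (Rabs _) with (Rabs (dB k s)) at 1 by (unfold dB; destruct Z_le_dec; [reflexivity|lia]).
      apply Rmult_le_compat; auto using Rabs_pos, dB_le.
    + rewrite Rabs_R0. lra.
  - intros l Hl. apply Rle_trans with (sumL (fun k => 23/25 * (m (k + 1)%Z * wt (k + 1)%Z)) l).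
    + apply sumL_le_in. intros k _. generalize (m3 (k + 1)%Z) (wt_pos (k + 1)). intros.
      destruct Z_le_dec; [|rewrite Rmult_0_l; apply Rmult_le_pos; [lra|apply Rmult_le_pos; lra]].
      apply Req_le. unfold wt. replace (Z.abs_nat (k + 1)) with (S (Z.abs_nat k)) by lia. simpl. field.
    + rewrite sumL_scal. apply Rmult_le_compat_l; [lra|].
      specialize (m2 (map (fun k => (k + 1)%Z) l)). rewrite sumL_map in m2. apply m2.
      apply FinFun.Injective_map_NoDup; [intros x y; lia|assumption].
Qed.

Lemma Bop_sub a b : Bop (a - b)%L = (Bop a - Bop b)%L.
Proof. apply lau_ext. intros. rewrite cf_sub, !cf_Bop, cf_sub. ring. Qed.

(** The selected solution is the only one, by [solveB_unique]; the recursion runs from high modes to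
    low ones, so it is solved as a fixed point instead of by induction. *)
Definition solveB (g : lau) : lau := epsilon (inhabits lzero) (fun v => v = (g - Bop v)%L).

Lemma solveB_ex g M : nrm g M -> exists v, nrm v (M / (1 - 23/25)) /\ v = (g - Bop v)%L.
Proof.
  intros H. destruct (lau_fixpoint (fun v => (g - Bop v)%L) (23/25) (M / (1 - 23/25))) as [v [H1 H2]].
  - lra.
  - replace (g - Bop lzero)%L with g.
    + eapply nrm_le; [exact H|]. apply Req_le. field.
    + replace (Bop lzero) with lzero; [ring|]. apply lau_ext. intros. rewrite cf_Bop, !cf_zero. ring.
  - intros a b N _ _ Hab. replace ((g - Bop a) - (g - Bop b))%L with (- (Bop a - Bop b))%L by ring.
    rewrite <- Bop_sub. apply nrm_opp, nrm_Bop, Hab.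
  - exists v. split; [assumption|]. symmetry; assumption.
Qed.

Lemma solveB_eq g : solveB g = (g - Bop (solveB g))%L.
Proof.
  unfold solveB. apply epsilon_spec. destruct (nrm_ex g) as [M [_ H]].
  destruct (solveB_ex g M H) as [v [_ E]]. exists v. exact E.
Qed.

Lemma solveB_unique u : u = (- Bop u)%L -> u = lzero.
Proof.
  intros E. destruct (nrm_ex u) as [M [_ H]]. apply nrm_small_zero with (M := M) (q := 23/25); [lra|].
  induction n as [|n IH]; [simpl; rewrite Rmult_1_r; assumption|].
  rewrite E. eapply nrm_le; [apply nrm_opp, nrm_Bop, IH|]. simpl. apply Req_le. ring.
Qed.

Lemma lip0_solveB : lip0 solveB.
Proof.
  split.
  - apply solveB_unique. rewrite (solveB_eq lzero) at 1. ring.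
  - exists (/ (1 - 23/25)). split; [lra|]. intros a b M H.
    destruct (solveB_ex _ _ H) as [w [Hw E]].
    replace (solveB a - solveB b)%L with w; [eapply nrm_le; [exact Hw|]; apply Req_le; field|].
    assert (K : (w - (solveB a - solveB b))%L = 0%L).
    { apply solveB_unique. rewrite !Bop_sub. rewrite E at 1. rewrite (solveB_eq a), (solveB_eq b) at 1. ring. }
    replace w with ((w - (solveB a - solveB b)) + (solveB a - solveB b))%L by ring. rewrite K. ring.
Qed.

Lemma supp_solveB g : supp 2 g -> supp 2 (solveB g).
Proof.
  intros H k s Hk. rewrite solveB_eq, cf_sub, cf_Bop, H by assumption.
  unfold dB. destruct Z_le_dec; [lia|]. ring.
Qed.

(** [tv] carries the unknowns [(n - 2 + fs) U_n], hence these divisors. The multiplier [dT] is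
    bounded too, so [zeta U'] is controlled in the same norm as the data: the first-order equation
    loses no derivative. *)
Definition dU (k : Z) (s : R) : R := if Z_le_dec 2 k then / (IZR k - 2 + fs s) else 0.
Definition dT (k : Z) (s : R) : R := if Z_le_dec 2 k then IZR k * / (IZR k - 2 + fs s) else 0.

Lemma dU_bcd : bcd dU.
Proof.
  split.
  - intros k s. unfold dU. destruct Z_le_dec as [L|L]; [|apply continuous_const].
    apply IZR_ge in L. generalize (fs_bounds s). intros.
    apply continuous_Rinv_comp; [|lra]. apply continuous_Rplus; [apply continuous_const|apply fs_bcont].
  - exists 2. intros k s. unfold dU. destruct Z_le_dec as [L|L]; [|rewrite Rabs_R0; lra].
    apply IZR_ge in L. generalize (fs_bounds s). intros.
    rewrite Rabs_pos_eq by (apply Rlt_le, Rinv_0_lt_compat; lra).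
    replace 2 with (/ (1/2)) by field. apply Rinv_le_contravar; lra.
Qed.
Lemma dT_bcd : bcd dT.
Proof.
  split.
  - intros k s. unfold dT. destruct Z_le_dec as [L|L]; [|apply continuous_const].
    apply IZR_ge in L. generalize (fs_bounds s). intros. apply continuous_Rmult; [apply continuous_const|].
    apply continuous_Rinv_comp; [|lra]. apply continuous_Rplus; [apply continuous_const|apply fs_bcont].
  - exists 4. intros k s. unfold dT. destruct Z_le_dec as [L|L]; [|rewrite Rabs_R0; lra].
    apply IZR_ge in L. generalize (fs_bounds s). intros.
    rewrite Rabs_pos_eq by (apply Rmult_le_pos; [lra|apply Rlt_le, Rinv_0_lt_compat; lra]).
    apply Rle_div_l; lra.
Qed.

(* The right inverse [R |-> (th, tg, tO)] of the linearization at the Crapper-type wave. The antisymmetric and symmetric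
   parts of the residual are eliminated algebraically ([tchi]); what remains is a first-order differential equation for
   [tU = p^2 tY], solved mode by mode through the recursion [solveB], with [tnu] fixed by the resonant mode 2. *)
Definition tR1 (R : lau) : lau := (half * (R - ltil R))%L.
Definition tR2 (R : lau) : lau := (half * (R + ltil R))%L.
Definition trr (R : lau) : lau := (tR2 R - QQ * tR1 R)%L.
(** The data of the reduced equation: minus the positive modes of [ltil crV * trr R], which the
    remaining unknowns have to compensate for in the conjugate of [tg R]. *)
Definition tD (R : lau) : lau := (- pge 1 (p' * im' * m * ip * trr R))%L.
(** A constant that the projection to positive powers does not see. This value cancels the
    coefficient of [te] at [zeta], so that the series for the unknown can start at [zeta^2]. *)
Definition tlam (R : lau) : lau := (LA * mean (z_1 * tD R))%L.
Definition te (R : lau) : lau := (LA * tlam R + (z1 - LA) * (tlam R + tD R))%L.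
Definition tv (R : lau) : lau := solveB (pge 2 (z_1 * (p * m * te R)))%L.
Definition tUr (R : lau) : lau := ldiag dU (tv R).
Definition tTr (R : lau) : lau := ldiag dT (tv R).
Definition tnu (R : lau) : lau :=
  (LN * (LA * (2 + Ls) * mean (z_1 * z_1 * tUr R) - mean (z_1 * z_1 * te R)))%L.
(** Coefficient of the explicit solution [a2 zeta^2] for the part of the right-hand side
    proportional to [tnu]. It is read off at [zeta^3]; what it leaves at [zeta^2] enters the factor
    [fN0] of [tnu]. *)
Definition ta2 (R : lau) : lau := (- (4 * LA * (1 + LA * LA) * Lsi) * tnu R)%L.
Definition tU (R : lau) : lau := (tUr R + ta2 R * z1 * z1)%L.
Definition tT (R : lau) : lau := (tTr R + 2 * ta2 R * z1 * z1)%L.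
Definition tY (R : lau) : lau := (tU R * ip * ip)%L.
Definition th (R : lau) : lau := (tT R * ip * ip - 2 * LA * z1 * tU R * ip * ip * ip)%L.
Definition tphi (R : lau) : lau := (p * p * im * im * th R)%L.
Definition tq (R : lau) : lau := (p * im * tphi R)%L.
(** Change of the vorticity. The second term offsets the rank-one contribution of the conjugate of
    [tphi R] that is computed in [tK3]. *)
Definition tO (R : lau) : lau := (tnu R + half * LA * mean (ip * ltil (tq R)))%L.
Definition tchi (R : lau) : lau := (half * (tR2 R + QQ * tR1 R - (tphi R - ltil (tphi R))))%L.
Definition teta (R : lau) : lau := (half * (tY R + ltil (tY R)))%L.
Definition tg (R : lau) : lau := (crV * tchi R + tO R * cr_eta - Ls * teta R)%L.

Lemma supp_tD R : supp 1 (tD R).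
Proof. unfold tD. apply supp_opp, supp_pge. Qed.

Lemma cf_z1 a k s : cf (z1 * a)%L k s = cf a (k - 1)%Z s.
Proof. apply lmul_mono_l. Qed.
Lemma cf_z_1 a k s : cf (z_1 * a)%L k s = cf a (k + 1)%Z s.
Proof. unfold z_1. rewrite lmul_mono_l. f_equal; lia. Qed.
Lemma cf_LA a k s : cf (LA * a)%L k s = amp s * cf a k s.
Proof. apply cst_mul_l, amp_bcont. Qed.
Lemma cf_Ls a k s : cf (Ls * a)%L k s = fs s * cf a k s.
Proof. apply cst_mul_l, fs_bcont. Qed.

Lemma is_const_LA : is_const LA. Proof. apply is_const_cst, amp_bcont. Qed.
Lemma is_const_Ls : is_const Ls. Proof. apply is_const_cst, fs_bcont. Qed.
Lemma is_const_Lsi : is_const Lsi. Proof. apply is_const_cst, fsi_bcont. Qed.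
Lemma is_const_LN : is_const LN. Proof. apply is_const_cst, fN_bcont. Qed.
Lemma is_const_half : is_const half. Proof. apply is_const_cst, bcont_const. Qed.

Ltac solve_const := repeat match goal with
  | |- is_const lone => apply is_const_one
  | |- is_const LA => apply is_const_LA
  | |- is_const Ls => apply is_const_Ls
  | |- is_const Lsi => apply is_const_Lsi
  | |- is_const LN => apply is_const_LN
  | |- is_const half => apply is_const_half
  | |- is_const (mean _) => apply is_const_P0
  | |- is_const (ladd _ _) => apply is_const_add
  | |- is_const (lsub _ _) => apply is_const_sub
  | |- is_const (lopp _) => apply is_const_opp
  | |- is_const (lmul _ _) => apply is_const_mul
  end.

Lemma is_const_tlam R : is_const (tlam R). Proof. unfold tlam. solve_const. Qed.
Lemma is_const_tnu R : is_const (tnu R). Proof. unfold tnu. solve_const. Qed.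
Lemma is_const_ta2 R : is_const (ta2 R). Proof. unfold ta2. apply is_const_mul; [solve_const|apply is_const_tnu]. Qed.
Lemma is_const_tO R : is_const (tO R). Proof. unfold tO. apply is_const_add; [apply is_const_tnu|solve_const]. Qed.

Lemma te_eq R : te R = (z1 * tlam R + z1 * tD R - LA * tD R)%L.
Proof. unfold te. ring. Qed.

Lemma supp_te R : supp 2 (te R).
Proof.
  intros k s Hk. assert (SD := supp_tD R). rewrite te_eq, cf_sub, cf_add, !cf_z1, cf_LA.
  destruct (Z.eq_dec k 1) as [->|N].
  - rewrite (SD (1 - 1)%Z) by lia. unfold tlam. rewrite cf_LA, cf_P0. simpl Z.sub.
    destruct Z.eq_dec; [|lia]. rewrite cf_z_1. replace (0 + 1)%Z with 1%Z by lia. ring.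
  - rewrite (SD (k - 1)%Z), (SD k), is_const_tlam by lia. ring.
Qed.

Definition tgg (R : lau) : lau := (p * m * te R)%L.

Lemma tgg_eq R : tgg R = (te R - LA * LA * (z1 * (z1 * te R)))%L.
Proof. unfold tgg, p, m. ring. Qed.
Lemma supp_tgg R : supp 2 (tgg R).
Proof.
  unfold tgg. replace (p * m * te R)%L with ((p * m) * te R)%L by ring.
  apply (supp_mul 0 2); [|apply supp_te]. apply supp_mul0; [apply supp_p|apply supp_m].
Qed.
Lemma tgg_2 R s : cf (tgg R) 2 s = cf (te R) 2 s.
Proof.
  rewrite tgg_eq, cf_sub. replace (LA * LA * (z1 * (z1 * te R)))%L with (LA * (LA * (z1 * (z1 * te R))))%L by ring.
  rewrite !cf_LA, !cf_z1, (supp_te R (2 - 1 - 1)%Z) by lia. ring.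
Qed.

Lemma supp_tv R : supp 2 (tv R).
Proof. apply supp_solveB, supp_pge. Qed.
Lemma tv_rec R k s : (2 <= k)%Z -> cf (tv R) k s + dB k s * cf (tv R) (k + 1)%Z s = cf (tgg R) (k + 1)%Z s.
Proof.
  intros Hk. unfold tv. rewrite solveB_eq at 1. rewrite cf_sub, cf_Bop, cf_pge.
  destruct Z_le_dec; [|lia]. rewrite cf_z_1. unfold tgg. ring.
Qed.

Lemma supp_tUr R : supp 2 (tUr R).
Proof. intros k s H. unfold tUr. rewrite cf_diag by apply dU_bcd. rewrite supp_tv by assumption. ring. Qed.
Lemma cf_tTr R k s : cf (tTr R) k s = IZR k * cf (tUr R) k s.
Proof.
  unfold tTr, tUr. rewrite !cf_diag by (apply dU_bcd || apply dT_bcd). unfold dU, dT.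
  destruct Z_le_dec; ring.
Qed.
Lemma supp_tTr R : supp 2 (tTr R).
Proof. intros k s H. rewrite cf_tTr, supp_tUr by assumption. ring. Qed.

Definition cU (R : lau) : lau := mean (z_1 * z_1 * tUr R)%L.
Definition ce (R : lau) : lau := mean (z_1 * z_1 * te R)%L.

Lemma cf_zz_1 a k s : cf (z_1 * z_1 * a)%L k s = cf a (k + 2)%Z s.
Proof. replace (z_1 * z_1 * a)%L with (z_1 * (z_1 * a))%L by ring. rewrite !cf_z_1. f_equal; lia. Qed.

(** From [zeta^3] on this is the recursion that defines [tv]. At [zeta^2] the unknown of mode 1 is
    absent, and the equation holds only up to the displayed multiple of [z1 * z1]. *)
Lemma tK0 R : ((z1 + LA) * (tTr R + Ls * tUr R) - 2 * z1 * tUr R =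
  tgg R + (LA * (2 + Ls) * cU R - ce R) * (z1 * z1))%L.
Proof.
  apply lau_ext. intros k s.
  assert (SU := supp_tUr R). assert (SV := supp_tv R).
  replace ((z1 + LA) * (tTr R + Ls * tUr R) - 2 * z1 * tUr R)%L with
   (z1 * tTr R + Ls * (z1 * tUr R) - (z1 * tUr R + z1 * tUr R) + LA * tTr R + LA * (Ls * tUr R))%L by ring.
  replace (tgg R + (LA * (2 + Ls) * cU R - ce R) * (z1 * z1))%L with
   (tgg R + z1 * (z1 * (LA * (cU R + cU R + Ls * cU R) - ce R)))%L by ring.
  rewrite !cf_add, !cf_sub, !cf_add, !cf_LA, !cf_Ls, !cf_z1, cf_sub, cf_LA, !cf_add, cf_Ls, !cf_tTr.
  unfold cU, ce. rewrite !cf_P0, minus_IZR.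
  destruct (Z_lt_dec k 2) as [L|L].
  - destruct Z.eq_dec; [lia|]. rewrite (SU k), (SU (k - 1)%Z), supp_tgg by lia. ring.
  - destruct (Z.eq_dec (k - 1 - 1) 0) as [E|E].
    + replace k with 2%Z by lia. rewrite (SU (2 - 1)%Z) by lia. rewrite !cf_zz_1, tgg_2.
      simpl Z.add. simpl Z.sub. ring.
    + assert (Rk := tv_rec R (k - 1) s ltac:(lia)). replace (k - 1 + 1)%Z with k in Rk by lia.
      rewrite <- Rk. unfold tUr. rewrite !cf_diag by apply dU_bcd. unfold dU, dB.
      destruct (Z_le_dec 2 k), (Z_le_dec 2 (k - 1)); try lia.
      rewrite minus_IZR. assert (3 <= IZR k) by (apply IZR_le; lia).
      generalize (fs_bounds s). intros. field. lra.
Qed.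

Definition tet (R : lau) : lau := (te R + 4 * tnu R * (1 + LA * LA) * z1 * z1 * ip)%L.

Lemma Ls_rel : (Ls * (1 + LA * LA))%L = (1 - LA * LA)%L.
Proof.
  rewrite Ls_eq. replace ((1 - LA * LA) * Li * (1 + LA * LA))%L with ((1 - LA * LA) * (Li * (1 + LA * LA)))%L by ring.
  rewrite Li_eq. ring.
Qed.

(** The defect of [tK0] is absorbed: [ta2] matches the coefficient of [zeta^3], and [LN_eq] says
    that [tnu] then matches the one of [zeta^2]. *)
Lemma tK1 R : ((z1 + LA) * (tT R + Ls * tU R) - 2 * z1 * tU R = p * m * tet R)%L.
Proof.
  unfold tT, tU, tet.
  replace ((z1 + LA) * (tTr R + 2 * ta2 R * z1 * z1 + Ls * (tUr R + ta2 R * z1 * z1)) - 2 * z1 * (tUr R + ta2 R * z1 * z1))%L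
   with ((z1 + LA) * (tTr R + Ls * tUr R) - 2 * z1 * tUr R + ta2 R * (Ls * z1 + LA * (2 + Ls)) * (z1 * z1))%L by ring.
  rewrite tK0.
  replace (p * m * (te R + 4 * tnu R * (1 + LA * LA) * z1 * z1 * ip))%L with
    (tgg R + (p * ip) * 4 * tnu R * (1 + LA * LA) * m * (z1 * z1))%L by (unfold tgg; ring).
  rewrite pip.
  assert (E1 : (ta2 R * Ls)%L = (- (4 * LA * (1 + LA * LA) * tnu R))%L).
  { unfold ta2. replace (- (4 * LA * (1 + LA * LA) * Lsi) * tnu R * Ls)%L with
     (- (4 * LA * (1 + LA * LA) * tnu R) * (Ls * Lsi))%L by ring. rewrite Lsi_eq. ring. }
  assert (E2 : (LA * (2 + Ls) * cU R - ce R = tnu R * (4 * (1 + LA * LA) * (1 + LA * LA * ((2 + Ls) * Lsi))))%L).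
  { unfold tnu. fold (cU R) (ce R).
    replace (LN * (LA * (2 + Ls) * cU R - ce R) * (4 * (1 + LA * LA) * (1 + LA * LA * ((2 + Ls) * Lsi))))%L with
     ((LA * (2 + Ls) * cU R - ce R) * (LN * (4 * (1 + LA * LA) * (1 + LA * LA * ((2 + Ls) * Lsi)))))%L by ring.
    rewrite LN_eq. ring. }
  rewrite E2.
  replace (ta2 R * (Ls * z1 + LA * (2 + Ls)))%L with ((ta2 R * Ls) * z1 + LA * (2 + Ls) * ta2 R)%L by ring.
  rewrite E1. unfold ta2, m. ring.
Qed.

(** The expansion of [1 / (zeta - A)] that is valid on the unit circle. It contains only negative
    powers, so [pge 1] annihilates it. *)
Definition iz : lau := (z_1 * im')%L.
Lemma iz_eq : ((z1 - LA) * iz)%L = 1%L.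
Proof.
  unfold iz. rewrite <- mim'. unfold m'.
  replace ((z1 - LA) * (z_1 * im'))%L with ((z1 * z_1 - LA * z_1) * im')%L by ring. rewrite zz. reflexivity.
Qed.
Lemma pm_iz : (p' * im')%L = ((z1 + LA) * iz)%L.
Proof.
  unfold iz, p'. replace ((z1 + LA) * (z_1 * im'))%L with ((z1 * z_1 + LA * z_1) * im')%L by ring.
  rewrite zz. reflexivity.
Qed.

(** The substitution [tY = tU / p^2] turns the differential equation for [tY] into the one with
    polynomial coefficients in [tK1]; [Ls_rel] brings the coefficients of [tU] into the form
    required there. *)
Lemma tK2 R : (p' * im' * m * ip * tphi R - Ls * tY R = iz * tet R)%L.
Proof.
  apply (cancel (z1 - LA)%L iz _ _ iz_eq). apply (cancel m im _ _ mim).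
  apply (cancel p ip _ _ pip). apply (cancel p ip _ _ pip).
  replace (p * (p * (m * ((z1 - LA) * (iz * tet R)))))%L with ((z1 - LA) * iz * p * (p * m * tet R))%L by ring.
  rewrite iz_eq, <- tK1.
  unfold tphi, th, tY.
  replace (p' * im' * m * ip * (p * p * im * im * (tT R * ip * ip - 2 * LA * z1 * tU R * ip * ip * ip)))%L with
   ((p' * im') * (m * im) * (p * ip) * im * ip * ip * (tT R * p - 2 * LA * z1 * tU R * (p * ip)))%L by ring.
  rewrite pm_iz, mim, pip.
  replace (p * (p * (m * ((z1 - LA) * ((z1 + LA) * iz * 1 * 1 * im * ip * ip * (tT R * p - 2 * LA * z1 * tU R * 1) - Ls * (tU R * ip * ip))))))%L with
   ((p * ip) * (p * ip) * ( ((z1 - LA) * iz) * (m * im) * (z1 + LA) * (tT R * p - 2 * LA * z1 * tU R) - Ls * (z1 - LA) * m * tU R))%L by ring.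
  rewrite iz_eq, mim, pip. unfold p, m.
  replace (1 * 1 * (1 * 1 * (z1 + LA) * (tT R * (1 + LA * z1) - 2 * LA * z1 * tU R) - Ls * (z1 - LA) * (1 - LA * z1) * tU R))%L with
   ((z1 + LA) * (tT R * (1 + LA * z1) - 2 * LA * z1 * tU R + Ls * (1 + LA * z1) * tU R) - 2 * z1 * (Ls * (1 + LA * LA)) * tU R)%L by ring.
  rewrite Ls_rel. ring.
Qed.

(** Partial fractions at [zeta = A]: there the function [4 (1 + A^2) zeta^2 / (1 + A zeta)] has the
    value [4 A^2], which is the residue left over after division by [zeta - A]. *)
Lemma tet_iz R : (iz * tet R)%L = (LA * (tlam R + 4 * LA * tnu R) * iz + (tlam R + 4 * LA * tnu R) + (tD R - tnu R * crY))%L.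
Proof.
  unfold tet, te.
  assert (E : (4 * (1 + LA * LA) * z1 * z1 * ip)%L = (4 * LA * LA + (z1 - LA) * (4 * LA + 4 * z1 * ip))%L).
  { apply (cancel p ip _ _ pip).
    replace (p * (4 * (1 + LA * LA) * z1 * z1 * ip))%L with (4 * (1 + LA * LA) * z1 * z1 * (p * ip))%L by ring.
    replace (p * (4 * LA * LA + (z1 - LA) * (4 * LA + 4 * z1 * ip)))%L with
      (p * (4 * LA * LA + (z1 - LA) * (4 * LA)) + (z1 - LA) * 4 * z1 * (p * ip))%L by ring.
    rewrite pip. unfold p. ring. }
  replace (4 * tnu R * (1 + LA * LA) * z1 * z1 * ip)%L with (tnu R * (4 * (1 + LA * LA) * z1 * z1 * ip))%L by ring.
  rewrite E. unfold crY.
  replace (iz * (LA * tlam R + (z1 - LA) * (tlam R + tD R) + tnu R * (4 * LA * LA + (z1 - LA) * (4 * LA + 4 * z1 * ip))))%L with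
    (LA * (tlam R + 4 * LA * tnu R) * iz + ((z1 - LA) * iz) * (tlam R + tD R + tnu R * (4 * LA + 4 * z1 * ip)))%L by ring.
  rewrite iz_eq. ring.
Qed.

Lemma supp1_Y0 : supp 1 crY.
Proof.
  unfold crY. apply supp_opp. replace (4 * z1 * ip)%L with (z1 * (4 * ip))%L by ring.
  apply (supp_mul 1 0); [apply supp_z1|solve_supp].
Qed.

(** In the decomposition of [tet_iz] the constants and the multiple of [iz] have no positive powers,
    whereas [tD R - tnu R * crY] has no others. *)
Lemma P_izet R : pge 1 (iz * tet R)%L = (tD R - tnu R * crY)%L.
Proof.
  assert (IL := is_const_tlam R). assert (IN := is_const_tnu R).
  assert (IC : is_const (tlam R + 4 * LA * tnu R)%L) by (apply is_const_add; [assumption|apply is_const_mul; [solve_const|assumption]]).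
  rewrite tet_iz. set (c := (tlam R + 4 * LA * tnu R)%L) in *.
  rewrite !pge_add, (pge_is_const _ IC).
  rewrite pge_isc_mul by (apply is_const_mul; [solve_const|assumption]).
  replace iz with (ltil (z1 * im))%L by (unfold iz; til; reflexivity).
  rewrite pge_til0 by solve_supp.
  rewrite (pge_id 1 (tD R - tnu R * crY)%L); [ring|].
  apply supp_sub; [apply supp_tD|]. apply (supp_mul 0 1); [apply supp_is_const; assumption|apply supp1_Y0].
Qed.

Lemma supp_tU R : supp 2 (tU R).
Proof.
  unfold tU. apply supp_add; [apply supp_tUr|].
  replace (ta2 R * z1 * z1)%L with (ta2 R * (z1 * z1))%L by ring.
  apply (supp_mul 0 2); [apply supp_is_const, is_const_ta2|apply (supp_mul 1 1); apply supp_z1].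
Qed.
Lemma supp_tT R : supp 2 (tT R).
Proof.
  unfold tT. apply supp_add; [apply supp_tTr|].
  replace (2 * ta2 R * z1 * z1)%L with (ta2 R * (2 * (z1 * z1)))%L by ring.
  apply (supp_mul 0 2); [apply supp_is_const, is_const_ta2|]. apply (supp_mul 0 2); [solve_supp|apply (supp_mul 1 1); apply supp_z1].
Qed.
Lemma supp_tY R : supp 1 (tY R).
Proof.
  unfold tY. replace (tU R * ip * ip)%L with (tU R * (ip * ip))%L by ring.
  apply (supp_mul 1 0); [apply (supp_le 2 1); [apply supp_tU|lia]|solve_supp].
Qed.
Lemma supp_th R : supp 1 (th R).
Proof.
  unfold th. apply supp_sub.
  - replace (tT R * ip * ip)%L with (tT R * (ip * ip))%L by ring.
    apply (supp_mul 1 0); [apply (supp_le 2 1); [apply supp_tT|lia]|solve_supp].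
  - replace (2 * LA * z1 * tU R * ip * ip * ip)%L with (tU R * (2 * LA * z1 * ip * ip * ip))%L by ring.
    apply (supp_mul 1 0); [apply (supp_le 2 1); [apply supp_tU|lia]|solve_supp].
Qed.
Lemma is_theta_tYh R : is_theta (tY R) (th R).
Proof.
  assert (DU : is_theta (tU R) (tT R)).
  { unfold tU, tT. replace (2 * ta2 R * z1 * z1)%L with ((0 * z1 + ta2 R * z1) * z1 + ta2 R * z1 * z1)%L by ring.
    apply is_theta_add; [intros k s; apply cf_tTr|].
    apply is_theta_mul; [apply is_theta_mul; [apply is_theta_is_const, is_const_ta2|]|]; apply is_theta_z1. }
  unfold tY, th.
  replace (tT R * ip * ip - 2 * LA * z1 * tU R * ip * ip * ip)%L with
   ((tT R * ip + tU R * - (LA * z1 * ip * ip)) * ip + (tU R * ip) * - (LA * z1 * ip * ip))%L by ring.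
  apply is_theta_mul; [apply is_theta_mul; [assumption|]|]; apply is_theta_ip.
Qed.
Lemma supp_tq R : supp 0 (tq R).
Proof.
  assert (supp 0 (th R)) by (apply (supp_le 1 0); [apply supp_th|lia]).
  assert (supp 0 p) by apply supp_p.
  unfold tq, tphi. solve_supp.
Qed.

(** [(1 + A zeta) W] equals [ltil q] and has no positive powers, so the positive coefficients of [W]
    form a geometric sequence with ratio [- A] that starts at the mean of [W]. The map is of rank
    one. *)
Lemma tail_ip q : supp 0 q -> pge 1 (ip * ltil q)%L = (mean (ip * ltil q) * (ip - 1))%L.
Proof.
  intros Hq. set (W := (ip * ltil q)%L).
  assert (E : (p * W = ltil q)%L).
  { unfold W. replace (p * (ip * ltil q))%L with ((p * ip) * ltil q)%L by ring. rewrite pip. ring. }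
  assert (Rec : forall k s, (1 <= k)%Z -> cf W k s = - amp s * cf W (k - 1)%Z s).
  { intros k s Hk. assert (K : cf (p * W)%L k s = 0) by (rewrite E, cf_til; apply Hq; lia).
    unfold p in K. replace ((1 + LA * z1) * W)%L with (W + LA * (z1 * W))%L in K by ring.
    rewrite cf_add, cf_LA, cf_z1 in K. lra. }
  assert (C : forall k s, cf ip k s = geoc (fun s => - amp s) k s).
  { intros. unfold ip. rewrite cf_geo; [reflexivity|apply fAm_bcont|apply fAm_abs]. }
  apply lau_ext. intros k s. rewrite is_const_mul_l by apply is_const_P0. rewrite cf_pge, cf_P0, cf_sub.
  destruct (Z.eq_dec 0 0) as [_|]; [|lia]. unfold lone. rewrite cf_mono, C. unfold geoc.
  destruct (Z_le_dec 1 k) as [L|L].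
  - destruct (Z_le_dec 0 k), (Z.eq_dec k 0); try lia.
    assert (G : forall n, cf W (Z.of_nat n) s = cf W 0 s * (- amp s) ^ n).
    { intros j. induction j as [|j IH]; [simpl; ring|]. rewrite Rec by lia.
      replace (Z.of_nat (S j) - 1)%Z with (Z.of_nat j) by lia. rewrite IH. simpl. ring. }
    rewrite <- (Z2Nat.id k) at 1 by lia. rewrite G. ring.
  - destruct (Z_le_dec 0 k) as [L0|L0].
    + destruct (Z.eq_dec k 0) as [E0|E0]; [subst; simpl; ring|lia].
    + destruct (Z.eq_dec k 0) as [E0|E0]; [lia|ring].
Qed.

(** Since [m / p = 2 / p - 1], only the simple pole of [1 / p] meets the nonpositive powers of
    [ltil (tq R)]. By [tail_ip] the positive part is a multiple of [1 / p - 1], which is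
    proportional to [crY] and can be absorbed in the vorticity. *)
Lemma tK3 R : pge 1 (p' * im' * m * ip * ltil (tphi R))%L = (half * LA * mean (ip * ltil (tq R)) * crY)%L.
Proof.
  assert (E : (p' * im' * m * ip * ltil (tphi R) = ip * ltil (tq R) + ip * ltil (tq R) - ltil (tq R))%L).
  { unfold tq. til.
    replace (p' * im' * m * ip * ltil (tphi R))%L with ((2 * ip - (p * ip)) * (p' * im' * ltil (tphi R)))%L
      by (unfold p, m; ring). rewrite pip. ring. }
  rewrite E, pge_sub, pge_add, tail_ip, pge_til0 by apply supp_tq.
  replace (mean (ip * ltil (tq R)) * (ip - 1) + mean (ip * ltil (tq R)) * (ip - 1) - 0)%L with
    (2 * mean (ip * ltil (tq R)) * (ip - 1))%L by ring.
  replace (ip - 1)%L with (- (LA * z1 * ip))%L by (rewrite <- pip; unfold p; ring).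
  unfold crY. replace (half * LA * mean (ip * ltil (tq R)) * - (4 * z1 * ip))%L with
    ((half * 2) * LA * mean (ip * ltil (tq R)) * - (2 * z1 * ip))%L by ring. rewrite half2. ring.
Qed.

Lemma ttR1 R : ltil (tR1 R) = (- tR1 R)%L.
Proof. unfold tR1. til. ring. Qed.
Lemma ttR2 R : ltil (tR2 R) = tR2 R.
Proof. unfold tR2. til. ring. Qed.
Lemma tR12 R : (tR1 R + tR2 R)%L = R.
Proof.
  unfold tR1, tR2. replace (half * (R - ltil R) + half * (R + ltil R))%L with ((half * 2) * R)%L by ring.
  rewrite half2. ring.
Qed.
Lemma ttchi R : ltil (tchi R) = (half * (trr R + tphi R - ltil (tphi R)))%L.
Proof. unfold tchi, trr. til. rewrite ttR1, ttR2, tQQ. ring. Qed.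

(** The requirement that governs the whole construction: the potential part of the velocity must
    continue into the fluid. In the positive modes of its conjugate the data [tD], the solved
    differential equation and the rank-one term cancel. *)
Lemma supp_tg R : supp 0 (tg R).
Proof.
  assert (E : pge 1 (ltil (tg R)) = 0%L).
  { assert (E1 : ltil (tg R) = (half * ((p' * im' * m * ip) * trr R + (p' * im' * m * ip * tphi R - Ls * tY R)
       - p' * im' * m * ip * ltil (tphi R) + tO R * crY + tO R * ltil crY - Ls * ltil (tY R)))%L).
    { unfold tg. til. rewrite ttchi. rewrite (is_const_til (tO R)) by apply is_const_tO.
      unfold cr_eta, teta, crV. til. ring. }
    rewrite E1, pge_isc_mul by apply is_const_half. rewrite !pge_sub, !pge_add, pge_sub, !pge_add.
    rewrite tK2, P_izet, tK3.
    rewrite (pge_isc_mul 1 (tO R) crY), (pge_isc_mul 1 (tO R) (ltil crY)) by apply is_const_tO.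
    rewrite (pge_isc_mul 1 Ls) by apply is_const_Ls.
    rewrite (pge_id 1 crY) by apply supp1_Y0.
    rewrite !pge_til0 by (apply (supp_le 1 0); [apply supp1_Y0 || apply supp_tY|lia]).
    replace (pge 1 (p' * im' * m * ip * trr R))%L with (- tD R)%L by (unfold tD; ring).
    unfold tO. ring. }
  intros k s Hk. assert (K := cf_pge 1 (ltil (tg R)) (- k) s). rewrite E, cf_zero, cf_til in K.
  destruct Z_le_dec; [|lia]. rewrite Z.opp_involutive in K. symmetry; exact K.
Qed.

(** With the velocity perturbation [V chi] and [h = Z phi], the product [V Z = SS] is real on the
    circle and factors out; only the imaginary part of [chi + phi] remains, and [tchi] prescribes
    it. *)
Lemma t_lin1 R : (crZ * (crV * tchi R) + crV * th R - ltil (crZ * (crV * tchi R) + crV * th R) = tR1 R)%L.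
Proof.
  assert (F : (th R = crZ * tphi R)%L).
  { unfold tphi, crZ. replace (m * m * ip * ip * (p * p * im * im * th R))%L with
     ((m * im) * (m * im) * (p * ip) * (p * ip) * th R)%L by ring. rewrite mim, pip. ring. }
  rewrite F. replace (crZ * (crV * tchi R) + crV * (crZ * tphi R))%L with ((crV * crZ) * (tchi R + tphi R))%L by ring.
  rewrite VZ0. til. rewrite tSS, ttchi. unfold tchi, trr.
  replace (SS * (half * (tR2 R + QQ * tR1 R - (tphi R - ltil (tphi R))) + tphi R) -
    SS * (half * (tR2 R - QQ * tR1 R + tphi R - ltil (tphi R)) + ltil (tphi R)))%L with
   ((half * 2) * (SS * QQ) * tR1 R + SS * (1 - half * 2) * (tphi R - ltil (tphi R)))%L by ring.
  rewrite half2, SQ. ring.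
Qed.

(** [V] has modulus one on the circle, so the linearized Bernoulli condition sees only the real part
    of [chi]. *)
Lemma t_lin2 R : (ltil crV * (crV * tchi R) + crV * ltil (crV * tchi R) = tR2 R)%L.
Proof.
  rewrite til_mul. replace (ltil crV * (crV * tchi R) + crV * (ltil crV * ltil (tchi R)))%L with
    ((crV * ltil crV) * (tchi R + ltil (tchi R)))%L by ring.
  rewrite VV0, ttchi. unfold tchi, trr.
  replace (1 * (half * (tR2 R + QQ * tR1 R - (tphi R - ltil (tphi R))) + half * (tR2 R - QQ * tR1 R + tphi R - ltil (tphi R))))%L
   with ((half * 2) * tR2 R)%L by ring. rewrite half2. ring.
Qed.

Lemma lip0_P0 F : lip0 F -> lip0 (fun R => mean (F R)).
Proof. unfold mean. apply lip0_diag, dind_bcd. Qed.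
Lemma lip0_pge n F : lip0 F -> lip0 (fun R => pge n (F R)).
Proof. unfold pge. apply lip0_diag, dind_bcd. Qed.
Global Opaque mean pge.

Ltac solve_lip0 := repeat match goal with
  | |- lip0 (fun R => R) => apply lip0_id
  | |- lip0 (fun R => ladd (@?f R) (@?g R)) => apply (lip0_add f g)
  | |- lip0 (fun R => lsub (@?f R) (@?g R)) => apply (lip0_sub f g)
  | |- lip0 (fun R => lopp (@?f R)) => apply (lip0_opp f)
  | |- lip0 (fun R => ltil (@?f R)) => apply (lip0_til f)
  | |- lip0 (fun R => mean (@?f R)) => apply (lip0_P0 f)
  | |- lip0 (fun R => pge ?n (@?f R)) => apply (lip0_pge n f)
  | |- lip0 (fun R => lmul ?a (@?f R)) => apply (lip0_mul a f)
  | |- lip0 (fun R => lmul (@?f R) ?a) => apply (lip0_mulr f a)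
  end.

Lemma lip0_tR1 : lip0 tR1. Proof. unfold tR1. solve_lip0. Qed.
Lemma lip0_tR2 : lip0 tR2. Proof. unfold tR2. solve_lip0. Qed.
Lemma lip0_trr : lip0 trr. Proof. unfold trr. solve_lip0; [exact lip0_tR2|exact lip0_tR1]. Qed.
Lemma lip0_tD : lip0 tD. Proof. unfold tD. solve_lip0. exact lip0_trr. Qed.
Lemma lip0_tlam : lip0 tlam. Proof. unfold tlam. solve_lip0. exact lip0_tD. Qed.
Lemma lip0_te : lip0 te. Proof. unfold te. solve_lip0; [exact lip0_tlam|exact lip0_tlam|exact lip0_tD]. Qed.
Lemma lip0_tv : lip0 tv.
Proof. apply (lip0_comp solveB (fun R => pge 2 (z_1 * (p * m * te R))%L)); [apply lip0_solveB|]. solve_lip0. exact lip0_te. Qed.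
Lemma lip0_tUr : lip0 tUr. Proof. apply (lip0_diag dU tv); [apply dU_bcd|apply lip0_tv]. Qed.
Lemma lip0_tTr : lip0 tTr. Proof. apply (lip0_diag dT tv); [apply dT_bcd|apply lip0_tv]. Qed.
Lemma lip0_tnu : lip0 tnu. Proof. unfold tnu. solve_lip0; [exact lip0_tUr|exact lip0_te]. Qed.
Lemma lip0_ta2 : lip0 ta2. Proof. unfold ta2. solve_lip0. exact lip0_tnu. Qed.
Lemma lip0_tU : lip0 tU. Proof. unfold tU. solve_lip0; [exact lip0_tUr|exact lip0_ta2]. Qed.
Lemma lip0_tT : lip0 tT. Proof. unfold tT. solve_lip0; [exact lip0_tTr|exact lip0_ta2]. Qed.
Lemma lip0_tY : lip0 tY. Proof. unfold tY. solve_lip0. exact lip0_tU. Qed.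
Lemma lip0_th : lip0 th. Proof. unfold th. solve_lip0; [exact lip0_tT|exact lip0_tU]. Qed.
Lemma lip0_tphi : lip0 tphi. Proof. unfold tphi. solve_lip0. exact lip0_th. Qed.
Lemma lip0_tq : lip0 tq. Proof. unfold tq. solve_lip0. exact lip0_tphi. Qed.
Lemma lip0_tO : lip0 tO. Proof. unfold tO. solve_lip0; [exact lip0_tnu|exact lip0_tq]. Qed.
Lemma lip0_tchi : lip0 tchi. Proof. unfold tchi. solve_lip0; [exact lip0_tR2|exact lip0_tR1|exact lip0_tphi|exact lip0_tphi]. Qed.
Lemma lip0_teta : lip0 teta. Proof. unfold teta. solve_lip0; exact lip0_tY. Qed.
Lemma lip0_tg : lip0 tg. Proof. unfold tg. solve_lip0; [exact lip0_tchi|exact lip0_tO|exact lip0_teta]. Qed.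

(** * Solution of the surface equations *)

(** The damping of a mode on its way to the bottom and back, for [e = exp (-2 d)]; only positive
    modes produce a reflected one. *)
Definition dE (e : R) (k : Z) (s : R) : R := if Z_le_dec 1 k then e ^ Z.to_nat k else 0.
Lemma dE_le e k s : 0 <= e <= 1 -> Rabs (dE e k s) <= e.
Proof.
  intros He. unfold dE. destruct Z_le_dec; [|rewrite Rabs_R0; lra].
  rewrite Rabs_pos_eq by (apply pow_le; lra).
  replace (Z.to_nat k) with (S (Z.to_nat (k - 1))) by lia. simpl.
  assert (e ^ Z.to_nat (k - 1) <= 1) by (rewrite <- (pow1 (Z.to_nat (k - 1))); apply pow_incr; lra). nra.
Qed.
Lemma dE_bcd e : 0 <= e <= 1 -> bcd (dE e).
Proof. intros He. split; [intros; apply continuous_const|]. exists e. intros. apply dE_le, He. Qed.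

Definition fam := R -> R -> lau -> lau.
(** Here [t] bounds [e] and [|G|], and [rho] is the radius of a ball. Maps in [fam_linear] are of
    size O(t) at zero with a bounded Lipschitz constant; in [fam_small] the Lipschitz constant is
    O(t + rho) as well, which is what the contraction requires. *)
Definition fam_bounded (F : fam) : Prop := exists C, 0 <= C /\ forall e G, 0 <= e <= 1 -> Rabs G <= 1 ->
  nrm (F e G lzero) C /\
  forall a b M, nrm a 1 -> nrm b 1 -> nrm (a - b)%L M -> nrm (F e G a - F e G b)%L (C * M).
Definition fam_linear (F : fam) : Prop := exists C, 0 <= C /\ forall t e G, 0 <= t <= 1 -> 0 <= e <= t -> Rabs G <= t ->
  nrm (F e G lzero) (C * t) /\
  forall a b M, nrm a 1 -> nrm b 1 -> nrm (a - b)%L M -> nrm (F e G a - F e G b)%L (C * M).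
Definition fam_small (F : fam) : Prop := exists C, 0 <= C /\ forall t rho e G,
  0 <= t <= 1 -> 0 <= rho <= 1 -> 0 <= e <= t -> Rabs G <= t ->
  nrm (F e G lzero) (C * t) /\
  forall a b M, nrm a rho -> nrm b rho -> nrm (a - b)%L M -> nrm (F e G a - F e G b)%L (C * (t + rho) * M).

Lemma fam_small_fam_linear F : fam_small F -> fam_linear F.
Proof.
  intros [C [C0 H]]. exists (2 * C). split; [lra|]. intros t e G Ht He HG.
  destruct (H t 1 e G Ht ltac:(lra) He HG) as [H1 H2]. split.
  - eapply nrm_le; [exact H1|]. nra.
  - intros a b M Ha Hb Hab. assert (0 <= M) by apply (nrm_ge0 _ _ Hab).
    eapply nrm_le; [apply H2; eassumption|]. apply Rmult_le_compat_r; nra.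
Qed.
Lemma fam_linear_fam_bounded F : fam_linear F -> fam_bounded F.
Proof.
  intros [C [C0 H]]. exists C. split; [lra|]. intros e G He HG.
  destruct (H 1 e G ltac:(lra) ltac:(lra) HG) as [H1 H2]. split; [|assumption].
  eapply nrm_le; [exact H1|]. lra.
Qed.
Lemma lip0_fam_linear F : lip0 F -> fam_linear (fun _ _ => F).
Proof.
  intros [F0 [C [C0 H]]]. exists C. split; [lra|]. intros t e G Ht He HG. split.
  - rewrite F0. eapply nrm_le; [apply nrm_zero|]. nra.
  - intros; apply H; assumption.
Qed.
Lemma fam_bounded_const c : fam_bounded (fun _ _ _ => c).
Proof.
  destruct (nrm_ex c) as [N [N0 HN]]. exists N. split; [assumption|]. intros e G _ _. split; [assumption|].
  intros a b M _ _ Hab. replace (c - c)%L with lzero by ring. eapply nrm_le; [apply nrm_zero|].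
  apply Rmult_le_pos; [assumption|apply (nrm_ge0 _ _ Hab)].
Qed.
Lemma fam_bounded_add F F' : fam_bounded F -> fam_bounded F' -> fam_bounded (fun e G R => F e G R + F' e G R)%L.
Proof.
  intros [C [C0 H]] [D [D0 H']]. exists (C + D). split; [lra|]. intros e G He HG.
  destruct (H e G He HG) as [H1 H2], (H' e G He HG) as [H3 H4]. split; [apply nrm_add; assumption|].
  intros a b M Ha Hb Hab.
  replace (F e G a + F' e G a - (F e G b + F' e G b))%L with ((F e G a - F e G b) + (F' e G a - F' e G b))%L by ring.
  rewrite Rmult_plus_distr_r. apply nrm_add; auto.
Qed.
Lemma fam_bounded_mulc c F : fam_bounded F -> fam_bounded (fun e G R => c * F e G R)%L.
Proof.
  intros [C [C0 H]]. destruct (nrm_ex c) as [N [N0 HN]]. exists (N * C). split; [apply Rmult_le_pos; assumption|].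
  intros e G He HG. destruct (H e G He HG) as [H1 H2]. split; [apply nrm_mul; assumption|].
  intros a b M Ha Hb Hab. replace (c * F e G a - c * F e G b)%L with (c * (F e G a - F e G b))%L by ring.
  rewrite Rmult_assoc. apply nrm_mul; auto.
Qed.
Lemma fam_bounded_til F : fam_bounded F -> fam_bounded (fun e G R => ltil (F e G R)).
Proof.
  intros [C [C0 H]]. exists C. split; [assumption|].
  intros e G He HG. destruct (H e G He HG) as [H1 H2]. split; [apply nrm_til; assumption|].
  intros a b M Ha Hb Hab. rewrite <- til_sub. apply nrm_til; auto.
Qed.
Lemma fam_linear_add F F' : fam_linear F -> fam_linear F' -> fam_linear (fun e G R => F e G R + F' e G R)%L.
Proof.
  intros [C [C0 H]] [D [D0 H']]. exists (C + D). split; [lra|]. intros t e G Ht He HG.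
  destruct (H t e G Ht He HG) as [H1 H2], (H' t e G Ht He HG) as [H3 H4].
  split; [rewrite Rmult_plus_distr_r; apply nrm_add; assumption|].
  intros a b M Ha Hb Hab.
  replace (F e G a + F' e G a - (F e G b + F' e G b))%L with ((F e G a - F e G b) + (F' e G a - F' e G b))%L by ring.
  rewrite Rmult_plus_distr_r. apply nrm_add; auto.
Qed.
Lemma fam_linear_til F : fam_linear F -> fam_linear (fun e G R => ltil (F e G R)).
Proof.
  intros [C [C0 H]]. exists C. split; [assumption|].
  intros t e G Ht He HG. destruct (H t e G Ht He HG) as [H1 H2]. split; [apply nrm_til; assumption|].
  intros a b M Ha Hb Hab. rewrite <- til_sub. apply nrm_til; auto.
Qed.
Lemma fam_small_add F F' : fam_small F -> fam_small F' -> fam_small (fun e G R => F e G R + F' e G R)%L.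
Proof.
  intros [C [C0 H]] [D [D0 H']]. exists (C + D). split; [lra|]. intros t rho e G Ht Hr He HG.
  destruct (H t rho e G Ht Hr He HG) as [H1 H2], (H' t rho e G Ht Hr He HG) as [H3 H4].
  split; [rewrite Rmult_plus_distr_r; apply nrm_add; assumption|].
  intros a b M Ha Hb Hab.
  replace (F e G a + F' e G a - (F e G b + F' e G b))%L with ((F e G a - F e G b) + (F' e G a - F' e G b))%L by ring.
  replace ((C + D) * (t + rho) * M) with (C * (t + rho) * M + D * (t + rho) * M) by ring.
  apply nrm_add; auto.
Qed.
Lemma fam_small_mulc c F : fam_small F -> fam_small (fun e G R => c * F e G R)%L.
Proof.
  intros [C [C0 H]]. destruct (nrm_ex c) as [N [N0 HN]]. exists (N * C). split; [apply Rmult_le_pos; assumption|].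
  intros t rho e G Ht Hr He HG. destruct (H t rho e G Ht Hr He HG) as [H1 H2].
  split; [rewrite Rmult_assoc; apply nrm_mul; assumption|].
  intros a b M Ha Hb Hab. replace (c * F e G a - c * F e G b)%L with (c * (F e G a - F e G b))%L by ring.
  rewrite !Rmult_assoc. rewrite <- (Rmult_assoc C). apply nrm_mul; auto.
Qed.
Lemma fam_small_til F : fam_small F -> fam_small (fun e G R => ltil (F e G R)).
Proof.
  intros [C [C0 H]]. exists C. split; [assumption|].
  intros t rho e G Ht Hr He HG. destruct (H t rho e G Ht Hr He HG) as [H1 H2]. split; [apply nrm_til; assumption|].
  intros a b M Ha Hb Hab. rewrite <- til_sub. apply nrm_til; auto.
Qed.
Lemma fam_small_opp F : fam_small F -> fam_small (fun e G R => - F e G R)%L.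
Proof.
  intros [C [C0 H]]. exists C. split; [assumption|].
  intros t rho e G Ht Hr He HG. destruct (H t rho e G Ht Hr He HG) as [H1 H2]. split; [apply nrm_opp; assumption|].
  intros a b M Ha Hb Hab. replace (- F e G a - - F e G b)%L with (- (F e G a - F e G b))%L by ring.
  apply nrm_opp; auto.
Qed.
Lemma fam_small_sub F F' : fam_small F -> fam_small F' -> fam_small (fun e G R => F e G R - F' e G R)%L.
Proof. intros. apply (fam_small_add F (fun e G R => - F' e G R)%L); [|apply fam_small_opp]; assumption. Qed.

(** On the ball each factor has norm O(t + rho), and it multiplies the bounded increment of the
    other factor. *)
Lemma fam_small_prod F F' : fam_linear F -> fam_linear F' -> fam_small (fun e G R => F e G R * F' e G R)%L.
Proof.
  intros [C [C0 H]] [D [D0 H']]. exists (2 * (C * D)). split; [nra|]. intros t rho e G Ht Hr He HG.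
  destruct (H t e G Ht He HG) as [H1 H2], (H' t e G Ht He HG) as [H3 H4].
  assert (CD : 0 <= C * D) by (apply Rmult_le_pos; assumption).
  split.
  - eapply nrm_le; [apply nrm_mul; [exact H1|exact H3]|].
    replace (C * t * (D * t)) with (C * D * (t * t)) by ring.
    replace (2 * (C * D) * t) with (C * D * (2 * t)) by ring. apply Rmult_le_compat_l; nra.
  - intros a b M Ha Hb Hab.
    assert (up : forall x, nrm x rho -> nrm x 1) by (intros x Hx; eapply nrm_le; [exact Hx|lra]).
    assert (Z : forall x, nrm x rho -> nrm (x - lzero)%L rho).
    { intros x Hx. replace (x - lzero)%L with x by ring. exact Hx. }
    assert (o : nrm lzero 1) by (eapply nrm_le; [apply nrm_zero|lra]).
    assert (Fa : nrm (F e G a) (C * (t + rho))).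
    { replace (F e G a) with (F e G lzero + (F e G a - F e G lzero))%L by ring.
      rewrite Rmult_plus_distr_l. apply nrm_add; [exact H1|apply H2; auto]. }
    assert (Fb : nrm (F' e G b) (D * (t + rho))).
    { replace (F' e G b) with (F' e G lzero + (F' e G b - F' e G lzero))%L by ring.
      rewrite Rmult_plus_distr_l. apply nrm_add; [exact H3|apply H4; auto]. }
    replace (F e G a * F' e G a - F e G b * F' e G b)%L with
      (F e G a * (F' e G a - F' e G b) + (F e G a - F e G b) * F' e G b)%L by ring.
    replace (2 * (C * D) * (t + rho) * M) with (C * (t + rho) * (D * M) + C * M * (D * (t + rho))) by ring.
    apply nrm_add; apply nrm_mul; auto.
Qed.

Lemma fam_small_E F : fam_bounded F -> fam_small (fun e G R => ldiag (dE e) (F e G R)).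
Proof.
  intros [C [C0 H]]. exists C. split; [assumption|]. intros t rho e G Ht Hr He HG.
  assert (e1 : 0 <= e <= 1) by lra.
  destruct (H e G e1 ltac:(lra)) as [H1 H2]. split.
  - eapply nrm_le; [apply nrm_diag with (C := e); [apply dE_bcd, e1|lra|intros; apply dE_le, e1|exact H1]|]. nra.
  - intros a b M Ha Hb Hab. rewrite <- diag_sub by (apply dE_bcd, e1).
    assert (up : forall x, nrm x rho -> nrm x 1) by (intros x Hx; eapply nrm_le; [exact Hx|lra]).
    assert (0 <= M) by apply (nrm_ge0 _ _ Hab). assert (0 <= C * M) by (apply Rmult_le_pos; assumption).
    eapply nrm_le; [apply nrm_diag with (C := e); [apply dE_bcd, e1|lra|intros; apply dE_le, e1|apply H2; eauto]|].
    nra.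
Qed.

Lemma fam_small_G F : fam_bounded F -> fam_small (fun e G R => cst (fun _ => G) * F e G R)%L.
Proof.
  intros [C [C0 H]]. exists C. split; [assumption|]. intros t rho e G Ht Hr He HG.
  destruct (H e G ltac:(lra) ltac:(lra)) as [H1 H2].
  assert (NG : nrm (cst (fun _ => G)) t).
  { unfold nrm. Transparent cst. unfold cst. rewrite cf_mk by (apply valid_cst, bcont_const). Opaque cst.
    eapply nb_le; [apply (cst_nb (fun _ => G) 0 t); intros; assumption|]. unfold wt; simpl; lra. }
  split.
  - eapply nrm_le; [apply nrm_mul; [exact NG|exact H1]|]. lra.
  - intros a b M Ha Hb Hab.
    replace (cst (fun _ => G) * F e G a - cst (fun _ => G) * F e G b)%L with (cst (fun _ => G) * (F e G a - F e G b))%L by ring.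
    assert (up : forall x, nrm x rho -> nrm x 1) by (intros x Hx; eapply nrm_le; [exact Hx|lra]).
    assert (0 <= M) by apply (nrm_ge0 _ _ Hab). assert (0 <= C * M) by (apply Rmult_le_pos; assumption).
    eapply nrm_le; [apply nrm_mul; [exact NG|apply H2; eauto]|]. nra.
Qed.

(* [Eq] vanishes iff the kinematic condition (an antisymmetric Laurent series) and the Bernoulli condition (a symmetric
   one) hold; [e = exp (-2 d)] measures the depth, [tau e] adds the terms reflected at the bottom. *)
Definition xh (R : lau) : lau := (crH + th R)%L.
Definition xY (R : lau) : lau := (crY + tY R)%L.
Definition xg (R : lau) : lau := (cr_g + tg R)%L.
Definition xOm (R : lau) : lau := (tO R - Ls)%L.
Definition tau (e : R) (a : lau) : lau := ltil (ldiag (dE e) a).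
Definition xHe (e : R) (R : lau) : lau := (xh R + tau e (xh R))%L.
Definition xeta (e : R) (R : lau) : lau :=
  (half * ((xY R - ldiag (dE e) (xY R)) + ltil (xY R - ldiag (dE e) (xY R))))%L.
Definition xU (e : R) (R : lau) : lau := (xg R + tau e (xg R) - xOm R * xeta e R)%L.
Definition Eq (e G : R) (R : lau) : lau :=
  ((nfun (xU e R) (xHe e R) - ltil (nfun (xU e R) (xHe e R)))
   + (xU e R + ltil (xU e R) + LA * xU e R * ltil (xU e R) + 2 * (cst (fun _ => G) * xeta e R)))%L.

Definition xDeta (e : R) (R : lau) : lau := (half * (ldiag (dE e) (xY R) + ltil (ldiag (dE e) (xY R))))%L.
(** What the velocity perturbation contains besides [crV * tchi R]: terms with a factor from [dE e]
    and terms quadratic in [R]. All of them are small in the sense of [fam_small]. *)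
Definition xDU (e : R) (R : lau) : lau := (tau e (xg R) - tO R * teta R + (tO R * xDeta e R - Ls * xDeta e R))%L.
Definition xDH (e : R) (R : lau) : lau := tau e (xh R).
Definition sU (e : R) (R : lau) : lau := (crV * tchi R + xDU e R)%L.
Definition sH (e : R) (R : lau) : lau := (th R + xDH e R)%L.

Lemma xU_eq e R : xU e R = (crU + sU e R)%L.
Proof.
  rewrite crU_eq. unfold xU, sU, xDU, xOm, xeta, xg, tg, teta, cr_eta, xDeta, xY. til. ring.
Qed.
Lemma xHe_eq e R : xHe e R = (crH + sH e R)%L.
Proof. unfold xHe, sH, xDH, xh. ring. Qed.

(* [Eq = R - Kmap] because [R] enters the unknowns through a right inverse; solutions are fixed points of [Kmap]. *)
Definition Kmap (e G : R) (R : lau) : lau :=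
  (- (((crZ * xDU e R + crV * xDH e R) - ltil (crZ * xDU e R + crV * xDH e R))
    + (ltil crV * xDU e R + crV * ltil (xDU e R))
    + LA * (sU e R * sH e R - ltil (sU e R * sH e R))
    + LA * (sU e R * ltil (sU e R)) + 2 * (cst (fun _ => G) * xeta e R)))%L.

(** Terms of order zero cancel by [crapper_E1] and [crapper_E2]; the linear ones add up to
    [tR1 R + tR2 R = R] by [t_lin1] and [t_lin2]; [Kmap] collects the rest with the opposite
    sign. *)
Lemma Kmap_eq e G R : Eq e G R = (R - Kmap e G R)%L.
Proof.
  assert (E1 := t_lin1 R). assert (E2 := t_lin2 R). assert (C1 := crapper_E1). assert (C2 := crapper_E2).
  rewrite <- (tR12 R) at 2. rewrite <- E1, <- E2.
  unfold Eq. rewrite xU_eq, xHe_eq. unfold Kmap.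
  assert (N : nfun (crU + sU e R)%L (crH + sH e R)%L = (nfun crU crH + (crZ * sU e R + crV * sH e R) + LA * (sU e R * sH e R))%L).
  { rewrite crZ_eq, crV_eq. unfold nfun. ring. }
  rewrite N. til. rewrite <- C1.
  assert (tV : ltil crV = (1 + LA * ltil crU)%L) by (rewrite crV_eq; til; ring).
  replace (crU + sU e R + (ltil crU + ltil (sU e R)) + LA * (crU + sU e R) * (ltil crU + ltil (sU e R)) + 2 * (cst (fun _ => G) * xeta e R))%L with
   ((crU + ltil crU + LA * crU * ltil crU) + ((1 + LA * ltil crU) * sU e R + (1 + LA * crU) * ltil (sU e R)) + LA * (sU e R * ltil (sU e R)) + 2 * (cst (fun _ => G) * xeta e R))%L by ring.
  rewrite C2, <- tV, <- crV_eq. unfold sU, sH, xDH. til. ring.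
Qed.

Lemma fam_small_tau F : fam_bounded F -> fam_small (fun e G R => tau e (F e G R)).
Proof. intros H. apply (fam_small_til (fun e G R => ldiag (dE e) (F e G R))), fam_small_E, H. Qed.

Lemma fam_bounded_aff c F : lip0 F -> fam_bounded (fun _ _ R => c + F R)%L.
Proof. intros H. apply (fam_bounded_add (fun _ _ _ => c) (fun _ _ => F)); [apply fam_bounded_const|apply fam_linear_fam_bounded, lip0_fam_linear, H]. Qed.

Lemma fam_small_Deta : fam_small (fun e G R => xDeta e R).
Proof.
  unfold xDeta. apply fam_small_mulc. assert (H : fam_small (fun e G R => ldiag (dE e) (xY R))).
  { apply (fam_small_E (fun _ _ R => xY R)). apply (fam_bounded_aff crY tY), lip0_tY. }
  apply fam_small_add; [assumption|]. apply (fam_small_til (fun e G R => ldiag (dE e) (xY R))), H.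
Qed.
Lemma fam_small_xDU : fam_small (fun e G R => xDU e R).
Proof.
  unfold xDU. apply fam_small_add; [apply fam_small_sub|apply fam_small_sub].
  - apply (fam_small_tau (fun _ _ R => xg R)), (fam_bounded_aff cr_g tg), lip0_tg.
  - apply (fam_small_prod (fun _ _ => tO) (fun _ _ => teta)); apply lip0_fam_linear; [apply lip0_tO|apply lip0_teta].
  - apply (fam_small_prod (fun _ _ => tO)); [apply lip0_fam_linear, lip0_tO|apply fam_small_fam_linear, fam_small_Deta].
  - apply fam_small_mulc, fam_small_Deta.
Qed.
Lemma fam_small_xDH : fam_small (fun e G R => xDH e R).
Proof. apply (fam_small_tau (fun _ _ R => xh R)), (fam_bounded_aff crH th), lip0_th. Qed.
Lemma fam_linear_sU : fam_linear (fun e G R => sU e R).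
Proof.
  unfold sU. apply (fam_linear_add (fun _ _ R => crV * tchi R)%L); [|apply fam_small_fam_linear, fam_small_xDU].
  apply lip0_fam_linear, lip0_mul, lip0_tchi.
Qed.
Lemma fam_linear_sH : fam_linear (fun e G R => sH e R).
Proof. unfold sH. apply (fam_linear_add (fun _ _ => th)); [apply lip0_fam_linear, lip0_th|apply fam_small_fam_linear, fam_small_xDH]. Qed.
Lemma fam_bounded_xeta : fam_bounded (fun e G R => xeta e R).
Proof.
  unfold xeta. apply fam_bounded_mulc.
  assert (H : fam_bounded (fun e G R => xY R - ldiag (dE e) (xY R))%L).
  { assert (B : fam_bounded (fun _ _ R => xY R)) by apply (fam_bounded_aff crY tY), lip0_tY.
    apply (fam_bounded_add (fun _ _ R => xY R) (fun e G R => - ldiag (dE e) (xY R))%L); [assumption|].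
    apply fam_linear_fam_bounded, fam_small_fam_linear, (fam_small_opp (fun e G R => ldiag (dE e) (xY R))), (fam_small_E (fun _ _ R => xY R)), B. }
  apply fam_bounded_add; [assumption|]. apply (fam_bounded_til (fun e G R => xY R - ldiag (dE e) (xY R))%L), H.
Qed.

Lemma fam_small_Kmap : fam_small Kmap.
Proof.
  unfold Kmap. assert (A : fam_small (fun e G R => crZ * xDU e R + crV * xDH e R)%L).
  { apply fam_small_add; apply fam_small_mulc; [apply fam_small_xDU|apply fam_small_xDH]. }
  assert (B : fam_small (fun e G R => sU e R * sH e R)%L) by (apply fam_small_prod; [apply fam_linear_sU|apply fam_linear_sH]).
  apply fam_small_opp, fam_small_add; [apply fam_small_add; [apply fam_small_add; [apply fam_small_add|]|]|].
  - apply fam_small_sub; [exact A|apply (fam_small_til _ A)].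
  - apply fam_small_add; apply fam_small_mulc; [apply fam_small_xDU|]. apply (fam_small_til _ fam_small_xDU).
  - apply fam_small_mulc, fam_small_sub; [exact B|apply (fam_small_til _ B)].
  - apply fam_small_mulc, fam_small_prod; [apply fam_linear_sU|apply (fam_linear_til _ fam_linear_sU)].
  - apply fam_small_mulc. apply (fam_small_G (fun e G R => xeta e R)), fam_bounded_xeta.
Qed.

Lemma Eq_solution eta : 0 < eta -> exists t, 0 < t /\ t <= 1 /\ forall e G, 0 <= e <= t -> Rabs G <= t ->
  exists R, nrm R eta /\ Eq e G R = lzero.
Proof.
  intros He. destruct fam_small_Kmap as [C [C0 H]].
  (* This [rho] and [t = rho / (2 (C + 1))] give [C (t + rho) <= 1/2] and [C t <= rho / 2], the two
     requirements of [lau_fixpoint] for [q = 1/2]. *)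
  set (rho := Rmin (Rmin eta 1) (/ (4 * (C + 1)))).
  assert (Hr : 0 < rho /\ rho <= eta /\ rho <= 1 /\ rho <= / (4 * (C + 1))).
  { assert (0 < / (4 * (C + 1))) by (apply Rinv_0_lt_compat; lra). unfold rho.
    repeat split; [apply Rmin_glb_lt; [apply Rmin_glb_lt; lra|assumption]| | |apply Rmin_r];
      eapply Rle_trans; [apply Rmin_l|apply Rmin_l|apply Rmin_l|apply Rmin_r]. }
  clearbody rho. destruct Hr as [r0 [r1 [r2 r3]]].
  assert (r4 : (C + 1) * rho <= 1/4).
  { apply (Rmult_le_compat_l (C + 1)) in r3; [|lra]. replace (1/4) with ((C + 1) * / (4 * (C + 1))) by (field; lra). exact r3. }
  assert (i1 : 0 < / (2 * (C + 1)) <= / 2).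
  { split; [apply Rinv_0_lt_compat; lra|apply Rinv_le_contravar; lra]. }
  exists (rho * / (2 * (C + 1))). split; [apply Rmult_lt_0_compat; lra|]. split; [nra|].
  intros e G Hee HG. set (t := rho * / (2 * (C + 1))) in *.
  assert (t2 : (C + 1) * t = rho / 2) by (unfold t; field; lra).
  assert (t0 : 0 <= t <= 1) by (unfold t; nra).
  destruct (H t rho e G t0 ltac:(lra) Hee HG) as [H1 H2].
  destruct (lau_fixpoint (Kmap e G) (1/2) rho) as [R [HR HK]].
  - lra.
  - eapply nrm_le; [exact H1|]. nra.
  - intros a b M Ha Hb Hab. assert (0 <= M) by apply (nrm_ge0 _ _ Hab).
    eapply nrm_le; [apply H2; eassumption|]. apply Rmult_le_compat_r; [assumption|]. nra.
  - exists R. split; [eapply nrm_le; eassumption|]. rewrite Kmap_eq, HK. ring.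
Qed.

(** * Closed forms of the explicit wave on the surface *)

Definition h0 (n : nat) (a : R) : R := -4 * INR n * (- a) ^ (n - 1).
(** [|1 + a zeta|^2] at [zeta = exp (- i al)]. *)
Definition cr_den (a al : R) : R := 1 + 2 * a * cos al + a * a.

Lemma cr_den_ge a al : 0 <= a <= 23/50 -> 29/100 <= cr_den a al <= 214/100.
Proof. intros H. unfold cr_den. generalize (COS_bound al). intros. nra. Qed.

Lemma ev_LA s al : ev LA s al = RtoC (amp s).
Proof. apply ev_cst, amp_bcont. Qed.
Lemma ev_z1 s al : ev z1 s al = (cos al, - sin al).
Proof. unfold z1. rewrite ev_mono. rewrite !Rmult_1_l. reflexivity. Qed.

Lemma ev_ip s al : ev ip s al =
  ((1 + amp s * cos al) / cr_den (amp s) al, amp s * sin al / cr_den (amp s) al).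
Proof.
  assert (E : Cmult (ev p s al) (ev ip s al) = RtoC 1) by (rewrite <- ev_mul, pip; apply ev_one).
  unfold p in E. rewrite ev_add, ev_mul, ev_one, ev_LA, ev_z1 in E.
  destruct (ev ip s al) as [x y]. unfold Cmult, Cplus, RtoC in E. simpl in E.
  injection E as E1 E2.
  assert (D : 0 < cr_den (amp s) al) by (generalize (cr_den_ge (amp s) al (amp_range s)); lra).
  assert (SC : sin al * sin al = 1 - cos al * cos al) by (generalize (sin2_cos2 al); unfold Rsqr; lra).
  set (a := amp s) in *. set (c := cos al) in *. set (u := sin al) in *.
  assert (DE : cr_den a al = (1 + a * c) * (1 + a * c) + a * u * (a * u)).
  { unfold cr_den. fold c. replace (a * u * (a * u)) with (a * a * (u * u)) by ring. rewrite SC. ring. }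
  assert (E1' : (1 + a * c) * x + a * u * y = 1) by (etransitivity; [|exact E1]; ring).
  assert (E2' : (1 + a * c) * y - a * u * x = 0) by (etransitivity; [|exact E2]; ring).
  f_equal; apply (Rmult_eq_reg_r (cr_den a al)); try lra; unfold Rdiv; rewrite Rmult_assoc, Rinv_l, Rmult_1_r by lra; rewrite DE.
  - replace (x * ((1 + a * c) * (1 + a * c) + a * u * (a * u))) with
      ((1 + a * c) * ((1 + a * c) * x + a * u * y) - a * u * ((1 + a * c) * y - a * u * x)) by ring.
    rewrite E1', E2'. ring.
  - replace (y * ((1 + a * c) * (1 + a * c) + a * u * (a * u))) with
      (a * u * ((1 + a * c) * x + a * u * y) + (1 + a * c) * ((1 + a * c) * y - a * u * x)) by ring.
    rewrite E1', E2'. ring.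
Qed.

Lemma cf_Yc k s : cf crY k s = if Z_le_dec 1 k then -4 * (- amp s) ^ Z.to_nat (k - 1) else 0.
Proof.
  unfold crY. replace (- (4 * z1 * ip))%L with (- (z1 * ip + z1 * ip + (z1 * ip + z1 * ip)))%L by ring.
  rewrite cf_opp, !cf_add, cf_z1. unfold ip. rewrite cf_geo by (apply fAm_bcont || apply fAm_abs).
  unfold geoc. destruct (Z_le_dec 0 (k - 1)), (Z_le_dec 1 k); try lia; ring.
Qed.

Lemma is_theta_YcHc : is_theta crY crH.
Proof.
  unfold crY, crH. replace (- (4 * z1 * ip))%L with ((0 - 4) * (z1 * ip))%L by ring.
  replace (- (4 * z1 * ip * ip))%L with (0 * (z1 * ip) + (0 - 4) * (z1 * ip + z1 * - (LA * z1 * ip * ip)))%L.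
  - apply is_theta_mul; [apply is_theta_is_const, is_const_sub; [intros k s _; apply cf_zero|solve_const]|]. apply is_theta_mul; [apply is_theta_z1|apply is_theta_ip].
  - replace (0 * (z1 * ip) + (0 - 4) * (z1 * ip + z1 * - (LA * z1 * ip * ip)))%L with
      (- (4 * z1 * ip * (1 - LA * z1 * ip)))%L by ring.
    replace (1 - LA * z1 * ip)%L with (1 - (p * ip) + ip)%L by (unfold p; ring). rewrite pip. ring.
Qed.

Lemma cf_Hc n s : cf crH (Z.of_nat n) s = h0 n (amp s).
Proof.
  rewrite (is_theta_YcHc (Z.of_nat n) s), cf_Yc. unfold h0. rewrite <- INR_IZR_INZ. destruct Z_le_dec.
  - replace (Z.to_nat (Z.of_nat n - 1)) with (n - 1)%nat by lia. ring.
  - replace n with O by lia. simpl. ring.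
Qed.

Definition Kc : lau := (- (4 * z1 * m * ip * ip * ip))%L.
Lemma is_theta_HcKc : is_theta crH Kc.
Proof.
  unfold crH, Kc. replace (- (4 * z1 * ip * ip))%L with ((0 - 4) * (z1 * ip * ip))%L by ring.
  set (X := (- (LA * z1 * ip * ip))%L).
  replace (- (4 * z1 * m * ip * ip * ip))%L with (0 * (z1 * ip * ip) + (0 - 4) * ((z1 * ip + z1 * X) * ip + (z1 * ip) * X))%L.
  - apply is_theta_mul; [apply is_theta_is_const, is_const_sub; [intros k s _; apply cf_zero|solve_const]|].
    apply is_theta_mul; [apply is_theta_mul; [apply is_theta_z1|apply is_theta_ip]|apply is_theta_ip].
  - unfold X. replace (0 * (z1 * ip * ip) + (0 - 4) * ((z1 * ip + z1 * - (LA * z1 * ip * ip)) * ip + z1 * ip * - (LA * z1 * ip * ip)))%L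
     with (- (4 * z1 * ip * ip * (1 - 2 * LA * z1 * ip)))%L by ring.
    replace (1 - 2 * LA * z1 * ip)%L with (1 - (p * ip) + m * ip)%L by (unfold p, m; ring). rewrite pip. ring.
Qed.
Lemma cf_Kc n s : cf Kc (Z.of_nat n) s = INR n * h0 n (amp s).
Proof. rewrite (is_theta_HcKc (Z.of_nat n) s), cf_Hc, <- INR_IZR_INZ. reflexivity. Qed.

Lemma supp1_Hc : supp 1 crH.
Proof. intros k s Hk. rewrite (is_theta_YcHc k s), supp1_Y0 by assumption. ring. Qed.
Lemma supp1_Kc : supp 1 Kc.
Proof. intros k s Hk. rewrite (is_theta_HcKc k s), supp1_Hc by assumption. ring. Qed.

Ltac eqR := match goal with |- @eq _ ?x ?y => change (@eq R x y) end.

Lemma ev_series_im a s al : supp 1 a ->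
  is_series (fun n => cf a (Z.of_nat n) s * sin (INR n * al)) (- snd (ev a s al)).
Proof.
  intros Ha. assert (H := has_sum_series _ _ (has_sum_scal (-1) _ _ (ev_has_im a s al))).
  replace (- snd (ev a s al)) with (-1 * snd (ev a s al)) by ring.
  eapply is_series_ext; [|exact H]. intros [|n]; unfold zfold; eqR.
  - rewrite (Ha (Z.of_nat 0)) by lia. rewrite (Ha 0%Z) by lia. simpl. ring.
  - rewrite (Ha (- _)%Z) by lia. rewrite <- INR_IZR_INZ. ring.
Qed.
Lemma ev_series_re a s al : supp 1 a ->
  is_series (fun n => cf a (Z.of_nat n) s * cos (INR n * al)) (fst (ev a s al)).
Proof.
  intros Ha. assert (H := has_sum_series _ _ (ev_has_re a s al)).
  eapply is_series_ext; [|exact H]. intros [|n]; unfold zfold; eqR.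
  - rewrite (Ha (Z.of_nat 0)) by lia. rewrite (Ha 0%Z) by lia. ring.
  - rewrite (Ha (- _)%Z) by lia. rewrite <- INR_IZR_INZ. ring.
Qed.

Lemma is_series_eq (u v : nat -> R) x y : (forall n, u n = v n) -> x = y -> is_series u x -> is_series v y.
Proof. intros E <-. apply is_series_ext, E. Qed.

Lemma crapper_y_sin a al : 0 <= a <= 23/50 ->
  is_series (fun n => h0 n a / INR n * sin (INR n * al)) (-4 * sin al / cr_den a al).
Proof.
  intros Ha. generalize (ev_series_im crY a al supp1_Y0).
  assert (D := cr_den_ge a al Ha). apply is_series_eq.
  - intros n. rewrite cf_Yc, amp_id by assumption. unfold h0. destruct Z_le_dec.
    + replace (Z.to_nat (Z.of_nat n - 1)) with (n - 1)%nat by lia. field. apply not_0_INR. lia.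
    + replace n with O by lia. simpl INR. rewrite (Rmult_0_l al), sin_0. ring.
  - unfold crY. rewrite ev_opp, !ev_mul, !ev_add, !ev_one, ev_z1, ev_ip, amp_id by assumption.
    simpl. field. lra.
Qed.

Lemma crapper_h_sin a al : 0 <= a <= 23/50 ->
  is_series (fun n => h0 n a * sin (INR n * al)) (-4 * (1 - a * a) * sin al / cr_den a al ^ 2).
Proof.
  intros Ha. generalize (ev_series_im crH a al supp1_Hc).
  assert (D := cr_den_ge a al Ha). apply is_series_eq.
  - intros n. rewrite cf_Hc, amp_id by assumption. reflexivity.
  - unfold crH. rewrite ev_opp, !ev_mul, !ev_add, !ev_one, ev_z1, ev_ip, amp_id by assumption.
    assert (SC : sin al * sin al = 1 - cos al * cos al) by (generalize (sin2_cos2 al); unfold Rsqr; lra).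
    simpl. set (c := cos al) in *. set (u := sin al) in *.
    assert (DD : cr_den a al = 1 + 2 * a * c + a * a) by reflexivity.
    apply (Rmult_eq_reg_r (cr_den a al * cr_den a al)); [|nra].
    field_simplify; [|lra|lra].
    replace (u ^ 3) with (u * (u * u)) by ring. rewrite SC. ring.
Qed.

Lemma crapper_h_cos a al : 0 <= a <= 23/50 ->
  is_series (fun n => h0 n a * cos (INR n * al)) (-4 * ((1 + a * a) * cos al + 2 * a) / cr_den a al ^ 2).
Proof.
  intros Ha. generalize (ev_series_re crH a al supp1_Hc).
  assert (D := cr_den_ge a al Ha). apply is_series_eq.
  - intros n. rewrite cf_Hc, amp_id by assumption. reflexivity.
  - unfold crH. rewrite ev_opp, !ev_mul, !ev_add, !ev_one, ev_z1, ev_ip, amp_id by assumption.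
    assert (SC : sin al * sin al = 1 - cos al * cos al) by (generalize (sin2_cos2 al); unfold Rsqr; lra).
    simpl. set (c := cos al) in *. set (u := sin al) in *.
    apply (Rmult_eq_reg_r (cr_den a al * cr_den a al)); [|nra].
    field_simplify; [|lra|lra].
    replace (u ^ 2) with (u * u) by ring. rewrite SC. ring.
Qed.

Lemma crapper_nh_sin a al : 0 <= a <= 23/50 ->
  is_series (fun n => INR n * h0 n a * sin (INR n * al))
   (-4 * sin al * ((1 + a * a) ^ 2 - 2 * a * (1 + a * a) * cos al - 8 * a * a) / cr_den a al ^ 3).
Proof.
  intros Ha. generalize (ev_series_im Kc a al supp1_Kc).
  assert (D := cr_den_ge a al Ha). apply is_series_eq.
  - intros n. rewrite cf_Kc, amp_id by assumption. reflexivity.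
  - unfold Kc, m. rewrite ev_opp, !ev_mul, ev_sub, !ev_mul, !ev_add, !ev_one, ev_z1, ev_ip, ev_LA, amp_id by assumption.
    assert (SC : sin al * sin al = 1 - cos al * cos al) by (generalize (sin2_cos2 al); unfold Rsqr; lra).
    simpl. set (c := cos al) in *. set (u := sin al) in *.
    apply (Rmult_eq_reg_r (cr_den a al * cr_den a al * cr_den a al)).
    2: { apply Rmult_integral_contrapositive; split; [|lra]. nra. }
    field_simplify; [|lra|lra].
    replace (u ^ 5) with (u * (u * u) * (u * u)) by ring.
    replace (u ^ 4) with ((u * u) * (u * u)) by ring.
    replace (u ^ 3) with (u * (u * u)) by ring. replace (u ^ 2) with (u * u) by ring. rewrite SC. ring.
Qed.

(** * From the Laurent equation to real series on the surface *)

Definition xJ (e : R) (R : lau) : lau := ((1 + LA * (xg R + tau e (xg R))) * (1 + LA * xHe e R))%L.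

Lemma dbl a : (a + a)%L = lzero -> a = lzero.
Proof.
  intros H. replace a with (half * (a + a))%L.
  - rewrite H. ring.
  - replace (half * (a + a))%L with ((half * 2) * a)%L by ring. rewrite half2. ring.
Qed.

(** Conjugation reverses the antisymmetric part of [Eq] and fixes the symmetric one, so the equation
    and its conjugate together separate the kinematic from the Bernoulli condition. *)
Lemma Eq_split e G R : Eq e G R = lzero ->
  nfun (xU e R) (xHe e R) = ltil (nfun (xU e R) (xHe e R)) /\ (xU e R + ltil (xU e R) + LA * xU e R * ltil (xU e R))%L = (- (2 * (cst (fun _ => G) * xeta e R)))%L.
Proof.
  intros HE. assert (HT : ltil (Eq e G R) = lzero) by (rewrite HE; apply til_zero).
  unfold Eq in *. set (n := nfun (xU e R) (xHe e R)) in *. set (U := xU e R) in *.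
  assert (TE : ltil (xeta e R) = xeta e R) by (unfold xeta; til; ring).
  set (et := xeta e R) in *.
  assert (TG : ltil (cst (fun _ => G)) = cst (fun _ => G)) by apply til_cst, bcont_const.
  rewrite til_add, !til_sub, !til_add, !til_mul, !til_add, !til_one, !til_til, tLA, TE, TG in HT.
  set (c := cst (fun _ => G)) in *.
  assert (A : (n - ltil n)%L = lzero).
  { apply dbl. transitivity (((n - ltil n) + (U + ltil U + LA * U * ltil U + 2 * (c * et))) -
     ((ltil n - n) + (ltil U + U + LA * ltil U * U + 2 * (c * et))))%L; [ring|]. rewrite HE, HT. ring. }
  split.
  - transitivity (ltil n + (n - ltil n))%L; [ring|]. rewrite A. ring.
  - rewrite A in HE. transitivity ((0 + (U + ltil U + LA * U * ltil U + 2 * (c * et))) - 2 * (c * et))%L; [ring|].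
    rewrite HE. ring.
Qed.

(** [V z'] is real by the kinematic condition, hence [(V z')^2 = |V|^2 |z'|^2]. Inserting
    [V z' = J - Om y z'], where [J] is the derivative of the complex potential, eliminates the
    velocity. *)
Lemma bernoulli_ev e G R s al : Eq e G R = lzero ->
  exists y cz sz jc js,
    ev (LA * xeta e R)%L s al = (y, 0) /\ ev (1 + LA * xHe e R)%L s al = (cz, sz) /\ ev (xJ e R) s al = (jc, js) /\ js = cf (xOm R) 0 s * y * sz /\ (jc - cf (xOm R) 0 s * y * cz) ^ 2 = (1 - 2 * G * y) * (cz ^ 2 + sz ^ 2).
Proof.
  intros HE. destruct (Eq_split e G R HE) as [E1 E2].
  assert (TE : ltil (LA * xeta e R)%L = (LA * xeta e R)%L) by (rewrite til_mul, tLA; unfold xeta; til; ring).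
  assert (Y : exists y, ev (LA * xeta e R)%L s al = (y, 0)).
  { exists (fst (ev (LA * xeta e R)%L s al)). assert (K := ev_til (LA * xeta e R)%L s al). rewrite TE in K.
    destruct (ev (LA * xeta e R)%L s al) as [a b]. unfold Cconj in K; simpl in *. injection K as K. f_equal. lra. }
  destruct Y as [y Ey].
  set (V := (1 + LA * xU e R)%L).
  assert (O : ev (xOm R) s al = RtoC (cf (xOm R) 0 s)).
  { assert (IO : is_const (xOm R)) by (unfold xOm; apply is_const_sub; [apply is_const_tO|solve_const]).
    apply ev_eq.
    - assert (H := has_sum_single (fun k => cf (xOm R) k s * cos (IZR k * al)) 0%Z). simpl in H.
      rewrite Rmult_0_l, cos_0, Rmult_1_r in H. apply H. intros k Hk. rewrite IO by assumption. ring.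
    - assert (H := has_sum_single (fun k => - (cf (xOm R) k s * sin (IZR k * al))) 0%Z). simpl in H.
      rewrite Rmult_0_l, sin_0, Rmult_0_r, Ropp_0 in H. apply H. intros k Hk. rewrite IO by assumption. ring. }
  assert (EV : V = ((1 + LA * (xg R + tau e (xg R))) - xOm R * (LA * xeta e R))%L) by (unfold V, xU; ring).
  assert (VZ : (V * (1 + LA * xHe e R))%L = (xJ e R - xOm R * (LA * xeta e R) * (1 + LA * xHe e R))%L).
  { rewrite EV. unfold xJ. ring. }
  assert (VZr : ltil (V * (1 + LA * xHe e R))%L = (V * (1 + LA * xHe e R))%L).
  { replace (V * (1 + LA * xHe e R))%L with (1 + LA * nfun (xU e R) (xHe e R))%L by (unfold V, nfun; ring).
    rewrite til_add, til_mul, til_one, tLA, <- E1. reflexivity. }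
  assert (VV : (V * ltil V)%L = (1 - 2 * (cst (fun _ => G) * (LA * xeta e R)))%L).
  { unfold V. rewrite til_add, til_mul, til_one, tLA.
    transitivity (1 + LA * (xU e R + ltil (xU e R) + LA * xU e R * ltil (xU e R)))%L; [ring|]. rewrite E2. ring. }
  apply (f_equal (fun x => ev x s al)) in VZ, VZr, VV.
  rewrite ev_til in VZr. rewrite ev_mul, ev_til, ev_sub, ev_one, ev_mul, ev_add, ev_one, ev_mul, Ey in VV.
  rewrite (ev_cst (fun _ => G)) in VV by apply bcont_const.
  rewrite ev_sub, !ev_mul, <- (ev_mul LA), O, Ey in VZ. rewrite ev_mul in VZr.
  destruct (ev V s al) as [v1 v2], (ev (1 + LA * xHe e R)%L s al) as [cz sz], (ev (xJ e R) s al) as [jc js].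
  exists y, cz, sz, jc, js. set (o := cf (xOm R) 0 s) in *.
  unfold Cmult, Cconj, Cminus, Cplus, Copp, RtoC in *. simpl in *.
  injection VZ as Z1 Z2. injection VZr as R2. injection VV as W1 W2.
  assert (Z3 : jc - o * y * cz = v1 * cz - v2 * sz) by lra.
  assert (Z4 : js - o * y * sz = v1 * sz + v2 * cz) by lra.
  assert (Z5 : v1 * sz + v2 * cz = 0) by lra.
  assert (W3 : v1 * v1 + v2 * v2 = 1 - 2 * G * y) by lra.
  split; [exact Ey|]. split; [reflexivity|]. split; [reflexivity|]. split; [lra|].
  transitivity ((v1 * v1 + v2 * v2) * (cz ^ 2 + sz ^ 2) - (v1 * sz + v2 * cz) ^ 2).
  - transitivity ((v1 * cz - v2 * sz) ^ 2); [rewrite <- Z3; ring|ring].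
  - rewrite Z5, W3. ring.
Qed.

(* The symmetry a_(-k) = e^k a_k expresses that the Laurent series is real on the bottom of the strip. *)
Definition tw (e : R) (a : lau) : Prop := forall k s, cf a (- k)%Z s = powerRZ e k * cf a k s.

Lemma tw_is_const e a : is_const a -> tw e a.
Proof.
  intros H k s. destruct (Z.eq_dec k 0) as [->|N]; [simpl; ring|]. rewrite !H by lia. ring.
Qed.
Lemma tw_add e a b : tw e a -> tw e b -> tw e (a + b)%L.
Proof. intros H1 H2 k s. rewrite !cf_add, H1, H2. ring. Qed.
Lemma tw_mul e a b : 0 < e -> tw e a -> tw e b -> tw e (a * b)%L.
Proof.
  intros He H1 H2 k s.
  apply (has_sum_unique _ _ _ (has_sum_opp _ _ (mul_has a b (- k) s))).
  eapply has_sum_ext; [|apply (has_sum_scal (powerRZ e k) _ _ (mul_has a b k s))].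
  intros j. simpl. replace (- k - - j)%Z with (- (k - j))%Z by lia. rewrite H1, H2.
  replace k with (j + (k - j))%Z at 1 by lia. rewrite powerRZ_add by lra. ring.
Qed.
Lemma cf_tau e a k s : 0 <= e <= 1 -> cf (tau e a) k s = dE e (- k) s * cf a (- k)%Z s.
Proof. intros He. unfold tau. rewrite cf_til, cf_diag by (apply dE_bcd, He). reflexivity. Qed.
Lemma powerRZ_nat e n : powerRZ e (Z.of_nat n) = e ^ n.
Proof. symmetry. apply pow_powerRZ. Qed.
Lemma tw_sym e a : 0 < e <= 1 -> supp 0 a -> tw e (a + tau e a)%L.
Proof.
  intros He Ha.
  assert (P : forall k s, (0 < k)%Z -> cf (a + tau e a)%L k s = cf a k s /\
     cf (a + tau e a)%L (- k)%Z s = powerRZ e k * cf a k s).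
  { intros k s Hk. rewrite !cf_add, !cf_tau, !Z.opp_involutive by lra. unfold dE.
    destruct (Z_le_dec 1 (- k)); [lia|]. destruct (Z_le_dec 1 k); [|lia].
    rewrite (Ha (- k)%Z) by lia. rewrite <- powerRZ_nat, Z2Nat.id by lia. split; ring. }
  intros k s. destruct (Z.lt_trichotomy k 0) as [L|[->|L]].
  - destruct (P (- k)%Z s ltac:(lia)) as [P1 P2]. rewrite Z.opp_involutive in P2. rewrite P1, P2.
    rewrite <- Rmult_assoc, <- powerRZ_add by lra. replace (k + - k)%Z with 0%Z by lia. simpl. ring.
  - simpl. ring.
  - destruct (P k s L) as [P1 P2]. rewrite P1, P2. ring.
Qed.

Lemma has_sum_at0 c : has_sum (fun k => if Z.eq_dec k 0 then c else 0) c.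
Proof.
  assert (H := has_sum_single (fun k => if Z.eq_dec k 0 then c else 0) 0%Z). simpl in H. apply H.
  intros i Hi. destruct Z.eq_dec; [exfalso; auto|reflexivity].
Qed.

(** The modes [n] and [- n] combine through [tw] into the factor [1 + e ^ n]. At [n = 0] this factor
    is 2, so the mean is counted once more on the right. *)
Lemma tw_series_re e a s al : tw e a ->
  is_series (fun n => cf a (Z.of_nat n) s * (1 + e ^ n) * cos (INR n * al)) (fst (ev a s al) + cf a 0 s).
Proof.
  intros Ha. assert (H := has_sum_series _ _ (has_sum_plus _ _ _ _ (ev_has_re a s al) (has_sum_at0 (cf a 0 s)))).
  eapply is_series_ext; [|exact H]. intros [|n]; unfold zfold; eqR.
  - simpl. rewrite Rmult_0_l, cos_0. ring.
  - destruct (Z.eq_dec (Z.of_nat (S n)) 0); [lia|]. destruct (Z.eq_dec (- Z.of_nat (S n)) 0); [lia|].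
    rewrite Ha, powerRZ_nat, opp_IZR, <- INR_IZR_INZ, Ropp_mult_distr_l_reverse, cos_neg. ring.
Qed.
Lemma tw_series_im e a s al : tw e a ->
  is_series (fun n => cf a (Z.of_nat n) s * (1 - e ^ n) * sin (INR n * al)) (- snd (ev a s al)).
Proof.
  intros Ha. assert (H := has_sum_series _ _ (has_sum_scal (-1) _ _ (ev_has_im a s al))).
  replace (- snd (ev a s al)) with (-1 * snd (ev a s al)) by ring.
  eapply is_series_ext; [|exact H]. intros [|n]; unfold zfold; eqR.
  - simpl. rewrite Rmult_0_l, sin_0. ring.
  - rewrite Ha, powerRZ_nat, opp_IZR, <- INR_IZR_INZ, Ropp_mult_distr_l_reverse, sin_neg. ring.
Qed.

Lemma nrm_coef_nat a M n s : nrm a M -> Rabs (cf a (Z.of_nat n) s) <= M * (2/3) ^ n.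
Proof.
  intros H. assert (K := nrm_coef a M (Z.of_nat n) s H). unfold wt in K.
  replace (Z.abs_nat (Z.of_nat n)) with n in K by lia.
  assert (E : (3/2) ^ n * (2/3) ^ n = 1) by (rewrite <- Rpow_mult_distr; replace (3/2 * (2/3)) with 1 by field; apply pow1).
  assert (0 < (2/3) ^ n) by (apply pow_lt; lra).
  apply (Rmult_le_compat_r ((2/3) ^ n)) in K; [|lra]. rewrite Rmult_assoc, E in K. lra.
Qed.

(** The perturbation argument enters the sequel only through this statement about real cosine and
    sine series with geometrically decaying coefficients. The bound [t] is uniform in the depth. At
    amplitude zero all higher [j] vanish, which makes the potential linear and the flow laminar. *)
Lemma wave_coefs eta : 0 < eta -> exists t, 0 < t /\ t <= 1 /\ forall e G, 0 < e <= t -> Rabs G <= t ->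
  exists (dl j : nat -> R -> R) (Om : R -> R) (C : R),
    (forall n s, continuous (dl n) s) /\ (forall n s, continuous (j n) s) /\ (forall s, continuous Om s) /\
    (forall n s, Rabs (dl n s) <= eta * (2/3) ^ n) /\ (forall n s, Rabs (j n s) <= C * (2/3) ^ n) /\
    (forall s, dl O s = 0) /\ (forall n, j (S n) 0 = 0) /\
    forall A, 0 <= A <= 23/50 -> forall al, exists y cz sz jc js,
      is_series (fun n => A * (h0 n A + dl n A) / INR n * (1 - e ^ n) * cos (INR n * al)) y /\
      is_series (fun n => A * (h0 n A + dl n A) * (1 + e ^ n) * cos (INR n * al)) (cz - 1) /\
      is_series (fun n => A * (h0 n A + dl n A) * (1 - e ^ n) * sin (INR n * al)) (- sz) /\
      is_series (fun n => j n A * (1 + e ^ n) * cos (INR n * al)) (jc + j O A) /\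
      is_series (fun n => j n A * (1 - e ^ n) * sin (INR n * al)) (- js) /\
      js = Om A * y * sz /\ (jc - Om A * y * cz) ^ 2 = (1 - 2 * G * y) * (cz ^ 2 + sz ^ 2).
Proof.
  intros Heta. destruct lip0_th as [th0 [C [C0 HC]]].
  destruct (Eq_solution (eta / (C + 1))) as [t [t0 [t1 Ht]]]; [apply Rdiv_lt_0_compat; lra|].
  exists t. split; [assumption|]. split; [assumption|]. intros e G He HG.
  destruct (Ht e G ltac:(lra) HG) as [X [HX HE]].
  assert (Nth : nrm (th X) eta).
  { replace (th X) with (th X - th lzero)%L by (rewrite th0; ring).
    eapply nrm_le; [apply HC; replace (X - lzero)%L with X by ring; exact HX|].
    assert (0 < eta / (C + 1)) by (apply Rdiv_lt_0_compat; lra).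
    replace eta with ((C + 1) * (eta / (C + 1))) at 2 by (field; lra). nra. }
  destruct (nrm_ex (xJ e X)) as [CJ [_ NJ]].
  exists (fun n s => cf (th X) (Z.of_nat n) s), (fun n s => cf (xJ e X) (Z.of_nat n) s), (fun s => cf (xOm X) 0 s), CJ.
  assert (T1 : forall s, cf (th X) (Z.of_nat 0) s = 0) by (intros; apply supp_th; lia).
  split; [intros; apply cf_valid|]. split; [intros; apply cf_valid|]. split; [intros; apply cf_valid|].
  split; [intros; apply nrm_coef_nat, Nth|]. split; [intros; apply nrm_coef_nat, NJ|]. split; [assumption|].
  split.
  { intros n. assert (F0 : amp 0 = 0) by (apply amp_id; lra).
    replace (xJ e X) with (1 + LA * ((xg X + tau e (xg X)) + xHe e X + LA * ((xg X + tau e (xg X)) * xHe e X)))%L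
      by (unfold xJ; ring).
    rewrite cf_add, cf_LA, F0. unfold lone. rewrite cf_mono. destruct Z.eq_dec; [lia|ring]. }
  intros A HA al. destruct (bernoulli_ev e G X A al HE) as [y [cz [sz [jc [js [E1 [E2 [E3 [E4 E5]]]]]]]]].
  assert (e1 : 0 < e <= 1) by lra.
  assert (Sh : supp 0 (xh X)).
  { unfold xh. apply supp_add; (apply (supp_le 1 0); [|lia]); [apply supp1_Hc|apply supp_th]. }
  assert (SY : supp 1 (xY X)) by (unfold xY; apply supp_add; [apply supp1_Y0|apply supp_tY]).
  assert (DY : is_theta (xY X) (xh X)) by (unfold xY, xh; apply is_theta_add; [apply is_theta_YcHc|apply is_theta_tYh]).
  assert (Sg : supp 0 (xg X)).
  { unfold xg. apply supp_add; [unfold cr_g; solve_supp|apply supp_tg]. }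
  assert (TH : tw e (1 + LA * xHe e X)%L).
  { apply tw_add; [apply tw_is_const; solve_const|]. apply tw_mul; [lra|apply tw_is_const; solve_const|apply tw_sym; assumption]. }
  assert (TJ : tw e (xJ e X)).
  { unfold xJ. apply tw_mul; [lra| |exact TH]. apply tw_add; [apply tw_is_const; solve_const|].
    apply tw_mul; [lra|apply tw_is_const; solve_const|apply tw_sym; assumption]. }
  assert (CH : forall n, cf (1 + LA * xHe e X)%L (Z.of_nat n) A = (if Nat.eq_dec n 0 then 1 else 0) + A * (h0 n A + cf (th X) (Z.of_nat n) A)).
  { intros n. rewrite cf_add, cf_LA, amp_id by assumption. unfold lone. rewrite cf_mono.
    unfold xHe. rewrite cf_add, cf_tau by lra. unfold dE. destruct (Z_le_dec 1 (- Z.of_nat n)); [lia|].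
    unfold xh. rewrite cf_add, cf_Hc, amp_id by assumption.
    destruct (Z.eq_dec (Z.of_nat n) 0), (Nat.eq_dec n 0); try lia; ring. }
  exists y, cz, sz, jc, js. split; [|split; [|split; [|split; [|split; [|split; assumption]]]]].
  - assert (TY : tw 1 (LA * xeta e X)%L).
    { intros k s. assert (T : ltil (LA * xeta e X)%L = (LA * xeta e X)%L) by (rewrite til_mul, tLA; unfold xeta; til; ring).
      rewrite <- T at 1. rewrite cf_til, Z.opp_involutive, powerRZ_R1. ring. }
    assert (K := tw_series_re 1 (LA * xeta e X)%L A al TY).
    replace y with (fst (ev (LA * xeta e X)%L A al) + cf (LA * xeta e X)%L 0 A).
    + assert (Z0' : cf (LA * xeta e X)%L 0 A = 0).
      { rewrite cf_LA. unfold xeta, half. rewrite cst_mul_l by apply bcont_const.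
        rewrite cf_add, cf_til. simpl Z.opp. rewrite !cf_sub, !cf_diag by (apply dE_bcd; lra). rewrite (SY 0%Z) by lia. ring. }
      generalize K; apply is_series_eq.
      * intros n. rewrite pow1.
        rewrite cf_LA, amp_id by assumption. unfold xeta, half. rewrite cst_mul_l by apply bcont_const.
        rewrite cf_add, cf_til, !cf_sub, !cf_diag by (apply dE_bcd; lra).
        rewrite (fun k H => SY k A H : cf (xY X) k A = 0) with (k := (- Z.of_nat n)%Z) by lia.
        destruct (Nat.eq_dec n 0) as [->|N].
        -- rewrite (SY (Z.of_nat 0)) by lia. rewrite T1. unfold h0. simpl INR. unfold Rdiv. ring.
        -- unfold dE. destruct (Z_le_dec 1 (Z.of_nat n)); [|lia]. rewrite Nat2Z.id.
           assert (D := DY (Z.of_nat n) A). unfold xh in D. rewrite cf_add, cf_Hc, amp_id in D by assumption.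
           rewrite D, <- INR_IZR_INZ. field. apply not_0_INR, N.
      * reflexivity.
    + rewrite E1. rewrite cf_LA. unfold xeta, half. rewrite cst_mul_l by apply bcont_const.
      rewrite cf_add, cf_til. simpl Z.opp. rewrite !cf_sub, !cf_diag by (apply dE_bcd; lra). rewrite (SY 0%Z) by lia. simpl. ring.
  - assert (K := tw_series_re e _ A al TH). rewrite E2 in K. simpl fst in K.
    (* [tw_series_re] gives the sum [cz + 1] with the term 2 at [n = 0]; adding -2 there leaves
       [cz - 1] and no mean. *)
    assert (K0 := has_sum_series _ _ (has_sum_at0 (-2))).
    generalize (is_series_plus _ _ _ _ K K0); apply is_series_eq.
    + intros n. rewrite CH. unfold plus; simpl. eqR. destruct n as [|n].
      * rewrite T1. unfold h0. simpl. rewrite Rmult_0_l, cos_0. ring.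
      * unfold zfold. destruct (Z.eq_dec (Z.of_nat (S n)) 0); [lia|]. destruct (Z.eq_dec (- Z.of_nat (S n)) 0); [lia|].
        destruct Nat.eq_dec; [lia|]. ring.
    + change 0%Z with (Z.of_nat 0). rewrite CH, T1. unfold plus, h0; simpl. ring.
  - assert (K := tw_series_im e _ A al TH). rewrite E2 in K. simpl snd in K.
    generalize K; apply is_series_eq; [|reflexivity]. intros n. rewrite CH. eqR. destruct Nat.eq_dec as [->|N]; [rewrite !pow_O; ring|ring].
  - assert (K := tw_series_re e _ A al TJ). rewrite E3 in K. exact K.
  - assert (K := tw_series_im e _ A al TJ). rewrite E3 in K. exact K.
Qed.

(** * Holomorphic functions in a strip *)

(** The polynomial weights make the class stable under [kc], that is, under differentiation of the
    series; [T] is the half-width of the strip. *)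
Definition okc (c : nat -> R) (T : R) : Prop :=
  forall j : nat, ex_series (fun k => Rabs (c k) * INR k ^ j * exp (INR k * T)).
Definition kc (c : nat -> R) (k : nat) : R := INR k * c k.
(** The phase [phi] covers cosines and sines at once: differentiation in [al] adds [PI / 2] to it
    and turns [c] into [kc c]. The sign [sg] selects growth or decay in [t]. *)
Definition wterm (c : nat -> R) (phi sg al t : R) (k : nat) : R :=
  c k * (cos (INR k * al + phi) * exp (sg * (INR k * t))).
Definition W (c : nat -> R) (phi sg al t : R) : R := Series (wterm c phi sg al t).
Definition cnorm (c : nat -> R) (T : R) : R := Series (fun k => Rabs (c k) * exp (INR k * T)).

Lemma okc_kc c T : okc c T -> okc (kc c) T.
Proof.
  intros H j. eapply ex_series_ext; [|apply (H (S j))]. intros k. unfold kc.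
  rewrite Rabs_mult, (Rabs_pos_eq (INR k)) by apply pos_INR. simpl. ring.
Qed.
Lemma okc0 c T : okc c T -> ex_series (fun k => Rabs (c k) * exp (INR k * T)).
Proof. intros H. eapply ex_series_ext; [|apply (H O)]. intros k. simpl. ring. Qed.

Lemma exp_le x y : x <= y -> exp x <= exp y.
Proof. intros [H| ->]; [apply Rlt_le, exp_increasing, H|lra]. Qed.

Lemma wterm_le c phi sg al t T k : Rabs sg <= 1 -> Rabs t <= T ->
  Rabs (wterm c phi sg al t k) <= Rabs (c k) * exp (INR k * T).
Proof.
  intros Hs Ht. unfold wterm. rewrite Rabs_mult. apply Rmult_le_compat_l; [apply Rabs_pos|].
  rewrite Rabs_mult. rewrite <- (Rmult_1_l (exp (INR k * T))).
  apply Rmult_le_compat; try apply Rabs_pos; [apply Rabs_le, COS_bound|].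
  rewrite Rabs_pos_eq by (apply Rlt_le, exp_pos). apply exp_le.
  assert (sg * t <= T).
  { eapply Rle_trans; [apply Rle_abs|]. rewrite Rabs_mult. generalize (Rabs_pos sg) (Rabs_pos t). nra. }
  generalize (pos_INR k). nra.
Qed.

Lemma ex_wterm c phi sg al t T : okc c T -> Rabs sg <= 1 -> Rabs t <= T -> ex_series (wterm c phi sg al t).
Proof.
  intros H Hs Ht. apply (ex_series_le (wterm c phi sg al t) (fun k => Rabs (c k) * exp (INR k * T))).
  - intros k. apply wterm_le; assumption.
  - apply okc0, H.
Qed.

Lemma W_le c phi sg al t T : okc c T -> Rabs sg <= 1 -> Rabs t <= T -> Rabs (W c phi sg al t) <= cnorm c T.
Proof.
  intros H Hs Ht. unfold W, cnorm.
  eapply Rle_trans; [apply Series_Rabs|].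
  - apply (ex_series_le (fun k => Rabs (wterm c phi sg al t k)) (fun k => Rabs (c k) * exp (INR k * T))); [|apply okc0, H].
    intros k. unfold norm; simpl; unfold abs; simpl. rewrite Rabs_Rabsolu. apply wterm_le; assumption.
  - apply Series_le; [|apply okc0, H]. intros k. split; [apply Rabs_pos|apply wterm_le; assumption].
Qed.

(** Each term has a Taylor remainder at most [M k * h^2], so the series has one at most
    [Series M * h^2]. *)
Lemma series_derive (f f' f'' : nat -> R -> R) (M : nat -> R) x (dl : R) : 0 < dl ->
  (forall k y, Rabs (y - x) < dl -> is_derive (f k) y (f' k y)) ->
  (forall k y, Rabs (y - x) < dl -> is_derive (f' k) y (f'' k y)) ->
  (forall k y, Rabs (y - x) < dl -> Rabs (f'' k y) <= M k) -> ex_series M ->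
  (forall y, Rabs (y - x) < dl -> ex_series (fun k => f k y)) -> ex_series (fun k => f' k x) ->
  is_derive (fun y => Series (fun k => f k y)) x (Series (fun k => f' k x)).
Proof.
  intros Hd H1 H2 H3 HM Hf Hf'.
  assert (E : forall k y, Rabs (y - x) < dl -> Rabs (f k y - f k x - f' k x * (y - x)) <= M k * (Rabs (y - x)) ^ 2).
  { intros k y Hy.
    assert (Hin : forall c, Rmin x y <= c <= Rmax x y -> Rabs (c - x) <= Rabs (y - x)).
    { intros c Hc. unfold Rmin, Rmax in Hc. unfold Rabs. destruct (Rle_dec x y); repeat destruct Rcase_abs; lra. }
    destruct (MVT_gen (f k) x y (f' k)) as [c [Hc Ec]].
    - intros z Hz. apply H1. eapply Rle_lt_trans; [apply Hin; lra|assumption].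
    - intros z Hz. apply continuity_pt_filterlim. apply (ex_derive_continuous (f k)). eexists. apply H1.
      eapply Rle_lt_trans; [apply Hin; lra|assumption].
    - rewrite Ec. replace (f' k c * (y - x) - f' k x * (y - x)) with ((f' k c - f' k x) * (y - x)) by ring.
      destruct (MVT_gen (f' k) x c (f'' k)) as [c' [Hc' Ec']].
      + intros z Hz. apply H2. eapply Rle_lt_trans; [apply Hin|exact Hy].
        unfold Rmin, Rmax in *. destruct (Rle_dec x y), (Rle_dec x c); lra.
      + intros z Hz. apply continuity_pt_filterlim. apply (ex_derive_continuous (f' k)). eexists. apply H2.
        eapply Rle_lt_trans; [apply Hin|exact Hy]. unfold Rmin, Rmax in *. destruct (Rle_dec x y), (Rle_dec x c); lra.
      + rewrite Ec', !Rabs_mult.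
        assert (A1 : Rabs (c - x) <= Rabs (y - x)) by (apply Hin; assumption).
        assert (A2 : Rabs (f'' k c') <= M k).
        { apply H3. eapply Rle_lt_trans; [apply Hin|exact Hy]. unfold Rmin, Rmax in *. destruct (Rle_dec x y), (Rle_dec x c); lra. }
        assert (P1 := Rabs_pos (c - x)). assert (P2 := Rabs_pos (y - x)). assert (P3 := Rabs_pos (f'' k c')).
        simpl. rewrite Rmult_1_r. replace (M k * (Rabs (y - x) * Rabs (y - x))) with (M k * Rabs (y - x) * Rabs (y - x)) by ring.
        apply Rmult_le_compat_r; [assumption|]. apply Rmult_le_compat; assumption. }
  apply is_derive_Reals. intros eps Heps.
  set (B := Series M).
  assert (M0 : forall k, 0 <= M k).
  { intros k. eapply Rle_trans; [apply Rabs_pos|apply (H3 k x)]. rewrite Rminus_diag_eq, Rabs_R0; auto. }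
  assert (B0 : 0 <= B).
  { unfold B. replace 0 with (Series (fun _ : nat => 0 * 0)) by (rewrite Series_scal_l; ring).
    apply Series_le; [|assumption]. intros k. rewrite Rmult_0_l. split; [lra|apply M0]. }
  assert (D : 0 < Rmin dl (eps / (B + 1))).
  { apply Rmin_glb_lt; [assumption|]. apply Rdiv_lt_0_compat; lra. }
  exists (mkposreal _ D). intros h Hh Hlt. simpl in Hlt.
  assert (Hh1 : Rabs (x + h - x) < dl).
  { replace (x + h - x) with h by ring. eapply Rlt_le_trans; [exact Hlt|apply Rmin_l]. }
  assert (Hh2 : Rabs h < eps / (B + 1)) by (eapply Rlt_le_trans; [exact Hlt|apply Rmin_r]).
  assert (Hx : Rabs (x - x) < dl) by (rewrite Rminus_diag_eq, Rabs_R0; auto).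
  replace ((Series (fun k => f k (x + h)) - Series (fun k => f k x)) / h - Series (fun k => f' k x))
    with (Series (fun k => (f k (x + h) - f k x - f' k x * h)) / h).
  - unfold Rdiv. rewrite Rabs_mult, Rabs_inv.
    apply Rmult_lt_reg_r with (Rabs h); [apply Rabs_pos_lt; assumption|].
    rewrite Rmult_assoc, Rinv_l, Rmult_1_r by (apply Rabs_no_R0; assumption).
    assert (T : forall k, Rabs (f k (x + h) - f k x - f' k x * h) <= M k * (Rabs h) ^ 2).
    { intros k. replace h with (x + h - x) at 2 3 by ring. apply E, Hh1. }
    assert (ET : ex_series (fun k => M k * (Rabs h) ^ 2)).
    { eapply ex_series_ext; [|apply (ex_series_scal ((Rabs h) ^ 2) M HM)]. intros; unfold scal; simpl; unfold mult; simpl; ring. }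
    eapply Rle_lt_trans; [apply Series_Rabs|].
    + apply (ex_series_le (fun k => Rabs (f k (x + h) - f k x - f' k x * h)) (fun k => M k * (Rabs h) ^ 2)); [|assumption].
      intros k. unfold norm; simpl; unfold abs; simpl. rewrite Rabs_Rabsolu. apply T.
    + eapply Rle_lt_trans; [apply (Series_le _ (fun k => M k * (Rabs h) ^ 2)); [|assumption]|].
      * intros k. split; [apply Rabs_pos|apply T].
      * rewrite Series_scal_r. fold B. assert (0 < Rabs h) by (apply Rabs_pos_lt; assumption).
        apply (Rmult_lt_compat_r (B + 1)) in Hh2; [|lra]. unfold Rdiv in Hh2.
        rewrite Rmult_assoc, Rinv_l, Rmult_1_r in Hh2 by lra. simpl. nra.
  - assert (S1 := Hf _ Hh1). assert (S2 := Hf _ Hx).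
    assert (S3 : ex_series (fun k => f' k x * h)).
    { eapply ex_series_ext; [|apply (ex_series_scal h _ Hf')]. intros; unfold scal; simpl; unfold mult; simpl; ring. }
    rewrite (Series_minus (fun k => f k (x + h) - f k x) (fun k => f' k x * h)); [|apply (ex_series_minus _ _ S1 S2)|assumption].
    rewrite Series_minus by assumption. rewrite Series_scal_r. field. assumption.
Qed.

Lemma is_derive_eq (f : R -> R) x l l' : is_derive f x l -> l = l' -> is_derive f x l'.
Proof. intros H <-. exact H. Qed.

Lemma W_dal c phi sg al t T : okc c T -> Rabs sg <= 1 -> Rabs t <= T ->
  is_derive (fun a => W c phi sg a t) al (W (kc c) (phi + PI / 2) sg al t).
Proof.
  intros H Hs Ht. unfold W.
  assert (C1 : forall k a ph cc, is_derive (fun a => wterm cc ph sg a t k) a (wterm (kc cc) (ph + PI / 2) sg a t k)).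
  { intros k a ph cc. unfold wterm, kc. auto_derive; [exact I|].
    replace (INR k * a + (ph + PI / 2)) with (PI / 2 + (INR k * a + ph)) by ring. rewrite cos_plus, cos_PI2, sin_PI2. ring. }
  apply (series_derive (fun k a => wterm c phi sg a t k) (fun k a => wterm (kc c) (phi + PI/2) sg a t k)
    (fun k a => wterm (kc (kc c)) (phi + PI/2 + PI/2) sg a t k) (fun k => Rabs (kc (kc c) k) * exp (INR k * T)) al 1); [lra| | | | | |].
  - intros; apply C1.
  - intros; apply C1.
  - intros. apply wterm_le; assumption.
  - apply okc0, okc_kc, okc_kc, H.
  - intros. apply ex_wterm with T; assumption.
  - apply ex_wterm with T; [apply okc_kc, H|assumption|assumption].
Qed.

Lemma W_dt c phi sg al t T : okc c T -> Rabs sg <= 1 -> Rabs t < T ->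
  is_derive (fun u => W c phi sg al u) t (sg * W (kc c) phi sg al t).
Proof.
  intros H Hs Ht. unfold W. rewrite <- Series_scal_l.
  assert (C1 : forall k u cc, is_derive (fun u => wterm cc phi sg al u k) u (sg * wterm (kc cc) phi sg al u k)).
  { intros k u cc. unfold wterm, kc. auto_derive; [exact I|]. ring. }
  assert (Hu : forall y, Rabs (y - t) < T - Rabs t -> Rabs y <= T).
  { intros y Hy. replace y with (t + (y - t)) by ring. eapply Rle_trans; [apply Rabs_triang|]. lra. }
  apply (series_derive (fun k u => wterm c phi sg al u k) (fun k u => sg * wterm (kc c) phi sg al u k)
    (fun k u => sg * (sg * wterm (kc (kc c)) phi sg al u k)) (fun k => Rabs (kc (kc c) k) * exp (INR k * T)) t (T - Rabs t)); [lra| | | | | |].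
  - intros; apply C1.
  - intros k y _. apply is_derive_scal, C1.
  - intros k y Hy. rewrite !Rabs_mult.
    assert (K := wterm_le (kc (kc c)) phi sg al y T k Hs (Hu y Hy)).
    assert (P1 := Rabs_pos sg). assert (P2 := Rabs_pos (wterm (kc (kc c)) phi sg al y k)).
    assert (Rabs sg * Rabs (wterm (kc (kc c)) phi sg al y k) <= Rabs (wterm (kc (kc c)) phi sg al y k)) by nra. nra.
  - apply okc0, okc_kc, okc_kc, H.
  - intros. apply ex_wterm with T; auto.
  - apply (ex_series_scal (V := R_NormedModule) sg (wterm (kc c) phi sg al t)). apply ex_wterm with T; [apply okc_kc, H|assumption|lra].
Qed.

Lemma W_lip c phi sg T : okc c T -> Rabs sg <= 1 -> exists B, 0 <= B /\ forall al t al' t', Rabs t < T -> Rabs t' < T ->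
  Rabs (W c phi sg al t - W c phi sg al' t') <= B * (Rabs (al - al') + Rabs (t - t')).
Proof.
  intros H Hs. exists (Rmax 0 (cnorm (kc c) T)). split; [apply Rmax_l|]. intros al t al' t' Ht Ht'.
  assert (BB := Rmax_r 0 (cnorm (kc c) T)). set (B := Rmax 0 (cnorm (kc c) T)) in *.
  replace (W c phi sg al t - W c phi sg al' t') with
   ((W c phi sg al t - W c phi sg al' t) + (W c phi sg al' t - W c phi sg al' t')) by ring.
  eapply Rle_trans; [apply Rabs_triang|]. rewrite Rmult_plus_distr_l. apply Rplus_le_compat.
  - destruct (MVT_gen (fun a => W c phi sg a t) al' al (fun a => W (kc c) (phi + PI/2) sg a t)) as [x [_ E]].
    + intros; apply W_dal with T; auto; lra.
    + intros. apply continuity_pt_filterlim. apply (ex_derive_continuous (fun a => W c phi sg a t)).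
      eexists. apply W_dal with T; auto; lra.
    + rewrite E, Rabs_mult. apply Rmult_le_compat_r; [apply Rabs_pos|].
      eapply Rle_trans; [apply W_le with (T := T); auto; [apply okc_kc, H|lra]|assumption].
  - assert (Hin : forall x, Rmin t' t <= x <= Rmax t' t -> Rabs x < T).
    { intros x Hx. unfold Rmin, Rmax in Hx. unfold Rabs in *. destruct (Rle_dec t' t); repeat destruct Rcase_abs; lra. }
    destruct (MVT_gen (fun u => W c phi sg al' u) t' t (fun u => sg * W (kc c) phi sg al' u)) as [x [Hx E]].
    + intros; apply W_dt with T; auto. apply Hin; lra.
    + intros. apply continuity_pt_filterlim. apply (ex_derive_continuous (fun u => W c phi sg al' u)).
      eexists. apply W_dt with T; auto.
    + rewrite E, !Rabs_mult. apply Rmult_le_compat_r; [apply Rabs_pos|].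
      assert (K := W_le (kc c) phi sg al' x T (okc_kc _ _ H) Hs (Rlt_le _ _ (Hin x Hx))).
      assert (P1 := Rabs_pos sg). assert (P2 := Rabs_pos (W (kc c) phi sg al' x)). nra.
Qed.

Definition pd2 (u ux uy : R -> R -> R) (T : R) : Prop := exists K, 0 <= K /\
  forall a t a' t', Rabs t < T -> Rabs t' < T ->
  Rabs (u a' t' - u a t - ux a t * (a' - a) - uy a t * (t' - t)) <= K * (Rabs (a' - a) + Rabs (t' - t)) ^ 2.

Lemma pd2_W c phi sg T : okc c T -> Rabs sg <= 1 ->
  pd2 (W c phi sg) (W (kc c) (phi + PI/2) sg) (fun a t => sg * W (kc c) phi sg a t) T.
Proof.
  intros H Hs. assert (Hk := okc_kc _ _ H).
  destruct (W_lip (kc c) (phi + PI/2) sg T Hk Hs) as [B [B0 HB]].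
  destruct (W_lip (kc c) phi sg T Hk Hs) as [D [D0 HD]].
  exists (B + D). split; [lra|]. intros a t a' t' Ht Ht'.
  destruct (MVT_gen (fun x => W c phi sg x t') a a' (fun x => W (kc c) (phi + PI/2) sg x t')) as [x [Hx E1]].
  { intros; apply W_dal with T; auto; lra. }
  { intros. apply continuity_pt_filterlim. apply (ex_derive_continuous (fun x => W c phi sg x t')).
    eexists. apply W_dal with T; auto; lra. }
  assert (Hin : forall y, Rmin t t' <= y <= Rmax t t' -> Rabs y < T /\ Rabs (y - t) <= Rabs (t' - t)).
  { intros y Hy. unfold Rmin, Rmax in Hy. unfold Rabs in *. destruct (Rle_dec t t'); repeat destruct Rcase_abs; lra. }
  destruct (MVT_gen (fun y => W c phi sg a y) t t' (fun y => sg * W (kc c) phi sg a y)) as [y [Hy E2]].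
  { intros; apply W_dt with T; auto. apply Hin; lra. }
  { intros. apply continuity_pt_filterlim. apply (ex_derive_continuous (fun x => W c phi sg a x)).
    eexists. apply W_dt with T; auto. apply Hin; lra. }
  destruct (Hin y Hy) as [Hy1 Hy2].
  assert (Hx' : Rabs (x - a) <= Rabs (a' - a)).
  { unfold Rmin, Rmax in Hx. unfold Rabs. destruct (Rle_dec a a'); repeat destruct Rcase_abs; lra. }
  replace (W c phi sg a' t' - W c phi sg a t - W (kc c) (phi + PI / 2) sg a t * (a' - a) - sg * W (kc c) phi sg a t * (t' - t))
    with ((W (kc c) (phi + PI/2) sg x t' - W (kc c) (phi + PI/2) sg a t) * (a' - a)
      + sg * (W (kc c) phi sg a y - W (kc c) phi sg a t) * (t' - t)).
  2: { transitivity ((W c phi sg a' t' - W c phi sg a t') + (W c phi sg a t' - W c phi sg a t) - W (kc c) (phi + PI / 2) sg a t * (a' - a) - sg * W (kc c) phi sg a t * (t' - t)); [rewrite E1, E2|]; ring. }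
  assert (K1 := HB x t' a t Ht' Ht). assert (K2 := HD a y a t Hy1 Ht).
  rewrite (Rminus_diag_eq a a eq_refl), Rabs_R0, Rplus_0_l in K2.
  eapply Rle_trans; [apply Rabs_triang|]. rewrite !Rabs_mult.
  assert (P1 := Rabs_pos (a' - a)). assert (P2 := Rabs_pos (t' - t)). assert (P3 := Rabs_pos sg).
  set (u := Rabs (a' - a)) in *. set (v := Rabs (t' - t)) in *.
  assert (Q1 : Rabs (W (kc c) (phi + PI / 2) sg x t' - W (kc c) (phi + PI / 2) sg a t) <= B * (u + v)).
  { eapply Rle_trans; [exact K1|]. apply Rmult_le_compat_l; [assumption|lra]. }
  assert (Q2 : Rabs (W (kc c) phi sg a y - W (kc c) phi sg a t) <= D * v).
  { eapply Rle_trans; [exact K2|]. apply Rmult_le_compat_l; assumption. }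
  assert (P4 := Rabs_pos (W (kc c) phi sg a y - W (kc c) phi sg a t)).
  apply Rle_trans with (B * (u + v) * (u + v) + D * (u + v) * (u + v)); [|apply Req_le; ring].
  apply Rplus_le_compat.
  - apply Rmult_le_compat; try assumption; [apply Rabs_pos|lra].
  - apply Rmult_le_compat; try lra; [apply Rmult_le_pos; assumption|].
    apply Rle_trans with (1 * (D * v)); [apply Rmult_le_compat; lra|]. nra.
Qed.

Lemma pd2_lin u ux uy v vx vy T x y : pd2 u ux uy T -> pd2 v vx vy T ->
  pd2 (fun a t => x * u a t + y * v a t) (fun a t => x * ux a t + y * vx a t) (fun a t => x * uy a t + y * vy a t) T.
Proof.
  intros [K [K0 HK]] [L [L0 HL]]. exists (Rabs x * K + Rabs y * L).
  assert (Px := Rabs_pos x). assert (Py := Rabs_pos y). split; [nra|].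
  intros a t a' t' Ht Ht'. specialize (HK a t a' t' Ht Ht'). specialize (HL a t a' t' Ht Ht').
  replace (x * u a' t' + y * v a' t' - (x * u a t + y * v a t) - (x * ux a t + y * vx a t) * (a' - a) - (x * uy a t + y * vy a t) * (t' - t))
   with (x * (u a' t' - u a t - ux a t * (a' - a) - uy a t * (t' - t)) + y * (v a' t' - v a t - vx a t * (a' - a) - vy a t * (t' - t))) by ring.
  eapply Rle_trans; [apply Rabs_triang|]. rewrite !Rabs_mult.
  replace ((Rabs x * K + Rabs y * L) * (Rabs (a' - a) + Rabs (t' - t)) ^ 2) with
   (Rabs x * (K * (Rabs (a' - a) + Rabs (t' - t)) ^ 2) + Rabs y * (L * (Rabs (a' - a) + Rabs (t' - t)) ^ 2)) by ring.
  apply Rplus_le_compat; apply Rmult_le_compat_l; assumption.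
Qed.

Lemma pd2_ext u ux uy ux' uy' T : pd2 u ux uy T -> (forall a t, ux a t = ux' a t) -> (forall a t, uy a t = uy' a t) ->
  pd2 u ux' uy' T.
Proof. intros [K [K0 H]] E1 E2. exists K. split; [assumption|]. intros. rewrite <- E1, <- E2. apply H; assumption. Qed.

(** Complex differentiability with a remainder that is quadratic uniformly in the strip. In this
    quantitative form it passes to products, reciprocals, compositions and inverse maps without any
    integral theorem. *)
Definition hol (f f' : C -> C) (T : R) : Prop := exists K, 0 <= K /\
  forall b b', Rabs (Im b) < T -> Rabs (Im b') < T ->
  Cmod (f b' - f b - f' b * (b' - b))%C <= K * (Cmod (b' - b)%C) ^ 2.

Lemma Cmod_le_sum (z : C) : Cmod z <= Rabs (Re z) + Rabs (Im z).
Proof.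
  unfold Cmod, Re, Im. assert (P1 := Rabs_pos (fst z)). assert (P2 := Rabs_pos (snd z)).
  apply Rsqr_incr_0; [|apply sqrt_pos|lra]. unfold Rsqr. rewrite sqrt_sqrt by (simpl; nra).
  assert (E1 : fst z ^ 2 = Rabs (fst z) * Rabs (fst z)) by (rewrite <- Rabs_mult; rewrite Rabs_pos_eq; [ring|nra]).
  assert (E2 : snd z ^ 2 = Rabs (snd z) * Rabs (snd z)) by (rewrite <- Rabs_mult; rewrite Rabs_pos_eq; [ring|nra]).
  rewrite E1, E2. nra.
Qed.
Lemma Re_le_Cmod (z : C) : Rabs (Re z) <= Cmod z.
Proof. eapply Rle_trans; [apply Rmax_l|apply (Rmax_Cmod z)]. Qed.
Lemma Im_le_Cmod (z : C) : Rabs (Im z) <= Cmod z.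
Proof. eapply Rle_trans; [apply Rmax_r|apply (Rmax_Cmod z)]. Qed.

(** The prescribed partial derivatives encode the Cauchy-Riemann equations; the 4 comes from
    [(|u| + |v|)^2 <= 4 |w|^2] for [w = u + i v]. *)
Lemma hol_of_pd2 (f f' : C -> C) T :
  pd2 (fun a t => Re (f (a, t))) (fun a t => Re (f' (a, t))) (fun a t => - Im (f' (a, t))) T ->
  pd2 (fun a t => Im (f (a, t))) (fun a t => Im (f' (a, t))) (fun a t => Re (f' (a, t))) T ->
  hol f f' T.
Proof.
  intros [K [K0 HK]] [L [L0 HL]]. exists (4 * (K + L)). split; [lra|].
  intros [a t] [a' t'] Ht Ht'. simpl in Ht, Ht'. specialize (HK a t a' t' Ht Ht'). specialize (HL a t a' t' Ht Ht').
  eapply Rle_trans; [apply Cmod_le_sum|].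
  replace (Re (f (a', t') - f (a, t) - f' (a, t) * ((a', t') - (a, t)))%C) with
    (Re (f (a', t')) - Re (f (a, t)) - Re (f' (a, t)) * (a' - a) - - Im (f' (a, t)) * (t' - t))
    by (unfold Re, Im; simpl; ring).
  replace (Im (f (a', t') - f (a, t) - f' (a, t) * ((a', t') - (a, t)))%C) with
    (Im (f (a', t')) - Im (f (a, t)) - Im (f' (a, t)) * (a' - a) - Re (f' (a, t)) * (t' - t))
    by (unfold Re, Im; simpl; ring).
  assert (U : Rabs (a' - a) <= Cmod ((a', t') - (a, t))%C) by apply (Re_le_Cmod ((a', t') - (a, t))%C).
  assert (V : Rabs (t' - t) <= Cmod ((a', t') - (a, t))%C) by apply (Im_le_Cmod ((a', t') - (a, t))%C).
  set (m := Cmod ((a', t') - (a, t))%C) in *.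
  assert (P1 := Rabs_pos (a' - a)). assert (P2 := Rabs_pos (t' - t)).
  assert (S : (Rabs (a' - a) + Rabs (t' - t)) ^ 2 <= 4 * m ^ 2) by nra.
  assert (K * (Rabs (a' - a) + Rabs (t' - t)) ^ 2 <= K * (4 * m ^ 2)) by (apply Rmult_le_compat_l; assumption).
  assert (L * (Rabs (a' - a) + Rabs (t' - t)) ^ 2 <= L * (4 * m ^ 2)) by (apply Rmult_le_compat_l; assumption).
  lra.
Qed.

(* Sine and cosine series of a complex argument. *)
Definition csn (c : nat -> R) (b : C) : C :=
  (/2 * W c (- (PI/2)) 1 (Re b) (Im b) + /2 * W c (- (PI/2)) (-1) (Re b) (Im b),
   /2 * W c 0 1 (Re b) (Im b) + - / 2 * W c 0 (-1) (Re b) (Im b)).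
Definition ccs (c : nat -> R) (b : C) : C :=
  (/2 * W c 0 1 (Re b) (Im b) + /2 * W c 0 (-1) (Re b) (Im b),
   - / 2 * W c (- (PI/2)) 1 (Re b) (Im b) + /2 * W c (- (PI/2)) (-1) (Re b) (Im b)).

Lemma W_pi c phi phi' sg a t : phi' = phi + PI -> W c phi' sg a t = - W c phi sg a t.
Proof.
  intros ->. unfold W. rewrite <- Series_opp. apply Series_ext. intros k. unfold wterm.
  rewrite <- Rplus_assoc, neg_cos. ring.
Qed.
Lemma W_phi c phi phi' sg a t : phi = phi' -> W c phi sg a t = W c phi' sg a t.
Proof. intros ->. reflexivity. Qed.

Lemma R1_abs : Rabs 1 <= 1. Proof. rewrite Rabs_R1; lra. Qed.
Lemma Rm1_abs : Rabs (-1) <= 1. Proof. unfold Rabs; destruct Rcase_abs; lra. Qed.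

Lemma hol_csn c T : okc c T -> hol (csn c) (ccs (kc c)) T.
Proof.
  intros H. apply hol_of_pd2.
  - eapply pd2_ext; [apply (pd2_lin _ _ _ _ _ _ T (/2) (/2) (pd2_W c (- (PI/2)) 1 T H R1_abs) (pd2_W c (- (PI/2)) (-1) T H Rm1_abs))| |].
    + intros a t. simpl. rewrite !(W_phi (kc c) (- (PI/2) + PI/2) 0) by ring. reflexivity.
    + intros a t. simpl. ring.
  - eapply pd2_ext; [apply (pd2_lin _ _ _ _ _ _ T (/2) (- / 2) (pd2_W c 0 1 T H R1_abs) (pd2_W c 0 (-1) T H Rm1_abs))| |].
    + intros a t. simpl. rewrite !(W_pi (kc c) (- (PI/2)) (0 + PI/2)) by field. ring.
    + intros a t. simpl. ring.
Qed.

Lemma hol_ccs c T : okc c T -> hol (ccs c) (fun b => - csn (kc c) b)%C T.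
Proof.
  intros H. apply hol_of_pd2.
  - eapply pd2_ext; [apply (pd2_lin _ _ _ _ _ _ T (/2) (/2) (pd2_W c 0 1 T H R1_abs) (pd2_W c 0 (-1) T H Rm1_abs))| |].
    + intros a t. simpl. rewrite !(W_pi (kc c) (- (PI/2)) (0 + PI/2)) by field. ring.
    + intros a t. simpl. ring.
  - eapply pd2_ext; [apply (pd2_lin _ _ _ _ _ _ T (- /2) (/ 2) (pd2_W c (- (PI/2)) 1 T H R1_abs) (pd2_W c (- (PI/2)) (-1) T H Rm1_abs))| |].
    + intros a t. simpl. rewrite !(W_phi (kc c) (- (PI/2) + PI/2) 0) by ring. ring.
    + intros a t. simpl. ring.
Qed.

Lemma hol_affine k c T : hol (fun b => k * b + c)%C (fun _ => k) T.
Proof.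
  exists 0. split; [lra|]. intros b b' _ _. replace (k * b' + c - (k * b + c) - k * (b' - b))%C with (RtoC 0) by ring.
  rewrite Cmod_0. lra.
Qed.
Lemma hol_plus f f' g g' T : hol f f' T -> hol g g' T -> hol (fun b => f b + g b)%C (fun b => f' b + g' b)%C T.
Proof.
  intros [K [K0 HK]] [L [L0 HL]]. exists (K + L). split; [lra|]. intros b b' H H'.
  replace (f b' + g b' - (f b + g b) - (f' b + g' b) * (b' - b))%C with
    ((f b' - f b - f' b * (b' - b)) + (g b' - g b - g' b * (b' - b)))%C by ring.
  eapply Rle_trans; [apply Cmod_triangle|]. rewrite Rmult_plus_distr_r. apply Rplus_le_compat; auto.
Qed.

Lemma locally_C_ex (b : C) (P : C -> Prop) (dl : R) : 0 < dl ->
  (forall b', Cmod (b' - b)%C < dl -> P b') -> locally b P.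
Proof.
  intros Hd H. apply locally_C. exists (mkposreal dl Hd). intros y Hy. apply H. exact Hy.
Qed.
Lemma locally_C_inv (b : C) (P : C -> Prop) : locally b P ->
  exists dl, 0 < dl /\ forall b', Cmod (b' - b)%C < dl -> P b'.
Proof.
  intros H. apply locally_C in H. destruct H as [dl H]. exists dl. split; [apply cond_pos|].
  intros b' Hb. apply H. exact Hb.
Qed.

Lemma quad_is_derive (f : C -> C) b l K dl : 0 < dl -> 0 <= K ->
  (forall b', Cmod (b' - b)%C < dl -> Cmod (f b' - f b - l * (b' - b))%C <= K * (Cmod (b' - b)%C) ^ 2) ->
  is_derive f b l.
Proof.
  intros Hd HK H. split; [apply is_linear_scal_l|].
  intros x Hx. assert (E : x = b).
  { symmetry. apply is_filter_lim_locally_unique. exact Hx. }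
  subst x. intros eps.
  assert (D : 0 < Rmin dl (eps / (K + 1))).
  { apply Rmin_glb_lt; [assumption|]. apply Rdiv_lt_0_compat; [apply cond_pos|lra]. }
  exists (mkposreal _ D). intros y Hy.
  assert (Hy' : Cmod (y - b)%C < Rmin dl (eps / (K + 1))) by exact Hy.
  change (Cmod (f y - f b - (y - b) * l)%C <= eps * Cmod (y - b)%C).
  replace (f y - f b - (y - b) * l)%C with (f y - f b - l * (y - b))%C by ring.
  eapply Rle_trans; [apply H; eapply Rlt_le_trans; [exact Hy'|apply Rmin_l]|].
  assert (H2 : Cmod (y - b)%C < eps / (K + 1)) by (eapply Rlt_le_trans; [exact Hy'|apply Rmin_r]).
  assert (P := Cmod_ge_0 (y - b)%C). set (m := Cmod (y - b)%C) in *.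
  apply (Rmult_lt_compat_r (K + 1)) in H2; [|lra]. unfold Rdiv in H2.
  rewrite Rmult_assoc, Rinv_l, Rmult_1_r in H2 by lra. simpl. nra.
Qed.

Lemma strip_nbhd b T : Rabs (Im b) < T -> forall b', Cmod (b' - b)%C < T - Rabs (Im b) -> Rabs (Im b') < T.
Proof.
  intros H b' Hb'. assert (K := Im_le_Cmod (b' - b)%C).
  replace (Im b') with (Im b + Im (b' - b)%C) by (unfold Im; simpl; ring).
  eapply Rle_lt_trans; [apply Rabs_triang|]. lra.
Qed.

Lemma quad_real (g : R -> R) x l K dl : 0 < dl -> 0 <= K ->
  (forall y, Rabs (y - x) < dl -> Rabs (g y - g x - l * (y - x)) <= K * (y - x) ^ 2) -> is_derive g x l.
Proof.
  intros Hd HK H. apply is_derive_Reals. intros eps Heps.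
  assert (D : 0 < Rmin dl (eps / (K + 1))).
  { apply Rmin_glb_lt; [assumption|]. apply Rdiv_lt_0_compat; lra. }
  exists (mkposreal _ D). intros h Hh Hlt. simpl in Hlt.
  assert (H1 : Rabs h < dl) by (eapply Rlt_le_trans; [exact Hlt|apply Rmin_l]).
  assert (H2 : Rabs h < eps / (K + 1)) by (eapply Rlt_le_trans; [exact Hlt|apply Rmin_r]).
  specialize (H (x + h)). replace (x + h - x) with h in H by ring. specialize (H H1).
  replace ((g (x + h) - g x) / h - l) with ((g (x + h) - g x - l * h) / h) by (field; assumption).
  unfold Rdiv. rewrite Rabs_mult, Rabs_inv.
  assert (Ph : 0 < Rabs h) by (apply Rabs_pos_lt; assumption).
  apply Rmult_lt_reg_r with (Rabs h); [assumption|]. rewrite Rmult_assoc, Rinv_l, Rmult_1_r by lra.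
  apply (Rmult_lt_compat_r (K + 1)) in H2; [|lra]. unfold Rdiv in H2.
  rewrite Rmult_assoc, Rinv_l, Rmult_1_r in H2 by lra.
  replace (h ^ 2) with (Rabs h * Rabs h) in H by (rewrite <- Rabs_mult, Rabs_pos_eq; [ring|nra]). nra.
Qed.

Lemma Cmod_R_mult (x : R) (w : C) : Cmod (RtoC x * w)%C = Rabs x * Cmod w.
Proof. rewrite Cmod_mult, Cmod_R. reflexivity. Qed.

(** The factor [k] selects the real direction that is read off, so that the real mean value theorem
    can be applied to a holomorphic map along a segment. *)
Lemma hol_line f f' T b w k x : hol f f' T -> Rabs (Im (b + RtoC x * w)%C) < T ->
  is_derive (fun s => Re (k * f (b + RtoC s * w))%C) x (Re (k * (f' (b + RtoC x * w) * w))%C).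
Proof.
  intros [K [K0 H]] Hb. set (b0 := (b + RtoC x * w)%C) in *.
  apply (quad_real _ x _ (Cmod k * K * (Cmod w) ^ 2) ((T - Rabs (Im b0)) / (Cmod w + 1))).
  - apply Rdiv_lt_0_compat; [lra|]. generalize (Cmod_ge_0 w); lra.
  - assert (P1 := Cmod_ge_0 k). assert (P2 := Cmod_ge_0 w). apply Rmult_le_pos; [apply Rmult_le_pos; assumption|simpl; nra].
  - intros y Hy. set (b1 := (b + RtoC y * w)%C).
    assert (E : (b1 - b0)%C = (RtoC (y - x) * w)%C) by (unfold b1, b0; rewrite RtoC_minus; ring).
    assert (N : Rabs (Im b1) < T).
    { apply (strip_nbhd b0 T Hb). rewrite E, Cmod_R_mult.
      assert (P2 := Cmod_ge_0 w). assert (P3 := Rabs_pos (y - x)).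
      apply (Rmult_lt_compat_r (Cmod w + 1)) in Hy; [|lra]. unfold Rdiv in Hy.
      rewrite Rmult_assoc, Rinv_l, Rmult_1_r in Hy by lra. nra. }
    specialize (H b0 b1 Hb N). rewrite E in H.
    change (b + RtoC x * w)%C with b0.
    replace (Re (k * f b1)%C - Re (k * f b0)%C - Re (k * (f' b0 * w))%C * (y - x)) with
      (Re (k * (f b1 - f b0 - f' b0 * (RtoC (y - x) * w)))%C) by (unfold Re; simpl; ring).
    eapply Rle_trans; [apply Re_le_Cmod|]. rewrite Cmod_mult.
    replace (Cmod k * K * Cmod w ^ 2 * (y - x) ^ 2) with (Cmod k * (K * (Rabs (y - x) * Cmod w) ^ 2)).
    + rewrite <- Cmod_R_mult. apply Rmult_le_compat_l; [apply Cmod_ge_0|exact H].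
    + replace ((y - x) ^ 2) with (Rabs (y - x) * Rabs (y - x)) by (rewrite <- Rabs_mult, Rabs_pos_eq; [ring|apply Rle_0_sqr]). ring.
Qed.

(** * Shape of the profiles *)

Lemma ex_series_scalR (c : R) (u : nat -> R) : ex_series u -> ex_series (fun k => c * u k).
Proof. intros H. apply (ex_series_scal (V := R_NormedModule) c u H). Qed.
Lemma ex_series_leR (u v : nat -> R) : (forall k, Rabs (u k) <= v k) -> ex_series v -> ex_series u.
Proof. intros H. apply (ex_series_le (V := R_CompleteNormedModule) u v). exact H. Qed.
Lemma Series_abs_le (u v : nat -> R) : (forall k, Rabs (u k) <= v k) -> ex_series v -> Rabs (Series u) <= Series v.
Proof.
  intros H Hv. eapply Rle_trans; [apply Series_Rabs, (ex_series_leR _ v); [|assumption]|].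
  - intros k. rewrite Rabs_Rabsolu. apply H.
  - apply Series_le; [|assumption]. intros k. split; [apply Rabs_pos|apply H].
Qed.

Lemma nat_pow_le k dl : 0 < dl -> INR k <= (1 + dl) ^ k / dl.
Proof.
  intros H. apply Rle_div_r; [assumption|]. generalize (poly k dl H). lra.
Qed.

Lemma ex_series_pow_geo j : forall q, 0 < q < 1 -> ex_series (fun k => INR k ^ j * q ^ k).
Proof.
  induction j as [|j IH]; intros q Hq.
  - apply (ex_series_ext (fun k => q ^ k)); [intros; simpl; ring|].
    apply ex_series_geom. rewrite Rabs_pos_eq; lra.
  - set (dl := (1 - q) / (2 * q)). assert (D : 0 < dl) by (apply Rdiv_lt_0_compat; lra).
    assert (E : (1 + dl) * q = (1 + q) / 2) by (unfold dl; field; lra).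
    apply (ex_series_leR _ (fun k => / dl * (INR k ^ j * ((1 + dl) * q) ^ k))).
    + intros k. assert (P := nat_pow_le k dl D). assert (P2 := pos_INR k).
      assert (P3 : 0 <= INR k ^ j) by (apply pow_le, pos_INR). assert (P4 : 0 <= q ^ k) by (apply pow_le; lra).
      rewrite Rabs_pos_eq by (apply Rmult_le_pos; [simpl; apply Rmult_le_pos|]; assumption).
      rewrite Rpow_mult_distr. simpl.
      replace (/ dl * (INR k ^ j * ((1 + dl) ^ k * q ^ k))) with ((1 + dl) ^ k / dl * (INR k ^ j * q ^ k)) by (unfold Rdiv; ring).
      rewrite Rmult_assoc. apply Rmult_le_compat_r; [apply Rmult_le_pos; assumption|assumption].
    + apply ex_series_scalR. apply IH. rewrite E. lra.
Qed.

Definition S3 : R := Series (fun k => INR k ^ 3 * (2/3) ^ k).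
Lemma ex_S3 : ex_series (fun k => INR k ^ 3 * (2/3) ^ k).
Proof. apply ex_series_pow_geo. lra. Qed.
Lemma S3_pos : 0 <= S3.
Proof.
  unfold S3. replace 0 with (Series (fun _ : nat => 0 * 0)) by (rewrite Series_scal_l; ring).
  apply Series_le; [|apply ex_S3]. intros k. rewrite Rmult_0_l. split; [lra|].
  apply Rmult_le_pos; apply pow_le; [apply pos_INR|lra].
Qed.

(** Allows perturbations to be compared with [sin al]. The main terms vanish at the ends of the half
    period at just this rate, and an absolute bound would not preserve signs there. *)
Lemma sin_nat_le k al : Rabs (sin (INR k * al)) <= INR k * Rabs (sin al).
Proof.
  induction k as [|k IH].
  - simpl. rewrite !Rmult_0_l, sin_0, Rabs_R0. lra.
  - rewrite S_INR. replace ((INR k + 1) * al) with (INR k * al + al) by ring. rewrite sin_plus.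
    eapply Rle_trans; [apply Rabs_triang|]. rewrite !Rabs_mult.
    assert (Rabs (cos al) <= 1) by apply Rabs_le, COS_bound.
    assert (Rabs (cos (INR k * al)) <= 1) by apply Rabs_le, COS_bound.
    assert (P1 := Rabs_pos (sin (INR k * al))). assert (P2 := Rabs_pos (sin al)). nra.
Qed.

Definition small2 (c : nat -> R) (m : R) : Prop := forall k, Rabs (c k) <= m * (INR k ^ 2 * (2/3) ^ k).

Lemma pow_nat_mono k i j : (i <= j)%nat -> (1 <= i)%nat -> INR k ^ i <= INR k ^ j.
Proof.
  intros H1 H2. destruct k as [|k].
  - simpl. rewrite !pow_i by lia. lra.
  - apply Rle_pow; [|assumption]. rewrite S_INR. generalize (pos_INR k). lra.
Qed.

Lemma small2_pos c m : small2 c m -> 0 <= m.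
Proof. intros H. specialize (H 1%nat). simpl in H. generalize (Rabs_pos (c 1%nat)). lra. Qed.

Lemma small_sin c m al : small2 c m ->
  ex_series (fun k => c k * sin (INR k * al)) /\ Rabs (Series (fun k => c k * sin (INR k * al))) <= m * S3 * Rabs (sin al).
Proof.
  intros H. assert (Hm := small2_pos _ _ H).
  assert (E : forall k, Rabs (c k * sin (INR k * al)) <= m * Rabs (sin al) * (INR k ^ 3 * (2/3) ^ k)).
  { intros k. rewrite Rabs_mult.
    replace (m * Rabs (sin al) * (INR k ^ 3 * (2/3) ^ k)) with (m * (INR k ^ 2 * (2/3) ^ k) * (INR k * Rabs (sin al))) by ring.
    apply Rmult_le_compat; try apply Rabs_pos; [apply H|apply sin_nat_le]. }
  assert (X : ex_series (fun k => m * Rabs (sin al) * (INR k ^ 3 * (2/3) ^ k))) by apply ex_series_scalR, ex_S3.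
  split; [apply (ex_series_leR _ _ E X)|].
  eapply Rle_trans; [apply (Series_abs_le _ _ E X)|]. rewrite Series_scal_l. fold S3. apply Req_le. ring.
Qed.

Lemma small_cos c m al : small2 c m ->
  ex_series (fun k => c k * cos (INR k * al)) /\ Rabs (Series (fun k => c k * cos (INR k * al))) <= m * S3.
Proof.
  intros H. assert (Hm := small2_pos _ _ H).
  assert (E : forall k, Rabs (c k * cos (INR k * al)) <= m * (INR k ^ 3 * (2/3) ^ k)).
  { intros k. rewrite Rabs_mult. rewrite <- (Rmult_1_r (m * _)).
    apply Rmult_le_compat; try apply Rabs_pos; [|apply Rabs_le, COS_bound].
    eapply Rle_trans; [apply H|]. apply Rmult_le_compat_l; [assumption|].
    apply Rmult_le_compat_r; [apply pow_le; lra|apply pow_nat_mono; lia]. }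
  assert (X : ex_series (fun k => m * (INR k ^ 3 * (2/3) ^ k))) by apply ex_series_scalR, ex_S3.
  split; [apply (ex_series_leR _ _ E X)|].
  eapply Rle_trans; [apply (Series_abs_le _ _ E X)|]. rewrite Series_scal_l. fold S3. lra.
Qed.

Lemma h0_le k a : 0 <= a <= 23/50 -> Rabs (h0 k a) <= 20 * (2/3) ^ k.
Proof.
  intros Ha. unfold h0. destruct k as [|k]; [simpl; rewrite Rmult_0_r, Rmult_0_l, Rabs_R0; lra|].
  replace (S k - 1)%nat with k by lia. rewrite !Rabs_mult, <- RPow_abs, Rabs_Ropp, (Rabs_pos_eq a) by lra.
  rewrite (Rabs_pos_eq (INR (S k))) by apply pos_INR. replace (Rabs (-4)) with 4 by (unfold Rabs; destruct Rcase_abs; lra).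
  assert (P1 : a ^ k <= (23/50) ^ k) by (apply pow_incr; lra).
  (* 31/69 is chosen so that [(1 + 31/69) * 23/50 = 2/3]. *)
  assert (P2 := nat_pow_le (S k) (31/69) ltac:(lra)).
  assert (P3 := pos_INR (S k)). assert (P4 : 0 <= a ^ k) by (apply pow_le; lra).
  assert (P5 : 0 < (23/50) ^ k) by (apply pow_lt; lra).
  apply Rle_trans with (4 * ((1 + 31/69) ^ S k / (31/69)) * (23/50) ^ k).
  - apply Rmult_le_compat; try nra.
  - replace (4 * ((1 + 31/69) ^ S k / (31/69)) * (23/50) ^ k) with (600/31 * ((1 + 31/69) * (23/50)) ^ S k).
    + replace ((1 + 31/69) * (23/50)) with (2/3) by field. apply Rmult_le_compat_r; [apply pow_le|]; lra.
    + rewrite Rpow_mult_distr. simpl. field.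
Qed.

(** The exponential normalizes the growing factor of each mode to 1 at the surface [t = d], and the
    2 removes the halves in [csn] and [ccs]; see [cd_exp]. *)
Definition cd (d : R) (g : nat -> R) (k : nat) : R := 2 * g k * exp (- (INR k * d)).
Definition geoB (g : nat -> R) : Prop := exists M, forall k, Rabs (g k) <= M * (2/3) ^ k.
(** The coefficients decay like [(2/3)^k], and [2/3 * 5/4 = 5/6 < 1] leaves a margin of [ln (5/4)]
    beyond the surface. *)
Definition Tof (d : R) : R := d + ln (5/4).

Lemma exp_nat k x : exp (INR k * x) = exp x ^ k.
Proof.
  induction k as [|k IH]; [simpl; rewrite Rmult_0_l; apply exp_0|].
  rewrite S_INR, Rmult_plus_distr_r, exp_plus, IH, Rmult_1_l. simpl. ring.
Qed.

Lemma Tof_gt d : d < Tof d.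
Proof. unfold Tof. assert (0 < ln (5/4)) by (rewrite <- ln_1; apply ln_increasing; lra). lra. Qed.

Lemma okc_cd d g : geoB g -> okc (cd d g) (Tof d).
Proof.
  intros [M HM] j.
  apply (ex_series_leR _ (fun k => 2 * M * (INR k ^ j * (5/6) ^ k))).
  - intros k. unfold cd. rewrite !Rabs_mult, !Rabs_Rabsolu.
    rewrite (Rabs_pos_eq 2) by lra.
    rewrite (Rabs_pos_eq (exp _)), (Rabs_pos_eq (exp (INR k * Tof d))) by apply Rlt_le, exp_pos.
    rewrite (Rabs_pos_eq (INR k ^ j)) by apply pow_le, pos_INR.
    assert (E : exp (- (INR k * d)) * exp (INR k * Tof d) = (5/4) ^ k).
    { rewrite <- exp_plus. replace (- (INR k * d) + INR k * Tof d) with (INR k * ln (5/4)) by (unfold Tof; ring).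
      rewrite exp_nat, exp_ln by lra. reflexivity. }
    replace (2 * Rabs (g k) * exp (- (INR k * d)) * INR k ^ j * exp (INR k * Tof d)) with
      (2 * Rabs (g k) * INR k ^ j * (exp (- (INR k * d)) * exp (INR k * Tof d))) by ring.
    rewrite E. replace (2 * M * (INR k ^ j * (5/6) ^ k)) with (2 * (M * (2/3) ^ k) * INR k ^ j * (5/4) ^ k).
    + apply Rmult_le_compat_r; [apply pow_le; lra|]. apply Rmult_le_compat_r; [apply pow_le, pos_INR|].
      apply Rmult_le_compat_l; [lra|apply HM].
    + replace (5/6) with (2/3 * (5/4)) by field. rewrite (Rpow_mult_distr (2/3)). ring.
  - apply ex_series_scalR, ex_series_pow_geo. lra.
Qed.

Lemma kc_cd d g : kc (cd d g) = cd d (kc g).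
Proof. apply functional_extensionality. intros k. unfold kc, cd. ring. Qed.

Lemma W_pair (c : nat -> R) phi a t T x y : okc c T -> Rabs t <= T ->
  x * W c phi 1 a t + y * W c phi (-1) a t =
  Series (fun k => c k * (cos (INR k * a + phi) * (x * exp (INR k * t) + y * exp (- (INR k * t))))).
Proof.
  intros H Ht. unfold W. rewrite <- !Series_scal_l.
  rewrite <- Series_plus.
  - apply Series_ext. intros k. unfold wterm. replace (1 * (INR k * t)) with (INR k * t) by ring.
    replace (-1 * (INR k * t)) with (- (INR k * t)) by ring. ring.
  - apply ex_series_scalR, (ex_wterm _ _ _ _ _ T H); [apply R1_abs|assumption].
  - apply ex_series_scalR, (ex_wterm _ _ _ _ _ T H); [apply Rm1_abs|assumption].
Qed.

(** [xx] is the damping of mode 1 below the surface and [yy] that of its reflection in the bottom.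
    Both are [exp (- d)] at the bottom [t = 0], where their differences vanish. *)
Definition xx (d t : R) : R := exp (t - d).
Definition yy (d t : R) : R := exp (- t - d).

Lemma cd_exp d g k t x y : cd d g k * (x * exp (INR k * t) + y * exp (- (INR k * t))) =
  2 * g k * (x * xx d t ^ k + y * yy d t ^ k).
Proof.
  unfold cd, xx, yy. rewrite <- !exp_nat.
  replace (INR k * (t - d)) with (INR k * t + - (INR k * d)) by ring.
  replace (INR k * (- t - d)) with (- (INR k * t) + - (INR k * d)) by ring. rewrite !exp_plus. ring.
Qed.

Lemma cos_sh x : cos (x + - (PI/2)) = sin x.
Proof. rewrite cos_plus, cos_neg, sin_neg, cos_PI2, sin_PI2. ring. Qed.

Lemma csn_re d g a t : okc (cd d g) (Tof d) -> Rabs t <= Tof d ->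
  Re (csn (cd d g) (a, t)) = Series (fun k => g k * (xx d t ^ k + yy d t ^ k) * sin (INR k * a)).
Proof.
  intros H Ht. unfold csn. simpl. rewrite (W_pair _ _ _ _ (Tof d)) by assumption.
  apply Series_ext. intros k. rewrite cos_sh, (Rmult_comm (sin _)), <- Rmult_assoc, cd_exp. field.
Qed.
Lemma csn_im d g a t : okc (cd d g) (Tof d) -> Rabs t <= Tof d ->
  Im (csn (cd d g) (a, t)) = Series (fun k => g k * (xx d t ^ k - yy d t ^ k) * cos (INR k * a)).
Proof.
  intros H Ht. unfold csn. simpl. rewrite (W_pair _ _ _ _ (Tof d)) by assumption.
  apply Series_ext. intros k. rewrite Rplus_0_r, (Rmult_comm (cos _)), <- Rmult_assoc, cd_exp. field.
Qed.
Lemma ccs_re d g a t : okc (cd d g) (Tof d) -> Rabs t <= Tof d ->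
  Re (ccs (cd d g) (a, t)) = Series (fun k => g k * (xx d t ^ k + yy d t ^ k) * cos (INR k * a)).
Proof.
  intros H Ht. unfold ccs. simpl. rewrite (W_pair _ _ _ _ (Tof d)) by assumption.
  apply Series_ext. intros k. rewrite Rplus_0_r, (Rmult_comm (cos _)), <- Rmult_assoc, cd_exp. field.
Qed.
Lemma ccs_im d g a t : okc (cd d g) (Tof d) -> Rabs t <= Tof d ->
  Im (ccs (cd d g) (a, t)) = - Series (fun k => g k * (xx d t ^ k - yy d t ^ k) * sin (INR k * a)).
Proof.
  intros H Ht. unfold ccs. simpl. rewrite (W_pair _ _ _ _ (Tof d)) by assumption.
  rewrite <- Series_opp.
  apply Series_ext. intros k. rewrite cos_sh, (Rmult_comm (sin _)), <- Rmult_assoc, cd_exp. field.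
Qed.

(** The margin 1/2000 is what the sign estimates on the surface can absorb. The 22 adds one unit for
    a coefficient of [dl] to 21 units for a reflected coefficient, which is bounded by
    [21 * (2/3) ^ k] and damped by at least [kap]. *)
Definition near_crapper (d : R) (dl : nat -> R) (kap : R) : Prop :=
  0 < d /\ 0 < kap <= 1/10000 /\ 22 * kap * S3 <= 1/2000 /\ exp (- d) <= kap /\ dl O = 0 /\
  forall k, Rabs (dl k) <= kap * (2/3) ^ k.

Definition hh (A : R) (dl : nat -> R) (k : nat) : R := h0 k A + dl k.
Definition gz (A : R) (dl : nat -> R) (k : nat) : R := A * hh A dl k / INR k.
Definition Zh (d A : R) (dl : nat -> R) (b : C) : C := (RtoC 1 * b + RtoC 0 + csn (cd d (gz A dl)) b)%C.
Definition Zh1 (d A : R) (dl : nat -> R) (b : C) : C := (RtoC 1 + ccs (cd d (kc (gz A dl))) b)%C.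
Definition Zh2 (d A : R) (dl : nat -> R) (b : C) : C := (RtoC 0 + - csn (cd d (kc (kc (gz A dl)))) b)%C.

Lemma hh_le A dl kap d k : 0 <= A <= 23/50 -> near_crapper d dl kap -> Rabs (hh A dl k) <= 21 * (2/3) ^ k.
Proof.
  intros HA [_ [K1 [_ [_ [_ K2]]]]]. unfold hh. eapply Rle_trans; [apply Rabs_triang|].
  assert (P : 0 <= (2/3) ^ k) by (apply pow_le; lra).
  generalize (h0_le k A HA) (K2 k). nra.
Qed.
Lemma hh_0 A dl kap d : near_crapper d dl kap -> hh A dl 0 = 0.
Proof. intros [_ [_ [_ [_ [E _]]]]]. unfold hh, h0. rewrite E. simpl. ring. Qed.

Lemma Rabs_div_nat x k : Rabs (x / INR k) <= Rabs x.
Proof.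
  destruct k as [|k].
  - simpl. unfold Rdiv. rewrite Rinv_0, Rmult_0_r, Rabs_R0. apply Rabs_pos.
  - unfold Rdiv. rewrite Rabs_mult, Rabs_inv. assert (1 <= INR (S k)) by (rewrite S_INR; generalize (pos_INR k); lra).
    rewrite (Rabs_pos_eq (INR (S k))) by lra. rewrite <- (Rmult_1_r (Rabs x)) at 2.
    apply Rmult_le_compat_l; [apply Rabs_pos|]. rewrite <- Rinv_1. apply Rinv_le_contravar; lra.
Qed.

Lemma geoB_gz A dl kap d : 0 <= A <= 23/50 -> near_crapper d dl kap -> geoB (gz A dl).
Proof.
  intros HA H. exists 21. intros k. unfold gz. eapply Rle_trans; [apply Rabs_div_nat|].
  rewrite Rabs_mult, (Rabs_pos_eq A) by lra. generalize (hh_le A dl kap d k HA H) (Rabs_pos (hh A dl k)). nra.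
Qed.
Lemma kc_gz A dl kap d k : near_crapper d dl kap -> kc (gz A dl) k = A * hh A dl k.
Proof.
  intros H. unfold kc, gz. destruct k as [|k]; [rewrite (hh_0 A dl kap d H); simpl; ring|].
  field. apply not_0_INR. lia.
Qed.

Lemma okc_gz A dl kap d : 0 <= A <= 23/50 -> near_crapper d dl kap -> okc (cd d (gz A dl)) (Tof d).
Proof. intros HA H. apply okc_cd, (geoB_gz A dl kap d); assumption. Qed.

Lemma hol_Zh A dl kap d : 0 <= A <= 23/50 -> near_crapper d dl kap -> hol (Zh d A dl) (Zh1 d A dl) (Tof d).
Proof.
  intros HA H. unfold Zh, Zh1. rewrite <- kc_cd.
  apply (hol_plus (fun b => RtoC 1 * b + RtoC 0)%C); [apply hol_affine|apply hol_csn, (okc_gz A dl kap d); assumption].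
Qed.
Lemma hol_Zh1 A dl kap d : 0 <= A <= 23/50 -> near_crapper d dl kap -> hol (Zh1 d A dl) (Zh2 d A dl) (Tof d).
Proof.
  intros HA H. unfold Zh1, Zh2. rewrite <- !kc_cd.
  apply (hol_plus (fun _ => RtoC 1) (fun _ => RtoC 0) (ccs (kc (cd d (gz A dl)))) (fun b => - csn (kc (kc (cd d (gz A dl)))) b)%C).
  - exists 0. split; [lra|]. intros. replace (RtoC 1 - RtoC 1 - RtoC 0 * (b' - b))%C with (RtoC 0) by ring. rewrite Cmod_0. lra.
  - apply hol_ccs, okc_kc, (okc_gz A dl kap d); assumption.
Qed.

Lemma geoB_scal a g : geoB g -> geoB (fun k => a * g k).
Proof.
  intros [M H]. exists (Rabs a * M). intros k. rewrite Rabs_mult, Rmult_assoc.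
  apply Rmult_le_compat_l; [apply Rabs_pos|apply H].
Qed.

Lemma xx_bounds d t : 0 <= t <= d -> 0 < yy d t /\ yy d t <= xx d t /\ xx d t <= 1 /\ yy d t <= exp (- d) /\ exp (- d) <= xx d t /\
  (0 < t -> yy d t < xx d t).
Proof.
  intros H. unfold xx, yy. repeat split.
  - apply exp_pos.
  - apply exp_le; lra.
  - rewrite <- exp_0. apply exp_le; lra.
  - apply exp_le; lra.
  - apply exp_le; lra.
  - intros. apply exp_increasing; lra.
Qed.

Lemma pow_diff_le x y k : 0 <= y <= x -> x <= 1 -> 0 <= x ^ k - y ^ k <= INR k * (x - y).
Proof.
  intros H Hx. induction k as [|k IH]; [simpl; lra|]. rewrite S_INR. simpl.
  replace (x * x ^ k - y * y ^ k) with (x * (x ^ k - y ^ k) + (x - y) * y ^ k) by ring.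
  assert (0 <= y ^ k <= 1).
  { split; [apply pow_le; lra|]. rewrite <- (pow1 k). apply pow_incr; lra. }
  generalize (pos_INR k). nra.
Qed.

(** Below the surface, where mode [k] is damped by [rho ^ k], the explicit wave of amplitude [A]
    behaves like the surface of the one with amplitude [A * rho]. Closed forms on the surface thus
    hold throughout the strip. *)
Lemma h0_damp k A rho : h0 k A * rho ^ k = rho * h0 k (A * rho).
Proof.
  unfold h0. destruct k as [|k]; [simpl; ring|]. replace (S k - 1)%nat with k by lia.
  replace (- (A * rho)) with ((- A) * rho) by ring. rewrite Rpow_mult_distr. simpl. ring.
Qed.

(** The expression vanishes for [a = b]. Once the factor [a - b] is split off, all terms other than
    [1 - a^2] contain the small number [b]. *)
Lemma crapper_quot a b c : 0 <= b <= a -> a <= 23/50 -> b <= 1/10000 -> -1 <= c <= 1 ->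
  (a - b) / 2 <= a * (1 - a * a) * (1 + 2 * b * c + b * b) ^ 2 - b * (1 - b * b) * (1 + 2 * a * c + a * a) ^ 2.
Proof.
  intros H1 H2 H3 H4.
  replace (a * (1 - a * a) * (1 + 2 * b * c + b * b) ^ 2 - b * (1 - b * b) * (1 + 2 * a * c + a * a) ^ 2) with
   ((a - b) * (1 - (a * a + a * b + b * b) - 8 * c * (a * b * (a + b)) - (2 + 4 * c * c) * (a * b + a * b * (a * b))
      - a * b * (a * a + a * b + b * b) + a * b * (a * b) * (a * b))) by ring.
  unfold Rdiv. apply Rmult_le_compat_l; [lra|].
  assert (B1 : 0 <= a * b <= 1/10000) by nra. assert (B2 : 0 <= a * a <= 529/2500) by nra.
  assert (B3 : 0 <= b * b <= 1/10000) by nra.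
  assert (B4 : 0 <= a * b * (a + b) <= 1/10000) by nra.
  assert (B5 : 0 <= a * b * (a * b) <= 1/10000) by nra.
  assert (B6 : 0 <= a * b * (a * a + a * b + b * b) <= 1/10000) by nra.
  assert (B7 : 0 <= a * b * (a * b) * (a * b)) by nra.
  assert (B8 : 0 <= 2 + 4 * c * c <= 6) by nra.
  assert (B9 : (2 + 4 * c * c) * (a * b + a * b * (a * b)) <= 6 * (2/10000)) by (apply Rmult_le_compat; lra).
  nra.
Qed.

(** Main term and perturbation both carry the factor [(x - y) * sin al], which vanishes on the
    bottom and at the ends of the half period. After division by it and by [A], a main term of at
    least 1/20 meets an error of at most 1/2000. *)
Lemma Zh_y_pos A dl kap d al t : 0 < A <= 23/50 -> near_crapper d dl kap -> 0 < al < PI -> 0 < t <= d ->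
  0 < Im (Zh1 d A dl (al, t)).
Proof.
  intros HA H Hal Ht. assert (HA' : 0 <= A <= 23/50) by lra.
  assert (HG := geoB_gz A dl kap d HA' H).
  assert (HT : Rabs t <= Tof d) by (rewrite Rabs_pos_eq; generalize (Tof_gt d); lra).
  destruct (xx_bounds d t ltac:(lra)) as [y0 [y1 [x1 [y2 [_ y3]]]]]. specialize (y3 (proj1 Ht)).
  set (x := xx d t) in *. set (y := yy d t) in *.
  assert (Ek : kc (gz A dl) = fun k => A * hh A dl k).
  { apply functional_extensionality. intros k. apply (kc_gz A dl kap d k H). }
  unfold Zh1. replace (Im (RtoC 1 + ccs (cd d (kc (gz A dl))) (al, t))%C) with (Im (ccs (cd d (kc (gz A dl))) (al, t)))
    by (unfold Im; simpl; ring).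
  assert (Gh : geoB (hh A dl)) by (exists 21; intros; apply (hh_le A dl kap d); assumption).
  rewrite ccs_im; [|rewrite Ek; apply okc_cd, geoB_scal, Gh|assumption]. fold x y. rewrite Ek.
  set (u := sin al). assert (Hu : 0 < u) by (apply sin_gt_0; lra).
  assert (Hk := H). destruct Hk as [Hd [K1 [K2 [K3 [K4 K5]]]]].
  assert (SM : small2 (fun k => dl k * (x ^ k - y ^ k)) (kap * (x - y))).
  { intros k. rewrite Rabs_mult. assert (Q := pow_diff_le x y k ltac:(lra) x1).
    rewrite (Rabs_pos_eq (x ^ k - y ^ k)) by lra. destruct k as [|k]; [simpl; rewrite K4, Rabs_R0; lra|].
    assert (INR (S k) ^ 1 <= INR (S k) ^ 2) by (apply pow_nat_mono; lia). rewrite pow_1 in H0.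
    replace (kap * (x - y) * (INR (S k) ^ 2 * (2/3) ^ S k)) with (kap * (2/3) ^ S k * (INR (S k) ^ 2 * (x - y))) by ring.
    apply Rmult_le_compat; [apply Rabs_pos|lra|apply K5|].
    eapply Rle_trans; [apply Q|]. apply Rmult_le_compat_r; lra. }
  destruct (small_sin _ _ al SM) as [X3 B3]. fold u in B3. rewrite (Rabs_pos_eq u) in B3 by lra.
  assert (Cx := crapper_h_sin (A * x) al ltac:(nra)). assert (Cy := crapper_h_sin (A * y) al ltac:(nra)). fold u in Cx, Cy.
  assert (Dx := cr_den_ge (A * x) al ltac:(nra)). assert (Dy := cr_den_ge (A * y) al ltac:(nra)).
  assert (E : Series (fun k => A * hh A dl k * (x ^ k - y ^ k) * sin (INR k * al)) =
    A * x * (-4 * (1 - A * x * (A * x)) * u / cr_den (A * x) al ^ 2) - A * y * (-4 * (1 - A * y * (A * y)) * u / cr_den (A * y) al ^ 2)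
    + A * Series (fun k => dl k * (x ^ k - y ^ k) * sin (INR k * al))).
  { rewrite <- (is_series_unique _ _ Cx), <- (is_series_unique _ _ Cy), <- !Series_scal_l.
    rewrite <- Series_minus.
    2, 3: apply ex_series_scalR; eexists; eassumption.
    rewrite <- Series_plus.
    - apply Series_ext. intros k. unfold hh.
      transitivity (A * (h0 k A * x ^ k) * sin (INR k * al) - A * (h0 k A * y ^ k) * sin (INR k * al) + A * (dl k * (x ^ k - y ^ k) * sin (INR k * al))); [ring|].
      rewrite !h0_damp. ring.
    - apply (ex_series_minus (V := R_NormedModule)); apply ex_series_scalR; eexists; eassumption.
    - apply ex_series_scalR, X3. }
  rewrite E. clear E.
  set (c := cos al). assert (Hc : -1 <= c <= 1) by apply COS_bound.
  assert (Q := crapper_quot (A * x) (A * y) c ltac:(nra) ltac:(nra) ltac:(nra) Hc).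
  assert (EDx : 1 + 2 * (A * x) * c + A * x * (A * x) = cr_den (A * x) al) by reflexivity.
  assert (EDy : 1 + 2 * (A * y) * c + A * y * (A * y) = cr_den (A * y) al) by reflexivity.
  rewrite EDx, EDy in Q. set (Da := cr_den (A * x) al) in *. set (Db := cr_den (A * y) al) in *.
  assert (M : 4 * u * ((A * x - A * y) / 2) / (Da ^ 2 * Db ^ 2) <=
    - (A * x * (-4 * (1 - A * x * (A * x)) * u / Da ^ 2) - A * y * (-4 * (1 - A * y * (A * y)) * u / Db ^ 2))).
  { replace (- (A * x * (-4 * (1 - A * x * (A * x)) * u / Da ^ 2) - A * y * (-4 * (1 - A * y * (A * y)) * u / Db ^ 2)))
     with (4 * u * (A * x * (1 - A * x * (A * x)) * Db ^ 2 - A * y * (1 - A * y * (A * y)) * Da ^ 2) / (Da ^ 2 * Db ^ 2)) by (field; lra).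
    apply Rmult_le_compat_r.
    - apply Rlt_le, Rinv_0_lt_compat. apply Rmult_lt_0_compat; apply pow_lt; lra.
    - apply Rmult_le_compat_l; lra. }
  assert (M2 : A * (x - y) * u * (1/20) <= 4 * u * ((A * x - A * y) / 2) / (Da ^ 2 * Db ^ 2)).
  { replace (4 * u * ((A * x - A * y) / 2) / (Da ^ 2 * Db ^ 2)) with (A * (x - y) * u * (2 / (Da ^ 2 * Db ^ 2))) by (field; lra).
    apply Rmult_le_compat_l; [apply Rmult_le_pos; [apply Rmult_le_pos|]; lra|].
    assert (Da ^ 2 * Db ^ 2 <= 40).
    { replace 40 with (5 * 8) by ring.
      assert (Da ^ 2 <= 5) by (simpl; nra). assert (Db ^ 2 <= 8) by (simpl; nra).
      apply Rmult_le_compat; try assumption; apply pow_le; lra. }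
    assert (0 < Da ^ 2 * Db ^ 2) by (apply Rmult_lt_0_compat; apply pow_lt; lra).
    set (X := Da ^ 2 * Db ^ 2) in *. clearbody X. apply (Rle_div_r (1/20) 2 X); lra. }
  apply Rabs_le_between in B3.
  set (P := Series (fun k => dl k * (x ^ k - y ^ k) * sin (INR k * al))) in *.
  assert (B4 : P <= 1/2000 * ((x - y) * u)).
  { eapply Rle_trans; [apply B3|]. replace (kap * (x - y) * S3 * u) with (kap * S3 * ((x - y) * u)) by ring.
    apply Rmult_le_compat_r; [nra|]. assert (0 <= kap * S3) by (apply Rmult_le_pos; [lra|apply S3_pos]). lra. }
  assert (B5 : 0 < A * (x - y) * u) by (apply Rmult_lt_0_compat; [apply Rmult_lt_0_compat; lra|lra]).
  assert (A * P <= A * (1/2000 * ((x - y) * u))) by (apply Rmult_le_compat_l; lra). nra.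
Qed.

Lemma Zh1_re_eq A dl kap d al t : 0 <= A <= 23/50 -> near_crapper d dl kap -> 0 <= t <= d ->
  Rabs (Re (Zh1 d A dl (al, t)) - (1 + A * xx d t * (-4 * ((1 + A * xx d t * (A * xx d t)) * cos al + 2 * (A * xx d t)) / cr_den (A * xx d t) al ^ 2))) <= 1/100.
Proof.
  intros HA H Ht.
  assert (HT : Rabs t <= Tof d) by (rewrite Rabs_pos_eq; generalize (Tof_gt d); lra).
  destruct (xx_bounds d t Ht) as [y0 [y1 [x1 [y2 [x0 _]]]]].
  assert (x0' : 0 < xx d t) by lra.
  set (x := xx d t) in *. set (y := yy d t) in *.
  assert (Ek : kc (gz A dl) = fun k => A * hh A dl k).
  { apply functional_extensionality. intros k. apply (kc_gz A dl kap d k H). }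
  unfold Zh1. replace (Re (RtoC 1 + ccs (cd d (kc (gz A dl))) (al, t))%C) with (1 + Re (ccs (cd d (kc (gz A dl))) (al, t)))
    by (unfold Re; simpl; ring).
  assert (Gh : geoB (hh A dl)) by (exists 21; intros; apply (hh_le A dl kap d); assumption).
  rewrite ccs_re; [|rewrite Ek; apply okc_cd, geoB_scal, Gh|assumption]. fold x y. rewrite Ek.
  assert (Hk := H). destruct Hk as [Hd [K1 [K2 [K3 [K4 K5]]]]].
  assert (SM : small2 (fun k => dl k * (x ^ k + y ^ k)) (2 * kap)).
  { intros k. destruct k as [|k]; [simpl; rewrite K4, Rmult_0_l, Rabs_R0; lra|].
    assert (0 <= x ^ S k <= 1) by (split; [apply pow_le; lra|rewrite <- (pow1 (S k)); apply pow_incr; lra]).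
    assert (0 <= y ^ S k <= 1) by (split; [apply pow_le; lra|rewrite <- (pow1 (S k)); apply pow_incr; lra]).
    rewrite Rabs_mult, (Rabs_pos_eq (x ^ S k + _)) by lra.
    assert (1 <= INR (S k) ^ 2) by (apply pow_R1_Rle; rewrite S_INR; generalize (pos_INR k); lra).
    assert (P : 0 < (2/3) ^ S k) by (apply pow_lt; lra).
    replace (2 * kap * (INR (S k) ^ 2 * (2/3) ^ S k)) with (kap * (2/3) ^ S k * (2 * INR (S k) ^ 2)) by ring.
    apply Rmult_le_compat; [apply Rabs_pos|lra|apply K5|lra]. }
  destruct (small_cos _ _ al SM) as [X3 B3].
  assert (Cx := crapper_h_cos (A * x) al ltac:(nra)). assert (Cy := crapper_h_cos (A * y) al ltac:(nra)).
  assert (Dy := cr_den_ge (A * y) al ltac:(nra)).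
  assert (E : Series (fun k => A * hh A dl k * (x ^ k + y ^ k) * cos (INR k * al)) =
    A * x * (-4 * ((1 + A * x * (A * x)) * cos al + 2 * (A * x)) / cr_den (A * x) al ^ 2)
    + A * y * (-4 * ((1 + A * y * (A * y)) * cos al + 2 * (A * y)) / cr_den (A * y) al ^ 2)
    + A * Series (fun k => dl k * (x ^ k + y ^ k) * cos (INR k * al))).
  { rewrite <- (is_series_unique _ _ Cx), <- (is_series_unique _ _ Cy), <- !Series_scal_l.
    rewrite <- !Series_plus.
    - apply Series_ext. intros k. unfold hh.
      transitivity (A * (h0 k A * x ^ k) * cos (INR k * al) + A * (h0 k A * y ^ k) * cos (INR k * al) + A * (dl k * (x ^ k + y ^ k) * cos (INR k * al))); [ring|].
      rewrite !h0_damp. ring.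
    - apply (ex_series_plus (V := R_NormedModule)); apply ex_series_scalR; eexists; eassumption.
    - apply ex_series_scalR, X3.
    - apply ex_series_scalR; eexists; eassumption.
    - apply ex_series_scalR; eexists; eassumption. }
  rewrite E. clear E.
  set (Px := A * x * _). set (Q := Series _) in *.
  replace (1 + (Px + A * y * (-4 * ((1 + A * y * (A * y)) * cos al + 2 * (A * y)) / cr_den (A * y) al ^ 2) + A * Q) - (1 + Px))
    with (A * y * (-4 * ((1 + A * y * (A * y)) * cos al + 2 * (A * y)) / cr_den (A * y) al ^ 2) + A * Q) by ring.
  eapply Rle_trans; [apply Rabs_triang|]. rewrite !Rabs_mult, (Rabs_pos_eq A), (Rabs_pos_eq y) by lra.
  assert (F : Rabs (-4 * ((1 + A * y * (A * y)) * cos al + 2 * (A * y)) / cr_den (A * y) al ^ 2) <= 100).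
  { unfold Rdiv. rewrite !Rabs_mult. replace (Rabs (-4)) with 4 by (unfold Rabs; destruct Rcase_abs; lra).
    assert (G1 : Rabs ((1 + A * y * (A * y)) * cos al + 2 * (A * y)) <= 2).
    { generalize (COS_bound al). intros. assert (0 <= A * y <= 1/10000) by nra.
      set (b := A * y) in *. assert (0 <= b * b <= 1/10000) by nra.
      assert ((1 + b * b) * cos al <= 1 + b * b) by nra. assert (- (1 + b * b) <= (1 + b * b) * cos al) by nra.
      apply Rabs_le. lra. }
    assert (G2 : Rabs (/ cr_den (A * y) al ^ 2) <= 12).
    { rewrite Rabs_pos_eq by (apply Rlt_le, Rinv_0_lt_compat, pow_lt; lra).
      replace 12 with (/ (/ 12)) by field. apply Rinv_le_contravar; [lra|]. nra. }
    assert (P1 := Rabs_pos ((1 + A * y * (A * y)) * cos al + 2 * (A * y))). assert (P2 := Rabs_pos (/ cr_den (A * y) al ^ 2)).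
    rewrite Rmult_assoc. assert (Rabs ((1 + A * y * (A * y)) * cos al + 2 * (A * y)) * Rabs (/ cr_den (A * y) al ^ 2) <= 2 * 12) by (apply Rmult_le_compat; lra). lra. }
  assert (P0 := Rabs_pos (-4 * ((1 + A * y * (A * y)) * cos al + 2 * (A * y)) / cr_den (A * y) al ^ 2)).
  assert (P1 := Rabs_pos Q). assert (SP := S3_pos). assert (Ay : 0 <= A * y <= 23/500000) by nra.
  set (F' := Rabs (-4 * _ / _)) in *.
  assert (A * y * F' <= 23/500000 * 100) by (apply Rmult_le_compat; lra).
  assert (A * Rabs Q <= 23/50 * (1/2000)) by (apply Rmult_le_compat; lra). lra.
Qed.

Lemma Zh_re A dl kap d al t : 0 <= A <= 23/50 -> near_crapper d dl kap -> Rabs t <= Tof d ->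
  Re (Zh d A dl (al, t)) = al + Series (fun k => gz A dl k * (xx d t ^ k + yy d t ^ k) * sin (INR k * al)).
Proof.
  intros HA H Ht. unfold Zh. rewrite <- csn_re by (try apply (okc_gz A dl kap d); assumption). unfold Re; simpl. ring.
Qed.
Lemma Zh_im A dl kap d al t : 0 <= A <= 23/50 -> near_crapper d dl kap -> Rabs t <= Tof d ->
  Im (Zh d A dl (al, t)) = t + Series (fun k => gz A dl k * (xx d t ^ k - yy d t ^ k) * cos (INR k * al)).
Proof.
  intros HA H Ht. unfold Zh. rewrite <- csn_im by (try apply (okc_gz A dl kap d); assumption). unfold Im; simpl. ring.
Qed.

Lemma abs_T d t : 0 < d -> 0 <= t <= d -> Rabs t < Tof d.
Proof. intros. rewrite Rabs_pos_eq; generalize (Tof_gt d); lra. Qed.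

Lemma xx_top d : xx d d = 1.
Proof. unfold xx. rewrite Rminus_diag_eq by reflexivity. apply exp_0. Qed.

Lemma INR_sq_ge1 k : 1 <= INR (S k) ^ 2.
Proof. apply pow_R1_Rle; rewrite S_INR; generalize (pos_INR k); lra. Qed.

Lemma yy_pow_le d dl kap k : near_crapper d dl kap -> 0 <= yy d d ^ S k <= kap.
Proof.
  intros [Hd [K1 [K2 [K3 _]]]]. destruct (xx_bounds d d ltac:(lra)) as [y0 [y1 [x1 [y2 _]]]].
  split; [apply pow_le; lra|]. simpl.
  assert (yy d d ^ k <= 1) by (rewrite <- (pow1 k); apply pow_incr; lra).
  assert (0 <= yy d d ^ k) by (apply pow_le; lra). nra.
Qed.

(** The factor [A] in the error is kept because the amplitude may be arbitrarily small, and [sin al]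
    because the angle may approach the ends of the half period. *)
Lemma Zh_top_x A dl kap d al : 0 <= A <= 23/50 -> near_crapper d dl kap ->
  Rabs (Re (Zh d A dl (al, d)) - (al - 4 * A * sin al / cr_den A al)) <= A / 2000 * Rabs (sin al).
Proof.
  intros HA H. assert (Hk := H). destruct Hk as [Hd [K1 [K2 [K3 [K4 K5]]]]].
  rewrite (Zh_re A dl kap) by (try apply Rlt_le, abs_T; try assumption; lra). rewrite xx_top.
  set (y := yy d d).
  assert (SM : small2 (fun k => (dl k + hh A dl k * y ^ k) / INR k) (22 * kap)).
  { intros k. destruct k as [|k].
    - rewrite K4, (hh_0 A dl kap d H). simpl. unfold Rdiv. rewrite !Rmult_0_l, Rplus_0_l, Rmult_0_l, Rabs_R0. lra.
    - eapply Rle_trans; [apply Rabs_div_nat|]. eapply Rle_trans; [apply Rabs_triang|].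
      assert (Y := yy_pow_le d dl kap k H). fold y in Y.
      rewrite Rabs_mult, (Rabs_pos_eq (y ^ S k)) by lra.
      assert (Q := hh_le A dl kap d (S k) HA H). assert (P := K5 (S k)). assert (I2 := INR_sq_ge1 k).
      set (q := (2/3) ^ S k) in *. assert (0 < q) by (apply pow_lt; lra).
      assert (Rabs (hh A dl (S k)) * y ^ S k <= 21 * q * kap) by (apply Rmult_le_compat; try lra; apply Rabs_pos).
      apply Rle_trans with (22 * kap * q); [lra|]. rewrite <- (Rmult_1_l q) at 1.
      apply Rmult_le_compat_l; [lra|]. apply Rmult_le_compat_r; lra. }
  destruct (small_sin _ _ al SM) as [X B].
  assert (Cy := crapper_y_sin A al HA).
  assert (E : Series (fun k => gz A dl k * (1 ^ k + y ^ k) * sin (INR k * al)) =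
    A * (-4 * sin al / cr_den A al) + A * Series (fun k => (dl k + hh A dl k * y ^ k) / INR k * sin (INR k * al))).
  { rewrite <- (is_series_unique _ _ Cy), <- !Series_scal_l, <- Series_plus.
    - apply Series_ext. intros k. unfold gz, hh, Rdiv. rewrite pow1. ring.
    - apply ex_series_scalR. eexists; eassumption.
    - apply ex_series_scalR, X. }
  rewrite E. set (Q := Series _) in *.
  replace (al + (A * (-4 * sin al / cr_den A al) + A * Q) - (al - 4 * A * sin al / cr_den A al)) with (A * Q) by (unfold Rdiv; ring).
  rewrite Rabs_mult, (Rabs_pos_eq A) by lra.
  replace (A / 2000 * Rabs (sin al)) with (A * (1/2000 * Rabs (sin al))) by field. apply Rmult_le_compat_l; [lra|].
  eapply Rle_trans; [exact B|]. apply Rmult_le_compat_r; [apply Rabs_pos|lra].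
Qed.

Lemma Zh_bot_x A dl kap d al : 0 <= A <= 23/50 -> near_crapper d dl kap ->
  Rabs (Re (Zh d A dl (al, 0)) - al) <= 1/1000 * Rabs (sin al).
Proof.
  intros HA H. assert (Hk := H). destruct Hk as [Hd [K1 [K2 [K3 [K4 K5]]]]].
  rewrite (Zh_re A dl kap) by (try apply Rlt_le, abs_T; try assumption; lra).
  assert (Ex : xx d 0 = exp (- d)) by (unfold xx; f_equal; ring).
  assert (Ey : yy d 0 = exp (- d)) by (unfold yy; f_equal; ring).
  rewrite Ex, Ey. set (y := exp (- d)) in *. assert (y0 : 0 < y) by apply exp_pos.
  assert (SM : small2 (fun k => gz A dl k * (y ^ k + y ^ k)) (42 * kap)).
  { intros k. destruct k as [|k].
    - unfold gz. rewrite (hh_0 A dl kap d H). simpl. unfold Rdiv. rewrite !Rmult_0_r, !Rmult_0_l, Rabs_R0. lra.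
    - assert (Y : 0 <= y ^ S k <= kap).
      { split; [apply pow_le; lra|]. simpl. assert (y ^ k <= 1) by (rewrite <- (pow1 k); apply pow_incr; lra).
        assert (0 <= y ^ k) by (apply pow_le; lra). nra. }
      rewrite Rabs_mult, (Rabs_pos_eq (y ^ S k + _)) by lra.
      assert (Q := hh_le A dl kap d (S k) HA H). assert (I2 := INR_sq_ge1 k).
      assert (G : Rabs (gz A dl (S k)) <= 21 * (2/3) ^ S k).
      { unfold gz. eapply Rle_trans; [apply Rabs_div_nat|]. rewrite Rabs_mult, (Rabs_pos_eq A) by lra.
        generalize (Rabs_pos (hh A dl (S k))). nra. }
      set (q := (2/3) ^ S k) in *. assert (0 < q) by (apply pow_lt; lra).
      apply Rle_trans with (21 * q * (2 * kap)); [apply Rmult_le_compat; try lra; apply Rabs_pos|].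
      replace (42 * kap * (INR (S k) ^ 2 * q)) with (21 * q * (2 * kap) * INR (S k) ^ 2) by ring.
      rewrite <- (Rmult_1_r (21 * q * (2 * kap))) at 1. apply Rmult_le_compat_l; [apply Rmult_le_pos; lra|lra]. }
  destruct (small_sin _ _ al SM) as [X B].
  replace (al + Series _ - al) with (Series (fun k => gz A dl k * (y ^ k + y ^ k) * sin (INR k * al))) by ring.
  eapply Rle_trans; [exact B|]. apply Rmult_le_compat_r; [apply Rabs_pos|].
  assert (0 <= kap * S3) by (apply Rmult_le_pos; [lra|apply S3_pos]). lra.
Qed.

Lemma Zh2_top A dl kap d al : 0 <= A <= 23/50 -> near_crapper d dl kap ->
  Rabs (Re (Zh2 d A dl (al, d)) - 4 * A * sin al * ((1 + A * A) ^ 2 - 2 * A * (1 + A * A) * cos al - 8 * A * A) / cr_den A al ^ 3)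
    <= A / 2000 * Rabs (sin al).
Proof.
  intros HA H. assert (Hk := H). destruct Hk as [Hd [K1 [K2 [K3 [K4 K5]]]]].
  assert (Gh : geoB (fun k => A * hh A dl k)) by (apply geoB_scal; exists 21; intros; apply (hh_le A dl kap d); assumption).
  assert (Ek : kc (kc (gz A dl)) = fun k => INR k * (A * hh A dl k)).
  { apply functional_extensionality. intros k. unfold kc at 1. rewrite (kc_gz A dl kap d k H). reflexivity. }
  set (y := yy d d).
  assert (SM : small2 (fun k => INR k * (dl k + hh A dl k * y ^ k)) (22 * kap)).
  { intros k. destruct k as [|k].
    - simpl. rewrite Rmult_0_l, Rabs_R0. lra.
    - rewrite Rabs_mult, (Rabs_pos_eq (INR (S k))) by apply pos_INR.
      assert (Y := yy_pow_le d dl kap k H). fold y in Y.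
      assert (Q := hh_le A dl kap d (S k) HA H). assert (P := K5 (S k)).
      set (q := (2/3) ^ S k) in *. assert (0 < q) by (apply pow_lt; lra).
      assert (R1 : Rabs (dl (S k) + hh A dl (S k) * y ^ S k) <= 22 * kap * q).
      { eapply Rle_trans; [apply Rabs_triang|]. rewrite Rabs_mult, (Rabs_pos_eq (y ^ S k)) by lra.
        assert (Rabs (hh A dl (S k)) * y ^ S k <= 21 * q * kap) by (apply Rmult_le_compat; try lra; apply Rabs_pos). lra. }
      assert (I : INR (S k) <= INR (S k) ^ 2) by (rewrite <- (pow_1 (INR (S k))) at 1; apply pow_nat_mono; lia).
      replace (22 * kap * (INR (S k) ^ 2 * q)) with (INR (S k) ^ 2 * (22 * kap * q)) by ring.
      apply Rmult_le_compat; [apply pos_INR|apply Rabs_pos|assumption|assumption]. }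
  destruct (small_sin _ _ al SM) as [X B].
  assert (Cn := crapper_nh_sin A al HA).
  assert (E : Re (Zh2 d A dl (al, d)) = - (A * (-4 * sin al * ((1 + A * A) ^ 2 - 2 * A * (1 + A * A) * cos al - 8 * A * A) / cr_den A al ^ 3)
     + A * Series (fun k => INR k * (dl k + hh A dl k * y ^ k) * sin (INR k * al)))).
  { unfold Zh2. replace (Re (RtoC 0 + - csn (cd d (kc (kc (gz A dl)))) (al, d))%C) with (- Re (csn (cd d (kc (kc (gz A dl)))) (al, d)))
      by (unfold Re; simpl; ring).
    rewrite csn_re; [|rewrite <- !kc_cd; apply okc_kc, okc_kc, (okc_gz A dl kap d); assumption|apply Rlt_le, abs_T; lra].
    rewrite xx_top, Ek. fold y. f_equal.
    rewrite <- (is_series_unique _ _ Cn), <- !Series_scal_l, <- Series_plus.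
    - apply Series_ext. intros k. unfold hh. rewrite pow1. ring.
    - apply ex_series_scalR. eexists; eassumption.
    - apply ex_series_scalR, X. }
  rewrite E. set (Q := Series _) in *.
  match goal with |- Rabs ?z <= _ => replace z with (- (A * Q)) by (unfold Rdiv; ring) end.
  rewrite Rabs_Ropp, Rabs_mult, (Rabs_pos_eq A) by lra.
  replace (A / 2000 * Rabs (sin al)) with (A * (1/2000 * Rabs (sin al))) by field. apply Rmult_le_compat_l; [lra|].
  eapply Rle_trans; [exact B|]. apply Rmult_le_compat_r; [apply Rabs_pos|lra].
Qed.

(** * Sign conditions on the axes and on the surface *)

Lemma div_ge a b c : 0 < c -> a * c <= b -> a <= b / c.
Proof. intros H1 H2. apply (Rle_div_r a b c); assumption. Qed.
Lemma div_le a b c : 0 < c -> a <= b * c -> a / c <= b.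
Proof. intros H1 H2. apply (Rle_div_l a b c); assumption. Qed.

(** On the axis the main term is the square of [(1 - a) / (1 + a)], at least 1296/10000 for
    [a <= 23/50], against an error of 1/100. *)
Lemma Zh1_re_0 A dl kap d t : 0 <= A <= 23/50 -> near_crapper d dl kap -> 0 <= t <= d -> 0 < Re (Zh1 d A dl (0, t)).
Proof.
  intros HA H Ht. assert (B := Zh1_re_eq A dl kap d 0 t HA H Ht).
  destruct (xx_bounds d t Ht) as [y0 [y1 [x1 [y2 [x0 _]]]]].
  rewrite cos_0 in B. unfold cr_den in B. rewrite cos_0 in B. set (a := A * xx d t) in *.
  assert (Ha : 0 <= a <= 23/50) by (unfold a; nra). clearbody a.
  replace (1 + a * (-4 * ((1 + a * a) * 1 + 2 * a) / (1 + 2 * a * 1 + a * a) ^ 2)) with (((1 - a) / (1 + a)) ^ 2) in B by (field; repeat split; nra).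
  assert (36/100 <= (1 - a) / (1 + a)) by (apply div_ge; lra).
  assert (1296/10000 <= ((1 - a) / (1 + a)) ^ 2) by nra. apply Rabs_le_between in B. lra.
Qed.

Lemma Zh1_re_pi A dl kap d t : 0 <= A <= 23/50 -> near_crapper d dl kap -> 0 <= t <= d -> 0 < Re (Zh1 d A dl (PI, t)).
Proof.
  intros HA H Ht. assert (B := Zh1_re_eq A dl kap d PI t HA H Ht).
  destruct (xx_bounds d t Ht) as [y0 [y1 [x1 [y2 [x0 _]]]]].
  rewrite cos_PI in B. unfold cr_den in B. rewrite cos_PI in B. set (a := A * xx d t) in *.
  assert (Ha : 0 <= a <= 23/50) by (unfold a; nra). clearbody a.
  replace (1 + a * (-4 * ((1 + a * a) * -1 + 2 * a) / (1 + 2 * a * -1 + a * a) ^ 2)) with (((1 + a) / (1 - a)) ^ 2) in B by (field; repeat split; nra).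
  assert (1 <= (1 + a) / (1 - a)) by (apply div_ge; lra).
  assert (1 <= ((1 + a) / (1 - a)) ^ 2) by nra. apply Rabs_le_between in B. lra.
Qed.

Lemma Zh_bot_lt A dl kap d al : 0 <= A <= 23/50 -> near_crapper d dl kap -> 0 < al < PI -> Re (Zh d A dl (al, 0)) < PI.
Proof.
  intros HA H Hal. assert (B := Zh_bot_x A dl kap d al HA H).
  assert (S : 0 < sin al) by (apply sin_gt_0; lra). rewrite (Rabs_pos_eq (sin al)) in B by lra.
  assert (sin al <= PI - al).
  { rewrite <- sin_PI_x. apply Rlt_le, sin_lt_x. lra. }
  apply Rabs_le_between in B. lra.
Qed.

Lemma fact_INR n : INR (fact (S n)) = INR (S n) * INR (fact n).
Proof. rewrite fact_simpl, mult_INR. reflexivity. Qed.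

Lemma sin_up x : 0 <= x <= 4 -> sin x <= x - x^3/6 + x^5/120 - x^7/5040 + x^9/362880.
Proof.
  intros H. assert (K := proj2 (pre_sin_bound x 1 (proj1 H) (proj2 H))).
  eapply Rle_trans; [exact K|]. apply Req_le. unfold sin_approx, sin_term.
  cbn [sum_f_R0 Nat.mul Nat.add]. rewrite !fact_INR. simpl INR. simpl pow. field.
Qed.
Lemma cos_low x : -2 <= x <= 2 -> 1 - x^2/2 + x^4/24 - x^6/720 <= cos x.
Proof.
  intros H. assert (K := proj1 (pre_cos_bound x 1 (proj1 H) (proj2 H))).
  eapply Rle_trans; [|exact K]. apply Req_le. unfold cos_approx, cos_term.
  cbn [sum_f_R0 Nat.mul Nat.add]. rewrite !fact_INR. simpl INR. simpl pow. field.
Qed.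
Lemma cos_up x : -2 <= x <= 2 -> cos x <= 1 - x^2/2 + x^4/24 - x^6/720 + x^8/40320.
Proof.
  intros H. assert (K := proj2 (pre_cos_bound x 1 (proj1 H) (proj2 H))).
  eapply Rle_trans; [exact K|]. apply Req_le. unfold cos_approx, cos_term.
  cbn [sum_f_R0 Nat.mul Nat.add]. rewrite !fact_INR. simpl INR. simpl pow. field.
Qed.

Lemma PI_up : PI < 316/100.
Proof.
  assert (C : cos (158/100) < 0) by (eapply Rle_lt_trans; [apply cos_up; lra|lra]).
  apply Rnot_le_lt. intros N. assert (0 <= cos (158/100)); [|lra]. apply cos_ge_0; lra.
Qed.
Lemma PI_low : 3 < PI.
Proof. generalize PI2_3_2. lra. Qed.

(** Taylor polynomials in [u = al^2] with one factor [al] divided out. 32041/10000 is the square of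
    179/100, and 12111/10000 is [1 + (23/50)^2] less the margin 5/10000. *)
Lemma crapper_margin u : 0 <= u <= 32041/10000 ->
  0 < 12111/10000 + 92/100 * (1 - u/2 + u^2/24 - u^3/720) - 184/100 * (1 - u/6 + u^2/120 - u^3/5040 + u^4/362880).
Proof.
  intros H.
  assert (u ^ 3 <= 32041/10000 * u ^ 2) by (simpl; nra).
  assert (u ^ 4 <= 32041/10000 * (32041/10000) * u ^ 2) by (simpl; nra). simpl in *. nra.
Qed.

(** [4 A / cr_den A al] increases with [A], because [(B - A) (1 - A B) >= 0] for [B = 23/50]. Only
    the largest amplitude remains to be checked, and there Taylor polynomials decide. *)
Lemma Zh_top_pos A dl kap d al : 0 <= A <= 23/50 -> near_crapper d dl kap -> 0 < al <= 179/100 -> 0 < Re (Zh d A dl (al, d)).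
Proof.
  intros HA H Hal. assert (B := Zh_top_x A dl kap d al HA H).
  assert (P3 := PI_low). assert (S : 0 < sin al) by (apply sin_gt_0; lra). rewrite (Rabs_pos_eq (sin al)) in B by lra.
  assert (D := cr_den_ge A al HA). assert (CB := COS_bound al).
  assert (Sx : sin al < al) by (apply sin_lt_x; lra).
  set (E := 12116/10000 + 92/100 * cos al).
  assert (HE : 29/100 <= E) by (unfold E; lra).
  assert (M : 4 * A * sin al / cr_den A al <= 184/100 * sin al / E).
  { replace (4 * A * sin al / cr_den A al) with (sin al * (4 * A / cr_den A al)) by (field; lra).
    replace (184/100 * sin al / E) with (sin al * ((184/100) / E)) by (field; lra).
    apply Rmult_le_compat_l; [lra|]. apply div_le; [lra|].
    replace (184 / 100 / E * cr_den A al) with (184/100 * cr_den A al / E) by (field; lra).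
    apply div_ge; [lra|]. unfold E, cr_den.
    assert (0 <= (23/50 - A) * (1 - 23/50 * A)) by (apply Rmult_le_pos; lra). nra. }
  assert (K : 184/100 * sin al < al * (E - 5/10000)).
  { assert (S1 := sin_up al ltac:(lra)). assert (C1 := cos_low al ltac:(lra)).
    assert (Mg := crapper_margin (al * al) ltac:(nra)).
    apply Rle_lt_trans with (184/100 * (al - al^3/6 + al^5/120 - al^7/5040 + al^9/362880)); [lra|].
    apply Rlt_le_trans with (al * (12111/10000 + 92/100 * (1 - al^2/2 + al^4/24 - al^6/720))).
    - assert (0 < al * (12111/10000 + 92/100 * (1 - al*al/2 + (al*al)^2/24 - (al*al)^3/720) - 184/100 * (1 - al*al/6 + (al*al)^2/120 - (al*al)^3/5040 + (al*al)^4/362880))).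
      { apply Rmult_lt_0_compat; lra. }
      apply (proj1 (Rlt_0_minus _ _)). eapply Rlt_le_trans; [exact H0|]. apply Req_le. field.
    - apply Rmult_le_compat_l; [lra|]. unfold E. lra. }
  assert (K2 : 184/100 * sin al / E < al - al * (5/10000) / E).
  { apply (Rmult_lt_reg_r E); [lra|]. unfold Rdiv. rewrite Rmult_minus_distr_r.
    rewrite !Rmult_assoc, !(Rmult_comm (/ E)), Rinv_r by lra. rewrite !Rmult_assoc in *. lra. }
  assert (K3 : al * (233/1000000) <= al * (5/10000) / E).
  { apply div_ge; [lra|]. rewrite Rmult_assoc. apply Rmult_le_compat_l; [lra|]. unfold E. lra. }
  assert (A / 2000 * sin al <= 23/100000 * al) by (apply Rmult_le_compat; lra).
  apply Rabs_le_between in B. lra.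
Qed.

(** 179/100 splits the half period: to its left [Zh_top_pos] keeps the profile off the axis, to its
    right [cos al <= - 217/1000] makes the horizontal coordinate strictly convex in [al]. *)
Lemma Zh2_top_pos A dl kap d al : 0 < A <= 23/50 -> near_crapper d dl kap -> 179/100 <= al < PI -> 0 < Re (Zh2 d A dl (al, d)).
Proof.
  intros HA H Hal. assert (HA' : 0 <= A <= 23/50) by lra. assert (B := Zh2_top A dl kap d al HA' H).
  assert (S : 0 < sin al) by (apply sin_gt_0; lra). rewrite (Rabs_pos_eq (sin al)) in B by lra.
  assert (D := cr_den_ge A al HA').
  assert (Hc : cos al <= - (217/1000)).
  { apply Rle_trans with (cos (179/100)).
    - destruct (Req_dec al (179/100)) as [->|N]; [lra|]. apply Rlt_le, cos_decreasing_1; lra.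
    - eapply Rle_trans; [apply cos_up; lra|]. lra. }
  assert (CB := COS_bound al).
  assert (K : 1/100 <= (1 + A * A) ^ 2 - 2 * A * (1 + A * A) * cos al - 8 * A * A).
  { assert (A * A <= 529/2500) by nra.
    assert (0 <= 2 * A * (1 + A * A)) by nra.
    assert (2 * A * (1 + A * A) * (217/1000) <= - (2 * A * (1 + A * A) * cos al)) by nra.
    assert (1/100 <= (1 + A * A) ^ 2 + 2 * A * (1 + A * A) * (217/1000) - 8 * A * A); [|lra].
    assert (0 <= (23/50 - A)) by lra. simpl. nra. }
  assert (D3 : 0 < cr_den A al ^ 3 <= 10).
  { split; [apply pow_lt; lra|]. apply Rle_trans with ((214/100) ^ 3); [apply pow_incr; lra|lra]. }
  assert (M : A * sin al * (4/1000) <= 4 * A * sin al * ((1 + A * A) ^ 2 - 2 * A * (1 + A * A) * cos al - 8 * A * A) / cr_den A al ^ 3).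
  { set (q := (1 + A * A) ^ 2 - _ - _) in *.
    apply div_ge; [lra|].
    assert (0 < A * sin al) by (apply Rmult_lt_0_compat; lra). set (v := A * sin al) in *.
    replace (4 * A * sin al * q) with (v * (4 * q)) by (unfold v; ring). rewrite Rmult_assoc.
    apply Rmult_le_compat_l; lra. }
  apply Rabs_le_between in B. assert (0 < A * sin al) by (apply Rmult_lt_0_compat; lra). lra.
Qed.

(** An angle with explicit sine and cosine at which the profile of largest amplitude has crossed the
    axis: the explicit wave has [x] close to -0.026 there, far beyond the perturbation. *)
Lemma Zh_top_neg dl kap d : near_crapper d dl kap -> Re (Zh d (23/50) dl (2 * PI / 3, d)) < 0.
Proof.
  intros H. assert (B := Zh_top_x (23/50) dl kap d (2 * PI / 3) ltac:(lra) H).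
  assert (E1 : sin (2 * PI / 3) = sqrt 3 / 2) by (transitivity (sin (2 * (PI / 3))); [f_equal; field|apply sin_2PI3]).
  assert (E2 : cos (2 * PI / 3) = - (1/2)) by (transitivity (cos (2 * (PI / 3))); [f_equal; field|rewrite cos_2PI3; field]).
  unfold cr_den in B. rewrite E1, E2 in B.
  replace (1 + 2 * (23 / 50) * - (1 / 2) + 23 / 50 * (23 / 50)) with (1879/2500) in B by field.
  assert (S3' : 173/100 <= sqrt 3 <= 2).
  { split.
    - rewrite <- (sqrt_Rsqr (173/100)) by lra. apply sqrt_le_1_alt. unfold Rsqr. lra.
    - rewrite <- (sqrt_Rsqr 2) by lra. apply sqrt_le_1_alt. unfold Rsqr. lra. }
  assert (P := PI_up). rewrite (Rabs_pos_eq (sqrt 3 / 2)) in B by lra.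
  apply Rabs_le_between in B. lra.
Qed.

(** * Inverse functions and the stream function *)

(** Pointwise form of [hol], for maps such as [pre] that are controlled only near each single
    point. *)
Definition quad (f : C -> C) (b l : C) : Prop := exists K dl, 0 <= K /\ 0 < dl <= 1 /\
  forall b', Cmod (b' - b)%C < dl -> Cmod (f b' - f b - l * (b' - b))%C <= K * Cmod (b' - b)%C ^ 2.

Lemma quad_hol f f' T b : hol f f' T -> Rabs (Im b) < T -> quad f b (f' b).
Proof.
  intros [K [K0 H]] Hb. exists K, (Rmin 1 (T - Rabs (Im b))). split; [assumption|].
  split; [split; [apply Rmin_glb_lt; lra|apply Rmin_l]|].
  intros b' Hb'. apply H; [assumption|]. apply (strip_nbhd b T Hb). eapply Rlt_le_trans; [exact Hb'|apply Rmin_r].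
Qed.

Lemma quad_lip f b l : quad f b l -> exists L dl, 0 <= L /\ 0 < dl <= 1 /\
  forall b', Cmod (b' - b)%C < dl -> Cmod (f b' - f b)%C <= L * Cmod (b' - b)%C.
Proof.
  intros [K [dl [K0 [D H]]]]. exists (K + Cmod l), dl. split; [generalize (Cmod_ge_0 l); lra|]. split; [assumption|].
  intros b' Hb'. specialize (H b' Hb').
  replace (f b' - f b)%C with ((f b' - f b - l * (b' - b)) + l * (b' - b))%C by ring.
  eapply Rle_trans; [apply Cmod_triangle|]. rewrite Cmod_mult.
  assert (P := Cmod_ge_0 (b' - b)%C). set (m := Cmod (b' - b)%C) in *. simpl in H. rewrite Rmult_1_r in H.
  assert (K * (m * m) <= K * m) by (apply Rmult_le_compat_l; [assumption|nra]). lra.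
Qed.

Lemma quad_mult f g b lf lg : quad f b lf -> quad g b lg -> quad (fun x => f x * g x)%C b (lf * g b + f b * lg)%C.
Proof.
  intros Hf Hg. destruct (quad_lip _ _ _ Hf) as [L [dL [L0 [DL HL]]]].
  destruct Hf as [K [dK [K0 [DK HK]]]], Hg as [M [dM [M0 [DM HM]]]].
  exists ((Cmod (f b) + L) * M + K * Cmod (g b) + L * Cmod lg), (Rmin dL (Rmin dK dM)).
  assert (P1 := Cmod_ge_0 (f b)). assert (P2 := Cmod_ge_0 (g b)). assert (P3 := Cmod_ge_0 lg).
  split; [assert (0 <= (Cmod (f b) + L) * M) by (apply Rmult_le_pos; lra); assert (0 <= K * Cmod (g b)) by (apply Rmult_le_pos; lra);
    assert (0 <= L * Cmod lg) by (apply Rmult_le_pos; lra); lra|].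
  split; [split; [repeat apply Rmin_glb_lt; lra|eapply Rle_trans; [apply Rmin_l|lra]]|].
  intros b' Hb'. assert (H1 := Rmin_l dL (Rmin dK dM)). assert (H2 := Rmin_r dL (Rmin dK dM)).
  assert (H3 := Rmin_l dK dM). assert (H4 := Rmin_r dK dM).
  specialize (HL b' ltac:(lra)). specialize (HK b' ltac:(lra)). specialize (HM b' ltac:(lra)).
  replace (f b' * g b' - f b * g b - (lf * g b + f b * lg) * (b' - b))%C with
    (f b' * (g b' - g b - lg * (b' - b)) + (f b' - f b - lf * (b' - b)) * g b + (f b' - f b) * (lg * (b' - b)))%C by ring.
  assert (Hfb : Cmod (f b') <= Cmod (f b) + L).
  { replace (f b') with (f b + (f b' - f b))%C by ring. eapply Rle_trans; [apply Cmod_triangle|].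
    assert (P := Cmod_ge_0 (b' - b)%C). assert (L * Cmod (b' - b)%C <= L * 1) by (apply Rmult_le_compat_l; lra). lra. }
  eapply Rle_trans; [apply Cmod_triangle|].
  eapply Rle_trans; [apply Rplus_le_compat_r, Cmod_triangle|]. rewrite !Cmod_mult.
  assert (P := Cmod_ge_0 (b' - b)%C). set (m := Cmod (b' - b)%C) in *.
  assert (A1 : Cmod (f b') * Cmod (g b' - g b - lg * (b' - b))%C <= (Cmod (f b) + L) * (M * m ^ 2)).
  { apply Rmult_le_compat; auto using Cmod_ge_0. }
  assert (A2 : Cmod (f b' - f b - lf * (b' - b))%C * Cmod (g b) <= K * m ^ 2 * Cmod (g b)) by (apply Rmult_le_compat_r; auto).
  assert (A3 : Cmod (f b' - f b)%C * (Cmod lg * m) <= L * m * (Cmod lg * m)).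
  { apply Rmult_le_compat_r; [apply Rmult_le_pos; assumption|assumption]. }
  simpl in *. lra.
Qed.

Lemma quad_inv f b l : quad f b l -> f b <> RtoC 0 -> quad (fun x => / f x)%C b (- l / (f b * f b))%C.
Proof.
  intros Hf Hn. destruct (quad_lip _ _ _ Hf) as [L [dL [L0 [DL HL]]]].
  destruct Hf as [K [dK [K0 [DK HK]]]]. set (c := Cmod (f b)). assert (Hc : 0 < c) by (apply Cmod_gt_0; exact Hn).
  assert (D2 : 0 < c / (2 * (L + 1))) by (apply Rdiv_lt_0_compat; lra).
  exists (K / (c * c) + L * L * 2 / (c * c * c)), (Rmin dL (Rmin dK (c / (2 * (L + 1))))).
  assert (cc : 0 < c * c) by nra. assert (ccc : 0 < c * c * c) by nra.
  split. { assert (0 <= K / (c * c)) by (apply Rmult_le_pos; [lra|apply Rlt_le, Rinv_0_lt_compat; lra]).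
    assert (0 <= L * L * 2 / (c * c * c)) by (apply Rmult_le_pos; [nra|apply Rlt_le, Rinv_0_lt_compat; lra]). lra. }
  split; [split; [repeat apply Rmin_glb_lt; lra|eapply Rle_trans; [apply Rmin_l|lra]]|].
  intros b' Hb'. assert (H1 := Rmin_l dL (Rmin dK (c / (2 * (L + 1))))). assert (H2 := Rmin_r dL (Rmin dK (c / (2 * (L + 1))))).
  assert (H3 := Rmin_l dK (c / (2 * (L + 1)))). assert (H4 := Rmin_r dK (c / (2 * (L + 1)))).
  specialize (HL b' ltac:(lra)). specialize (HK b' ltac:(lra)).
  assert (P := Cmod_ge_0 (b' - b)%C).
  assert (Lm : L * Cmod (b' - b)%C <= c / 2).
  { assert (Cmod (b' - b)%C * (2 * (L + 1)) <= c).
    { apply Rlt_le. apply (Rmult_lt_reg_r (/ (2 * (L + 1)))); [apply Rinv_0_lt_compat; lra|].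
      rewrite Rmult_assoc, Rinv_r, Rmult_1_r by lra. unfold Rdiv in H4. lra. } nra. }
  assert (Hfb : c / 2 <= Cmod (f b')).
  { assert (c <= Cmod (f b') + Cmod (f b' - f b)%C); [|lra]. unfold c.
    replace (f b) with (f b' + - (f b' - f b))%C at 1 by ring. eapply Rle_trans; [apply Cmod_triangle|].
    rewrite Cmod_opp. lra. }
  assert (Hn' : f b' <> RtoC 0) by (intro E; rewrite E, Cmod_0 in Hfb; lra).
  replace (/ f b' - / f b - - l / (f b * f b) * (b' - b))%C with
    (- (f b' - f b - l * (b' - b)) / (f b * f b) + (f b' - f b) * (f b' - f b) / (f b * f b * f b'))%C.
  2: { field. split; assumption. }
  eapply Rle_trans; [apply Cmod_triangle|].
  rewrite !Cmod_div by (try (apply Cmult_neq_0; [apply Cmult_neq_0|]; assumption); try (apply Cmult_neq_0; assumption)).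
  rewrite Cmod_opp, !Cmod_mult. fold c. set (m := Cmod (b' - b)%C) in *. set (v := Cmod (f b' - f b)%C) in *.
  set (u := Cmod (f b' - f b - l * (b' - b))%C) in *. set (q := Cmod (f b')) in *.
  rewrite Rmult_plus_distr_r. apply Rplus_le_compat.
  - replace (K / (c * c) * m ^ 2) with (K * m ^ 2 / (c * c)) by (field; lra).
    apply Rmult_le_compat_r; [apply Rlt_le, Rinv_0_lt_compat; lra|assumption].
  - replace (L * L * 2 / (c * c * c) * m ^ 2) with ((L * m) * (L * m) * / (c * c * (c / 2))) by (field; lra).
    assert (0 <= v) by apply Cmod_ge_0. assert (0 < c * c * (c / 2)) by (apply Rmult_lt_0_compat; lra).
    apply Rmult_le_compat.
    + nra.
    + apply Rlt_le, Rinv_0_lt_compat. apply Rmult_lt_0_compat; lra.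
    + apply Rmult_le_compat; assumption.
    + apply Rinv_le_contravar; [assumption|]. apply Rmult_le_compat_l; lra.
Qed.

Lemma quad_comp f g b lf lg : quad f (g b) lf -> quad g b lg -> quad (fun x => f (g x)) b (lf * lg)%C.
Proof.
  intros Hf Hg. destruct (quad_lip _ _ _ Hg) as [L [dL [L0 [DL HL]]]].
  destruct Hf as [K [dK [K0 [DK HK]]]], Hg as [M [dM [M0 [DM HM]]]].
  assert (D2 : 0 < dK / (L + 1)) by (apply Rdiv_lt_0_compat; lra).
  exists (K * (L * L) + Cmod lf * M), (Rmin dL (Rmin dM (dK / (L + 1)))).
  assert (P1 := Cmod_ge_0 lf).
  split; [assert (0 <= K * (L * L)) by (apply Rmult_le_pos; nra); nra|].
  split; [split; [repeat apply Rmin_glb_lt; lra|eapply Rle_trans; [apply Rmin_l|lra]]|].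
  intros b' Hb'. assert (H1 := Rmin_l dL (Rmin dM (dK / (L + 1)))). assert (H2 := Rmin_r dL (Rmin dM (dK / (L + 1)))).
  assert (H3 := Rmin_l dM (dK / (L + 1))). assert (H4 := Rmin_r dM (dK / (L + 1))).
  specialize (HL b' ltac:(lra)). specialize (HM b' ltac:(lra)).
  assert (P := Cmod_ge_0 (b' - b)%C).
  assert (S : Cmod (g b' - g b)%C < dK).
  { eapply Rle_lt_trans; [exact HL|].
    assert (Cmod (b' - b)%C * (L + 1) < dK).
    { apply (Rmult_lt_reg_r (/ (L + 1))); [apply Rinv_0_lt_compat; lra|].
      rewrite Rmult_assoc, Rinv_r, Rmult_1_r by lra. unfold Rdiv in H4. lra. } nra. }
  specialize (HK _ S).
  replace (f (g b') - f (g b) - lf * lg * (b' - b))%C with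
   ((f (g b') - f (g b) - lf * (g b' - g b)) + lf * (g b' - g b - lg * (b' - b)))%C by ring.
  eapply Rle_trans; [apply Cmod_triangle|]. rewrite Cmod_mult. set (m := Cmod (b' - b)%C) in *.
  set (v := Cmod (g b' - g b)%C) in *. assert (0 <= v) by apply Cmod_ge_0.
  assert (v ^ 2 <= L * L * m ^ 2) by (simpl; nra).
  assert (K * v ^ 2 <= K * (L * L * m ^ 2)) by (apply Rmult_le_compat_l; assumption).
  assert (Cmod lf * Cmod (g b' - g b - lg * (b' - b))%C <= Cmod lf * (M * m ^ 2)) by (apply Rmult_le_compat_l; assumption).
  lra.
Qed.

Lemma quad_der f b l : quad f b l -> is_derive f b l.
Proof. intros [K [dl [K0 [D H]]]]. apply (quad_is_derive f b l K dl); [lra|assumption|assumption]. Qed.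

Lemma Cmod_pair_x x y a : Cmod ((x, y) - (a, y))%C = Rabs (x - a).
Proof. replace ((x, y) - (a, y))%C with (RtoC (x - a)) by (unfold RtoC, Cminus, Cplus, Copp; simpl; f_equal; ring). apply Cmod_R. Qed.
Lemma Cmod_pair_y x y a : Cmod ((x, y) - (x, a))%C = Rabs (y - a).
Proof.
  replace ((x, y) - (x, a))%C with (RtoC (y - a) * Ci)%C by (unfold RtoC, Ci, Cminus, Cplus, Copp, Cmult; simpl; f_equal; ring).
  rewrite Cmod_R_mult. replace (Cmod Ci) with 1; [ring|]. unfold Cmod, Ci; simpl. rewrite <- sqrt_1 at 1. f_equal. ring.
Qed.

Lemma quad_part f x y l : quad f (x, y) l ->
  is_derive (fun u => Re (f (u, y))) x (Re l) /\ is_derive (fun u => Im (f (u, y))) x (Im l) /\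
  is_derive (fun u => Re (f (x, u))) y (- Im l) /\ is_derive (fun u => Im (f (x, u))) y (Re l).
Proof.
  intros [K [dl [K0 [D H]]]].
  assert (Hx : forall u, Rabs (u - x) < dl -> Cmod (f (u, y) - f (x, y) - l * ((u, y) - (x, y)))%C <= K * (u - x) ^ 2).
  { intros u Hu. specialize (H (u, y)). rewrite Cmod_pair_x, pow2_abs in H. auto. }
  assert (Hy : forall u, Rabs (u - y) < dl -> Cmod (f (x, u) - f (x, y) - l * ((x, u) - (x, y)))%C <= K * (u - y) ^ 2).
  { intros u Hu. specialize (H (x, u)). rewrite Cmod_pair_y, pow2_abs in H. auto. }
  split; [|split; [|split]]; apply quad_real with (K := K) (dl := dl); try lra; intros u Hu.
  - eapply Rle_trans; [|apply (Hx u Hu)]. eapply Rle_trans; [|apply Re_le_Cmod]. apply Req_le. f_equal. unfold Re; simpl; ring.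
  - eapply Rle_trans; [|apply (Hx u Hu)]. eapply Rle_trans; [|apply Im_le_Cmod]. apply Req_le. f_equal. unfold Im; simpl; ring.
  - eapply Rle_trans; [|apply (Hy u Hu)]. eapply Rle_trans; [|apply Re_le_Cmod]. apply Req_le. f_equal. unfold Re, Im; simpl; ring.
  - eapply Rle_trans; [|apply (Hy u Hu)]. eapply Rle_trans; [|apply Im_le_Cmod]. apply Req_le. f_equal. unfold Re, Im; simpl; ring.
Qed.

Lemma hol_dx_re f f' T a t : hol f f' T -> Rabs t < T -> is_derive (fun x => Re (f (x, t))) a (Re (f' (a, t))).
Proof. intros H Ht. exact (proj1 (quad_part f a t _ (quad_hol f f' T (a, t) H Ht))). Qed.
Lemma hol_dx_im f f' T a t : hol f f' T -> Rabs t < T -> is_derive (fun x => Im (f (x, t))) a (Im (f' (a, t))).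
Proof. intros H Ht. exact (proj1 (proj2 (quad_part f a t _ (quad_hol f f' T (a, t) H Ht)))). Qed.
Lemma hol_dy_re f f' T a t : hol f f' T -> Rabs t < T -> is_derive (fun y => Re (f (a, y))) t (- Im (f' (a, t))).
Proof. intros H Ht. exact (proj1 (proj2 (proj2 (quad_part f a t _ (quad_hol f f' T (a, t) H Ht))))). Qed.
Lemma hol_dy_im f f' T a t : hol f f' T -> Rabs t < T -> is_derive (fun y => Im (f (a, y))) t (Re (f' (a, t))).
Proof. intros H Ht. exact (proj2 (proj2 (proj2 (quad_part f a t _ (quad_hol f f' T (a, t) H Ht))))). Qed.

Definition ccont (f : C -> C) (b : C) : Prop :=
  forall eps, 0 < eps -> exists dl, 0 < dl /\ forall b', Cmod (b' - b)%C < dl -> Cmod (f b' - f b)%C < eps.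

Lemma quad_ccont f b l : quad f b l -> ccont f b.
Proof.
  intros H eps He. destruct (quad_lip _ _ _ H) as [L [dL [L0 [DL HL]]]].
  assert (0 < eps / (L + 1)) by (apply Rdiv_lt_0_compat; lra).
  exists (Rmin dL (eps / (L + 1))). split; [apply Rmin_glb_lt; lra|]. intros b' Hb'.
  assert (H1 := Rmin_l dL (eps / (L + 1))). assert (H2 := Rmin_r dL (eps / (L + 1))).
  eapply Rle_lt_trans; [apply HL; lra|]. assert (P := Cmod_ge_0 (b' - b)%C).
  assert (Cmod (b' - b)%C * (L + 1) < eps).
  { apply (Rmult_lt_reg_r (/ (L + 1))); [apply Rinv_0_lt_compat; lra|].
    rewrite Rmult_assoc, Rinv_r, Rmult_1_r by lra. unfold Rdiv in H2. lra. } nra.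
Qed.

Lemma ccont_filterlim f b : ccont f b -> filterlim f (locally b) (locally (f b)).
Proof.
  intros H P HP. apply locally_C_inv in HP. destruct HP as [e [He HP]].
  destruct (H e He) as [dl [D Hd]]. apply (locally_C_ex b _ dl D). intros b' Hb'. apply HP, Hd, Hb'.
Qed.
Lemma ccont_re f b : ccont f b -> filterlim (fun x => Re (f x)) (locally b) (locally (Re (f b))).
Proof.
  intros H. apply filterlim_locally. intros eps. destruct (H eps (cond_pos eps)) as [dl [D Hd]].
  apply (locally_C_ex b _ dl D). intros b' Hb'. change (Rabs (Re (f b') - Re (f b)) < eps).
  eapply Rle_lt_trans; [|apply (Hd b' Hb')]. apply (Re_le_Cmod (f b' - f b)%C).
Qed.
Lemma ccont_im f b : ccont f b -> filterlim (fun x => Im (f x)) (locally b) (locally (Im (f b))).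
Proof.
  intros H. apply filterlim_locally. intros eps. destruct (H eps (cond_pos eps)) as [dl [D Hd]].
  apply (locally_C_ex b _ dl D). intros b' Hb'. change (Rabs (Im (f b') - Im (f b)) < eps).
  eapply Rle_lt_trans; [|apply (Hd b' Hb')]. apply (Im_le_Cmod (f b' - f b)%C).
Qed.
Lemma ccont_comp f g b : ccont g b -> ccont f (g b) -> ccont (fun x => f (g x)) b.
Proof.
  intros Hg Hf e He. destruct (Hf e He) as [d1 [D1 H1]]. destruct (Hg d1 D1) as [d2 [D2 H2]].
  exists d2. split; [assumption|]. auto.
Qed.

(* Open mapping by Newton iteration with frozen derivative. *)
Lemma open_map f f' f'' T b : hol f f' T -> hol f' f'' T -> Rabs (Im b) < T -> f' b <> RtoC 0 ->
  forall eps, 0 < eps -> exists dl, 0 < dl /\ forall q, Cmod (q - f b)%C < dl -> exists b', Cmod (b' - b)%C < eps /\ f b' = q.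
Proof.
  intros [K [K0 HK]] Hf' Hb Hn eps He. set (k := f' b). set (c := Cmod k). assert (Hc : 0 < c) by (apply Cmod_gt_0; exact Hn).
  assert (Q := quad_ccont _ _ _ (quad_hol _ _ _ _ Hf' Hb)). destruct (Q (c / 4)) as [d1 [D1 Hd1]]; [lra|].
  (* On the ball of radius [r] the iteration [N] contracts by 1/2: one half of this from the
     remainder, since [K * (2 * r) <= c / 4], the other from the variation of [f']. A first step
     below [r / 4] then keeps all iterates within [r / 2] of [b]. *)
  set (r := Rmin (Rmin d1 (eps / 2)) (Rmin ((T - Rabs (Im b)) / 2) (c / (8 * (K + 1))))).
  assert (Hr : 0 < r /\ r <= d1 /\ r <= eps / 2 /\ r <= (T - Rabs (Im b)) / 2 /\ r <= c / (8 * (K + 1))).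
  { assert (0 < c / (8 * (K + 1))) by (apply Rdiv_lt_0_compat; lra). unfold r.
    repeat split; [repeat apply Rmin_glb_lt; lra| | | |].
    - eapply Rle_trans; [apply Rmin_l|apply Rmin_l].
    - eapply Rle_trans; [apply Rmin_l|apply Rmin_r].
    - eapply Rle_trans; [apply Rmin_r|apply Rmin_l].
    - eapply Rle_trans; [apply Rmin_r|apply Rmin_r]. }
  clearbody r. destruct Hr as [r0 [r1 [r2 [r3 r4]]]].
  assert (r5 : K * (2 * r) <= c / 4).
  { assert (r * (8 * (K + 1)) <= c); [|nra].
    apply (Rmult_le_compat_r (8 * (K + 1))) in r4; [|lra]. unfold Rdiv in r4. rewrite Rmult_assoc, Rinv_l in r4 by lra. lra. }
  exists (c * r / 4). split; [nra|]. intros q Hq.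
  set (N x := (x + (q - f x) / k)%C).
  assert (Inr : forall x, Cmod (x - b)%C < r -> Rabs (Im x) < T).
  { intros x Hx. apply (strip_nbhd b T Hb). lra. }
  assert (LN : forall x y, Cmod (x - b)%C < r -> Cmod (y - b)%C < r -> Cmod (N x - N y)%C <= / 2 * Cmod (x - y)%C).
  { intros x y Hx Hy. specialize (HK y x (Inr y Hy) (Inr x Hx)). assert (Hy1 := Hd1 y ltac:(lra)).
    replace (N x - N y)%C with (- ((f x - f y - f' y * (x - y)) + (f' y - f' b) * (x - y)) / k)%C by (unfold N, k; field; exact Hn).
    rewrite Cmod_div by exact Hn. rewrite Cmod_opp. fold c.
    apply (Rmult_le_reg_r c); [assumption|]. unfold Rdiv. rewrite Rmult_assoc, Rinv_l, Rmult_1_r by lra.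
    eapply Rle_trans; [apply Cmod_triangle|]. rewrite Cmod_mult.
    assert (Hxy : Cmod (x - y)%C <= 2 * r).
    { replace (x - y)%C with ((x - b) + - (y - b))%C by ring. eapply Rle_trans; [apply Cmod_triangle|]. rewrite Cmod_opp. lra. }
    assert (P := Cmod_ge_0 (x - y)%C). set (m := Cmod (x - y)%C) in *. simpl in HK. rewrite Rmult_1_r in HK.
    assert (K * (m * m) <= c / 4 * m).
    { rewrite <- Rmult_assoc. apply Rmult_le_compat_r; [assumption|]. eapply Rle_trans; [|exact r5].
      apply Rmult_le_compat_l; assumption. }
    assert (Cmod (f' y - f' b)%C * m <= c / 4 * m) by (apply Rmult_le_compat_r; lra). lra. }
  set (X := fix X n := match n with O => b | S n => N (X n) end).
  assert (S0 : Cmod (X 1%nat - X 0%nat)%C < r / 4).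
  { simpl. replace (N b - b)%C with ((q - f b) / k)%C by (unfold N; ring). rewrite Cmod_div by exact Hn. fold c.
    apply (Rmult_lt_reg_r c); [assumption|]. unfold Rdiv. rewrite Rmult_assoc, Rinv_l, Rmult_1_r by lra. lra. }
  assert (SX : forall n, Cmod (X n - b)%C <= r / 2 * (1 - (/2) ^ n) /\ Cmod (X (S n) - X n)%C <= r / 4 * (/2) ^ n).
  { assert (Pn : forall n, 0 < (/2) ^ n) by (intros; apply pow_lt; lra).
    induction n as [|n [IH1 IH2]].
    - split; [simpl; replace (b - b)%C with (RtoC 0) by ring; rewrite Cmod_0; lra|]. simpl pow. lra.
    - assert (A1 : Cmod (X (S n) - b)%C <= r / 2 * (1 - (/2) ^ S n)).
      { replace (X (S n) - b)%C with ((X (S n) - X n) + (X n - b))%C by ring.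
        eapply Rle_trans; [apply Cmod_triangle|]. simpl pow. lra. }
      split; [exact A1|]. change (X (S (S n))) with (N (X (S n))). change (X (S n)) with (N (X n)) at 2.
      eapply Rle_trans; [apply LN|].
      + generalize (Pn (S n)). nra.
      + generalize (Pn n). nra.
      + simpl pow. lra. }
  assert (EX : forall (p : C -> R), (forall z, Rabs (p z) <= Cmod z) -> (forall z w, p (z - w)%C = p z - p w) ->
    exists l, is_lim_seq (fun n => p (X n)) (Finite l)).
  { intros p Hp1 Hp2.
    assert (ES : ex_series (fun n => p (X (S n)) - p (X n))).
    { apply (ex_series_le (V := R_CompleteNormedModule) _ (fun n => r / 4 * (/2) ^ n)).
      - intros n. change (Rabs (p (X (S n)) - p (X n)) <= r / 4 * (/ 2) ^ n). rewrite <- Hp2.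
        eapply Rle_trans; [apply Hp1|apply SX].
      - apply (ex_series_scal (V := R_NormedModule) (r/4) (fun n => (/2)^n)). apply ex_series_geom. rewrite Rabs_pos_eq; lra. }
    destruct ES as [l Hl]. exists (p (X O) + l).
    apply is_lim_seq_incr_1.
    apply (is_lim_seq_ext (fun n => p (X O) + sum_n (fun n => p (X (S n)) - p (X n)) n)).
    - intros n. induction n as [|n IH]; [rewrite sum_O; ring|]. rewrite sum_Sn. unfold plus; simpl plus. unfold plus in *; simpl in *. lra.
    - apply is_lim_seq_plus'; [apply is_lim_seq_const|exact Hl]. }
  destruct (EX Re) as [l1 Hl1]; [apply Re_le_Cmod|intros; unfold Re; simpl; ring|].
  destruct (EX Im) as [l2 Hl2]; [apply Im_le_Cmod|intros; unfold Im; simpl; ring|].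
  set (L := (l1, l2) : C).
  assert (CL : forall e, 0 < e -> exists n0, forall n, (n0 <= n)%nat -> Cmod (X n - L)%C < e).
  { intros e He'. apply is_lim_seq_spec in Hl1. apply is_lim_seq_spec in Hl2.
    assert (e2 : 0 < e / 2) by lra.
    destruct (Hl1 (mkposreal _ e2)) as [n1 H1]. destruct (Hl2 (mkposreal _ e2)) as [n2 H2]. simpl in H1, H2.
    exists (max n1 n2). intros n Hn'. eapply Rle_lt_trans; [apply Cmod_le_sum|].
    specialize (H1 n ltac:(lia)). specialize (H2 n ltac:(lia)).
    replace (Re (X n - L)%C) with (Re (X n) - l1) by (unfold Re; simpl; ring).
    replace (Im (X n - L)%C) with (Im (X n) - l2) by (unfold Im; simpl; ring). lra. }
  assert (BL : Cmod (L - b)%C <= r / 2).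
  { apply le_epsilon. intros e He'. destruct (CL e He') as [n0 H]. specialize (H n0 (le_n _)).
    replace (L - b)%C with (- (X n0 - L) + (X n0 - b))%C by ring. eapply Rle_trans; [apply Cmod_triangle|]. rewrite Cmod_opp.
    destruct (SX n0) as [B _]. assert (0 < (/2) ^ n0) by (apply pow_lt; lra). nra. }
  exists L. split; [lra|].
  assert (NL : N L = L).
  { assert (Z : Cmod (N L - L)%C <= 0).
    { apply le_epsilon. intros e He'. destruct (CL (e / 2)) as [n0 H]; [lra|].
      replace (N L - L)%C with (- (N (X n0) - N L) + (X (S n0) - L))%C by (simpl; ring).
      eapply Rle_trans; [apply Cmod_triangle|]. rewrite Cmod_opp.
      assert (H1 := H n0 (le_n _)). assert (H2 := H (S n0) ltac:(lia)).
      assert (H3 := LN (X n0) L). destruct (SX n0) as [B _]. assert (0 < (/2) ^ n0) by (apply pow_lt; lra).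
      specialize (H3 ltac:(nra) ltac:(lra)). lra. }
    assert (Z2 := Cmod_ge_0 (N L - L)%C). replace (N L) with ((N L - L) + L)%C by ring.
    rewrite (Cmod_eq_0 (N L - L)%C) by lra. ring. }
  unfold N in NL. replace (f L) with (q - k * ((L + (q - f L) / k) - L))%C by (field; exact Hn).
  rewrite NL. ring.
Qed.

(* In the variable [b = alpha + i t], [0 <= t <= d], the map [cz] is the conformal parametrization shifted so that
   [t = d] is the free surface, and [cj] is a complex potential with [psi = - Om/2 y^2 + Im cj + const]. *)
Record flow : Type := Flow {
  cd_ : R; cT : R; cM : R; cOm : R; cG : R;
  cz : C -> C; cz1 : C -> C; cz2 : C -> C; cj : C -> C; cj1 : C -> C; cj2 : C -> C }.

(** All that the verification of a solution uses, free of series. Injectivity is asked only with one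
    point in the interior, so the surface may touch itself. [ok_close] makes the map proper on the
    unbounded strip. [ok_surf1] and [ok_surf2] are the kinematic and Bernoulli conditions with the
    factor [cz1] cleared. *)
Record flow_ok (F : flow) : Prop := {
  ok_d : 0 < cd_ F < cT F;
  ok_z : hol (cz F) (cz1 F) (cT F);
  ok_z1 : hol (cz1 F) (cz2 F) (cT F);
  ok_z2 : forall b, Rabs (Im b) < cT F -> ccont (cz2 F) b;
  ok_j : hol (cj F) (cj1 F) (cT F);
  ok_j1 : hol (cj1 F) (cj2 F) (cT F);
  ok_j2 : forall b, Rabs (Im b) < cT F -> ccont (cj2 F) b;
  ok_per : forall b, cz F (b + RtoC (2 * PI))%C = (cz F b + RtoC (2 * PI))%C;
  ok_bot : forall a, Im (cz F (a, 0)) = - cd_ F;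
  ok_nz : forall a t, 0 < t <= cd_ F -> cz1 F (a, t) <> RtoC 0;
  ok_im : forall a t, 0 < t <= cd_ F -> - cd_ F < Im (cz F (a, t));
  ok_inj : forall a t a' t', 0 < t < cd_ F -> 0 < t' <= cd_ F -> cz F (a, t) = cz F (a', t') -> a = a' /\ t = t';
  ok_close : forall a t, 0 <= t <= cd_ F -> Rabs (Re (cz F (a, t)) - a) <= cM F;
  ok_jper : forall b, Im (cj F (b + RtoC (2 * PI))%C) = Im (cj F b);
  ok_jbot : forall a, Im (cj F (a, 0)) = 0;
  ok_surf1 : forall a, Im (cj1 F (a, cd_ F) - RtoC (cOm F * Im (cz F (a, cd_ F))) * cz1 F (a, cd_ F))%C = 0;
  ok_surf2 : forall a, (Re (cj1 F (a, cd_ F) - RtoC (cOm F * Im (cz F (a, cd_ F))) * cz1 F (a, cd_ F))%C) ^ 2 =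
    (1 - 2 * cG F * Im (cz F (a, cd_ F))) * Cmod (cz1 F (a, cd_ F)) ^ 2;
  ok_sym : forall al, (forall b, Im (cz F (b, cd_ F)) <= Im (cz F (al, cd_ F))) \/
      (forall b, Im (cz F (al, cd_ F)) <= Im (cz F (b, cd_ F))) ->
    forall a t, 0 <= t <= cd_ F -> exists a', cz F (a', t) = reflect (Re (cz F (al, cd_ F))) (cz F (a, t)) /\
      Im (cj F (a', t)) = Im (cj F (a, t)) }.

(** * The stream function on the closed fluid domain *)

Definition cstrip (F : flow) (b : C) : Prop := 0 <= Im b <= cd_ F.
Definition ostrip (F : flow) (b : C) : Prop := 0 < Im b < cd_ F.
Definition potential (F : flow) (b : C) : R := - cOm F / 2 * Im (cz F b) ^ 2 + Im (cj F b).
Definition Psi (F : flow) (b : C) : R := potential F b - potential F (0, cd_ F).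
(** A choice of preimage. At a contact point it picks one of two, and [Psi_wd] makes the choice
    immaterial. *)
Definition pre (F : flow) (p : C) : C := epsilon (inhabits p) (fun b => cstrip F b /\ cz F b = p).

(** The normalization [|grad psi|^2 = 1 - 2 G y] on the surface fixes the Bernoulli constant at 1/2;
    the shift by [(0, cd_ F)] moves the surface to the top edge required of the conformal
    variable. *)
Definition wave_of (F : flow) : wave :=
  Wave (cOm F) (1/2) (Psi F (0, 0)) (cd_ F) (fun p => exists b, ostrip F b /\ cz F b = p)
    (fun x y => Psi F (pre F (x, y))) (fun a => cz F (a + (0, cd_ F))%C).

Lemma C_surj (p : C) : (Re p, Im p) = p.
Proof. destruct p; reflexivity. Qed.
Lemma C_ext (p q : C) : Re p = Re q -> Im p = Im q -> p = q.
Proof. destruct p, q; unfold Re, Im; simpl; intros -> ->; reflexivity. Qed.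

Lemma Cmod_sq z : Cmod z ^ 2 = Re z ^ 2 + Im z ^ 2.
Proof. unfold Cmod, Re, Im. rewrite <- Rsqr_pow2, Rsqr_sqrt; [reflexivity|nra]. Qed.

Lemma cstrip_T F b : flow_ok F -> cstrip F b -> Rabs (Im b) < cT F.
Proof. intros H [H1 H2]. destruct (ok_d F H). rewrite Rabs_pos_eq; lra. Qed.
Lemma o_c F b : ostrip F b -> cstrip F b.
Proof. unfold ostrip, cstrip; lra. Qed.

Lemma cz_ccont F b : flow_ok F -> cstrip F b -> ccont (cz F) b.
Proof. intros H Hb. eapply quad_ccont, (quad_hol _ _ _ _ (ok_z F H)), cstrip_T; assumption. Qed.

(** The derivative along the surface is [Im (cj1 - Om y cz1)], which vanishes by [ok_surf1]. *)
Lemma potential_surface F a : flow_ok F -> Psi F (a, cd_ F) = 0.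
Proof.
  intros H. assert (D := ok_d F H). assert (T : Rabs (cd_ F) < cT F) by (rewrite Rabs_pos_eq; lra).
  assert (K : forall x, is_derive (fun x => potential F (x, cd_ F)) x 0).
  { intros x. unfold potential. set (g := fun x => Im (cz F (x, cd_ F))). set (h := fun x => Im (cj F (x, cd_ F))).
    assert (Hg : is_derive g x (Im (cz1 F (x, cd_ F)))) by (apply (hol_dx_im _ _ (cT F)); [apply ok_z|]; assumption).
    assert (Hh : is_derive h x (Im (cj1 F (x, cd_ F)))) by (apply (hol_dx_im _ _ (cT F)); [apply ok_j|]; assumption).
    change (is_derive (fun x => - cOm F / 2 * g x ^ 2 + h x) x 0).
    assert (S := ok_surf1 F H x). fold (g x) in S.
    auto_derive; [split; [exists (Im (cz1 F (x, cd_ F))); exact Hg|split; [exists (Im (cj1 F (x, cd_ F))); exact Hh|exact I]]|].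
    change (fun x0 : R => g x0) with g. change (fun x0 : R => h x0) with h.
    rewrite (is_derive_unique _ _ _ Hg), (is_derive_unique _ _ _ Hh).
    unfold Im, Cminus, Cplus, Copp, Cmult, RtoC in *; simpl in *. lra. }
  unfold Psi. destruct (Rtotal_order 0 a) as [L|[L|L]].
  - rewrite <- (eq_is_derive (fun x => potential F (x, cd_ F)) 0 a); [ring|intros; apply K|exact L].
  - subst; ring.
  - rewrite (eq_is_derive (fun x => potential F (x, cd_ F)) a 0); [ring|intros; apply K|exact L].
Qed.

Lemma Psi_bottom F a : flow_ok F -> Psi F (a, 0) = Psi F (0, 0).
Proof. intros H. unfold Psi, potential. rewrite !(ok_bot F H), !(ok_jbot F H). reflexivity. Qed.

(** Distinct preimages of one point lie both on the surface or both on the bottom, and [Psi] is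
    constant on each. *)
Lemma Psi_wd F b b' : flow_ok F -> cstrip F b -> cstrip F b' -> cz F b = cz F b' -> Psi F b = Psi F b'.
Proof.
  intros H. destruct b as [a t], b' as [a' t']. unfold cstrip; simpl. intros Hb Hb' E. assert (D := ok_d F H).
  assert (E2 := f_equal Im E).
  destruct (Req_dec t 0) as [->|N].
  - destruct (Req_dec t' 0) as [->|N']; [rewrite Psi_bottom, (Psi_bottom F a'); auto|].
    rewrite (ok_bot F H) in E2. assert (K := ok_im F H a' t'). lra.
  - destruct (Req_dec t' 0) as [->|N'].
    + rewrite (ok_bot F H) in E2. assert (K := ok_im F H a t). lra.
    + destruct (Req_dec t (cd_ F)) as [->|M], (Req_dec t' (cd_ F)) as [->|M'].
      * rewrite !potential_surface; auto.
      * destruct (ok_inj F H a' t' a (cd_ F)) as [<- <-]; auto; lra.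
      * destruct (ok_inj F H a t a' (cd_ F)) as [<- <-]; auto; lra.
      * destruct (ok_inj F H a t a' t') as [<- <-]; auto; lra.
Qed.

Lemma pre_spec F b : cstrip F b -> cstrip F (pre F (cz F b)) /\ cz F (pre F (cz F b)) = cz F b.
Proof. intros Hb. unfold pre. apply epsilon_spec. exists b. auto. Qed.

Lemma stream_cz F b : flow_ok F -> cstrip F b -> psi (wave_of F) (cz F b) = Psi F b.
Proof.
  intros H Hb. unfold psi, wave_of; simpl. rewrite C_surj. destruct (pre_spec F b Hb) as [P1 P2].
  apply Psi_wd; auto.
Qed.

Lemma pre_unique F b : flow_ok F -> ostrip F b -> pre F (cz F b) = b.
Proof.
  intros H Hb. destruct (pre_spec F b (o_c F b Hb)) as [P1 P2]. set (b' := pre F (cz F b)) in *. clearbody b'.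
  destruct b as [a t], b' as [a' t']. unfold ostrip, cstrip in *; simpl in *.
  destruct (Req_dec t' 0) as [->|N].
  - apply (f_equal Im) in P2. rewrite (ok_bot F H) in P2. assert (K := ok_im F H a t). lra.
  - destruct (ok_inj F H a t a' t') as [-> ->]; auto; lra.
Qed.

(** Compactness for a property that persists when the threshold [d] shrinks: finitely many local
    thresholds have a common positive one. *)
Lemma rect_uniform (P : R -> C -> Prop) l1 r1 l2 r2 : (forall d d' b, 0 < d' <= d -> P d b -> P d' b) ->
  (forall b0, l1 <= Re b0 <= r1 -> l2 <= Im b0 <= r2 -> exists d, 0 < d /\ forall b, Cmod (b - b0)%C < 2 * d -> P d b) ->
  exists d, 0 < d /\ forall b, l1 <= Re b <= r1 -> l2 <= Im b <= r2 -> P d b.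
Proof.
  intros Hm Hl.
  assert (L : forall x y, exists d : posreal, l1 <= x <= r1 -> l2 <= y <= r2 -> forall b, Cmod (b - (x, y))%C < 2 * d -> P d b).
  { intros x y. destruct (classic (l1 <= x <= r1 /\ l2 <= y <= r2)) as [[Hx Hy]|N]; [|exists (mkposreal 1 Rlt_0_1); tauto].
    destruct (Hl (x, y) Hx Hy) as [d [D Hd]]. exists (mkposreal d D). intros _ _. exact Hd. }
  set (dlt := fun x y => proj1_sig (constructive_indefinite_description _ (L x y))).
  assert (Ld := fun x y => proj2_sig (constructive_indefinite_description _ (L x y))).
  destruct (compactness_value_2d l1 r1 l2 r2 dlt) as [e Hc].
  exists e. split; [apply cond_pos|]. intros b Hx Hy. apply NNPP. intros N.
  apply (Hc (Re b) (Im b) Hx Hy). intros [u [w [Hu [Hw [K1 [K2 K3]]]]]]. apply N.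
  apply (Hm (dlt u w)); [split; [apply cond_pos|exact K3]|]. apply (Ld u w Hu Hw).
  change (Cmod (b - (u, w))%C < 2 * dlt u w). eapply Rle_lt_trans; [apply Cmod_le_sum|].
  replace (Re (b - (u, w))%C) with (Re b - u) by (unfold Re; simpl; ring).
  replace (Im (b - (u, w))%C) with (Im b - w) by (unfold Im; simpl; ring). lra.
Qed.

Lemma ccont_away (f : C -> C) b p0 : ccont f b -> f b <> p0 ->
  exists d, 0 < d /\ forall b', Cmod (b' - b)%C < 2 * d -> d <= Cmod (f b' - p0)%C.
Proof.
  intros Hf E. set (m := Cmod (f b - p0)%C). assert (Hm : 0 < m).
  { apply Cmod_gt_0. intro Z. apply E. replace (f b) with ((f b - p0) + p0)%C by ring. rewrite Z. ring. }
  destruct (Hf (m / 2)) as [dl [D Hd]]; [lra|].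
  exists (Rmin (dl / 2) (m / 2)). split; [apply Rmin_glb_lt; lra|].
  intros b' K. assert (R1 := Rmin_l (dl / 2) (m / 2)). assert (R2 := Rmin_r (dl / 2) (m / 2)).
  specialize (Hd b' ltac:(lra)).
  assert (m <= Cmod (f b' - p0)%C + Cmod (f b' - f b)%C); [|lra]. unfold m.
  replace (f b - p0)%C with ((f b' - p0) + - (f b' - f b))%C by ring.
  eapply Rle_trans; [apply Cmod_triangle|]. rewrite Cmod_opp. lra.
Qed.

(** An image close to [p0] comes from a point close to one of the preimages of [p0], whichever it
    is, once [ok_close] has confined the candidates to a compact rectangle. This takes the place of
    a continuous inverse, which fails to exist at contact points. *)
Lemma strip_compact F (f : C -> R) v p0 : flow_ok F ->
  (forall b, cstrip F b -> forall eps, 0 < eps -> exists dl, 0 < dl /\ forall b', cstrip F b' -> Cmod (b' - b)%C < dl -> Rabs (f b' - f b) < eps) ->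
  (forall b, cstrip F b -> cz F b = p0 -> f b = v) ->
  forall eps, 0 < eps -> exists dl, 0 < dl /\ forall b, cstrip F b -> Cmod (cz F b - p0)%C < dl -> Rabs (f b - v) < eps.
Proof.
  intros H Hf Hv eps He.
  destruct (rect_uniform (fun d b => cstrip F b -> d <= Cmod (cz F b - p0)%C \/ Rabs (f b - v) < eps)
    (Re p0 - cM F - 1) (Re p0 + cM F + 1) 0 (cd_ F)) as [e [E0 He']].
  - intros d d' b Hd K Hb. destruct (K Hb); [left; lra|right; assumption].
  - intros b _ Hb. destruct (classic (cz F b = p0)) as [E|E].
    + destruct (Hf b Hb eps He) as [dl [D Hd]]. exists (dl / 2). split; [lra|].
      intros b' K Hb'. right. rewrite <- (Hv b Hb E). apply Hd; [assumption|]. lra.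
    + destruct (ccont_away (cz F) b p0 (cz_ccont F b H Hb) E) as [dl [D Hd]]. exists dl. auto.
  - exists (Rmin 1 e). split; [apply Rmin_glb_lt; lra|].
    intros b Hb K. assert (R1 := Rmin_l 1 e). assert (R2 := Rmin_r 1 e).
    destruct (He' b) as [G|G]; [|exact Hb|exact Hb|lra|exact G].
    assert (C1 := ok_close F H (Re b) (Im b) Hb). rewrite C_surj in C1.
    assert (C2 := Re_le_Cmod (cz F b - p0)%C). replace (Re (cz F b - p0)%C) with (Re (cz F b) - Re p0) in C2 by (unfold Re; simpl; ring).
    apply Rabs_le_between in C1. assert (C3 : Rabs (Re (cz F b) - Re p0) <= 1) by lra. apply Rabs_le_between in C3. lra.
Qed.

Lemma closure_cz F p : flow_ok F -> closure (domain (wave_of F)) p -> exists b, cstrip F b /\ cz F b = p.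
Proof.
  intros H Hp. apply NNPP. intros N.
  (* If [p] had no preimage, the constant function 0 would satisfy the hypotheses with the limit
     value 1, so the images stay away from [p]. *)
  destruct (strip_compact F (fun _ => 0) 1 p H) with (eps := 1) as [dl [D Hd]]; [| |lra|].
  - intros. exists 1. split; [lra|]. intros. rewrite Rminus_0_r, Rabs_R0. assumption.
  - intros b Hb E. elim N. eauto.
  - destruct (Hp (fun q => Cmod (q - p)%C < dl)) as [q [Q1 [b [Hb E]]]].
    + apply (locally_C_ex p _ dl D). auto.
    + subst q. specialize (Hd b (o_c F b Hb) Q1). replace (0 - 1) with (-1) in Hd by ring. rewrite Rabs_left in Hd; lra.
Qed.

Lemma cz_closure F b : flow_ok F -> cstrip F b -> closure (domain (wave_of F)) (cz F b).
Proof.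
  intros H Hb V HV. apply locally_C_inv in HV. destruct HV as [e [He HV]].
  destruct (cz_ccont F b H Hb e He) as [dl [D Hd]]. assert (P := ok_d F H). unfold cstrip in Hb.
  assert (exists t, 0 < t < cd_ F /\ Rabs (t - Im b) < dl) as [t [T1 T2]].
  { destruct (Rle_lt_dec (Im b) (cd_ F / 2)) as [L|L].
    - exists (Im b + Rmin (dl / 2) (cd_ F / 4)). assert (R1 := Rmin_l (dl / 2) (cd_ F / 4)).
      assert (R2 := Rmin_r (dl / 2) (cd_ F / 4)). assert (0 < Rmin (dl / 2) (cd_ F / 4)) by (apply Rmin_glb_lt; lra).
      split; [lra|]. rewrite Rabs_pos_eq; lra.
    - exists (Im b - Rmin (dl / 2) (cd_ F / 4)). assert (R1 := Rmin_l (dl / 2) (cd_ F / 4)).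
      assert (R2 := Rmin_r (dl / 2) (cd_ F / 4)). assert (0 < Rmin (dl / 2) (cd_ F / 4)) by (apply Rmin_glb_lt; lra).
      split; [lra|]. rewrite Rabs_left; lra. }
  exists (cz F (Re b, t)). split.
  - apply HV, Hd. rewrite <- (C_surj b) at 2. rewrite Cmod_pair_y. exact T2.
  - simpl. exists (Re b, t). split; [exact T1|reflexivity].
Qed.

Lemma Psi_ccont F b : flow_ok F -> cstrip F b -> forall eps, 0 < eps ->
  exists dl, 0 < dl /\ forall b', cstrip F b' -> Cmod (b' - b)%C < dl -> Rabs (Psi F b' - Psi F b) < eps.
Proof.
  intros H Hb eps He.
  assert (Q1 := quad_ccont _ _ _ (quad_hol _ _ _ _ (ok_z F H) (cstrip_T F b H Hb))).
  assert (Q2 := quad_ccont _ _ _ (quad_hol _ _ _ _ (ok_j F H) (cstrip_T F b H Hb))).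
  apply ccont_im in Q1. apply ccont_im in Q2.
  assert (K : filterlim (Psi F) (locally b) (locally (Psi F b))).
  { change (continuous (Psi F) b). unfold Psi, potential.
    apply (continuous_minus (V := R_NormedModule)); [|apply continuous_const].
    apply (continuous_plus (V := R_NormedModule)); [|exact Q2].
    apply (continuous_mult (K := R_AbsRing)); [apply continuous_const|].
    simpl. apply (continuous_mult (K := R_AbsRing)); [exact Q1|].
    apply (continuous_mult (K := R_AbsRing)); [exact Q1|apply continuous_const]. }
  specialize (K (fun r => Rabs (r - Psi F b) < eps)).
  assert (L : locally (Psi F b) (fun r : R => Rabs (r - Psi F b) < eps)) by (exists (mkposreal eps He); intros y Hy; exact Hy).
  destruct (locally_C_inv b _ (K L)) as [dl [D Hd]].
  exists dl. split; [assumption|]. intros b' _ Hb'. apply Hd, Hb'.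
Qed.

Lemma psi_continuous F p : flow_ok F -> closure (domain (wave_of F)) p ->
  filterlim (psi (wave_of F)) (within (closure (domain (wave_of F))) (locally p)) (locally (psi (wave_of F) p)).
Proof.
  intros H Hp. destruct (closure_cz F p H Hp) as [b0 [Hb0 E0]]. apply filterlim_locally. intros eps.
  destruct (strip_compact F (Psi F) (Psi F b0) p H) with (eps := pos eps) as [dl [D Hd]].
  - intros b Hb. apply Psi_ccont; assumption.
  - intros b Hb E. apply Psi_wd; auto. congruence.
  - apply cond_pos.
  - apply (locally_C_ex p _ dl D). intros q Hq Cq. destruct (closure_cz F q H Cq) as [b [Hb E]].
    rewrite <- E, <- E0, !stream_cz by assumption. apply (Hd b Hb). rewrite E. exact Hq.
Qed.

Lemma open_domain F : flow_ok F -> open (domain (wave_of F)).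
Proof.
  intros H p [b [Hb E]]. assert (Hc := o_c F b Hb). destruct b as [a t]. unfold ostrip in Hb; simpl in Hb.
  destruct (open_map _ _ _ _ (a, t) (ok_z F H) (ok_z1 F H) (cstrip_T F _ H Hc) (ok_nz F H a t ltac:(lra)) (Rmin t (cd_ F - t)))
    as [dl [D Hd]]; [apply Rmin_glb_lt; lra|].
  apply (locally_C_ex p _ dl D). intros q Hq. rewrite <- E in Hq. destruct (Hd q Hq) as [b' [Hb' Eb]].
  exists b'. split; [|exact Eb]. assert (K := Im_le_Cmod (b' - (a, t))%C).
  replace (Im (b' - (a, t))%C) with (Im b' - t) in K by (unfold Im; simpl; ring).
  assert (R1 := Rmin_l t (cd_ F - t)). assert (R2 := Rmin_r t (cd_ F - t)).
  assert (K2 : Rabs (Im b' - t) < Rmin t (cd_ F - t)) by lra. apply Rabs_lt_between in K2. unfold ostrip. lra.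
Qed.

Lemma pre_ccont F b : flow_ok F -> ostrip F b -> ccont (pre F) (cz F b).
Proof.
  intros H Hb eps He. assert (Hc := o_c F b Hb). assert (Hb' := Hb). unfold ostrip in Hb'.
  destruct (open_map _ _ _ _ b (ok_z F H) (ok_z1 F H) (cstrip_T F _ H Hc)) with (eps := Rmin eps (Rmin (Im b) (cd_ F - Im b)))
    as [dl [D Hd]]; [rewrite <- (C_surj b); apply (ok_nz F H); lra|repeat apply Rmin_glb_lt; lra|].
  exists dl. split; [assumption|]. intros q Hq. destruct (Hd q Hq) as [b1 [B1 B2]].
  assert (R0 := Rmin_l eps (Rmin (Im b) (cd_ F - Im b))). assert (R0' := Rmin_r eps (Rmin (Im b) (cd_ F - Im b))).
  assert (R1 := Rmin_l (Im b) (cd_ F - Im b)). assert (R2 := Rmin_r (Im b) (cd_ F - Im b)).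
  assert (O1 : ostrip F b1).
  { assert (K := Im_le_Cmod (b1 - b)%C). replace (Im (b1 - b)%C) with (Im b1 - Im b) in K by (unfold Im; simpl; ring).
    assert (K2 : Rabs (Im b1 - Im b) < Rmin (Im b) (cd_ F - Im b)) by lra. apply Rabs_lt_between in K2. unfold ostrip. lra. }
  rewrite <- B2, !pre_unique by assumption. lra.
Qed.

(** Near [b] one has [c |b' - b| <= 2 |cz b' - cz b|] with [c = |cz1 b|], which converts the
    quadratic remainder of [cz] into one for the inverse. *)
Lemma pre_quad F b : flow_ok F -> ostrip F b -> quad (pre F) (cz F b) (/ cz1 F b)%C.
Proof.
  intros H Hb. assert (Hc := o_c F b Hb). assert (Hn : cz1 F b <> RtoC 0).
  { rewrite <- (C_surj b). apply (ok_nz F H). unfold ostrip in Hb. lra. }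
  destruct (ok_z F H) as [K [K0 HK]]. set (c := Cmod (cz1 F b)). assert (cp : 0 < c) by (apply Cmod_gt_0; exact Hn).
  assert (HT := cstrip_T F b H Hc).
  assert (E0 : 0 < Rmin (cT F - Rabs (Im b)) (c / (2 * (K + 1)))).
  { apply Rmin_glb_lt; [lra|]. apply Rdiv_lt_0_compat; lra. }
  destruct (pre_ccont F b H Hb _ E0) as [d1 [D1 H1]].
  destruct (locally_C_inv _ _ (open_domain F H (cz F b) (ex_intro _ b (conj Hb eq_refl)))) as [d2 [D2 H2]].
  assert (ccc : 0 < c * c * c) by (apply Rmult_lt_0_compat; nra).
  exists (4 * K / (c * c * c)), (Rmin 1 (Rmin d1 d2)).
  split; [apply Rmult_le_pos; [lra|apply Rlt_le, Rinv_0_lt_compat; lra]|].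
  split; [split; [repeat apply Rmin_glb_lt; lra|apply Rmin_l]|].
  intros q Hq. assert (R1 := Rmin_r 1 (Rmin d1 d2)). assert (R2 := Rmin_l d1 d2). assert (R3 := Rmin_r d1 d2).
  destruct (H2 q ltac:(lra)) as [b' [Hb' <-]]. specialize (H1 (cz F b') ltac:(lra)).
  rewrite !pre_unique in * by assumption.
  assert (S1 := Rmin_l (cT F - Rabs (Im b)) (c / (2 * (K + 1)))). assert (S2 := Rmin_r (cT F - Rabs (Im b)) (c / (2 * (K + 1)))).
  specialize (HK b b' HT (cstrip_T F b' H (o_c F b' Hb'))).
  set (m := Cmod (b' - b)%C) in *. set (Q := Cmod (cz F b' - cz F b)%C) in *.
  assert (m0 : 0 <= m) by apply Cmod_ge_0.
  assert (Hm : m * (K + 1) <= c / 2).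
  { assert (m * (2 * (K + 1)) <= c); [|lra]. apply Rlt_le. apply (Rmult_lt_reg_r (/ (2 * (K + 1)))); [apply Rinv_0_lt_compat; lra|].
    rewrite Rmult_assoc, Rinv_r, Rmult_1_r by lra. unfold Rdiv in S2. lra. }
  assert (Hmq : c * m <= 2 * Q).
  { assert (c * m <= Q + K * m ^ 2).
    { unfold c, m. rewrite <- Cmod_mult.
      replace (cz1 F b * (b' - b))%C with ((cz F b' - cz F b) + - (cz F b' - cz F b - cz1 F b * (b' - b)))%C by ring.
      eapply Rle_trans; [apply Cmod_triangle|]. rewrite Cmod_opp. fold m. fold Q. lra. }
    simpl in *. nra. }
  replace (b' - b - / cz1 F b * (cz F b' - cz F b))%C with (- (cz F b' - cz F b - cz1 F b * (b' - b)) / cz1 F b)%C by (field; exact Hn).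
  rewrite Cmod_div by exact Hn. rewrite Cmod_opp. fold c.
  apply (Rmult_le_reg_r c); [assumption|]. unfold Rdiv at 1. rewrite Rmult_assoc, Rinv_l, Rmult_1_r by lra.
  eapply Rle_trans; [exact HK|]. replace (4 * K / (c * c * c) * Q ^ 2 * c) with (K * (2 * Q / c) ^ 2) by (field; lra).
  apply Rmult_le_compat_l; [assumption|]. apply pow_incr. split; [assumption|].
  apply (Rmult_le_reg_r c); [assumption|]. unfold Rdiv. rewrite Rmult_assoc, Rinv_l by lra. lra.
Qed.

Lemma ex_diff_step (D : C -> Prop) (f a b : R -> R -> R) n : open D ->
  (forall x y, D (x, y) -> continuity_2d_pt f x y /\ is_derive (fun u => f u y) x (a x y) /\ is_derive (fun v => f x v) y (b x y)) ->
  (forall x y, D (x, y) -> ex_diff_n a n x y) -> (forall x y, D (x, y) -> ex_diff_n b n x y) ->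
  forall x y, D (x, y) -> ex_diff_n f (S n) x y.
Proof.
  intros HD H Ha Hb x y Hxy. destruct (H x y Hxy) as [H1 [H2 H3]].
  assert (L : locally_2d (fun u v => D (u, v)) x y).
  { apply locally_2d_locally. generalize (HD (x, y) Hxy). apply filter_imp. intros [u v]; auto. }
  split; [assumption|]. split; [eexists; exact H2|]. split; [eexists; exact H3|]. split.
  - apply (ex_diff_n_ext_loc a); [|auto]. revert L. apply locally_2d_impl, locally_2d_forall. intros u v K.
    symmetry. apply is_derive_unique. apply (H u v K).
  - apply (ex_diff_n_ext_loc b); [|auto]. revert L. apply locally_2d_impl, locally_2d_forall. intros u v K.
    symmetry. apply is_derive_unique. apply (H u v K).
Qed.

Lemma partial_second (D : C -> Prop) (f a b : R -> R -> R) x y axx byy : open D ->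
  (forall x y, D (x, y) -> is_derive (fun u => f u y) x (a x y) /\ is_derive (fun v => f x v) y (b x y)) ->
  D (x, y) -> is_derive (fun u => a u y) x axx -> is_derive (fun v => b x v) y byy ->
  partial_derive 2 0 f x y = axx /\ partial_derive 0 2 f x y = byy.
Proof.
  intros HD H Hxy Ha Hb.
  assert (L : locally_2d (fun u v => D (u, v)) x y).
  { apply locally_2d_locally. generalize (HD (x, y) Hxy). apply filter_imp. intros [u v]; auto. }
  split; unfold partial_derive; simpl.
  - apply is_derive_unique. apply (is_derive_ext_loc (fun u => a u y)); [|exact Ha].
    apply locally_2d_1d_const_y in L. revert L. apply filter_imp. intros u K. symmetry. apply is_derive_unique, (H u y K).
  - apply is_derive_unique. apply (is_derive_ext_loc (fun v => b x v)); [|exact Hb].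
    apply locally_2d_1d_const_x in L. revert L. apply filter_imp. intros u K. symmetry. apply is_derive_unique, (H x u K).
Qed.

Lemma cont2_of_filterlim (f : C -> R) x y : filterlim f (locally ((x, y) : C)) (locally (f (x, y))) ->
  continuity_2d_pt (fun u v => f (u, v)) x y.
Proof.
  intros H. apply continuity_2d_pt_filterlim. eapply filterlim_ext; [|exact H]. intros [u v]; reflexivity.
Qed.

(* In the fluid, [psi_y + Om y + i psi_x = gg]. *)
Definition cg (F : flow) (b : C) : C := (cj1 F b * / cz1 F b)%C.
Definition cg1 (F : flow) (b : C) : C := (cj2 F b * / cz1 F b + cj1 F b * (- cz2 F b / (cz1 F b * cz1 F b)))%C.
Definition gg (F : flow) (p : C) : C := cg F (pre F p).
Definition gk (F : flow) (p : C) : C := (cg1 F (pre F p) * / cz1 F (pre F p))%C.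

Definition good F b := 0 < Im b <= cd_ F.
Lemma good_T F b : flow_ok F -> good F b -> Rabs (Im b) < cT F.
Proof. intros H Hb. apply cstrip_T; [assumption|]. unfold good, cstrip in *; lra. Qed.
Lemma good_nz F b : flow_ok F -> good F b -> cz1 F b <> RtoC 0.
Proof. intros H Hb. rewrite <- (C_surj b). apply (ok_nz F H). exact Hb. Qed.

Lemma cg_quad F b : flow_ok F -> good F b -> quad (cg F) b (cg1 F b).
Proof.
  intros H Hb. unfold cg, cg1. apply (quad_mult (cj1 F) (fun b => / cz1 F b)%C).
  - apply (quad_hol _ _ _ _ (ok_j1 F H)), good_T; assumption.
  - apply (quad_inv (cz1 F)); [|apply good_nz; assumption]. apply (quad_hol _ _ _ _ (ok_z1 F H)), good_T; assumption.
Qed.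

Lemma ccont_mult f g b : ccont f b -> ccont g b -> ccont (fun x => f x * g x)%C b.
Proof.
  intros Hf Hg e He. assert (P1 := Cmod_ge_0 (f b)). assert (P2 := Cmod_ge_0 (g b)).
  set (N := 1 + Cmod (f b) + Cmod (g b)). assert (0 < e / (2 * N)) by (apply Rdiv_lt_0_compat; unfold N; lra).
  assert (E0 : 0 < Rmin 1 (e / (2 * N))) by (apply Rmin_glb_lt; lra).
  destruct (Hf _ E0) as [d1 [D1 H1]]. destruct (Hg _ E0) as [d2 [D2 H2]].
  exists (Rmin d1 d2). split; [apply Rmin_glb_lt; assumption|]. intros b' Hb'.
  assert (R1 := Rmin_l d1 d2). assert (R2 := Rmin_r d1 d2). assert (R3 := Rmin_l 1 (e / (2 * N))). assert (R4 := Rmin_r 1 (e / (2 * N))).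
  specialize (H1 b' ltac:(lra)). specialize (H2 b' ltac:(lra)).
  replace (f b' * g b' - f b * g b)%C with ((f b' - f b) * (g b' - g b) + ((f b' - f b) * g b + f b * (g b' - g b)))%C by ring.
  eapply Rle_lt_trans; [apply Cmod_triangle|]. eapply Rle_lt_trans; [apply Rplus_le_compat_l, Cmod_triangle|]. rewrite !Cmod_mult.
  assert (Q1 := Cmod_ge_0 (f b' - f b)%C). assert (Q2 := Cmod_ge_0 (g b' - g b)%C).
  set (u := Cmod (f b' - f b)%C) in *. set (v := Cmod (g b' - g b)%C) in *.
  assert (E : e / (2 * N) * N = e / 2) by (unfold N; field; unfold N in *; lra). set (m := e / (2 * N)) in *.
  assert (u * v <= m * 1) by (apply Rmult_le_compat; lra).
  assert (u * Cmod (g b) <= m * Cmod (g b)) by (apply Rmult_le_compat_r; lra).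
  assert (Cmod (f b) * v <= Cmod (f b) * m) by (apply Rmult_le_compat_l; lra).
  unfold N in E. lra.
Qed.
Lemma ccont_plus f g b : ccont f b -> ccont g b -> ccont (fun x => f x + g x)%C b.
Proof.
  intros Hf Hg e He. destruct (Hf (e / 2)) as [d1 [D1 H1]]; [lra|]. destruct (Hg (e / 2)) as [d2 [D2 H2]]; [lra|].
  exists (Rmin d1 d2). split; [apply Rmin_glb_lt; assumption|]. intros b' Hb'.
  assert (R1 := Rmin_l d1 d2). assert (R2 := Rmin_r d1 d2). specialize (H1 b' ltac:(lra)). specialize (H2 b' ltac:(lra)).
  replace (f b' + g b' - (f b + g b))%C with ((f b' - f b) + (g b' - g b))%C by ring.
  eapply Rle_lt_trans; [apply Cmod_triangle|]. lra.
Qed.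
Lemma ccont_ext f g b : (forall x, f x = g x) -> ccont f b -> ccont g b.
Proof. intros E H e He. destruct (H e He) as [d [D K]]. exists d. split; [assumption|]. intros. rewrite <- !E. auto. Qed.

Lemma inv_ccont F b : flow_ok F -> good F b -> ccont (fun b => / cz1 F b)%C b.
Proof.
  intros H Hb. eapply quad_ccont. apply (quad_inv (cz1 F)); [|apply good_nz; assumption].
  apply (quad_hol _ _ _ _ (ok_z1 F H)), good_T; assumption.
Qed.
Lemma cg1_ccont F b : flow_ok F -> good F b -> ccont (cg1 F) b.
Proof.
  intros H Hb. assert (HT := good_T F b H Hb). assert (I := inv_ccont F b H Hb).
  apply (ccont_ext (fun b => cj2 F b * / cz1 F b + cj1 F b * (RtoC (-1) * cz2 F b * (/ cz1 F b * / cz1 F b)))%C).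
  { intros x. unfold cg1, Cdiv. destruct (classic (cz1 F x = RtoC 0)) as [E|E].
    - rewrite E. replace (RtoC 0 * RtoC 0)%C with (RtoC 0) by ring. replace (/ RtoC 0)%C with (RtoC 0); [ring|].
      unfold Cinv, RtoC; simpl. f_equal; unfold Rdiv; ring.
    - replace (/ (cz1 F x * cz1 F x))%C with (/ cz1 F x * / cz1 F x)%C by (field; exact E). ring_simplify. 
      replace (RtoC (-1)) with (- RtoC 1)%C by (unfold RtoC, Copp; simpl; f_equal; ring). ring. }
  apply ccont_plus; apply ccont_mult; auto using ok_j2.
  - eapply quad_ccont, (quad_hol _ _ _ _ (ok_j1 F H)); assumption.
  - apply ccont_mult; [|apply ccont_mult; assumption]. apply ccont_mult; [|apply ok_z2; assumption].
    intros e He. exists 1. split; [lra|]. intros. replace (RtoC (-1) - RtoC (-1))%C with (RtoC 0) by ring. rewrite Cmod_0. assumption.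
Qed.

Lemma o_good F b : ostrip F b -> good F b.
Proof. unfold ostrip, good; lra. Qed.

Lemma gg_quad F p : flow_ok F -> domain (wave_of F) p -> quad (gg F) p (gk F p) /\ ccont (gk F) p.
Proof.
  intros H [b [Hb <-]]. unfold gk, gg. split.
  - rewrite pre_unique by assumption. apply quad_comp; [|apply pre_quad; assumption].
    rewrite pre_unique by assumption. apply cg_quad; [assumption|apply o_good, Hb].
  - assert (P := pre_ccont F b H Hb).
    apply (ccont_mult (fun p => cg1 F (pre F p)) (fun p => / cz1 F (pre F p))%C).
    + apply (ccont_comp (cg1 F)); [exact P|]. rewrite pre_unique by assumption. apply cg1_ccont; auto using o_good.
    + apply (ccont_comp (fun b => / cz1 F b)%C); [exact P|]. rewrite pre_unique by assumption. apply inv_ccont; auto using o_good.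
Qed.

Lemma stream_d F x y : flow_ok F -> domain (wave_of F) (x, y) ->
  continuity_2d_pt (stream (wave_of F)) x y /\
  is_derive (fun u => stream (wave_of F) u y) x (Im (gg F (x, y))) /\
  is_derive (fun v => stream (wave_of F) x v) y (- cOm F * y + Re (gg F (x, y))).
Proof.
  intros H Hp. set (c0 := potential F (0, cd_ F)).
  assert (E : forall q, domain (wave_of F) q -> Psi F (pre F q) = - cOm F / 2 * Im q ^ 2 + Im (cj F (pre F q)) - c0).
  { intros q [b [Hb <-]]. unfold Psi, potential. rewrite pre_unique by assumption. reflexivity. }
  assert (Q : quad (fun q => cj F (pre F q)) (x, y) (gg F (x, y))).
  { destruct Hp as [b [Hb E1]]. rewrite <- E1. unfold gg, cg. rewrite pre_unique by assumption.
    apply quad_comp; [|apply pre_quad; assumption]. rewrite pre_unique by assumption.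
    apply (quad_hol _ _ _ _ (ok_j F H)), good_T; auto using o_good. }
  assert (L : locally_2d (fun u v => domain (wave_of F) (u, v)) x y).
  { apply locally_2d_locally. generalize (open_domain F H (x, y) Hp). apply filter_imp. intros [u v]; auto. }
  destruct (quad_part _ _ _ _ Q) as [_ [Q1 [_ Q2]]]. split; [|split].
  - apply (continuity_2d_pt_ext_loc (fun u v => (fun q => - cOm F / 2 * Im q ^ 2 + Im (cj F (pre F q)) - c0) (u, v))).
    + revert L. apply locally_2d_impl, locally_2d_forall. intros u v K. simpl. rewrite (E _ K). reflexivity.
    + apply (cont2_of_filterlim (fun q => - cOm F / 2 * Im q ^ 2 + Im (cj F (pre F q)) - c0)).
      change (continuous (fun q : C => - cOm F / 2 * Im q ^ 2 + Im (cj F (pre F q)) - c0) ((x, y) : C)).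
      apply (continuous_minus (V := R_NormedModule) (fun q : C => - cOm F / 2 * Im q ^ 2 + Im (cj F (pre F q)))); [|apply continuous_const].
      assert (CI : continuous (fun q : C => Im q) (x, y)) by apply continuous_snd.
      apply (continuous_plus (V := R_NormedModule) (fun q : C => - cOm F / 2 * Im q ^ 2)); [|exact (ccont_im _ _ (quad_ccont _ _ _ Q))].
      apply (continuous_mult (K := R_AbsRing) (fun _ : C => - cOm F / 2) (fun q : C => Im q ^ 2)); [apply continuous_const|].
      apply (continuous_mult (K := R_AbsRing) (fun q : C => Im q) (fun q : C => Im q * 1)); [exact CI|].
      apply (continuous_mult (K := R_AbsRing) (fun q : C => Im q) (fun _ : C => 1)); [exact CI|apply continuous_const].
  - apply (is_derive_ext_loc (fun u => - cOm F / 2 * y ^ 2 + Im (cj F (pre F (u, y))) - c0)).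
    + apply locally_2d_1d_const_y in L. revert L. apply filter_imp. intros u K. simpl. rewrite (E _ K). reflexivity.
    + eapply is_derive_eq; [apply (is_derive_minus (V := R_NormedModule)); [apply (is_derive_plus (V := R_NormedModule));
        [apply is_derive_const|exact Q1]|apply is_derive_const]|]. unfold minus, plus, opp, zero; simpl. ring.
  - apply (is_derive_ext_loc (fun v => - cOm F / 2 * v ^ 2 + Im (cj F (pre F (x, v))) - c0)).
    + apply locally_2d_1d_const_x in L. revert L. apply filter_imp. intros v K. simpl. rewrite (E _ K). reflexivity.
    + eapply is_derive_eq; [apply (is_derive_minus (V := R_NormedModule)); [apply (is_derive_plus (V := R_NormedModule));
        [|exact Q2]|apply is_derive_const]|].
      * instantiate (1 := - cOm F * y). auto_derive; [exact I|field].
      * unfold minus, plus, opp, zero; simpl. ring.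
Qed.

(** In the two second derivatives the harmonic part contributes [Im gk] with opposite signs; the
    quadratic part leaves [- cOm F]. *)
Lemma stream_poisson F p : flow_ok F -> domain (wave_of F) p ->
  ex_diff_n (stream (wave_of F)) 2 (Re p) (Im p) /\
  partial_derive 2 0 (stream (wave_of F)) (Re p) (Im p) + partial_derive 0 2 (stream (wave_of F)) (Re p) (Im p) = - cOm F.
Proof.
  intros H. destruct p as [x y]. simpl Re; simpl Im. intros Hp. assert (O := open_domain F H).
  set (D := domain (wave_of F)) in *.
  assert (Dk : forall x y, D (x, y) -> is_derive (fun u => Re (gg F (u, y))) x (Re (gk F (x, y))) /\
     is_derive (fun u => Im (gg F (u, y))) x (Im (gk F (x, y))) /\
     is_derive (fun v => Re (gg F (x, v))) y (- Im (gk F (x, y))) /\ is_derive (fun v => Im (gg F (x, v))) y (Re (gk F (x, y)))).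
  { intros u v K. apply quad_part, gg_quad; assumption. }
  assert (Cy : forall x y, continuity_2d_pt (fun u v => - cOm F * v) x y).
  { intros u v. apply (cont2_of_filterlim (fun q => - cOm F * Im q)).
    apply (continuous_mult (K := R_AbsRing) (fun _ => - cOm F) (fun q : C => Im q)); [apply continuous_const|apply continuous_snd]. }
  assert (Dy : forall x y, D (x, y) -> is_derive (fun u => - cOm F * y + Re (gg F (u, y))) x (Re (gk F (x, y))) /\
     is_derive (fun v => - cOm F * v + Re (gg F (x, v))) y (- cOm F - Im (gk F (x, y)))).
  { intros u v K. destruct (Dk u v K) as [K1 [K2 [K3 K4]]]. split.
    - eapply is_derive_eq; [apply (is_derive_plus (V := R_NormedModule)); [apply is_derive_const|exact K1]|]. unfold plus, zero; simpl; ring.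
    - eapply is_derive_eq; [apply (is_derive_plus (V := R_NormedModule)); [|exact K3]|].
      + instantiate (1 := - cOm F). auto_derive; [exact I|ring].
      + unfold plus; simpl; ring. }
  assert (C0 : forall f, (forall p, D p -> ccont f p) -> forall x y, D (x, y) ->
     continuity_2d_pt (fun u v => Re (f (u, v))) x y /\ continuity_2d_pt (fun u v => Im (f (u, v))) x y).
  { intros f Hf u v K. split; [apply (cont2_of_filterlim (fun q => Re (f q))), ccont_re|apply (cont2_of_filterlim (fun q => Im (f q))), ccont_im]; auto. }
  assert (Cg := C0 (gg F) (fun p K => quad_ccont _ _ _ (proj1 (gg_quad F p H K)))).
  assert (Ck := C0 (gk F) (fun p K => proj2 (gg_quad F p H K))).
  split.
  - apply (ex_diff_step D _ (fun x y => Im (gg F (x, y))) (fun x y => - cOm F * y + Re (gg F (x, y)))); try assumption.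
    + intros u v K. apply stream_d; assumption.
    + apply (ex_diff_step D _ (fun x y => Im (gk F (x, y))) (fun x y => Re (gk F (x, y)))); try assumption.
      * intros u v K. split; [apply Cg, K|]. split; apply (Dk u v K).
      * intros u v K. split; [apply Ck, K|exact I].
      * intros u v K. split; [apply Ck, K|exact I].
    + apply (ex_diff_step D _ (fun x y => Re (gk F (x, y))) (fun x y => - cOm F - Im (gk F (x, y)))); try assumption.
      * intros u v K. split; [apply continuity_2d_pt_plus; [apply Cy|apply Cg, K]|]. apply Dy, K.
      * intros u v K. split; [apply Ck, K|exact I].
      * intros u v K. split; [|exact I]. apply continuity_2d_pt_minus; [apply continuity_2d_pt_const|apply Ck, K].
  - destruct (partial_second D (stream (wave_of F)) (fun x y => Im (gg F (x, y))) (fun x y => - cOm F * y + Re (gg F (x, y))) x y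
      (Im (gk F (x, y))) (- cOm F - Im (gk F (x, y)))) as [-> ->]; try assumption; [|apply Dk; assumption|apply Dy; assumption|ring].
    intros u v K. apply stream_d; assumption.
Qed.

(** * Connectedness of images of convex sets *)

Definition clamp (s : R) : R := Rmax 0 (Rmin 1 s).
Lemma clamp_range s : 0 <= clamp s <= 1.
Proof. unfold clamp. split; [apply Rmax_l|]. apply Rmax_lub; [lra|apply Rmin_l]. Qed.
Lemma clamp_lip s s' : Rabs (clamp s' - clamp s) <= Rabs (s' - s).
Proof. unfold clamp, Rmax, Rmin. repeat destruct Rle_dec; unfold Rabs; repeat destruct Rcase_abs; lra. Qed.
Lemma clamp0 : clamp 0 = 0.
Proof. unfold clamp. rewrite Rmin_right, Rmax_left; lra. Qed.
Lemma clamp1 : clamp 1 = 1.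
Proof. unfold clamp. rewrite Rmin_left, Rmax_right; lra. Qed.

(* A separation pulled back to a segment gives a locally constant, hence constant, function on [R]. *)
Lemma image_connected (P : C -> Prop) (f : C -> C) :
  (forall a b s, P a -> P b -> 0 <= s <= 1 -> P (a + RtoC s * (b - a))%C) -> (forall b, P b -> ccont f b) ->
  connected (fun p => exists b, P b /\ f b = p).
Proof.
  intros Hc Hf V W HV HW Hcov Hdis. apply NNPP. intros N. apply not_or_and in N. destruct N as [N1 N2].
  apply not_all_ex_not in N1. destruct N1 as [p N1]. apply imply_to_and in N1. destruct N1 as [Up Vp].
  apply not_all_ex_not in N2. destruct N2 as [q N2]. apply imply_to_and in N2. destruct N2 as [Uq Wq].
  assert (Wp : W p) by (destruct (Hcov p Up); tauto). assert (Vq : V q) by (destruct (Hcov q Uq); tauto).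
  destruct Up as [a [Pa Ea]], Uq as [b [Pb Eb]].
  set (c s := (a + RtoC (clamp s) * (b - a))%C).
  assert (Pc : forall s, P (c s)) by (intros; apply Hc; auto using clamp_range).
  set (g s := if excluded_middle_informative (V (f (c s))) then 1 else 0).
  assert (CC : forall s e, 0 < e -> exists d, 0 < d /\ forall s', Rabs (s' - s) < d -> Cmod (c s' - c s)%C < e).
  { intros s e He. assert (P0 := Cmod_ge_0 (b - a)%C). exists (e / (Cmod (b - a)%C + 1)). split; [apply Rdiv_lt_0_compat; lra|].
    intros s' Hs. replace (c s' - c s)%C with (RtoC (clamp s' - clamp s) * (b - a))%C.
    2: { unfold c. rewrite RtoC_minus. ring. }
    rewrite Cmod_R_mult. eapply Rle_lt_trans; [apply Rmult_le_compat_r; [assumption|apply clamp_lip]|].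
    apply (Rmult_lt_compat_r (Cmod (b - a)%C + 1)) in Hs; [|lra]. unfold Rdiv in Hs. rewrite Rmult_assoc, Rinv_l in Hs by lra.
    generalize (Rabs_pos (s' - s)). nra. }
  assert (Lc : forall O : C -> Prop, open O -> forall s, O (f (c s)) -> locally s (fun s' => O (f (c s')))).
  { intros O HO s Hs. destruct (locally_C_inv _ _ (HO _ Hs)) as [e [He H1]].
    destruct (Hf (c s) (Pc s) e He) as [d1 [D1 H2]]. destruct (CC s d1 D1) as [d2 [D2 H3]].
    exists (mkposreal d2 D2). intros s' Hs'. apply H1, H2, H3. exact Hs'. }
  assert (Dg : forall s, is_derive g s 0).
  { intros s. apply (is_derive_ext_loc (fun _ => g s)); [|apply (is_derive_const (V := R_NormedModule))].
    assert (Us : exists b, P b /\ f b = f (c s)) by eauto.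
    destruct (Hcov _ Us) as [Hs|Hs].
    - generalize (Lc V HV s Hs). apply filter_imp. intros s' K. unfold g. repeat destruct excluded_middle_informative; tauto.
    - generalize (Lc W HW s Hs). apply filter_imp. intros s' K. unfold g.
      assert (Us' : exists b, P b /\ f b = f (c s')) by eauto.
      repeat destruct excluded_middle_informative; try reflexivity; exfalso; [apply (Hdis _ Us)|apply (Hdis _ Us')]; assumption. }
  assert (G := eq_is_derive g 0 1 (fun t _ => Dg t) Rlt_0_1). unfold g in G.
  assert (E0 : f (c 0) = p) by (rewrite <- Ea; unfold c; rewrite clamp0; f_equal; apply C_ext; unfold Re, Im; simpl; ring).
  assert (E1 : f (c 1) = q) by (rewrite <- Eb; unfold c; rewrite clamp1; f_equal; apply C_ext; unfold Re, Im; simpl; ring).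
  rewrite E0, E1 in G. repeat destruct excluded_middle_informative; tauto || lra.
Qed.

(** * Verification of the clauses of a solution *)

Lemma trace_cz F a : trace (wave_of F) a = cz F (a, cd_ F).
Proof. unfold trace; simpl. f_equal. unfold Cplus; simpl. f_equal; ring. Qed.

Lemma conf_in F a : strip (cd_ F) a -> ostrip F (a + (0, cd_ F))%C.
Proof. unfold strip, ostrip. unfold Im, Cplus; simpl. lra. Qed.

Lemma conf_good F al : flow_ok F -> good F (al, cd_ F).
Proof. intros H. assert (D := ok_d F H). unfold good; simpl; lra. Qed.

Lemma shift_shift F (b : C) : (b - (0, cd_ F) + (0, cd_ F))%C = b.
Proof. apply C_ext; unfold Re, Im; simpl; ring. Qed.
Lemma filterlim_within_locally {V : UniformSpace} (f : C -> V) D a G : filterlim f (locally a) G -> filterlim f (within D (locally a)) G.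
Proof. intros H. eapply filterlim_filter_le_1; [apply (filter_le_within (F := locally a))|exact H]. Qed.

Lemma filterlim_conf {V : UniformSpace} F (f : C -> V) a :
  filterlim f (locally (a + (0, cd_ F))%C) (locally (f (a + (0, cd_ F))%C)) ->
  filterlim (fun a => f (a + (0, cd_ F))%C) (locally a) (locally (f (a + (0, cd_ F))%C)).
Proof.
  intros H. eapply filterlim_comp; [|exact H]. intros P HP. destruct (locally_C_inv _ _ HP) as [d [D K]].
  apply (locally_C_ex a _ d D). intros b Hb. apply K. replace (b + (0, cd_ F) - (a + (0, cd_ F)))%C with (b - a)%C by ring. exact Hb.
Qed.

Lemma conf_derive F a : flow_ok F -> Rabs (Im (a + (0, cd_ F))%C) < cT F ->
  is_derive (conf (wave_of F)) a (cz1 F (a + (0, cd_ F))%C).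
Proof.
  intros H Ha. simpl. apply quad_der.
  replace (cz1 F (a + (0, cd_ F))%C) with (cz1 F (a + (0, cd_ F))%C * RtoC 1)%C by ring.
  apply (quad_comp (cz F) (fun a => a + (0, cd_ F))%C).
  - apply (quad_hol _ _ _ _ (ok_z F H)); assumption.
  - exists 0, 1. split; [lra|]. split; [lra|]. intros b _.
    replace (b + (0, cd_ F) - (a + (0, cd_ F)) - RtoC 1 * (b - a))%C with (RtoC 0) by ring. rewrite Cmod_0. lra.
Qed.

Lemma trace_derive F al : flow_ok F -> is_derive (trace (wave_of F)) al (cz1 F (al, cd_ F)).
Proof.
  intros H. assert (D := ok_d F H). assert (T : Rabs (cd_ F) < cT F) by (rewrite Rabs_pos_eq; lra).
  assert (R := hol_dx_re _ _ _ al (cd_ F) (ok_z F H) T). assert (I := hol_dx_im _ _ _ al (cd_ F) (ok_z F H) T).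
  apply (is_derive_ext (fun a => plus (scal (Re (cz F (a, cd_ F))) ((1, 0) : C)) (scal (Im (cz F (a, cd_ F))) ((0, 1) : C)))).
  - intros a. rewrite trace_cz. apply C_ext; unfold Re, Im; cbn; unfold mult, scal, plus; cbn; unfold mult; cbn; ring.
  - replace (cz1 F (al, cd_ F)) with (plus (scal (Re (cz1 F (al, cd_ F))) ((1, 0) : C)) (scal (Im (cz1 F (al, cd_ F))) ((0, 1) : C))).
    + apply (is_derive_plus (V := prod_NormedModule R_AbsRing R_NormedModule R_NormedModule)); apply (is_derive_scal_l (V := prod_NormedModule R_AbsRing R_NormedModule R_NormedModule)); assumption.
    + apply C_ext; unfold Re, Im; cbn; unfold mult, scal, plus; cbn; unfold mult; cbn; ring.
Qed.

(** Along the bottom the horizontal coordinate differs from [a] by at most [cM F], so by the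
    intermediate value theorem it takes every real value. *)
Lemma bottom_surj F x : flow_ok F -> exists a, cz F (a, 0) = (x, - cd_ F).
Proof.
  intros H. assert (D := ok_d F H). set (f := fun a => Re (cz F (a, 0))).
  assert (Cf : continuity f).
  { intros a. apply continuity_pt_filterlim. apply (ex_derive_continuous f). eexists.
    apply (hol_dx_re _ _ _ a 0 (ok_z F H)). rewrite Rabs_R0; lra. }
  assert (B : forall a, Rabs (f a - a) <= cM F) by (intros; apply (ok_close F H); lra).
  assert (B1 := B (x - cM F)). assert (B2 := B (x + cM F)). apply Rabs_le_between in B1. apply Rabs_le_between in B2.
  destruct (IVT_gen f (x - cM F) (x + cM F) x Cf) as [a [_ Ha]].
  { rewrite Rmin_left, Rmax_right by lra. lra. }
  exists a. apply C_ext; [exact Ha|apply (ok_bot F H)].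
Qed.

Lemma wave_conformal F : flow_ok F -> conformal_description (cd_ F) (wave_of F).
Proof.
  intros H. assert (D := ok_d F H). unfold conformal_description. change (depth (wave_of F)) with (cd_ F).
  assert (ST : forall a, - cd_ F <= Im a <= 0 -> cstrip F (a + (0, cd_ F))%C) by (intros a Ha; unfold cstrip, Im, Cplus in *; simpl; lra).
  repeat match goal with |- _ /\ _ => split end.
  - lra.
  - intros a Ha. eexists. apply conf_derive; [assumption|]. apply cstrip_T; [assumption|]. apply o_c, conf_in, Ha.
  - intros a b Ha Hb E. simpl in E. apply conf_in in Ha. apply conf_in in Hb.
    apply (f_equal (pre F)) in E.
    rewrite !pre_unique in E by assumption. replace a with (a + (0, cd_ F) - (0, cd_ F))%C by ring. rewrite E. ring.
  - intros p. simpl. split.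
    + intros [b [Hb <-]]. exists (b - (0, cd_ F))%C. rewrite shift_shift. split; [|reflexivity].
      unfold strip, ostrip, Im, Cminus, Cplus, Copp in *; simpl. lra.
    + intros [a [Ha <-]]. eexists. split; [apply conf_in, Ha|reflexivity].
  - intros a Ha. apply filterlim_within_locally. apply (filterlim_conf F (cz F)). apply ccont_filterlim, cz_ccont; [assumption|].
    apply ST. lra.
  - intros p. split.
    + intros Hp. destruct (bottom_surj F (Re p) H) as [a Ha]. exists (a, - cd_ F). split; [reflexivity|]. simpl.
      rewrite <- (C_surj p), Hp, <- Ha. f_equal. unfold Cplus; simpl. f_equal; ring.
    + intros [a [Ha <-]]. simpl. rewrite <- (ok_bot F H (Re a)). f_equal. f_equal. apply C_ext; unfold Re, Im, Cplus in *; simpl; lra.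
  - intros al. split.
    + apply filterlim_within_locally. replace (trace (wave_of F) al) with (cz F ((al, 0) + (0, cd_ F))%C) by reflexivity.
      apply (filterlim_conf F (cz F)). apply ccont_filterlim, cz_ccont; [assumption|]. apply ST. simpl. lra.
    + exists (cz1 F (al, cd_ F)). split; [apply (good_nz F (al, cd_ F) H), conf_good, H|]. split; [apply trace_derive, H|].
      assert (E : ((al, 0) + (0, cd_ F))%C = (al, cd_ F)) by (unfold Cplus; simpl; f_equal; ring).
      apply (filterlim_ext_loc (fun a => cz1 F (a + (0, cd_ F))%C)).
      * apply (locally_C_ex _ _ 1 Rlt_0_1). intros a _ Ha. symmetry. apply is_C_derive_unique. apply conf_derive; [assumption|].
        apply cstrip_T; [assumption|]. apply o_c, conf_in, Ha.
      * apply filterlim_within_locally. rewrite <- E. apply (filterlim_conf F (cz1 F)). rewrite E. apply ccont_filterlim.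
        eapply quad_ccont, (quad_hol _ _ _ _ (ok_z1 F H)), good_T; [assumption|apply conf_good, H].
  - intros a _. simpl. rewrite <- (ok_per F H). f_equal. ring.
Qed.

Lemma closure_not_open (U : C -> Prop) p : open U -> U p -> ~ closure (fun q => ~ U q) p.
Proof. intros HO Hp Hc. destruct (Hc U (HO p Hp)) as [q [Q1 Q2]]. tauto. Qed.
Lemma closure_sub (U : C -> Prop) p : U p -> closure U p.
Proof. intros H V HV. exists p. split; [apply locally_singleton; exact HV|exact H]. Qed.

Lemma domain_not_surface F al : flow_ok F -> ~ domain (wave_of F) (cz F (al, cd_ F)).
Proof.
  intros H [[a t] [Hb E]]. unfold ostrip in Hb; simpl in Hb. destruct (ok_inj F H a t al (cd_ F)); auto; lra.
Qed.
Lemma domain_above F p : flow_ok F -> domain (wave_of F) p -> - cd_ F < Im p.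
Proof. intros H [[a t] [Hb <-]]. unfold ostrip in Hb; simpl in Hb. apply (ok_im F H). lra. Qed.

Lemma wave_fluid F : flow_ok F -> fluid_domain (cd_ F) (wave_of F).
Proof.
  intros H. assert (D := ok_d F H). split; [split; [|split]|split].
  - exists (cz F (0, cd_ F / 2)), (0, cd_ F / 2). split; [unfold ostrip; simpl; lra|reflexivity].
  - apply open_domain, H.
  - apply (image_connected (ostrip F) (cz F)).
    + intros a b s Ha Hb Hs. unfold ostrip in *.
      replace (Im (a + RtoC s * (b - a))%C) with (Im a + s * (Im b - Im a)) by (unfold Im; simpl; ring).
      destruct (Req_dec s 1) as [->|]; [lra|]. assert (0 < 1 - s) by lra.
      assert (0 < (1 - s) * Im a) by nra. assert (0 < (1 - s) * (cd_ F - Im a)) by nra.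
      assert (0 <= s * Im b) by nra. assert (0 <= s * (cd_ F - Im b)) by nra. lra.
    + intros b Hb. apply cz_ccont; auto using o_c.
  - intros p Hp. apply domain_above; assumption.
  - intros p. split.
    + intros [C1 C2]. destruct (closure_cz F p H C1) as [b [Hb <-]].
      destruct (Req_dec (Im b) (cd_ F)) as [E|N].
      * left. exists (Re b). rewrite trace_cz, <- E, C_surj. reflexivity.
      * destruct (Req_dec (Im b) 0) as [E0|N0].
        -- right. rewrite <- (ok_bot F H (Re b)), <- E0, C_surj. reflexivity.
        -- exfalso. apply (closure_not_open _ _ (open_domain F H)) in C2; [assumption|].
           exists b. split; [|reflexivity]. unfold ostrip, cstrip in *. lra.
    + intros [[al <-]|Hp].
      * rewrite trace_cz. split; [apply cz_closure; [assumption|unfold cstrip; simpl; lra]|].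
        apply closure_sub, domain_not_surface, H.
      * destruct (bottom_surj F (Re p) H) as [a Ha]. rewrite <- Hp, C_surj in Ha. rewrite <- Ha.
        split; [apply cz_closure; [assumption|unfold cstrip; simpl; lra]|].
        apply closure_sub. intros K. apply domain_above in K; [|assumption]. rewrite Ha in K. lra.
Qed.

Lemma domain_shift F p : flow_ok F -> domain (wave_of F) p -> domain (wave_of F) (p + RtoC (2 * PI))%C.
Proof.
  intros H [b [Hb <-]]. exists (b + RtoC (2 * PI))%C. rewrite (ok_per F H). split; [|reflexivity].
  unfold ostrip, Im in *; simpl in *. lra.
Qed.
Lemma ok_per_m F b : flow_ok F -> cz F (b - RtoC (2 * PI))%C = (cz F b - RtoC (2 * PI))%C.
Proof.
  intros H. assert (E := ok_per F H (b - RtoC (2 * PI))%C).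
  replace (b - RtoC (2 * PI) + RtoC (2 * PI))%C with b in E by ring. rewrite E. ring.
Qed.

Lemma wave_periodic F : flow_ok F -> periodic_x (wave_of F).
Proof.
  intros H. split.
  - intros p. split; [|apply domain_shift, H]. intros [b [Hb E]]. exists (b - RtoC (2 * PI))%C.
    rewrite (ok_per_m F _ H), E. split; [|ring]. unfold ostrip, Im in *; simpl in *. lra.
  - intros p Hp. destruct (closure_cz F p H Hp) as [b [Hb <-]].
    rewrite <- (ok_per F H), !stream_cz by (try assumption; unfold cstrip, Im in *; simpl in *; lra).
    unfold Psi, potential. rewrite (ok_per F H), (ok_jper F H).
    replace (Im (cz F b + RtoC (2 * PI))%C) with (Im (cz F b)) by (unfold Im; simpl; ring). reflexivity.
Qed.

Lemma reflect_invol c p : reflect c (reflect c p) = p.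
Proof. unfold reflect. apply C_ext; unfold Re, Im; simpl; ring. Qed.

Lemma wave_symmetric F : flow_ok F -> reflection_symmetric (wave_of F).
Proof.
  intros H al Hal.
  assert (S : forall a t, 0 <= t <= cd_ F -> exists a', cz F (a', t) = reflect (Re (trace (wave_of F) al)) (cz F (a, t)) /\
      Im (cj F (a', t)) = Im (cj F (a, t))).
  { rewrite trace_cz. apply (ok_sym F H). unfold is_crest, is_trough in Hal.
    destruct Hal as [Hal|Hal]; [left|right]; intros b; specialize (Hal b); rewrite !trace_cz in Hal; exact Hal. }
  set (c := Re (trace (wave_of F) al)) in *. clearbody c.
  assert (D1 : forall p, domain (wave_of F) p -> domain (wave_of F) (reflect c p)).
  { intros p [[a t] [Hb <-]]. destruct (S a t (o_c F _ Hb)) as [a' [E _]]. exists (a', t). split; [exact Hb|exact E]. }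
  split.
  - intros p. split; [|apply D1]. intros Hp. rewrite <- (reflect_invol c p). apply D1, Hp.
  - intros p Hp. destruct (closure_cz F p H Hp) as [[a t] [Hb <-]]. destruct (S a t Hb) as [a' [E1 E2]].
    rewrite <- E1, !stream_cz by assumption. unfold Psi, potential. rewrite E1, E2. reflexivity.
Qed.

(** In the strip variable the velocity [cg] is continuous up to the surface, so each branch of the
    surface has its own gradient limit, also at a contact point. Dividing [ok_surf1] and [ok_surf2]
    by [cz1] gives the Bernoulli condition. *)
Lemma wave_equations F : flow_ok F -> water_wave_equations (cG F) (cd_ F) (wave_of F).
Proof.
  intros H. assert (D := ok_d F H). split; [|split; [|split; [|split]]].
  - intros p Hp. apply psi_continuous; assumption.
  - intros p Hp. apply (stream_poisson F p H Hp).
  - intros al. rewrite trace_cz, stream_cz by (try assumption; unfold cstrip; simpl; lra). apply potential_surface, H.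
  - intros al.
    assert (E : ((al, 0) + (0, cd_ F))%C = (al, cd_ F)) by (unfold Cplus; simpl; f_equal; ring).
    assert (Gd := conf_good F al H). assert (Cc := quad_ccont _ _ _ (cg_quad F _ H Gd)).
    assert (P : forall a, strip (cd_ F) a -> forall q, q = conf (wave_of F) a ->
       domain (wave_of F) q /\ gg F q = cg F (a + (0, cd_ F))%C).
    { intros a Ha q ->. apply conf_in in Ha. simpl. split; [eexists; split; [exact Ha|reflexivity]|]. unfold gg. rewrite pre_unique by assumption. reflexivity. }
    exists (Im (cg F (al, cd_ F))), (- cOm F * Im (cz F (al, cd_ F)) + Re (cg F (al, cd_ F))).
    split; [|split].
    + apply (filterlim_ext_loc (fun a => Im (cg F (a + (0, cd_ F))%C))).
      * apply (locally_C_ex _ _ 1 Rlt_0_1). intros a _ Ha. symmetry. destruct (P a Ha _ eq_refl) as [P1 P2]. rewrite <- P2.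
        rewrite <- (C_surj (conf (wave_of F) a)) in P1 |- * at 1. apply is_derive_unique. rewrite <- (C_surj (conf (wave_of F) a)) at 3.
        apply stream_d; assumption.
      * apply filterlim_within_locally. rewrite <- E. apply (filterlim_conf F (fun b => Im (cg F b))). rewrite E. apply ccont_im, Cc.
    + apply (filterlim_ext_loc (fun a => (fun b => - cOm F * Im (cz F b) + Re (cg F b)) (a + (0, cd_ F))%C)).
      * apply (locally_C_ex _ _ 1 Rlt_0_1). intros a _ Ha. symmetry. destruct (P a Ha _ eq_refl) as [P1 P2]. rewrite <- P2.
        change (cz F (a + (0, cd_ F))%C) with (conf (wave_of F) a).
        rewrite <- (C_surj (conf (wave_of F) a)) in P1. apply is_derive_unique.
        assert (K := proj2 (proj2 (stream_d F _ _ H P1))). rewrite C_surj in K. exact K.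
      * apply filterlim_within_locally. rewrite <- E. apply (filterlim_conf F (fun b => - cOm F * Im (cz F b) + Re (cg F b))). rewrite E.
        assert (K1 := ccont_re _ _ Cc).
        assert (K2 := ccont_im _ _ (quad_ccont _ _ _ (quad_hol _ _ _ _ (ok_z F H) (good_T F _ H Gd)))).
        apply (continuous_plus (V := R_NormedModule) (fun b => - cOm F * Im (cz F b)) (fun b => Re (cg F b))); [|exact K1].
        apply (continuous_mult (K := R_AbsRing) (fun _ => - cOm F) (fun b => Im (cz F b))); [apply continuous_const|exact K2].
    + rewrite trace_cz. change (bernoulli (wave_of F)) with (1/2).
      assert (S1 := ok_surf1 F H al). assert (S2 := ok_surf2 F H al). set (y := Im (cz F (al, cd_ F))) in *.
      assert (Hn := good_nz F _ H Gd). set (v := (cj1 F (al, cd_ F) - RtoC (cOm F * y) * cz1 F (al, cd_ F))%C) in *.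
      assert (Ev : (cg F (al, cd_ F) - RtoC (cOm F * y))%C = (v / cz1 F (al, cd_ F))%C) by (unfold cg, v; field; exact Hn).
      assert (M : Cmod (cg F (al, cd_ F) - RtoC (cOm F * y))%C ^ 2 = 1 - 2 * cG F * y).
      { rewrite Ev, Cmod_div by exact Hn. unfold Rdiv. rewrite Rpow_mult_distr, (Cmod_sq v), S1, S2.
        assert (Cmod (cz1 F (al, cd_ F)) <> 0) by (apply Rgt_not_eq, Cmod_gt_0, Hn). field. assumption. }
      rewrite Cmod_sq in M.
      replace (Re (cg F (al, cd_ F) - RtoC (cOm F * y))%C) with (Re (cg F (al, cd_ F)) - cOm F * y) in M by (unfold Re; simpl; ring).
      replace (Im (cg F (al, cd_ F) - RtoC (cOm F * y))%C) with (Im (cg F (al, cd_ F))) in M by (unfold Im; simpl; ring).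
      simpl in *. lra.
  - intros p Hp. destruct (bottom_surj F (Re p) H) as [a Ha]. rewrite <- Hp, C_surj in Ha. rewrite <- Ha.
    rewrite stream_cz by (try assumption; unfold cstrip; simpl; lra). apply Psi_bottom, H.
Qed.

Theorem wave_solution F : flow_ok F -> injective_profile (wave_of F) \/ touching_profile (wave_of F) ->
  solution (cG F) (cd_ F) (wave_of F).
Proof.
  intros H T. split; [apply wave_conformal, H|]. split; [apply wave_fluid, H|]. split; [apply wave_periodic, H|].
  split; [apply wave_symmetric, H|]. split; [apply wave_equations, H|exact T].
Qed.

(** * Injectivity of the conformal map *)

Lemma perZ {T} (f : R -> T) : (forall x, f (x + 2 * PI) = f x) -> forall n x, f (x + 2 * PI * IZR n) = f x.
Proof.
  intros H. assert (N : forall (n : nat) x, f (x + 2 * PI * INR n) = f x).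
  { induction n as [|n IH]; intros x; [simpl; f_equal; ring|]. rewrite S_INR.
    replace (x + 2 * PI * (INR n + 1)) with (x + 2 * PI * INR n + 2 * PI) by ring. rewrite H. apply IH. }
  intros n x. destruct (Z_le_gt_dec 0 n) as [L|L].
  - rewrite <- (Z2Nat.id n L), <- INR_IZR_INZ. apply N.
  - rewrite <- (N (Z.to_nat (- n)) (x + 2 * PI * IZR n)). f_equal.
    rewrite (INR_IZR_INZ (Z.to_nat (- n))), Z2Nat.id by lia. rewrite opp_IZR. ring.
Qed.

Lemma cos_perZ x n : cos (x + 2 * PI * IZR n) = cos x.
Proof. apply (perZ cos). intros y. replace (y + 2 * PI) with (y + 2 * INR 1 * PI) by (simpl; ring). apply cos_period. Qed.

Lemma W_perZ c phi sg n a t : W c phi sg (a + 2 * PI * IZR n) t = W c phi sg a t.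
Proof.
  apply (perZ (fun a => W c phi sg a t)). intros x. unfold W. apply Series_ext. intros k. unfold wterm. f_equal. f_equal.
  rewrite <- (cos_perZ (INR k * x + phi) (Z.of_nat k)), <- INR_IZR_INZ. f_equal. ring.
Qed.

(** The common shape of the conformal map, with [k = 1], and of the complex potential, with [k] the
    mean flow; periodicity, reflection symmetry and reality on the bottom are proved for both at
    once. *)
Definition Lc (k : R) (c : nat -> R) (b : C) : C := (RtoC k * b + RtoC 0 + csn c b)%C.

Lemma Lc_perZ k c n a t : Lc k c (a + 2 * PI * IZR n, t) = (Lc k c (a, t) + RtoC (k * (2 * PI * IZR n)))%C.
Proof. unfold Lc, csn. cbn [Re Im fst snd]. rewrite !W_perZ. apply C_ext; unfold Re, Im; simpl; ring. Qed.

Lemma Lc_refl k d g a t : okc (cd d g) (Tof d) -> Rabs t <= Tof d ->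
  Lc k (cd d g) (- a, t) = (- Re (Lc k (cd d g) (a, t)), Im (Lc k (cd d g) (a, t))).
Proof.
  intros H Ht. unfold Lc. apply C_ext.
  - replace (Re (RtoC k * ((- a)%R, t) + RtoC 0 + csn (cd d g) ((- a)%R, t))%C) with (k * - a + Re (csn (cd d g) (- a, t))) by (unfold Re; simpl; ring).
    rewrite csn_re by assumption.
    replace (Re (RtoC k * (a, t) + RtoC 0 + csn (cd d g) (a, t))%C) with (k * a + Re (csn (cd d g) (a, t))) by (unfold Re; simpl; ring).
    rewrite csn_re by assumption.
    unfold Re; simpl. rewrite (Series_ext _ (fun k0 : nat => - (g k0 * (xx d t ^ k0 + yy d t ^ k0) * sin (INR k0 * a)))).
    + rewrite Series_opp. ring.
    + intros n. rewrite Ropp_mult_distr_r_reverse, sin_neg. ring.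
  - replace (Im (RtoC k * ((- a)%R, t) + RtoC 0 + csn (cd d g) ((- a)%R, t))%C) with (k * t + Im (csn (cd d g) (- a, t))) by (unfold Im; simpl; ring).
    rewrite csn_im by assumption.
    replace (Im (RtoC k * (a, t) + RtoC 0 + csn (cd d g) (a, t))%C) with (k * t + Im (csn (cd d g) (a, t))) by (unfold Im; simpl; ring).
    rewrite csn_im by assumption.
    unfold Im; simpl. rewrite (Series_ext (fun k0 : nat => g k0 * (xx d t ^ k0 - yy d t ^ k0) * cos (INR k0 * - a))
      (fun k0 : nat => g k0 * (xx d t ^ k0 - yy d t ^ k0) * cos (INR k0 * a))); [ring|].
    intros n. rewrite Ropp_mult_distr_r_reverse, cos_neg. reflexivity.
Qed.

Lemma Lc_bot k d g a : 0 < d -> okc (cd d g) (Tof d) -> Im (Lc k (cd d g) (a, 0)) = 0.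
Proof.
  intros Hd H. unfold Lc. assert (T := Tof_gt d).
  replace (Im (RtoC k * (a, 0) + RtoC 0 + csn (cd d g) (a, 0))%C) with (Im (csn (cd d g) (a, 0))) by (unfold Im; simpl; ring).
  rewrite csn_im by (try assumption; rewrite Rabs_R0; lra).
  rewrite (Series_ext _ (fun _ => 0 * 0)).
  - rewrite Series_scal_l. ring.
  - intros n. replace (yy d 0) with (xx d 0) by (unfold xx, yy; f_equal; ring). ring.
Qed.

Lemma Lc_close d g a t : okc (cd d g) (Tof d) -> Rabs t <= Tof d ->
  Rabs (Re (Lc 1 (cd d g) (a, t)) - a) <= cnorm (cd d g) (Tof d).
Proof.
  intros H Ht. unfold Lc. replace (Re (RtoC 1 * (a, t) + RtoC 0 + csn (cd d g) (a, t))%C - a) with (Re (csn (cd d g) (a, t))) by (unfold Re; simpl; ring).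
  unfold csn; simpl. assert (B1 := W_le (cd d g) (- (PI / 2)) 1 a t (Tof d) H R1_abs Ht).
  assert (B2 := W_le (cd d g) (- (PI / 2)) (-1) a t (Tof d) H Rm1_abs Ht).
  apply Rabs_le_between in B1. apply Rabs_le_between in B2. apply Rabs_le. lra.
Qed.

Lemma hol_Lc k d g : okc (cd d g) (Tof d) ->
  hol (Lc k (cd d g)) (fun b => RtoC k + ccs (kc (cd d g)) b)%C (Tof d) /\
  hol (fun b => RtoC k + ccs (kc (cd d g)) b)%C (fun b => RtoC 0 + - csn (kc (kc (cd d g))) b)%C (Tof d) /\
  (forall b, Rabs (Im b) < Tof d -> ccont (fun b => RtoC 0 + - csn (kc (kc (cd d g))) b)%C b).
Proof.
  intros H.
  assert (K : forall r, hol (fun _ => RtoC r) (fun _ => RtoC 0) (Tof d)).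
  { intros r. exists 0. split; [lra|]. intros. replace (RtoC r - RtoC r - RtoC 0 * (b' - b))%C with (RtoC 0) by ring. rewrite Cmod_0. lra. }
  assert (O := okc_kc _ _ H). assert (O2 := okc_kc _ _ O). split; [|split].
  - apply (hol_plus (fun b => RtoC k * b + RtoC 0)%C); [apply hol_affine|apply hol_csn, H].
  - apply (hol_plus (fun _ => RtoC k) (fun _ => RtoC 0) (ccs (kc (cd d g)))); [apply K|apply hol_ccs, O].
  - intros b Hb e He.
    destruct (quad_ccont _ _ _ (quad_hol _ _ _ _ (hol_csn _ _ O2) Hb) e He) as [dl [D Hd]]. exists dl. split; [assumption|].
    intros b' Hb'. replace (RtoC 0 + - csn (kc (kc (cd d g))) b' - (RtoC 0 + - csn (kc (kc (cd d g))) b))%C with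
      (- (csn (kc (kc (cd d g))) b' - csn (kc (kc (cd d g))) b))%C by ring. rewrite Cmod_opp. apply Hd, Hb'.
Qed.

Lemma fold_angle a : exists (n : Z) (s a0 : R), (s = 1 \/ s = -1) /\ 0 <= a0 <= PI /\ a = 2 * PI * IZR n + s * a0.
Proof.
  (* [up] of the quotient less one half rounds to a nearest period, which leaves a remainder of
     absolute value at most [PI]. *)
  assert (P := PI_RGT_0). set (m := up (a / (2 * PI) - / 2)). destruct (archimed (a / (2 * PI) - / 2)) as [A1 A2]. fold m in A1, A2.
  assert (E : a = 2 * PI * (a / (2 * PI))) by (field; lra). set (q := a / (2 * PI)) in *.
  assert (B : - PI <= a - 2 * PI * IZR m <= PI) by (rewrite E; split; nra).
  destruct (Rle_lt_dec 0 (a - 2 * PI * IZR m)).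
  - exists m, 1, (a - 2 * PI * IZR m). split; [auto|]. split; [lra|ring].
  - exists m, (-1), (- (a - 2 * PI * IZR m)). split; [auto|]. split; [lra|ring].
Qed.

(** The sign condition on the surface is not strict, so the amplitude of first contact is
    included. *)
Definition admissible (d A : R) (dl : nat -> R) (kap : R) : Prop :=
  0 < A <= 23/50 /\ near_crapper d dl kap /\ forall al, 0 < al < PI -> 0 <= Re (Zh d A dl (al, d)).

Lemma adm_okc d A dl kap : admissible d A dl kap -> okc (cd d (gz A dl)) (Tof d).
Proof. intros [H1 [H2 _]]. apply (okc_gz A dl kap d); [lra|assumption]. Qed.
Lemma adm_d d A dl kap t : admissible d A dl kap -> 0 <= t <= d -> Rabs t < Tof d.
Proof. intros [_ [[H _] _]] Ht. apply abs_T; assumption. Qed.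

Lemma Zh_perZ d A dl n a t : Zh d A dl (a + 2 * PI * IZR n, t) = (Zh d A dl (a, t) + RtoC (2 * PI * IZR n))%C.
Proof. change (Zh d A dl) with (Lc 1 (cd d (gz A dl))). rewrite Lc_perZ, Rmult_1_l. reflexivity. Qed.
Lemma Zh_refl d A dl kap a t : admissible d A dl kap -> 0 <= t <= d ->
  Zh d A dl (- a, t) = (- Re (Zh d A dl (a, t)), Im (Zh d A dl (a, t))).
Proof. intros H Ht. apply (Lc_refl 1); [eapply adm_okc; eassumption|]. apply Rlt_le, (adm_d d A dl kap); assumption. Qed.

Lemma Zh_fold d A dl kap n s a0 t : admissible d A dl kap -> 0 <= t <= d -> s = 1 \/ s = -1 ->
  Re (Zh d A dl (2 * PI * IZR n + s * a0, t)) = 2 * PI * IZR n + s * Re (Zh d A dl (a0, t)) /\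
  Im (Zh d A dl (2 * PI * IZR n + s * a0, t)) = Im (Zh d A dl (a0, t)).
Proof.
  intros H Ht Hs. rewrite (Rplus_comm (2 * PI * IZR n)), Zh_perZ. destruct Hs as [-> | ->].
  - replace (1 * a0) with a0 by ring. split; unfold Re, Im; simpl; ring.
  - replace (-1 * a0) with (- a0) by ring. rewrite (Zh_refl d A dl kap) by assumption. split; unfold Re, Im; simpl; ring.
Qed.

Lemma Zh_x0 d A dl kap t : admissible d A dl kap -> 0 <= t <= d -> Re (Zh d A dl (0, t)) = 0.
Proof.
  intros H Ht. assert (K := Zh_refl d A dl kap 0 t H Ht). rewrite Ropp_0 in K. apply (f_equal Re) in K. set (z := Zh d A dl (0, t)) in *. clearbody z. unfold Re in *; simpl in K. lra.
Qed.
Lemma Zh_xpi d A dl kap t : admissible d A dl kap -> 0 <= t <= d -> Re (Zh d A dl (PI, t)) = PI.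
Proof.
  intros H Ht. destruct (Zh_fold d A dl kap 1 (-1) PI t H Ht) as [K _]; [auto|].
  replace (2 * PI * 1 + -1 * PI) with PI in K by ring. lra.
Qed.

Lemma seg_ge lo x y s : lo <= x -> lo <= y -> 0 <= s <= 1 -> lo <= x + s * (y - x).
Proof. intros. assert (0 <= (1 - s) * (x - lo)) by nra. assert (0 <= s * (y - lo)) by nra. lra. Qed.
Lemma seg_gt lo x y s : lo < x -> lo <= y -> 0 <= s < 1 -> lo < x + s * (y - x).
Proof. intros. assert (0 < (1 - s) * (x - lo)) by nra. assert (0 <= s * (y - lo)) by nra. lra. Qed.
Lemma seg_le hi x y s : x <= hi -> y <= hi -> 0 <= s <= 1 -> x + s * (y - x) <= hi.
Proof. intros. assert (0 <= (1 - s) * (hi - x)) by nra. assert (0 <= s * (hi - y)) by nra. lra. Qed.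
Lemma seg_lt hi x y s : x < hi -> y <= hi -> 0 <= s < 1 -> x + s * (y - x) < hi.
Proof. intros. assert (0 < (1 - s) * (hi - x)) by nra. assert (0 <= s * (hi - y)) by nra. lra. Qed.

(* Noshiro-Warschawski argument: Im Z' > 0 on a convex set. *)
Lemma Zh_noshiro d A dl kap p q : admissible d A dl kap -> 0 < Re p < PI -> 0 < Im p <= d -> 0 <= Re q <= PI -> 0 <= Im q <= d ->
  q <> p -> 0 < Im ((Zh d A dl q - Zh d A dl p) * Cconj (q - p))%C.
Proof.
  (* With this [k] the derivative of [Re (k Z)] along the segment is [|w|^2 Im Z']. *)
  intros [HA [Hn _]] P1 P2 Q1 Q2 N. set (w := (q - p)%C). set (k := (- Ci * Cconj w)%C).
  assert (HA' : 0 <= A <= 23/50) by lra. assert (Hd : 0 < d) by apply Hn.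
  set (f := fun s => Re (k * Zh d A dl (p + RtoC s * w))%C).
  assert (Hi : forall s, Im (p + RtoC s * w)%C = Im p + s * (Im q - Im p)) by (intros; unfold w, Im; simpl; ring).
  assert (Hr : forall s, Re (p + RtoC s * w)%C = Re p + s * (Re q - Re p)) by (intros; unfold w, Re; simpl; ring).
  assert (Hw : 0 < Cmod w ^ 2).
  { apply pow_lt. apply Cmod_gt_0. intro E. apply N. replace q with (w + p)%C by (unfold w; ring). rewrite E. ring. }
  assert (D : forall s, 0 <= s <= 1 -> is_derive f s (Re (k * (Zh1 d A dl (p + RtoC s * w) * w))%C)).
  { intros s Hs. apply (hol_line _ _ (Tof d)); [apply (hol_Zh A dl kap d HA' Hn)|]. rewrite Hi. apply abs_T; [assumption|]. split; [apply seg_ge|apply seg_le]; lra. }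
  destruct (MVT_cor2 f (fun s => Re (k * (Zh1 d A dl (p + RtoC s * w) * w))%C) 0 1 Rlt_0_1) as [s [E Hs]].
  { intros s Hs. apply is_derive_Reals, D, Hs. }
  replace (Im ((Zh d A dl q - Zh d A dl p) * Cconj w)%C) with (f 1 - f 0).
  2: { unfold f. replace (p + RtoC 1 * w)%C with q by (unfold w; ring). replace (p + RtoC 0 * w)%C with p by ring.
       unfold k, Cconj, Ci, Re, Im; simpl; ring. }
  rewrite E. replace (Re (k * (Zh1 d A dl (p + RtoC s * w) * w))%C) with (Cmod w ^ 2 * Im (Zh1 d A dl (p + RtoC s * w)%C)).
  2: { rewrite Cmod_sq. unfold k, Cconj, Ci, Re, Im; simpl; ring. }
  rewrite Rminus_0_r, Rmult_1_r. apply Rmult_lt_0_compat; [assumption|].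
  rewrite <- (C_surj (p + RtoC s * w)%C), Hr, Hi. apply (Zh_y_pos A dl kap d); try assumption; split; (apply seg_gt || apply seg_lt || apply seg_le); lra.
Qed.

Lemma pos_derive_incr (f f' : R -> R) a b : a < b -> (forall x, a <= x <= b -> is_derive f x (f' x)) ->
  (forall x, a < x < b -> 0 < f' x) -> f a < f b.
Proof.
  intros H D P. destruct (MVT_cor2 f f' a b H) as [c [E Hc]]; [intros; apply is_derive_Reals, D; assumption|].
  specialize (P c Hc). nra.
Qed.

Lemma Zh_y_axis d A dl kap (a t t' : R) : admissible d A dl kap -> a = 0 \/ a = PI -> 0 <= t -> t < t' -> t' <= d ->
  Im (Zh d A dl (a, t)) < Im (Zh d A dl (a, t')).
Proof.
  intros [HA [Hn _]] Ha T1 T2 T3. assert (HA' : 0 <= A <= 23/50) by lra. assert (Hd : 0 < d) by apply Hn.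
  apply (pos_derive_incr (fun t => Im (Zh d A dl (a, t))) (fun t => Re (Zh1 d A dl (a, t)))); [assumption| |].
  - intros x Hx. apply (hol_dy_im _ _ (Tof d) a x (hol_Zh A dl kap d HA' Hn)). apply abs_T; lra.
  - intros x Hx. destruct Ha as [-> | ->]; [apply (Zh1_re_0 A dl kap d)|apply (Zh1_re_pi A dl kap d)]; auto; lra.
Qed.

Lemma Zh_x_decr d A dl kap a t t' : admissible d A dl kap -> 0 < a < PI -> 0 <= t -> t < t' -> t' <= d ->
  Re (Zh d A dl (a, t')) < Re (Zh d A dl (a, t)).
Proof.
  intros [HA [Hn _]] Ha T1 T2 T3. assert (HA' : 0 <= A <= 23/50) by lra. assert (Hd : 0 < d) by apply Hn.
  assert (K := pos_derive_incr (fun t => - Re (Zh d A dl (a, t))) (fun t => Im (Zh1 d A dl (a, t))) t t').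
  enough (- Re (Zh d A dl (a, t)) < - Re (Zh d A dl (a, t'))) by lra. apply K; [assumption| |].
  - intros x Hx. eapply is_derive_eq; [apply (is_derive_opp (V := R_NormedModule)), (hol_dy_re _ _ (Tof d) a x (hol_Zh A dl kap d HA' Hn)); apply abs_T; lra|].
    unfold opp; simpl; ring.
  - intros x Hx. apply (Zh_y_pos A dl kap d); auto; lra.
Qed.

Lemma Zh_y_incr d A dl kap a a' t : admissible d A dl kap -> 0 <= a -> a < a' -> a' <= PI -> 0 < t <= d ->
  Im (Zh d A dl (a, t)) < Im (Zh d A dl (a', t)).
Proof.
  intros [HA [Hn _]] A1 A2 A3 Ht. assert (HA' : 0 <= A <= 23/50) by lra. assert (Hd : 0 < d) by apply Hn.
  apply (pos_derive_incr (fun a => Im (Zh d A dl (a, t))) (fun a => Im (Zh1 d A dl (a, t)))); [assumption| |].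
  - intros x Hx. apply (hol_dx_im _ _ (Tof d) x t (hol_Zh A dl kap d HA' Hn)). apply abs_T; lra.
  - intros x Hx. apply (Zh_y_pos A dl kap d); auto; lra.
Qed.

(** [Im Z' > 0] makes the horizontal coordinate strictly decreasing in [t]; it lies between its
    surface value, nonnegative by admissibility, and its bottom value, which is below [PI]. *)
Lemma Zh_x_range d A dl kap a t : admissible d A dl kap -> 0 < a < PI -> 0 <= t <= d ->
  0 <= Re (Zh d A dl (a, t)) < PI /\ (t < d -> 0 < Re (Zh d A dl (a, t))).
Proof.
  intros H Ha Ht. assert (H' := H). destruct H' as [HA [Hn Hx]]. specialize (Hx a Ha).
  assert (B := Zh_bot_lt A dl kap d a ltac:(lra) Hn Ha).
  assert (K : t < d -> 0 < Re (Zh d A dl (a, t))).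
  { intros L. assert (K := Zh_x_decr d A dl kap a t d H Ha ltac:(lra) L ltac:(lra)). lra. }
  split; [|exact K]. split.
  - destruct (Req_dec t d) as [->|]; [assumption|]. apply Rlt_le, K. lra.
  - destruct (Req_dec t 0) as [->|]; [assumption|].
    assert (K2 := Zh_x_decr d A dl kap a 0 t H Ha ltac:(lra) ltac:(lra) ltac:(lra)). lra.
Qed.

(** [Zh_noshiro] needs one of the points off the two vertical axes. The axes themselves are
    separated by their horizontal coordinates, and points of one axis by the monotonicity of the
    height. *)
Lemma Zh_half_inj d A dl kap p q : admissible d A dl kap -> 0 <= Re p <= PI -> 0 < Im p <= d -> 0 <= Re q <= PI -> 0 < Im q <= d ->
  Zh d A dl p = Zh d A dl q -> p = q.
Proof.
  intros H P1 P2 Q1 Q2 E. apply NNPP. intros N.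
  assert (I : forall p q, 0 < Re p < PI -> 0 < Im p <= d -> 0 <= Re q <= PI -> 0 < Im q <= d -> p <> q -> Zh d A dl p <> Zh d A dl q).
  { intros p' q' I1 I2 I3 I4 I5 I6. assert (K := Zh_noshiro d A dl kap p' q' H I1 I2 I3 ltac:(lra) (fun e => I5 (eq_sym e))).
    rewrite I6 in K. replace ((Zh d A dl q' - Zh d A dl q') * Cconj (q' - p'))%C with (RtoC 0) in K by ring.
    unfold Im, RtoC in K; simpl in K. lra. }
  destruct (Req_dec (Re p) 0) as [p0|p0]; [|destruct (Req_dec (Re p) PI) as [p1|p1]; [|apply (I p q); auto; lra]].
  - destruct (Req_dec (Re q) 0) as [q0|q0]; [|destruct (Req_dec (Re q) PI) as [q1|q1]; [|apply (I q p); auto; lra]].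
    + apply N. apply C_ext; [lra|]. rewrite <- (C_surj p), <- (C_surj q), p0, q0 in E. apply (f_equal Im) in E.
      destruct (Rtotal_order (Im p) (Im q)) as [L|[L|L]]; [|exact L|];
        apply (Zh_y_axis d A dl kap 0) in L; auto; lra.
    + rewrite <- (C_surj p), <- (C_surj q), p0, q1 in E. apply (f_equal Re) in E.
      rewrite (Zh_x0 d A dl kap), (Zh_xpi d A dl kap) in E by (auto; lra). generalize PI_RGT_0; lra.
  - destruct (Req_dec (Re q) 0) as [q0|q0]; [|destruct (Req_dec (Re q) PI) as [q1|q1]; [|apply (I q p); auto; lra]].
    + rewrite <- (C_surj p), <- (C_surj q), p1, q0 in E. apply (f_equal Re) in E.
      rewrite (Zh_x0 d A dl kap), (Zh_xpi d A dl kap) in E by (auto; lra). generalize PI_RGT_0; lra.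
    + apply N. apply C_ext; [lra|]. rewrite <- (C_surj p), <- (C_surj q), p1, q1 in E. apply (f_equal Im) in E.
      destruct (Rtotal_order (Im p) (Im q)) as [L|[L|L]]; [|exact L|];
        apply (Zh_y_axis d A dl kap PI) in L; auto; lra.
Qed.

Lemma IZR_small (n : Z) : -1 < IZR n < 1 -> n = 0%Z.
Proof. intros [H1 H2]. apply lt_IZR in H1. apply lt_IZR in H2. lia. Qed.

(** Both points are folded into one half period, whose image lies between the axes 0 and [PI].
    Comparing horizontal coordinates modulo the period shows that the folded images agree. Different
    signs are then possible only on an axis, and off the parameters 0 and [PI] only a surface point
    with horizontal coordinate 0 qualifies. *)
Lemma Zh_coincide d A dl kap a t a' t' : admissible d A dl kap -> 0 < t <= d -> 0 < t' <= d ->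
  Zh d A dl (a, t) = Zh d A dl (a', t') -> t = t' /\ (a = a' \/ t = d /\ exists (n : Z) s a0, (s = 1 \/ s = -1) /\
    0 < a0 < PI /\ Re (Zh d A dl (a0, d)) = 0 /\ a = 2 * PI * IZR n + s * a0 /\ a' = 2 * PI * IZR n - s * a0).
Proof.
  intros H Ht Ht' E. destruct (fold_angle a) as [n [s [a0 [Hs [Ha Ea]]]]]. destruct (fold_angle a') as [n' [s' [a0' [Hs' [Ha' Ea']]]]].
  destruct (Zh_fold d A dl kap n s a0 t H ltac:(lra) Hs) as [X1 Y1]. destruct (Zh_fold d A dl kap n' s' a0' t' H ltac:(lra) Hs') as [X2 Y2].
  rewrite <- Ea in X1, Y1. rewrite <- Ea' in X2, Y2. rewrite E, X2 in X1. rewrite E, Y2 in Y1.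
  assert (PP := PI_RGT_0).
  assert (XB : forall a t, 0 <= a <= PI -> 0 < t <= d -> 0 <= Re (Zh d A dl (a, t)) <= PI).
  { intros u v Hu Hv. destruct (Req_dec u 0) as [->|]; [rewrite (Zh_x0 d A dl kap) by (auto; lra); lra|].
    destruct (Req_dec u PI) as [->|]; [rewrite (Zh_xpi d A dl kap) by (auto; lra); lra|].
    destruct (Zh_x_range d A dl kap u v H) as [K _]; lra. }
  assert (B1 := XB a0 t Ha Ht). assert (B2 := XB a0' t' Ha' Ht').
  set (x := Re (Zh d A dl (a0, t))) in *. set (x' := Re (Zh d A dl (a0', t'))) in *.
  assert (Hn : IZR (n' - n) = (s * x - s' * x') / (2 * PI)) by (rewrite minus_IZR; field_simplify; [|lra]; apply (Rmult_eq_reg_r (2 * PI)); [field_simplify; lra|lra]).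
  assert (EX : x = x').
  { assert (C1 : 2 * PI * IZR (n' - n) = s * x - s' * x') by (rewrite Hn; field; lra).
    destruct (Z_dec (n' - n) 0) as [[L|L]|L].
    - assert (IZR (n' - n) <= -1) by (apply (IZR_le _ (-1)); lia). destruct Hs as [-> | ->], Hs' as [-> | ->]; nra.
    - assert (1 <= IZR (n' - n)) by (apply (IZR_le 1); lia). destruct Hs as [-> | ->], Hs' as [-> | ->]; nra.
    - rewrite L in C1. destruct Hs as [-> | ->], Hs' as [-> | ->]; lra. }
  assert (EP : (a0, t) = (a0', t')).
  { apply (Zh_half_inj d A dl kap); auto. apply C_ext; [exact EX|]. symmetry. exact Y1. }
  injection EP as <- <-. split; [reflexivity|].
  destruct (classic (s = s')) as [<-|Ns].
  - left. replace x' with x in Hn. assert (n' = n).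
    { assert (n' - n = 0)%Z; [|lia]. apply IZR_small. rewrite Hn. unfold Rdiv. rewrite Rminus_diag, Rmult_0_l. lra. }
    subst n'. lra.
  - assert (s' = - s) by (destruct Hs as [-> | ->], Hs' as [-> | ->]; lra). subst s'.
    assert (C1 : 2 * PI * IZR (n' - n) = s * (2 * x)) by (rewrite Hn, <- EX; field; lra).
    destruct (Req_dec a0 0) as [Z0|Z0].
    { assert (x = 0) by (unfold x; rewrite Z0; apply (Zh_x0 d A dl kap); auto; lra). left.
      assert (n' - n = 0)%Z; [|assert (n' = n) by lia; subst n'; rewrite Ea, Ea', Z0; ring].
      apply IZR_small. rewrite Hn. rewrite <- EX, H0. replace ((s * 0 - - s * 0) / (2 * PI)) with 0 by (field; lra). lra. }
    destruct (Req_dec a0 PI) as [Z1|Z1].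
    { assert (x = PI) by (unfold x; rewrite Z1; apply (Zh_xpi d A dl kap); auto; lra). left.
      rewrite H0 in C1. rewrite minus_IZR in C1. rewrite Ea, Ea', Z1.
      assert (2 * PI * IZR n' = 2 * PI * IZR n + s * (2 * PI)) by lra. lra. }
    destruct (Zh_x_range d A dl kap a0 t H) as [R1 R2]; [lra|lra|]. fold x in R1, R2.
    assert (n' - n = 0)%Z.
    { apply IZR_small. assert (-(2 * PI) < s * (2 * x) < 2 * PI) by (destruct Hs as [-> | ->]; lra).
      split; apply Rnot_le_lt; intro; nra. }
    assert (n' = n) by lia. subst n'.
    assert (x = 0) by (rewrite Z.sub_diag in C1; destruct Hs as [-> | ->]; lra).
    right. assert (t = d) by (destruct (Rle_lt_or_eq_dec t d); lra). subst t. split; [reflexivity|].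
    exists n, s, a0. repeat split; auto; lra.
Qed.

(** * The concrete flow built from the coefficients *)

Definition jz (jn : nat -> R) (k : nat) : R := jn k / INR k.

(** The conclusion of [wave_coefs] at one amplitude with [e = exp (-2 * d)], the value of [yy d d],
    by which a reflected mode is damped at the surface. *)
Definition surface_conditions (d A G Om : R) (dl jn : nat -> R) : Prop := forall al, exists y cz sz jc js,
  is_series (fun n => A * (h0 n A + dl n) / INR n * (1 - exp (-2 * d) ^ n) * cos (INR n * al)) y /\
  is_series (fun n => A * (h0 n A + dl n) * (1 + exp (-2 * d) ^ n) * cos (INR n * al)) (cz - 1) /\
  is_series (fun n => A * (h0 n A + dl n) * (1 - exp (-2 * d) ^ n) * sin (INR n * al)) (- sz) /\
  is_series (fun n => jn n * (1 + exp (-2 * d) ^ n) * cos (INR n * al)) (jc + jn O) /\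
  is_series (fun n => jn n * (1 - exp (-2 * d) ^ n) * sin (INR n * al)) (- js) /\
  js = Om * y * sz /\ (jc - Om * y * cz) ^ 2 = (1 - 2 * G * y) * (cz ^ 2 + sz ^ 2).

(** The map [Zh] is real on the bottom [t = 0], so lowering it by [d] puts the bottom at height
    [- d]: physical depth and conformal depth coincide. *)
Definition water_flow (d A G Om : R) (dl jn : nat -> R) : flow :=
  Flow d (Tof d) (cnorm (cd d (gz A dl)) (Tof d)) Om G
    (fun b => Zh d A dl b - (0, d))%C (Zh1 d A dl) (Zh2 d A dl)
    (Lc (jn O) (cd d (jz jn))) (fun b => RtoC (jn O) + ccs (kc (cd d (jz jn))) b)%C
    (fun b => RtoC 0 + - csn (kc (kc (cd d (jz jn)))) b)%C.

Lemma yy_top d : yy d d = exp (-2 * d).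
Proof. unfold yy. f_equal. ring. Qed.

Lemma okc_jz d jn : geoB jn -> okc (cd d (jz jn)) (Tof d).
Proof.
  intros [M H]. apply okc_cd. exists M. intros k. unfold jz. eapply Rle_trans; [apply Rabs_div_nat|apply H].
Qed.

Lemma surface_values d A G Om dl jn kap al : 0 <= A <= 23/50 -> near_crapper d dl kap -> geoB jn ->
  surface_conditions d A G Om dl jn ->
  let Z1 := Zh1 d A dl (al, d) in let J1 := cj1 (water_flow d A G Om dl jn) (al, d) in let y := Im (Zh d A dl (al, d)) - d in
  Im J1 = Om * y * Im Z1 /\ (Re J1 - Om * y * Re Z1) ^ 2 = (1 - 2 * G * y) * (Re Z1 ^ 2 + Im Z1 ^ 2).
Proof.
  intros HA Hn Hj HS Z1 J1 y. destruct (HS al) as [y' [cz [sz [jc [js [S1 [S2 [S3 [S4 [S5 [S6 S7]]]]]]]]]]].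
  assert (Hd : 0 < d) by apply Hn.
  assert (T : Rabs d <= Tof d) by (rewrite Rabs_pos_eq; generalize (Tof_gt d); lra).
  assert (Og := okc_gz A dl kap d HA Hn). assert (Oj := okc_jz d jn Hj).
  assert (Ogk : okc (cd d (kc (gz A dl))) (Tof d)) by (rewrite <- kc_cd; apply okc_kc, Og).
  assert (Ojk : okc (cd d (kc (jz jn))) (Tof d)) by (rewrite <- kc_cd; apply okc_kc, Oj).
  assert (Ek : forall k, kc (jz jn) k = if Nat.eqb k 0 then 0 else jn k).
  { intros [|k]; unfold kc, jz; [simpl; ring|]. simpl Nat.eqb. cbv iota. field. apply not_0_INR. lia. }
  assert (Ey : y = y').
  { unfold y. rewrite (Zh_im A dl kap) by assumption. rewrite xx_top, yy_top.
    rewrite (Series_ext _ (fun n => A * (h0 n A + dl n) / INR n * (1 - exp (-2 * d) ^ n) * cos (INR n * al))).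
    - rewrite (is_series_unique _ _ S1). ring.
    - intros n. unfold gz, hh. rewrite pow1. reflexivity. }
  assert (E1 : Re Z1 = cz).
  { unfold Z1, Zh1. replace (Re (RtoC 1 + ccs (cd d (kc (gz A dl))) (al, d))%C) with (1 + Re (ccs (cd d (kc (gz A dl))) (al, d))) by (unfold Re; simpl; ring).
    rewrite ccs_re by assumption. rewrite xx_top, yy_top.
    rewrite (Series_ext _ (fun n => A * (h0 n A + dl n) * (1 + exp (-2 * d) ^ n) * cos (INR n * al))).
    - rewrite (is_series_unique _ _ S2). ring.
    - intros n. rewrite (kc_gz A dl kap d) by assumption. unfold hh. rewrite pow1. reflexivity. }
  assert (E2 : Im Z1 = sz).
  { unfold Z1, Zh1. replace (Im (RtoC 1 + ccs (cd d (kc (gz A dl))) (al, d))%C) with (Im (ccs (cd d (kc (gz A dl))) (al, d))) by (unfold Im; simpl; ring).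
    rewrite ccs_im by assumption. rewrite xx_top, yy_top.
    rewrite (Series_ext _ (fun n => A * (h0 n A + dl n) * (1 - exp (-2 * d) ^ n) * sin (INR n * al))).
    - rewrite (is_series_unique _ _ S3). ring.
    - intros n. rewrite (kc_gz A dl kap d) by assumption. unfold hh. rewrite pow1. reflexivity. }
  assert (E3 : Re J1 = jc).
  { unfold J1. cbn [cj1 water_flow]. rewrite kc_cd. replace (Re (RtoC (jn O) + ccs (cd d (kc (jz jn))) (al, d))%C) with (jn O + Re (ccs (cd d (kc (jz jn))) (al, d))) by (unfold Re; simpl; ring).
    rewrite ccs_re by assumption. rewrite xx_top, yy_top.
    (* [kc] drops the mode 0, whereas the series in [S4] contains it with the factor 2. The mean
       flow [jn O] that is added in [cj1] makes up the difference. *)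
    set (f := fun n => jn n * (1 + exp (-2 * d) ^ n) * cos (INR n * al)) in S4.
    rewrite Series_incr_1_aux by (rewrite Ek; simpl; ring).
    rewrite (Series_ext _ (fun k => f (S k))) by (intros k; unfold f; rewrite Ek, pow1; reflexivity).
    assert (K := Series_incr_1 f (ex_intro _ _ S4)). rewrite (is_series_unique _ _ S4) in K.
    unfold f at 1 in K. simpl in K. rewrite Rmult_0_l, cos_0 in K. lra. }
  assert (E4 : Im J1 = js).
  { unfold J1. cbn [cj1 water_flow]. rewrite kc_cd. replace (Im (RtoC (jn O) + ccs (cd d (kc (jz jn))) (al, d))%C) with (Im (ccs (cd d (kc (jz jn))) (al, d))) by (unfold Im; simpl; ring).
    rewrite ccs_im by assumption. rewrite xx_top, yy_top.
    set (f := fun n => jn n * (1 - exp (-2 * d) ^ n) * sin (INR n * al)) in S5.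
    rewrite (Series_ext _ f).
    - rewrite (is_series_unique _ _ S5). ring.
    - intros k. unfold f. rewrite Ek, pow1. destruct k; [simpl; replace (0 * al) with 0 by ring; rewrite sin_0; ring|reflexivity]. }
  rewrite E1, E2, E3, E4, Ey. split; assumption.
Qed.

Lemma Zh_zero d dl b : Zh d 0 dl b = b.
Proof.
  unfold Zh, csn. assert (E : forall phi sg a t, W (cd d (gz 0 dl)) phi sg a t = 0).
  { intros. unfold W. rewrite (Series_ext _ (fun _ => 0 * 0)); [rewrite Series_scal_l; ring|].
    intros k. unfold wterm, cd, gz, hh. unfold Rdiv. ring. }
  rewrite !E. apply C_ext; unfold Re, Im; simpl; ring.
Qed.
Lemma Lc_const k d jn b : (forall n, jn (S n) = 0) -> Lc k (cd d (jz jn)) b = (RtoC k * b)%C.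
Proof.
  intros H. unfold Lc, csn. assert (E : forall phi sg a t, W (cd d (jz jn)) phi sg a t = 0).
  { intros. unfold W. rewrite (Series_ext _ (fun _ => 0 * 0)); [rewrite Series_scal_l; ring|].
    intros [|n]; unfold wterm, cd, jz, Rdiv; [simpl; rewrite Rinv_0; ring|rewrite H; ring]. }
  rewrite !E. apply C_ext; unfold Re, Im; simpl; ring.
Qed.
Lemma Zh1_zero d dl b : Zh1 d 0 dl b = RtoC 1.
Proof.
  unfold Zh1, ccs. assert (E : forall phi sg a t, W (cd d (kc (gz 0 dl))) phi sg a t = 0).
  { intros. unfold W. rewrite (Series_ext _ (fun _ => 0 * 0)); [rewrite Series_scal_l; ring|].
    intros k. unfold wterm, cd, kc, gz, hh. unfold Rdiv. ring. }
  rewrite !E. apply C_ext; unfold Re, Im; simpl; ring.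
Qed.

Lemma Zh1_fold d A dl kap n s a0 t : 0 <= A <= 23/50 -> near_crapper d dl kap -> Rabs t <= Tof d -> s = 1 \/ s = -1 ->
  Re (Zh1 d A dl (2 * PI * IZR n + s * a0, t)) = Re (Zh1 d A dl (a0, t)) /\
  Im (Zh1 d A dl (2 * PI * IZR n + s * a0, t)) = s * Im (Zh1 d A dl (a0, t)).
Proof.
  intros HA Hn Ht Hs. assert (O : okc (cd d (kc (gz A dl))) (Tof d)) by (rewrite <- kc_cd; apply okc_kc, (okc_gz A dl kap d); assumption).
  assert (R : forall a, Re (Zh1 d A dl (a, t)) = 1 + Re (ccs (cd d (kc (gz A dl))) (a, t))) by (intros; unfold Zh1, Re; simpl; ring).
  assert (I : forall a, Im (Zh1 d A dl (a, t)) = Im (ccs (cd d (kc (gz A dl))) (a, t))) by (intros; unfold Zh1, Im; simpl; ring).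
  rewrite !R, !I, !ccs_re, !ccs_im by assumption.
  assert (C : forall k, cos (INR k * (2 * PI * IZR n + s * a0)) = cos (INR k * a0) /\ sin (INR k * (2 * PI * IZR n + s * a0)) = s * sin (INR k * a0)).
  { intros k. replace (INR k * (2 * PI * IZR n + s * a0)) with (s * (INR k * a0) + 2 * PI * IZR (Z.of_nat k * n)) by (rewrite mult_IZR, <- INR_IZR_INZ; ring).
    rewrite cos_perZ. replace (sin (s * (INR k * a0) + 2 * PI * IZR (Z.of_nat k * n))) with (sin (s * (INR k * a0))).
    - destruct Hs as [-> | ->]; [rewrite !Rmult_1_l; auto|]. replace (-1 * (INR k * a0)) with (- (INR k * a0)) by ring. rewrite cos_neg, sin_neg. split; ring.
    - rewrite <- !cos_sh. rewrite <- (cos_perZ (s * (INR k * a0) + - (PI / 2)) (Z.of_nat k * n)). f_equal. ring. }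
  split.
  - f_equal. apply Series_ext. intros k. rewrite (proj1 (C k)). reflexivity.
  - rewrite Ropp_mult_distr_r_reverse, <- Series_scal_l. f_equal. apply Series_ext. intros k. rewrite (proj2 (C k)). ring.
Qed.

Lemma Zh1_nz d A dl kap a t : 0 < A <= 23/50 -> near_crapper d dl kap -> 0 < t <= d -> Zh1 d A dl (a, t) <> RtoC 0.
Proof.
  intros HA Hn Ht E. assert (Hd : 0 < d) by apply Hn.
  destruct (fold_angle a) as [n [s [a0 [Hs [Ha ->]]]]].
  destruct (Zh1_fold d A dl kap n s a0 t ltac:(lra) Hn) as [R I]; [generalize (abs_T d t Hd); lra|assumption|].
  rewrite E in R, I. change (Re (RtoC 0)) with 0 in R; change (Im (RtoC 0)) with 0 in I.
  destruct (Req_dec a0 0) as [->|]; [assert (K := Zh1_re_0 A dl kap d t ltac:(lra) Hn ltac:(lra)); lra|].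
  destruct (Req_dec a0 PI) as [->|]; [assert (K := Zh1_re_pi A dl kap d t ltac:(lra) Hn ltac:(lra)); lra|].
  assert (K := Zh_y_pos A dl kap d a0 t HA Hn ltac:(lra) Ht). destruct Hs as [-> | ->]; lra.
Qed.

Lemma Zh_im_pos d A dl kap a t : admissible d A dl kap -> 0 < t <= d -> 0 < Im (Zh d A dl (a, t)).
Proof.
  intros H Ht. destruct (fold_angle a) as [n [s [a0 [Hs [Ha ->]]]]].
  rewrite (proj2 (Zh_fold d A dl kap n s a0 t H ltac:(lra) Hs)).
  assert (K := Zh_y_axis d A dl kap 0 0 t H ltac:(auto) ltac:(lra) (proj1 Ht) (proj2 Ht)).
  change (Zh d A dl) with (Lc 1 (cd d (gz A dl))) in K at 1. rewrite Lc_bot in K by (try (eapply adm_okc; eassumption); lra).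
  destruct (Req_dec a0 0) as [->|]; [assumption|].
  assert (K2 := Zh_y_incr d A dl kap 0 a0 t H). lra.
Qed.

Lemma hol_shift f f' c T : hol f f' T -> hol (fun b => f b - c)%C f' T.
Proof.
  intros [K [K0 H]]. exists K. split; [assumption|]. intros b b' Hb Hb'.
  replace (f b' - c - (f b - c) - f' b * (b' - b))%C with (f b' - f b - f' b * (b' - b))%C by ring. auto.
Qed.

Lemma Lc_im_shift k d g n a t : okc (cd d g) (Tof d) -> Rabs t <= Tof d ->
  Im (Lc k (cd d g) (2 * PI * IZR n - a, t)) = Im (Lc k (cd d g) (a, t)).
Proof.
  intros H Ht. replace (2 * PI * IZR n - a) with (- a + 2 * PI * IZR n) by ring. rewrite Lc_perZ.
  replace (Im (Lc k (cd d g) ((- a)%R, t) + RtoC (k * (2 * PI * IZR n)))%C) with (Im (Lc k (cd d g) ((- a)%R, t))) by (unfold Im; simpl; ring).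
  rewrite Lc_refl by assumption. reflexivity.
Qed.

(** Amplitude zero is treated apart: there the map is the identity up to a vertical shift, and every
    surface point is a crest and a trough, so that symmetry about every vertical line has to be
    shown. *)
Lemma water_flow_ok d A G Om dl jn kap : near_crapper d dl kap -> geoB jn -> (A = 0 /\ forall n, jn (S n) = 0) \/ admissible d A dl kap ->
  surface_conditions d A G Om dl jn -> flow_ok (water_flow d A G Om dl jn).
Proof.
  intros Hn Hj HA HS. assert (HA' : 0 <= A <= 23/50) by (destruct HA as [[-> _]|[K _]]; lra).
  assert (Hd : 0 < d) by apply Hn. assert (T := Tof_gt d).
  assert (Og := okc_gz A dl kap d HA' Hn). assert (Oj := okc_jz d jn Hj).
  assert (TT : forall t, 0 <= t <= d -> Rabs t <= Tof d) by (intros; rewrite Rabs_pos_eq; lra).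
  destruct (hol_Lc (jn O) d (jz jn) Oj) as [J1 [J2 J3]]. destruct (hol_Lc 1 d (gz A dl) Og) as [_ [_ Z3]].
  rewrite !kc_cd in Z3.
  assert (Ob : forall a, Im (Zh d A dl (a, 0)) = 0) by (intros; apply (Lc_bot 1); assumption).
  assert (Sh : forall b, Im (b - (0, d))%C = Im b - d) by (intros; unfold Im; simpl; ring).
  assert (Shr : forall b, Re (b - (0, d))%C = Re b) by (intros; unfold Re; simpl; ring).
  assert (P2 : forall b : C, (b + RtoC (2 * PI))%C = (Re b + 2 * PI * IZR 1, Im b)) by (intros; apply C_ext; unfold Re, Im; simpl; ring).
  constructor; cbn [cd_ cT cM cOm cG cz cz1 cz2 cj cj1 cj2 water_flow].
  - lra.
  - apply hol_shift, (hol_Zh A dl kap); assumption.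
  - apply (hol_Zh1 A dl kap); assumption.
  - exact Z3.
  - exact J1.
  - exact J2.
  - exact J3.
  - intros b. rewrite P2, Zh_perZ, C_surj. rewrite Rmult_1_r. ring.
  - intros a. rewrite Sh, Ob. ring.
  - intros a t Ht. destruct HA as [[-> HJ]|HA]; [rewrite Zh1_zero; intro E; apply (f_equal Re) in E; unfold Re in E; simpl in E; lra|].
    apply (Zh1_nz d A dl kap); [apply HA|assumption|assumption].
  - intros a t Ht. rewrite Sh. destruct HA as [[-> HJ]|HA]; [rewrite Zh_zero; simpl; lra|].
    generalize (Zh_im_pos d A dl kap a t HA Ht). lra.
  - intros a t a' t' Ht Ht' E. assert (E2 : Zh d A dl (a, t) = Zh d A dl (a', t')).
    { replace (Zh d A dl (a, t)) with (Zh d A dl (a, t) - (0, d) + (0, d))%C by ring. rewrite E. ring. }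
    destruct HA as [[-> HJ]|HA]; [rewrite !Zh_zero in E2; injection E2; auto|].
    destruct (Zh_coincide d A dl kap a t a' t' HA ltac:(lra) Ht' E2) as [K1 [K2|[K2 _]]]; [auto|lra].
  - intros a t Ht. rewrite Shr. apply (Lc_close d (gz A dl)); auto.
  - intros b. rewrite P2, Lc_perZ, C_surj. unfold Im; simpl. ring.
  - intros a. apply Lc_bot; assumption.
  - intros a. destruct (surface_values d A G Om dl jn kap a HA' Hn Hj HS) as [K _]. cbn [cj1 water_flow] in K. rewrite Sh.
    set (J := (RtoC (jn 0%nat) + ccs (kc (cd d (jz jn))) (a, d))%C) in *.
    replace (Im (J - RtoC (Om * (Im (Zh d A dl (a, d)) - d)) * Zh1 d A dl (a, d))%C) with
      (Im J - Om * (Im (Zh d A dl (a, d)) - d) * Im (Zh1 d A dl (a, d))) by (unfold Im; simpl; ring). lra.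
  - intros a. destruct (surface_values d A G Om dl jn kap a HA' Hn Hj HS) as [_ K]. cbn [cj1 water_flow] in K. rewrite Sh, Cmod_sq, <- K.
    set (J := (RtoC (jn 0%nat) + ccs (kc (cd d (jz jn))) (a, d))%C) in *. f_equal. unfold Re, Im; simpl; ring.
  - intros al Hal a t Ht.
    assert (SYM : exists c, Re (Zh d A dl (al, d)) = c /\ forall a t, 0 <= t <= d -> Zh d A dl (2 * c - a, t) = reflect c (Zh d A dl (a, t)) /\
       Im (Lc (jn O) (cd d (jz jn)) (2 * c - a, t)) = Im (Lc (jn O) (cd d (jz jn)) (a, t))).
    { destruct HA as [[E0 HJ]|HA].
      - exists al. subst A. rewrite Zh_zero. split; [reflexivity|]. intros u v Hv. rewrite !Zh_zero. split; [reflexivity|].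
        rewrite !(Lc_const (jn O) d jn _ HJ). unfold Im; simpl; ring.
      (* The height is strictly monotone on a half period, so crests and troughs occur only at
         multiples of [PI]. *)
      - assert (exists n, al = PI * IZR n) as [m Em].
        { destruct (fold_angle al) as [n [s [a0 [Hs [Ha Ea]]]]].
          assert (Y : forall x, Im (Zh d A dl (2 * PI * IZR n + s * x, d)) = Im (Zh d A dl (x, d))) by (intros; apply (Zh_fold d A dl kap); auto; lra).
          assert (a0 = 0 \/ a0 = PI) as [-> | ->].
          { destruct (Req_dec a0 0) as [|N0]; [auto|]. destruct (Req_dec a0 PI) as [|N1]; [auto|]. exfalso.
            assert (I1 := Zh_y_incr d A dl kap 0 a0 d HA ltac:(lra) ltac:(lra) ltac:(lra) ltac:(lra)).
            assert (I2 := Zh_y_incr d A dl kap a0 PI d HA ltac:(lra) ltac:(lra) ltac:(lra) ltac:(lra)).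
            destruct Hal as [Hal|Hal]; [specialize (Hal PI)|specialize (Hal 0)]; rewrite !Sh, Ea, Y in Hal; lra. }
          - exists (2 * n)%Z. rewrite mult_IZR, Ea. ring.
          - destruct Hs as [-> | ->]; [exists (2 * n + 1)%Z; rewrite plus_IZR, mult_IZR, Ea; ring|exists (2 * n - 1)%Z; rewrite minus_IZR, mult_IZR, Ea; ring]. }
        assert (RF : forall u v, 0 <= v <= d -> Zh d A dl (2 * al - u, v) = reflect al (Zh d A dl (u, v))).
        { intros u v Hv. destruct (Zh_fold d A dl kap m (-1) u v HA Hv ltac:(auto)) as [F1 F2].
          replace (2 * al - u) with (2 * PI * IZR m + -1 * u) by (rewrite Em; ring). apply C_ext; [rewrite F1|rewrite F2; reflexivity].
          rewrite Em. unfold reflect, Re; simpl. ring. }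
        exists al. split.
        + assert (K := RF al d ltac:(lra)). apply (f_equal Re) in K. replace (2 * al - al) with al in K by ring.
          set (z := Zh d A dl (al, d)) in *. clearbody z. unfold reflect, Re in *; simpl in K. lra.
        + intros u v Hv. split; [apply RF, Hv|]. replace (2 * al - u) with (2 * PI * IZR m - u) by (rewrite Em; ring).
          apply Lc_im_shift; auto. }
    destruct SYM as [c [Ec SYM]]. destruct (SYM a t Ht) as [S1 S2]. exists (2 * c - a). rewrite S1, S2, Shr, Ec.
    split; [|reflexivity]. unfold reflect. apply C_ext; unfold Re, Im; simpl; ring.
Qed.

(** * The touching wave *)

Lemma rect_away (f : C -> C) l1 r1 l2 r2 p0 : (forall b, l1 <= Re b <= r1 -> l2 <= Im b <= r2 -> ccont f b) ->
  (forall b, l1 <= Re b <= r1 -> l2 <= Im b <= r2 -> f b <> p0) ->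
  exists dl, 0 < dl /\ forall b, l1 <= Re b <= r1 -> l2 <= Im b <= r2 -> dl <= Cmod (f b - p0)%C.
Proof.
  intros Hf Hn. apply rect_uniform; [intros; lra|]. intros b Hx Hy. apply ccont_away; auto.
Qed.

(** [Re b] is the parameter of the half profile and fixes the height; [Im b] in [-1, 1] sweeps the
    horizontal segment from the mirror image to the profile. *)
Definition lens_map (xs ys : R -> R) (b : C) : C := (Im b * xs (Re b), ys (Re b)).
Definition lens (xs ys : R -> R) (a0 : R) (p : C) : Prop :=
  exists b, (0 < Re b < a0 /\ -1 < Im b < 1) /\ lens_map xs ys b = p.

Lemma ccont_pair (u v : C -> R) (b : C) : filterlim u (locally b) (locally (u b)) -> filterlim v (locally b) (locally (v b)) ->
  ccont (fun x => (u x, v x)) b.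
Proof.
  intros Hu Hv e He. assert (e2 : 0 < e / 2) by lra.
  assert (K1 : locally b (fun x => Rabs (u x - u b) < e / 2)) by (apply (Hu (fun r => Rabs (r - u b) < e / 2)); exists (mkposreal _ e2); intros y Hy; exact Hy).
  assert (K2 : locally b (fun x => Rabs (v x - v b) < e / 2)) by (apply (Hv (fun r => Rabs (r - v b) < e / 2)); exists (mkposreal _ e2); intros y Hy; exact Hy).
  destruct (locally_C_inv _ _ (filter_and _ _ K1 K2)) as [d [D H]]. exists d. split; [assumption|]. intros b' Hb'.
  destruct (H b' Hb') as [H1 H2]. eapply Rle_lt_trans; [apply Cmod_le_sum|].
  replace (Re ((u b', v b') - ((u b)%R, (v b)%R))%C) with (u b' - u b) by (unfold Re; simpl; ring).
  replace (Im ((u b', v b') - ((u b)%R, (v b)%R))%C) with (v b' - v b) by (unfold Im; simpl; ring). lra.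
Qed.

Lemma lens_ccont (xs ys : R -> R) b : (forall a, continuous xs a) -> (forall a, continuous ys a) -> ccont (lens_map xs ys) b.
Proof.
  intros Hx Hy. apply (ccont_pair (fun b => Im b * xs (Re b)) (fun b => ys (Re b))).
  - apply (continuous_mult (K := R_AbsRing) (fun b : C => Im b) (fun b : C => xs (Re b))); [apply continuous_snd|].
    apply (continuous_comp (fun b : C => Re b) xs); [apply continuous_fst|apply Hx].
  - apply (continuous_comp (fun b : C => Re b) ys); [apply continuous_fst|apply Hy].
Qed.

(** Heights increase strictly along the half profile, so the horizontal segments are disjoint and
    the open rectangle parametrizes the region injectively. Its horizontal sides give the two arcs,
    its vertical sides collapse to the end points. *)
Lemma lens_bubble (xs ys : R -> R) a0 : 0 < a0 -> (forall a, continuous xs a) -> (forall a, continuous ys a) ->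
  (forall a a', 0 <= a -> a < a' -> a' <= a0 -> ys a < ys a') -> (forall a, 0 < a < a0 -> 0 < xs a) -> xs 0 = 0 -> xs a0 = 0 ->
  is_domain (lens xs ys a0) /\ (exists M, forall p, lens xs ys a0 p -> Cmod p <= M) /\
  (forall p, boundary (lens xs ys a0) p <-> exists a, 0 <= a <= a0 /\ (p = (xs a, ys a) \/ p = (- xs a, ys a))).
Proof.
  intros Ha0 Cx Cy Hy Hx X0 X1.
  assert (CC := fun b => lens_ccont xs ys b Cx Cy).
  assert (HO : open (lens xs ys a0)).
  { intros p [[a s] [[Ha Hs] <-]]. cbn [Re Im fst snd] in Ha, Hs. unfold lens_map. cbn [Re Im fst snd].
    set (m := xs a - Rabs (s * xs a)). assert (Hm : 0 < m).
    { unfold m. specialize (Hx a Ha). rewrite Rabs_mult, (Rabs_pos_eq (xs a)) by lra.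
      assert (Rabs s < 1) by (apply Rabs_def1; lra). nra. }
    assert (m2 : 0 < m / 2) by lra.
    destruct (Cx a (fun v => Rabs (v - xs a) < m / 2)) as [d1 D1]; [exists (mkposreal _ m2); intros y K; exact K|].
    set (d := Rmin (d1 / 2) (Rmin (a / 2) ((a0 - a) / 2))). assert (P := cond_pos d1).
    assert (Hd : 0 < d /\ d < d1 /\ d < a /\ d < a0 - a).
    { assert (0 < d) by (unfold d; repeat apply Rmin_glb_lt; lra).
      assert (R1 := Rmin_l (d1 / 2) (Rmin (a / 2) ((a0 - a) / 2))). assert (R2 := Rmin_r (d1 / 2) (Rmin (a / 2) ((a0 - a) / 2))).
      assert (R3 := Rmin_l (a / 2) ((a0 - a) / 2)). assert (R4 := Rmin_r (a / 2) ((a0 - a) / 2)). fold d in R1, R2. lra. }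
    assert (L1 := Hy (a - d) a ltac:(lra) ltac:(lra) ltac:(lra)). assert (L2 := Hy a (a + d) ltac:(lra) ltac:(lra) ltac:(lra)).
    set (e := Rmin (m / 2) (Rmin (ys a - ys (a - d)) (ys (a + d) - ys a))).
    assert (He : 0 < e /\ e <= m / 2 /\ e <= ys a - ys (a - d) /\ e <= ys (a + d) - ys a).
    { assert (0 < e) by (unfold e; repeat apply Rmin_glb_lt; lra).
      assert (R1 := Rmin_l (m / 2) (Rmin (ys a - ys (a - d)) (ys (a + d) - ys a))). assert (R2 := Rmin_r (m / 2) (Rmin (ys a - ys (a - d)) (ys (a + d) - ys a))).
      assert (R3 := Rmin_l (ys a - ys (a - d)) (ys (a + d) - ys a)). assert (R4 := Rmin_r (ys a - ys (a - d)) (ys (a + d) - ys a)). fold e in R1, R2. lra. }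
    destruct He as [E0 [E1 [E2 E3]]]. apply (locally_C_ex _ _ e E0). intros [X Y] Hq.
    assert (Q1 := Re_le_Cmod ((X, Y) - ((s * xs a)%R, ys a))%C). assert (Q2 := Im_le_Cmod ((X, Y) - ((s * xs a)%R, ys a))%C).
    replace (Re ((X, Y) - ((s * xs a)%R, ys a))%C) with (X - s * xs a) in Q1 by (unfold Re; simpl; ring).
    replace (Im ((X, Y) - ((s * xs a)%R, ys a))%C) with (Y - ys a) in Q2 by (unfold Im; simpl; ring).
    assert (Q3 : Rabs (Y - ys a) < e) by lra. apply Rabs_lt_between in Q3.
    (* A nearby height [Y] is attained at a parameter [a'] near [a], and the half-width there still
       exceeds [|X|]. *)
    destruct (IVT_gen ys (a - d) (a + d) Y) as [a' [A1 A2]].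
    { intros u. apply continuity_pt_filterlim, Cy. }
    { rewrite Rmin_left, Rmax_right by lra. lra. }
    rewrite Rmin_left, Rmax_right in A1 by lra.
    assert (K := D1 a' ltac:(change (Rabs (a' - a) < d1); apply Rabs_def1; lra)). simpl in K. apply Rabs_lt_between in K.
    assert (XX : Rabs X < xs a').
    { replace X with ((X - s * xs a) + s * xs a) by ring. eapply Rle_lt_trans; [apply Rabs_triang|]. unfold m in *. lra. }
    assert (xp := Rabs_pos X). exists (a', X / xs a'). unfold lens_map. cbn [Re Im fst snd]. split; [split; [lra|]|].
    - apply Rabs_lt_between in XX. split; apply (Rmult_lt_reg_r (xs a')); try lra; unfold Rdiv; rewrite Rmult_assoc, Rinv_l by lra; lra.
    - rewrite A2. f_equal. field. lra. }
  assert (HC : forall a s, 0 <= a <= a0 -> -1 <= s <= 1 -> closure (lens xs ys a0) (lens_map xs ys (a, s))).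
  { intros a s Ha Hs V HV. destruct (locally_C_inv _ _ HV) as [e [E0 HV']]. destruct (CC (a, s) e E0) as [d [D Hd]].
    (* A boundary point of the rectangle is moved by the fraction [r] towards the centre
       [(a0 / 2, 0)], which brings it into the open rectangle. *)
    set (r := Rmin (1 / 2) (d / (2 * (a0 + 2)))).
    assert (r0 : 0 < r) by (unfold r; apply Rmin_glb_lt; [lra|apply Rdiv_lt_0_compat; lra]).
    assert (r1 := Rmin_l (1 / 2) (d / (2 * (a0 + 2)))). assert (r2 := Rmin_r (1 / 2) (d / (2 * (a0 + 2)))). fold r in r1, r2.
    assert (r3 : r * (a0 + 2) <= d / 2).
    { apply (Rmult_le_compat_r (a0 + 2)) in r2; [|lra]. replace (d / (2 * (a0 + 2)) * (a0 + 2)) with (d / 2) in r2 by (field; lra). exact r2. }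
    exists (lens_map xs ys (a + r * (a0 / 2 - a), s + r * (0 - s))). split.
    - apply HV', Hd. eapply Rle_lt_trans; [apply Cmod_le_sum|].
      replace (Re (((a + r * (a0 / 2 - a))%R, (s + r * (0 - s))%R) - (a, s))%C) with (r * (a0 / 2 - a)) by (unfold Re; simpl; ring).
      replace (Im (((a + r * (a0 / 2 - a))%R, (s + r * (0 - s))%R) - (a, s))%C) with (r * (0 - s)) by (unfold Im; simpl; ring).
      rewrite !Rabs_mult, (Rabs_pos_eq r) by lra.
      assert (Rabs (a0 / 2 - a) <= a0 / 2) by (apply Rabs_le; lra). assert (Rabs (0 - s) <= 1) by (apply Rabs_le; lra). nra.
    - eexists. split; [|reflexivity]. cbn [Re Im fst snd]. split; split; nra. }
  split; [split; [|split]|split].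
  - exists (lens_map xs ys (a0 / 2, 0)), (a0 / 2, 0). split; [cbn [Re Im fst snd]; lra|reflexivity].
  - exact HO.
  - apply (image_connected (fun b => 0 < Re b < a0 /\ -1 < Im b < 1) (lens_map xs ys)).
    + intros a b s [A1 A2] [B1 B2] Hs.
      replace (Re (a + RtoC s * (b - a))%C) with (Re a + s * (Re b - Re a)) by (unfold Re; simpl; ring).
      replace (Im (a + RtoC s * (b - a))%C) with (Im a + s * (Im b - Im a)) by (unfold Im; simpl; ring).
      assert (SL : forall u v lo, lo < u -> lo < v -> lo < u + s * (v - u)).
      { intros u v lo U V. destruct (Req_dec s 1) as [->|]; [lra|].
        assert (0 < (1 - s) * (u - lo)) by (apply Rmult_lt_0_compat; lra). assert (0 <= s * (v - lo)) by nra. lra. }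
      assert (SR : forall u v hi, u < hi -> v < hi -> u + s * (v - u) < hi).
      { intros u v hi U V. assert (K := SL (- u) (- v) (- hi) ltac:(lra) ltac:(lra)). lra. }
      split; split; (apply SL || apply SR); lra.
    + intros b _. apply CC.
  - destruct (continuity_ab_maj xs 0 a0) as [m [M1 _]]; [lra|intros; apply continuity_pt_filterlim, Cx|].
    exists (Rabs (xs m) + (Rabs (ys 0) + Rabs (ys a0))). intros p [[a s] [[Ha Hs] <-]]. cbn [Re Im fst snd] in Ha, Hs.
    unfold lens_map. cbn [Re Im fst snd]. eapply Rle_trans; [apply Cmod_le_sum|]. cbn [Re Im fst snd]. apply Rplus_le_compat.
    + assert (K := M1 a ltac:(lra)). specialize (Hx a Ha). rewrite Rabs_mult, (Rabs_pos_eq (xs a)) by lra.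
      assert (Rabs s <= 1) by (apply Rabs_le; lra). generalize (Rle_abs (xs m)). nra.
    + assert (L1 := Hy 0 a ltac:(lra) ltac:(lra) ltac:(lra)). assert (L2 := Hy a a0 ltac:(lra) ltac:(lra) ltac:(lra)).
      unfold Rabs; repeat destruct Rcase_abs; lra.
  - intros p. split.
    + intros [C1 C2].
      assert (exists b, (0 <= Re b <= a0 /\ -1 <= Im b <= 1) /\ lens_map xs ys b = p) as [[a s] [[Ha Hs] <-]].
      { apply NNPP. intros N. destruct (rect_away (lens_map xs ys) 0 a0 (-1) 1 p) as [d [D Hd]]; [intros; apply CC| |].
        - intros b B1 B2 E. apply N. eauto.
        - destruct (C1 (fun q => Cmod (q - p)%C < d)) as [q [Q1 [b [[B1 B2] <-]]]]; [apply (locally_C_ex p _ d D); auto|].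
          specialize (Hd b ltac:(lra) ltac:(lra)). lra. }
      cbn [Re Im fst snd] in Ha, Hs. unfold lens_map in *. cbn [Re Im fst snd] in *.
      assert (NU : ~ lens xs ys a0 (s * xs a, ys a)) by (intros K; exact (closure_not_open _ _ HO K C2)).
      exists a. split; [assumption|].
      assert (a = 0 \/ a = a0 \/ s = 1 \/ s = -1) as [-> | [-> | [-> | ->]]].
      { apply NNPP. intros N. apply NU. exists (a, s). cbn [Re Im fst snd]. split; [|reflexivity].
        assert (a <> 0 /\ a <> a0 /\ s <> 1 /\ s <> -1) by tauto. lra. }
      * left. f_equal. rewrite X0. ring.
      * left. f_equal. rewrite X1. ring.
      * left. f_equal. ring.
      * right. f_equal. ring.
    + intros [a [Ha Hp]].
      assert (exists s, (s = 1 \/ s = -1) /\ p = lens_map xs ys (a, s)) as [s [Hs ->]].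
      { destruct Hp as [-> | ->]; [exists 1|exists (-1)]; (split; [auto|]); unfold lens_map; cbn [Re Im fst snd]; f_equal; ring. }
      split; [apply HC; [assumption|destruct Hs as [-> | ->]; lra]|].
      apply closure_sub. intros [[a' s'] [[A1 A2] E]]. cbn [Re Im fst snd] in A1, A2. unfold lens_map in E. cbn [Re Im fst snd] in E.
      injection E as E1 E2.
      assert (a = a').
      { destruct (Rtotal_order a a') as [L|[L|L]]; [apply Hy in L; lra|exact L|apply Hy in L; lra]. }
      subst a'. specialize (Hx a A1). assert (s' = s) by (apply (Rmult_eq_reg_r (xs a)); lra). destruct Hs as [-> | ->]; lra.
Qed.

(** * Dependence on the amplitude and the first contact *)

Lemma ex_series_geo_pow M j : ex_series (fun k => M * (2/3) ^ k * INR k ^ j).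
Proof.
  apply (ex_series_ext (fun k => M * (INR k ^ j * (2/3) ^ k))); [intros; simpl; ring|]. apply ex_series_scalR, ex_series_pow_geo. lra.
Qed.

(** The tail beyond [N] is below [eps / 2] for all [s'] by the geometric majorant; the finite head
    is continuous in [s'] and vanishes at [s]. *)
Lemma dominated_series_cont (c : nat -> R -> R) M j s : (forall k, continuous (c k) s) -> (forall k s, Rabs (c k s) <= M * (2/3) ^ k) ->
  forall eps, 0 < eps -> exists dl, 0 < dl /\ forall s', Rabs (s' - s) < dl ->
    Series (fun k => Rabs (c k s' - c k s) * INR k ^ j) < eps.
Proof.
  intros Hc HM eps He. set (b := fun k => 2 * M * (2/3) ^ k * INR k ^ j).
  assert (Hb : ex_series b) by apply ex_series_geo_pow.
  assert (Hf : forall s' k, 0 <= Rabs (c k s' - c k s) * INR k ^ j <= b k).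
  { intros s' k. assert (0 <= INR k ^ j) by (apply pow_le, pos_INR). split; [apply Rmult_le_pos; [apply Rabs_pos|assumption]|].
    apply Rmult_le_compat_r; [assumption|]. eapply Rle_trans; [apply (Rabs_triang (c k s') (- c k s))|]. rewrite Rabs_Ropp.
    generalize (HM k s') (HM k s). lra. }
  assert (exists N, Series b - sum_n b N < eps / 2) as [N HN].
  { assert (K : is_lim_seq (sum_n b) (Series b)) by exact (Series_correct b Hb). apply is_lim_seq_spec in K. assert (e2 : 0 < eps / 2) by lra. destruct (K (mkposreal _ e2)) as [N HN].
    exists N. specialize (HN N (le_n _)). simpl in HN. apply Rabs_lt_between in HN. lra. }
  assert (CS : forall n, continuous (fun s' => sum_n (fun k => Rabs (c k s' - c k s) * INR k ^ j) n) s).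
  { assert (C1 : forall k, continuous (fun s' => Rabs (c k s' - c k s) * INR k ^ j) s).
    { intros k. apply (continuous_mult (K := R_AbsRing)); [|apply continuous_const].
      apply (continuous_comp (fun s' => c k s' - c k s) Rabs); [|apply continuous_Rabs].
      apply (continuous_minus (V := R_NormedModule)); [apply Hc|apply continuous_const]. }
    induction n as [|n IH]; [apply (continuous_ext (fun s' => Rabs (c O s' - c O s) * INR 0 ^ j)); [intros; rewrite sum_O; reflexivity|apply C1]|].
    apply (continuous_ext (fun s' => plus (sum_n (fun k => Rabs (c k s' - c k s) * INR k ^ j) n) (Rabs (c (S n) s' - c (S n) s) * INR (S n) ^ j)));
      [intros; rewrite sum_Sn; reflexivity|]. apply (continuous_plus (V := R_NormedModule)); [exact IH|apply C1]. }
  assert (Z : sum_n (fun k => Rabs (c k s - c k s) * INR k ^ j) N = 0).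
  { rewrite (sum_n_ext _ (fun _ => 0)); [|intros; rewrite Rminus_diag, Rabs_R0; apply Rmult_0_l]. rewrite sum_n_const. apply Rmult_0_r. }
  assert (e2 : 0 < eps / 2) by lra.
  destruct (CS N (fun r => Rabs (r - 0) < eps / 2)) as [dl Hd]; [rewrite Z; exists (mkposreal _ e2); intros y K; exact K|].
  exists dl. split; [apply cond_pos|]. intros s' Hs'. specialize (Hd s' Hs').
  assert (Ef : ex_series (fun k => Rabs (c k s' - c k s) * INR k ^ j)).
  { apply (ex_series_le (V := R_CompleteNormedModule) _ b); [|exact Hb]. intros k. destruct (Hf s' k). change (Rabs (Rabs (c k s' - c k s) * INR k ^ j) <= b k).
    rewrite Rabs_pos_eq; assumption. }
  rewrite (Series_incr_n _ (S N)) by (try assumption; lia). rewrite (Series_incr_n b (S N)) in HN by (try assumption; lia).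
  simpl pred in *. rewrite <- !sum_n_Reals in *.
  assert (Series (fun k => Rabs (c (S N + k)%nat s' - c (S N + k)%nat s) * INR (S N + k) ^ j) <= Series (fun k => b (S N + k)%nat)).
  { apply Series_le; [intros k; apply (Hf s' (S N + k)%nat)|]. apply (ex_series_incr_n b (S N)), Hb. }
  apply Rabs_lt_between in Hd. lra.
Qed.

Definition family (d : R) (dlf : nat -> R -> R) (kap : R) : Prop :=
  (forall n s, continuous (dlf n) s) /\ forall s, near_crapper d (fun n => dlf n s) kap.
Definition dls (dlf : nat -> R -> R) (s : R) (n : nat) : R := dlf n (amp s).

Lemma fam_near d dlf kap s : family d dlf kap -> near_crapper d (dls dlf s) kap.
Proof. intros [_ H]. apply H. Qed.

Lemma h0_continuous k s : continuous (h0 k) s.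
Proof.
  unfold h0. apply (continuous_mult (K := R_AbsRing)); [apply continuous_const|].
  induction (k - 1)%nat as [|n IH]; simpl; [apply continuous_const|].
  apply (continuous_mult (K := R_AbsRing)); [|exact IH]. apply (continuous_opp (V := R_NormedModule)), continuous_id.
Qed.

Lemma gz_continuous d dlf kap k s : family d dlf kap -> continuous (fun s => gz (amp s) (dls dlf s) k) s.
Proof.
  intros [H _]. unfold gz, hh, dls. apply (continuous_mult (K := R_AbsRing)); [|apply continuous_const].
  apply (continuous_mult (K := R_AbsRing)); [apply amp_bcont|].
  apply (continuous_plus (V := R_NormedModule)).
  - apply (continuous_comp amp (h0 k)); [apply amp_bcont|apply h0_continuous].
  - apply (continuous_comp amp (dlf k)); [apply amp_bcont|apply H].
Qed.
Lemma gz_bound d dlf kap k s : family d dlf kap -> Rabs (gz (amp s) (dls dlf s) k) <= 21 * (2/3) ^ k.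
Proof.
  intros H. assert (HA := amp_range s). unfold gz. eapply Rle_trans; [apply Rabs_div_nat|].
  rewrite Rabs_mult, (Rabs_pos_eq (amp s)) by lra.
  generalize (hh_le (amp s) (dls dlf s) kap d k HA (fam_near d dlf kap s H)) (Rabs_pos (hh (amp s) (dls dlf s) k)). nra.
Qed.

Definition xs (d : R) (dlf : nat -> R -> R) (s al : R) : R := Re (Zh d (amp s) (dls dlf s) (al, d)).

(** Coefficients are compared, so the bound holds for all angles at once. This matters because the
    angle of contact is not known in advance. *)
Lemma xs_unif d dlf kap s eps : family d dlf kap -> 0 < eps -> exists dl, 0 < dl /\ forall s', Rabs (s' - s) < dl -> forall al,
  Rabs (xs d dlf s' al - xs d dlf s al) < eps.
Proof.
  intros H He. assert (Hd : 0 < d) by apply (fam_near d dlf kap s H).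
  destruct (dominated_series_cont (fun k s => gz (amp s) (dls dlf s) k) 21 0 s) with (eps := eps / 2) as [dl [D Hdl]];
    [intros k; apply (gz_continuous d dlf kap), H|intros k u; apply (gz_bound d dlf kap), H|lra|].
  exists dl. split; [assumption|]. intros s' Hs' al. specialize (Hdl s' Hs').
  assert (T : Rabs d <= Tof d) by (rewrite Rabs_pos_eq; generalize (Tof_gt d); lra).
  unfold xs. rewrite !(Zh_re _ _ kap) by (try apply amp_range; try assumption; apply (fam_near d dlf kap), H).
  rewrite xx_top, yy_top. set (e := exp (-2 * d)). assert (E : forall k, 0 <= e ^ k <= 1).
  { intros k. assert (0 < e <= 1) by (unfold e; split; [apply exp_pos|rewrite <- exp_0; apply exp_le; lra]).
    split; [apply pow_le; lra|]. rewrite <- (pow1 k). apply pow_incr. lra. }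
  assert (EX : forall u, ex_series (fun k => gz (amp u) (dls dlf u) k * (1 ^ k + e ^ k) * sin (INR k * al))).
  { intros u. apply (ex_series_le (V := R_CompleteNormedModule) _ (fun k => 42 * (2/3) ^ k * INR k ^ 0)); [|apply ex_series_geo_pow].
    intros k. change (Rabs (gz (amp u) (dls dlf u) k * (1 ^ k + e ^ k) * sin (INR k * al)) <= 42 * (2/3) ^ k * INR k ^ 0).
    rewrite pow1, !Rabs_mult, (Rabs_pos_eq (1 + e ^ k)) by (generalize (E k); lra).
    assert (Rabs (sin (INR k * al)) <= 1) by (apply Rabs_le, SIN_bound). assert (B := gz_bound d dlf kap k u H).
    assert (P := Rabs_pos (gz (amp u) (dls dlf u) k)). assert (P2 := Rabs_pos (sin (INR k * al))). specialize (E k).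
    assert (Rabs (gz (amp u) (dls dlf u) k) * (1 + e ^ k) <= 21 * (2/3) ^ k * 2) by (apply Rmult_le_compat; lra).
    rewrite pow_O, Rmult_1_r. rewrite <- (Rmult_1_r (42 * (2/3) ^ k)). apply Rmult_le_compat; try lra. apply Rmult_le_pos; lra. }
  match goal with |- Rabs (al + ?X - (al + ?Y)) < _ => replace (al + X - (al + Y)) with (X - Y) by ring end.
  rewrite <- Series_minus by apply EX.
  assert (Ef : ex_series (fun k => Rabs (gz (amp s') (dls dlf s') k - gz (amp s) (dls dlf s) k) * INR k ^ 0)).
  { apply (ex_series_le (V := R_CompleteNormedModule) _ (fun k => 42 * (2/3) ^ k * INR k ^ 0)); [|apply ex_series_geo_pow].
    intros k. change (Rabs (Rabs (gz (amp s') (dls dlf s') k - gz (amp s) (dls dlf s) k) * INR k ^ 0) <= 42 * (2/3) ^ k * INR k ^ 0).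
    rewrite !pow_O, !Rmult_1_r, Rabs_Rabsolu. eapply Rle_trans; [apply Rabs_triang|]. rewrite Rabs_Ropp.
    generalize (gz_bound d dlf kap k s' H) (gz_bound d dlf kap k s H). lra. }
  eapply Rle_lt_trans; [apply (Series_abs_le _ (fun k => 2 * (Rabs (gz (amp s') (dls dlf s') k - gz (amp s) (dls dlf s) k) * INR k ^ 0)))|].
  - intros k. rewrite pow1, pow_O, Rmult_1_r.
    replace (gz (amp s') (dls dlf s') k * (1 + e ^ k) * sin (INR k * al) - gz (amp s) (dls dlf s) k * (1 + e ^ k) * sin (INR k * al))
      with ((gz (amp s') (dls dlf s') k - gz (amp s) (dls dlf s) k) * ((1 + e ^ k) * sin (INR k * al))) by ring.
    rewrite Rabs_mult, Rmult_comm. apply Rmult_le_compat_r; [apply Rabs_pos|]. specialize (E k).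
    rewrite Rabs_mult, (Rabs_pos_eq (1 + e ^ k)) by lra. assert (Rabs (sin (INR k * al)) <= 1) by (apply Rabs_le, SIN_bound).
    generalize (Rabs_pos (sin (INR k * al))). nra.
  - apply ex_series_scalR, Ef.
  - rewrite Series_scal_l. lra.
Qed.

Lemma fam_d d dlf kap : family d dlf kap -> 0 < d.
Proof. intros H. apply (fam_near d dlf kap 0 H). Qed.

Lemma xs_derive d dlf kap s al : family d dlf kap -> is_derive (xs d dlf s) al (Re (Zh1 d (amp s) (dls dlf s) (al, d))).
Proof.
  intros H. assert (Hd := fam_d d dlf kap H).
  apply (hol_dx_re _ _ (Tof d) al d (hol_Zh (amp s) (dls dlf s) kap d (amp_range s) (fam_near d dlf kap s H))). apply abs_T; lra.
Qed.
Lemma xs_continuous d dlf kap s al : family d dlf kap -> continuous (xs d dlf s) al.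
Proof. intros H. apply (ex_derive_continuous (xs d dlf s)). eexists. apply (xs_derive d dlf kap); assumption. Qed.

Lemma xs_refl d dlf kap s al : family d dlf kap -> xs d dlf s (- al) = - xs d dlf s al /\ xs d dlf s (2 * PI - al) = 2 * PI - xs d dlf s al.
Proof.
  intros H. assert (Hd := fam_d d dlf kap H). assert (N := fam_near d dlf kap s H).
  assert (E : Zh d (amp s) (dls dlf s) (- al, d) = (- xs d dlf s al, Im (Zh d (amp s) (dls dlf s) (al, d)))).
  { apply (Lc_refl 1); [apply (okc_gz _ _ kap); [apply amp_range|exact N]|]. rewrite Rabs_pos_eq; generalize (Tof_gt d); lra. }
  split; unfold xs at 1.
  - rewrite E. reflexivity.
  - replace (2 * PI - al) with (- al + 2 * PI * IZR 1) by ring. rewrite Zh_perZ, E. unfold Re; simpl. ring.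
Qed.
Lemma xs_pi d dlf kap s : family d dlf kap -> xs d dlf s PI = PI.
Proof. intros H. destruct (xs_refl d dlf kap s PI H) as [_ K]. replace (2 * PI - PI) with PI in K by ring. lra. Qed.

(** [As] is obtained as the supremum of the lower bounds of the amplitudes with a point [x <= 0] on
    the open half profile; [Zh_top_neg] shows that there are such amplitudes. Contact is attained
    because small angles are excluded by [Zh_top_pos] and [x = PI] at the other end, so a compact
    interval remains. *)
Lemma critical_amplitude d dlf kap : family d dlf kap -> exists As, 0 < As <= 23/50 /\
  (forall A, 0 <= A < As -> forall al, 0 < al < PI -> 0 < xs d dlf A al) /\
  (forall al, 0 < al < PI -> 0 <= xs d dlf As al) /\
  exists a0, 179/100 <= a0 < PI /\ xs d dlf As a0 = 0.
Proof.
  intros H. assert (PL := PI_low).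
  set (E := fun A => 0 <= A <= 23/50 /\ exists al, 0 < al < PI /\ xs d dlf A al <= 0).
  set (L := fun a => forall A, E A -> a <= A).
  assert (E1 : E (23/50)).
  { split; [lra|]. exists (2 * PI / 3). split; [lra|]. unfold xs. rewrite amp_id by lra. apply Rlt_le, (Zh_top_neg _ kap), (fam_near d dlf kap), H. }
  destruct (completeness L) as [As [As1 As2]].
  - exists (23/50). intros a Ha. apply Ha, E1.
  - exists 0. intros A [HA _]. lra.
  - assert (A0 : 0 <= As) by (apply As1; intros A [HA _]; lra).
    assert (AE : forall A, E A -> As <= A) by (intros A HA; apply As2; intros a Ha; apply Ha, HA).
    assert (A1 : As <= 23/50) by (apply AE, E1).
    assert (B1 : forall A, 0 <= A < As -> forall al, 0 < al < PI -> 0 < xs d dlf A al).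
    { intros A HA al Hal. apply Rnot_le_lt. intros N. assert (As <= A); [|lra]. apply AE. split; [lra|eauto]. }
    assert (Z0 : forall al, xs d dlf 0 al = al) by (intros; unfold xs; rewrite amp_id, Zh_zero by lra; reflexivity).
    assert (B2 : forall al, 0 < al < PI -> 0 <= xs d dlf As al).
    { intros al Hal. apply Rnot_lt_le. intros N. destruct (Req_dec As 0) as [Z|Z]; [rewrite Z, Z0 in N; lra|].
      destruct (xs_unif d dlf kap As (- xs d dlf As al) H) as [dl [D Hd]]; [lra|].
      set (A := Rmax (As / 2) (As - dl / 2)). assert (0 <= A < As) by (unfold A, Rmax; destruct Rle_dec; lra).
      assert (Rabs (A - As) < dl) by (unfold A, Rmax; destruct Rle_dec; unfold Rabs; destruct Rcase_abs; lra).
      assert (K := Hd A ltac:(assumption) al). apply Rabs_lt_between in K. assert (K2 := B1 A ltac:(assumption) al Hal). lra. }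
    assert (B3 : exists a0, 179/100 <= a0 < PI /\ xs d dlf As a0 = 0).
    { destruct (continuity_ab_min (xs d dlf As) (179/100) PI) as [m [M1 M2]]; [lra|intros; apply continuity_pt_filterlim, (xs_continuous d dlf kap), H|].
      destruct (Rle_lt_dec (xs d dlf As m) 0) as [L0|L0].
      - exists m. destruct (Req_dec m PI) as [->|N]; [rewrite (xs_pi d dlf kap) in L0 by assumption; lra|].
        split; [lra|]. assert (K := B2 m). lra.
      (* A positive minimum on [[179/100, PI]] would persist for slightly larger amplitudes and make
         [As + dl / 2] a lower bound. *)
      - exfalso. destruct (xs_unif d dlf kap As (xs d dlf As m) H L0) as [dl [D Hd]].
        assert (L (As + dl / 2)); [|assert (K := As1 _ H0); lra].
        intros A [HA [al [Hal K]]]. apply Rnot_lt_le. intros N.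
        assert (AsA : As <= A) by (apply AE; split; eauto).
        assert (K2 := Hd A ltac:(apply Rabs_def1; lra) al). apply Rabs_lt_between in K2.
        destruct (Rle_lt_dec al (179/100)) as [C|C].
        + assert (K3 := Zh_top_pos (amp A) (dls dlf A) kap d al (amp_range A) (fam_near d dlf kap A H) ltac:(lra)). unfold xs in K. lra.
        + assert (K3 := M1 al ltac:(lra)). lra. }
    exists As. destruct B3 as [a0 [A2 A3]]. split; [|split; [|split]]; auto; [|eauto].
    split; [|assumption]. destruct (Req_dec As 0) as [Z|]; [|lra]. rewrite Z, Z0 in A3. lra.
Qed.

Lemma min_derive (f : R -> R) a b c l : a < c < b -> (forall x, a < x < b -> f c <= f x) -> is_derive f c l -> l = 0.
Proof.
  intros H Hm Hd. apply is_derive_Reals in Hd. assert (pr : derivable_pt f c) by (exists l; exact Hd).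
  rewrite <- (deriv_minimum f a b c pr (proj1 H) (proj2 H) (fun x p q => Hm x (conj p q))). symmetry. apply derive_pt_eq_0, Hd.
Qed.

(** A zero of the nonnegative function [xs] is a minimum, so its derivative vanishes there. All
    zeros lie beyond 179/100, where the derivative increases strictly, hence there is only one. *)
Lemma touching_point d dlf kap As a0 : family d dlf kap -> 0 < As <= 23/50 -> (forall al, 0 < al < PI -> 0 <= xs d dlf As al) ->
  179/100 <= a0 < PI -> xs d dlf As a0 = 0 ->
  Re (Zh1 d (amp As) (dls dlf As) (a0, d)) = 0 /\ forall a, 0 < a < PI -> xs d dlf As a = 0 -> a = a0.
Proof.
  intros H HA Hx Ha0 Z. assert (N := fam_near d dlf kap As H). assert (Hd := fam_d d dlf kap H).
  assert (MD : forall a, 0 < a < PI -> xs d dlf As a = 0 -> Re (Zh1 d (amp As) (dls dlf As) (a, d)) = 0).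
  { intros a Ha Za. apply (min_derive (xs d dlf As) 0 PI a); [assumption|intros; rewrite Za; auto|apply (xs_derive d dlf kap), H]. }
  assert (PL := PI_low). split; [apply MD; [lra|assumption]|].
  assert (ST : forall a b, 179/100 <= a -> a < b -> b < PI -> xs d dlf As a = 0 -> xs d dlf As b <> 0).
  { intros a b C1 C2 C3 Za Zb.
    assert (K := pos_derive_incr (fun u => Re (Zh1 d (amp As) (dls dlf As) (u, d))) (fun u => Re (Zh2 d (amp As) (dls dlf As) (u, d))) a b C2).
    cbv beta in K. rewrite !MD in K by (assumption || lra). assert (0 < 0); [|lra]. apply K.
    - intros x Cx. apply (hol_dx_re _ _ (Tof d) x d (hol_Zh1 (amp As) (dls dlf As) kap d (amp_range As) N)). apply abs_T; lra.
    - intros x Cx. apply (Zh2_top_pos (amp As) (dls dlf As) kap d); [rewrite amp_id; lra|assumption|lra]. }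
  intros a Ha Za. destruct (Rle_lt_dec a (179/100)) as [C|C].
  - assert (K := Zh_top_pos (amp As) (dls dlf As) kap d a (amp_range As) N ltac:(lra)). unfold xs in Za. lra.
  - destruct (Rtotal_order a a0) as [O|[O|O]]; [|assumption|]; exfalso; [apply (ST a a0)|apply (ST a0 a)]; auto; lra.
Qed.

Lemma trace_water d A G Om dl jn a :
  trace (wave_of (water_flow d A G Om dl jn)) a = (Re (Zh d A dl (a, d)), Im (Zh d A dl (a, d)) - d).
Proof. rewrite trace_cz. simpl. apply C_ext; unfold Re, Im; simpl; ring. Qed.

Lemma trace_eq d A G Om dl jn a b :
  trace (wave_of (water_flow d A G Om dl jn)) a = trace (wave_of (water_flow d A G Om dl jn)) b -> Zh d A dl (a, d) = Zh d A dl (b, d).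
Proof. rewrite !trace_water. intros E. apply C_ext; [exact (f_equal Re E)|assert (K := f_equal Im E); cbn [Im fst snd] in K; lra]. Qed.

Lemma water_injective d A G Om dl jn kap : 0 < d ->
  A = 0 \/ admissible d A dl kap /\ (forall al, 0 < al < PI -> Re (Zh d A dl (al, d)) <> 0) ->
  injective_profile (wave_of (water_flow d A G Om dl jn)).
Proof.
  intros Hd HA a b E. apply trace_eq in E. destruct HA as [->|[HA Hx]].
  - rewrite !Zh_zero in E. injection E; auto.
  - destruct (Zh_coincide d A dl kap a d b d HA ltac:(lra) ltac:(lra) E) as [_ [K|[_ [n [s [a0 [_ [K1 [K2 _]]]]]]]]]; [exact K|].
    elim (Hx a0 K1 K2).
Qed.

(** At equal heights the inequality of [Zh_noshiro] reduces to [(x' - x) (d - t) > 0]: in the half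
    period a fluid point lies strictly to the right of the surface point, whereas bubble points
    satisfy [|X| <= x]. Mirror images and other periods are excluded since [x' <= PI]. *)
Lemma bubble_outside d A G Om dl jn kap a0 p : admissible d A dl kap -> 0 < a0 < PI ->
  lens (fun a => Re (Zh d A dl (a, d))) (fun a => Im (Zh d A dl (a, d)) - d) a0 p -> ~ domain (wave_of (water_flow d A G Om dl jn)) p.
Proof.
  intros H Ha0 [[a s] [[Ha Hs] <-]] [[a' t] [Ht E]]. cbn [Re Im fst snd] in Ha, Hs. unfold ostrip in Ht. simpl in Ht.
  unfold lens_map in E. cbn [Re Im fst snd cz water_flow] in E.
  destruct (fold_angle a') as [n [sg [b [Hsg [Hb Eb]]]]].
  destruct (Zh_fold d A dl kap n sg b t H ltac:(lra) Hsg) as [X Y]. rewrite <- Eb in X, Y.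
  assert (E1 := f_equal Re E). assert (E2 := f_equal Im E). cbn [Re Im fst snd] in E1, E2.
  replace (Re (Zh d A dl (a', t) - (0, d))%C) with (Re (Zh d A dl (a', t))) in E1 by (unfold Re; simpl; ring).
  replace (Im (Zh d A dl (a', t) - (0, d))%C) with (Im (Zh d A dl (a', t)) - d) in E2 by (unfold Im; simpl; ring).
  assert (Nq : ((b, t) : C) <> (a, d)) by (intros K; injection K; lra).
  assert (K := Zh_noshiro d A dl kap (a, d) (b, t) H).
  cbn [Re Im fst snd] in K. specialize (K ltac:(lra) ltac:(lra) ltac:(lra) ltac:(lra) Nq).
  set (x := Re (Zh d A dl (a, d))) in *. set (x' := Re (Zh d A dl (b, t))) in *.
  replace (Im ((Zh d A dl (b, t) - Zh d A dl (a, d)) * Cconj ((b, t) - (a, d)))%C) with ((x' - x) * (d - t) + (Im (Zh d A dl (b, t)) - Im (Zh d A dl (a, d))) * (b - a)) in K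
    by (unfold x, x', Cconj, Re, Im; simpl; ring).
  replace (Im (Zh d A dl (b, t)) - Im (Zh d A dl (a, d))) with 0 in K by lra. rewrite Rmult_0_l, Rplus_0_r in K.
  assert (xx : x < x') by nra.
  destruct (Zh_x_range d A dl kap a d H ltac:(lra) ltac:(lra)) as [B1 _]. fold x in B1.
  assert (B2 : x' <= PI).
  { unfold x'. destruct (Req_dec b 0) as [->|]; [rewrite (Zh_x0 d A dl kap) by (auto; lra); generalize PI_RGT_0; lra|].
    destruct (Req_dec b PI) as [->|]; [rewrite (Zh_xpi d A dl kap) by (auto; lra); lra|].
    destruct (Zh_x_range d A dl kap b t H); lra. }
  assert (SX : - x <= s * x <= x) by nra. rewrite <- E1, X in SX. assert (PP := PI_RGT_0).
  destruct (Z_dec n 0) as [[L|L]|L].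
  - assert (IZR n <= -1) by (apply (IZR_le _ (-1)); lia). destruct Hsg as [-> | ->]; nra.
  - assert (1 <= IZR n) by (apply (IZR_le 1); lia). destruct Hsg as [-> | ->]; nra.
  - subst n. destruct Hsg as [-> | ->]; lra.
Qed.

Lemma water_touching d A G Om dl jn kap a0 : flow_ok (water_flow d A G Om dl jn) -> admissible d A dl kap ->
  0 < a0 < PI -> Re (Zh d A dl (a0, d)) = 0 ->
  Re (Zh1 d A dl (a0, d)) = 0 -> (forall a, 0 < a < PI -> Re (Zh d A dl (a, d)) = 0 -> a = a0) ->
  touching_profile (wave_of (water_flow d A G Om dl jn)).
Proof.
  intros HF H Ha0 Z0 Z1 Uq. assert (H' := H). destruct H' as [HA [Hn Hx]]. assert (Hd : 0 < d) by apply Hn.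
  assert (PP := PI_RGT_0). assert (HA' : 0 <= A <= 23/50) by lra.
  assert (T : Rabs d < Tof d) by (apply abs_T; lra).
  assert (RF := fun a => Zh_refl d A dl kap a d H ltac:(lra)).
  exists (- a0), a0. split; [lra|]. split; [|split; [|split]].
  - rewrite !trace_water, RF. cbn [Re Im fst snd]. rewrite Z0, Ropp_0. reflexivity.
  - intros b1 b2 Hb E. apply trace_eq in E.
    destruct (Zh_coincide d A dl kap b1 d b2 d H ltac:(lra) ltac:(lra) E) as [_ [K|[_ [n [s [a [Hs [K1 [K2 [-> ->]]]]]]]]]]; [lra|].
    apply Uq in K2; [|assumption]. subst a. exists n. destruct Hs as [-> | ->]; lra.
  (* Both tangents are vertical, as [x] is stationary at the contact; the reflection reverses the
     vertical component, hence the factor -1. *)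
  - exists (Zh1 d A dl (- a0, d)), (Zh1 d A dl (a0, d)), (-1).
    split; [apply (trace_derive _ (- a0) HF)|]. split; [apply (trace_derive _ a0 HF)|]. split; [lra|].
    destruct (Zh1_fold d A dl kap 0 (-1) a0 d HA' Hn ltac:(lra) ltac:(auto)) as [R I].
    replace (2 * PI * 0 + -1 * a0) with (- a0) in R, I by ring.
    apply C_ext.
    + replace (Re (RtoC (-1) * Zh1 d A dl ((- a0)%R, d))%C) with (- Re (Zh1 d A dl ((- a0)%R, d))) by (unfold Re; simpl; ring). rewrite R. lra.
    + replace (Im (RtoC (-1) * Zh1 d A dl ((- a0)%R, d))%C) with (- Im (Zh1 d A dl ((- a0)%R, d))) by (unfold Im; simpl; ring). rewrite I. lra.
  - destruct (lens_bubble (fun a => Re (Zh d A dl (a, d))) (fun a => Im (Zh d A dl (a, d)) - d) a0) as [B1 [B2 B3]].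
    + lra.
    + intros a. apply (ex_derive_continuous (fun a => Re (Zh d A dl (a, d)))). eexists. apply (hol_dx_re _ _ (Tof d) a d (hol_Zh A dl kap d HA' Hn) T).
    + intros a. apply (continuous_minus (V := R_NormedModule)); [|apply continuous_const].
      apply (ex_derive_continuous (fun a => Im (Zh d A dl (a, d)))). eexists. apply (hol_dx_im _ _ (Tof d) a d (hol_Zh A dl kap d HA' Hn) T).
    + intros a a' C1 C2 C3. assert (K := Zh_y_incr d A dl kap a a' d H C1 C2 ltac:(lra) ltac:(lra)). lra.
    + intros a Ha. assert (K := Hx a ltac:(lra)). destruct (Req_dec (Re (Zh d A dl (a, d))) 0) as [C|C]; [|lra].
      apply Uq in C; lra.
    + apply (Zh_x0 d A dl kap); [assumption|lra].
    + exact Z0.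
    + eexists. split; [exact B1|]. split; [exact B2|]. split; [|intros p; apply (bubble_outside d A G Om dl jn kap a0 p H Ha0)].
      intros p. rewrite (B3 p). split.
      * intros [a [Ha [-> | ->]]]; [exists a|exists (- a)]; (split; [lra|]); rewrite trace_water; [reflexivity|].
        rewrite RF. reflexivity.
      * intros [b [Hb <-]]. rewrite trace_water. destruct (Rle_lt_dec 0 b) as [L|L].
        -- exists b. split; [lra|]. left; reflexivity.
        -- exists (- b). split; [lra|]. right. rewrite RF. cbn [Re Im fst snd]. f_equal. ring.
Qed.

(** * Continuity in the Hoelder norm *)

Definition cosine_series (c : nat -> R) (al : R) : R := W c 0 1 al 0.
(** One power of [k] more than the order 3: the Hoelder seminorm of the third derivative is
    controlled through a Lipschitz bound. *)
Definition S4 (c : nat -> R) : R := Series (fun k => Rabs (c k) * INR k ^ 4).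

Lemma iter_kc c j k : Nat.iter j kc c k = INR k ^ j * c k.
Proof. induction j as [|j IH]; simpl; [ring|]. unfold kc at 1. rewrite IH. ring. Qed.
Lemma okc_iter c T j : okc c T -> okc (Nat.iter j kc c) T.
Proof. intros H. induction j as [|j IH]; [exact H|apply okc_kc, IH]. Qed.

Lemma cosine_Derive_n c j : okc c 0 -> Derive_n (cosine_series c) j = fun al => W (Nat.iter j kc c) (INR j * (PI / 2)) 1 al 0.
Proof.
  intros H. induction j as [|j IH]; apply functional_extensionality; intros al.
  - simpl. rewrite Rmult_0_l. reflexivity.
  - simpl Derive_n. rewrite IH. rewrite S_INR. replace ((INR j + 1) * (PI / 2)) with (INR j * (PI / 2) + PI / 2) by ring.
    apply is_derive_unique, (W_dal _ _ _ _ _ 0 (okc_iter c 0 j H)); [rewrite Rabs_R1; lra|rewrite Rabs_R0; lra].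
Qed.

Lemma cnorm_S4 c j : okc c 0 -> c O = 0 -> (j <= 4)%nat -> cnorm (Nat.iter j kc c) 0 <= S4 c.
Proof.
  intros H H0 Hj. unfold cnorm, S4. apply Series_le.
  - intros k. rewrite Rmult_0_r, exp_0, Rmult_1_r. split; [apply Rabs_pos|]. rewrite iter_kc.
    destruct k as [|k]; [rewrite H0, Rmult_0_r, Rabs_R0; lra|].
    rewrite Rabs_mult, (Rabs_pos_eq (INR (S k) ^ j)) by (apply pow_le, pos_INR). rewrite Rmult_comm.
    apply Rmult_le_compat_l; [apply Rabs_pos|]. apply Rle_pow; [rewrite S_INR; generalize (pos_INR k); lra|exact Hj].
  - eapply ex_series_ext; [|apply (H 4%nat)]. intros k. simpl. rewrite Rmult_0_r, exp_0, Rmult_1_r. reflexivity.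
Qed.

Lemma Lub_finite (E : R -> Prop) M : (exists r, E r) -> (forall r, E r -> 0 <= r <= M) -> exists l, Lub_Rbar E = Finite l /\ 0 <= l <= M.
Proof.
  intros [r Hr] H. destruct (Lub_Rbar_correct E) as [U L]. specialize (L (Finite M)).
  assert (HM : is_ub_Rbar E (Finite M)) by (intros x Hx; apply (H x Hx)). specialize (L HM). specialize (U r Hr). specialize (H r Hr).
  destruct (Lub_Rbar E) as [l| |]; simpl in *; try tauto. exists l. split; [reflexivity|lra].
Qed.

Lemma sup_norm_W c phi : okc c 0 -> exists l, sup_norm (fun al => W c phi 1 al 0) = Finite l /\ 0 <= l <= cnorm c 0.
Proof.
  intros H. apply Lub_finite; [exists (Rabs (W c phi 1 0 0)), 0; reflexivity|].
  intros r [a ->]. split; [apply Rabs_pos|]. apply (W_le c phi 1 a 0 0 H); [rewrite Rabs_R1; lra|rewrite Rabs_R0; lra].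
Qed.

(** Distances up to 1 are covered by the Lipschitz bound, larger ones by the sup norm, so the bound
    does not depend on [theta]. *)
Lemma holder_W theta c phi : 0 < theta < 1 -> okc c 0 ->
  exists l, holder_seminorm theta (fun al => W c phi 1 al 0) = Finite l /\ 0 <= l <= 2 * cnorm c 0 + cnorm (kc c) 0.
Proof.
  intros Ht H. assert (B : forall a, Rabs (W c phi 1 a 0) <= cnorm c 0) by (intros; apply (W_le c phi 1 a 0 0 H); [rewrite Rabs_R1; lra|rewrite Rabs_R0; lra]).
  set (L := cnorm (kc c) 0).
  assert (DB : forall a, Rabs (W (kc c) (phi + PI / 2) 1 a 0) <= L) by (intros; apply (W_le _ _ 1 a 0 0 (okc_kc c 0 H)); [rewrite Rabs_R1; lra|rewrite Rabs_R0; lra]).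
  assert (Lip : forall a b, Rabs (W c phi 1 a 0 - W c phi 1 b 0) <= L * Rabs (a - b)).
  { intros a b. destruct (MVT_gen (fun a => W c phi 1 a 0) b a (fun a => W (kc c) (phi + PI / 2) 1 a 0)) as [x [_ E]].
    - intros x _. apply (W_dal c phi 1 x 0 0 H); [rewrite Rabs_R1; lra|rewrite Rabs_R0; lra].
    - intros x _. apply continuity_pt_filterlim. apply (ex_derive_continuous (fun a => W c phi 1 a 0)). eexists.
      apply (W_dal c phi 1 x 0 0 H); [rewrite Rabs_R1; lra|rewrite Rabs_R0; lra].
    - rewrite E, Rabs_mult. apply Rmult_le_compat_r; [apply Rabs_pos|apply DB]. }
  assert (L0 : 0 <= L) by (generalize (DB 0) (Rabs_pos (W (kc c) (phi + PI / 2) 1 0 0)); lra).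
  assert (N0 : 0 <= cnorm c 0) by (generalize (B 0) (Rabs_pos (W c phi 1 0 0)); lra).
  apply Lub_finite; [exists (Rabs (W c phi 1 1 0 - W c phi 1 0 0) / Rpower (Rabs (1 - 0)) theta), 1, 0; split; [lra|reflexivity]|].
  intros r [a [b [Hab ->]]]. set (m := Rabs (a - b)). assert (Hm : 0 < m) by (apply Rabs_pos_lt; lra).
  assert (P : 0 < Rpower m theta) by apply exp_pos.
  split; [apply Rmult_le_pos; [apply Rabs_pos|apply Rlt_le, Rinv_0_lt_compat, P]|].
  apply (Rmult_le_reg_r (Rpower m theta)); [exact P|]. unfold Rdiv. rewrite Rmult_assoc, Rinv_l, Rmult_1_r by lra.
  destruct (Rle_lt_dec m 1) as [C|C].
  - assert (m <= Rpower m theta).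
    { rewrite <- (Rpower_1 m) at 1 by assumption. unfold Rpower. apply exp_le.
      assert (ln m <= 0) by (rewrite <- ln_1; apply ln_le; lra). nra. }
    eapply Rle_trans; [apply Lip|]. fold m. assert (L * m <= L * Rpower m theta) by (apply Rmult_le_compat_l; assumption).
    assert (0 <= cnorm c 0 * Rpower m theta) by (apply Rmult_le_pos; lra). lra.
  - assert (1 <= Rpower m theta).
    { rewrite <- (Rpower_O m Hm). unfold Rpower. apply exp_le. assert (0 <= ln m) by (rewrite <- ln_1; apply ln_le; lra). nra. }
    eapply Rle_trans; [apply (Rabs_triang (W c phi 1 a 0) (- W c phi 1 b 0))|]. rewrite Rabs_Ropp. generalize (B a) (B b). nra.
Qed.

(** Four sup norms and the seminorm with its 2 + 1 contributions give 7, each of them being at most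
    [S4 c]. *)
Lemma cosine_holder theta c : 0 < theta < 1 -> okc c 0 -> c O = 0 ->
  exists r, holder_norm 3 theta (cosine_series c) = Finite r /\ r <= 7 * S4 c.
Proof.
  intros Ht H H0. unfold holder_norm. cbn [Ck_norm]. rewrite !cosine_Derive_n by assumption.
  assert (N := fun j => cnorm_S4 c j H H0).
  destruct (sup_norm_W c 0 H) as [l0 [E0 B0]]. destruct (sup_norm_W _ (INR 1 * (PI / 2)) (okc_iter c 0 1 H)) as [l1 [E1 B1]].
  destruct (sup_norm_W _ (INR 2 * (PI / 2)) (okc_iter c 0 2 H)) as [l2 [E2 B2]].
  destruct (sup_norm_W _ (INR 3 * (PI / 2)) (okc_iter c 0 3 H)) as [l3 [E3 B3]].
  destruct (holder_W theta _ (INR 3 * (PI / 2)) Ht (okc_iter c 0 3 H)) as [l4 [E4 B4]].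
  change (fun al : R => W c 0 1 al 0) with (cosine_series c) in E0. rewrite E0, E1, E2, E3, E4. simpl Rbar_plus.
  eexists. split; [reflexivity|].
  assert (N0 := N 0%nat ltac:(lia)). assert (N1 := N 1%nat ltac:(lia)). assert (N2 := N 2%nat ltac:(lia)).
  assert (N3 := N 3%nat ltac:(lia)). assert (N4 := N 4%nat ltac:(lia)).
  change (Nat.iter 0 kc c) with c in N0. change (kc (Nat.iter 3 kc c)) with (Nat.iter 4 kc c) in B4. lra.
Qed.

Lemma cosine_holder_space theta c : 0 < theta < 1 -> okc c 0 -> c O = 0 -> holder_space 3 theta (cosine_series c).
Proof.
  intros Ht H H0. split; [|split].
  - intros a. unfold cosine_series. rewrite <- (W_perZ c 0 1 1 a 0). f_equal. ring.
  - intros j a _. destruct j as [|j]; [exact I|]. simpl. rewrite cosine_Derive_n by assumption. eexists.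
    apply (W_dal _ _ _ _ _ 0 (okc_iter c 0 j H)); [rewrite Rabs_R1; lra|rewrite Rabs_R0; lra].
  - destruct (cosine_holder theta c Ht H H0) as [r [E _]]. rewrite E. exact I.
Qed.

Definition elev (d A : R) (dl : nat -> R) (k : nat) : R := gz A dl k * (1 - exp (-2 * d) ^ k).

Lemma exp_pow_range d k : 0 < d -> 0 <= exp (-2 * d) ^ k <= 1.
Proof.
  intros H. assert (0 < exp (-2 * d) <= 1) by (split; [apply exp_pos|rewrite <- exp_0; apply exp_le; lra]).
  split; [apply pow_le; lra|]. rewrite <- (pow1 k). apply pow_incr. lra.
Qed.

Lemma okc_geo c M : (forall k, Rabs (c k) <= M * (2/3) ^ k) -> okc c 0.
Proof.
  intros H j. apply (ex_series_leR _ (fun k => M * (2/3) ^ k * INR k ^ j)); [|apply ex_series_geo_pow].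
  intros k. rewrite Rmult_0_r, exp_0, Rmult_1_r, Rabs_mult, Rabs_Rabsolu, (Rabs_pos_eq (INR k ^ j)) by (apply pow_le, pos_INR).
  apply Rmult_le_compat_r; [apply pow_le, pos_INR|apply H].
Qed.

Lemma elevation_water d A G Om dl jn kap : 0 <= A <= 23/50 -> near_crapper d dl kap ->
  elevation (wave_of (water_flow d A G Om dl jn)) = cosine_series (elev d A dl).
Proof.
  intros HA Hn. assert (Hd : 0 < d) by apply Hn. apply functional_extensionality. intros al. unfold elevation. rewrite trace_water. cbn [Im snd].
  rewrite (Zh_im A dl kap) by (try assumption; rewrite Rabs_pos_eq; generalize (Tof_gt d); lra).
  rewrite xx_top, yy_top. unfold cosine_series, W. match goal with |- d + ?X - d = _ => replace (d + X - d) with X by ring end.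
  apply Series_ext. intros k. unfold wterm, elev. rewrite pow1, Rplus_0_r, !Rmult_0_r, exp_0. ring.
Qed.

Lemma elev_0 d A dl : elev d A dl O = 0.
Proof. unfold elev. simpl. ring. Qed.

Lemma elev_bound d dlf kap k s : family d dlf kap -> Rabs (elev d (amp s) (dls dlf s) k) <= 21 * (2/3) ^ k.
Proof.
  intros H. unfold elev. rewrite Rabs_mult. assert (E := exp_pow_range d k (fam_d d dlf kap H)).
  rewrite (Rabs_pos_eq (1 - exp (-2 * d) ^ k)) by lra.
  generalize (gz_bound d dlf kap k s H) (Rabs_pos (gz (amp s) (dls dlf s) k)). nra.
Qed.

Lemma elev_continuous d dlf kap theta s eps : family d dlf kap -> 0 < theta < 1 -> 0 < eps -> exists dl, 0 < dl /\
  forall s', Rabs (s' - s) < dl -> Rbar_lt (holder_norm 3 theta (fun al => cosine_series (elev d (amp s') (dls dlf s')) al -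
     cosine_series (elev d (amp s) (dls dlf s)) al)) eps.
Proof.
  intros H Ht He.
  destruct (dominated_series_cont (fun k s => elev d (amp s) (dls dlf s) k) 21 4 s) with (eps := eps / 7) as [dl [D Hdl]].
  - intros k. unfold elev. apply (continuous_mult (K := R_AbsRing)); [apply (gz_continuous d dlf kap), H|apply continuous_const].
  - intros k u. apply (elev_bound d dlf kap), H.
  - lra.
  - exists dl. split; [assumption|]. intros s' Hs'. specialize (Hdl s' Hs').
    set (c := fun k => elev d (amp s') (dls dlf s') k - elev d (amp s) (dls dlf s) k).
    assert (Oc : okc c 0).
    { apply (okc_geo c 42). intros k. unfold c. eapply Rle_trans; [apply (Rabs_triang (elev d (amp s') (dls dlf s') k) (- elev d (amp s) (dls dlf s) k))|]. rewrite Rabs_Ropp.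
      generalize (elev_bound d dlf kap k s' H) (elev_bound d dlf kap k s H). lra. }
    replace (fun al => cosine_series (elev d (amp s') (dls dlf s')) al - cosine_series (elev d (amp s) (dls dlf s)) al) with (cosine_series c).
    + destruct (cosine_holder theta c Ht Oc) as [r [E Hr]]; [unfold c; rewrite !elev_0; ring|]. rewrite E. unfold S4, c in Hr. simpl. lra.
    + apply functional_extensionality. intros al. unfold cosine_series, W.
      assert (EX : forall u, ex_series (wterm (elev d (amp u) (dls dlf u)) 0 1 al 0)).
      { intros u. apply (ex_wterm _ _ _ _ _ 0 (okc_geo _ 21 (fun k => elev_bound d dlf kap k u H))); [rewrite Rabs_R1; lra|rewrite Rabs_R0; lra]. }
      rewrite <- Series_minus by apply EX. apply Series_ext. intros k. unfold wterm, c. ring.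
Qed.

(** * The curve from the laminar flow to contact *)

Lemma small_exp x : 0 < x -> exists d0, 0 < d0 /\ forall d, d0 <= d -> exp (- d) <= x.
Proof.
  intros H. exists (Rmax 1 (- ln x)). split; [eapply Rlt_le_trans; [|apply Rmax_l]; lra|].
  intros d Hd. assert (R := Rmax_r 1 (- ln x)). rewrite <- (exp_ln x H). apply exp_le. lra.
Qed.

(** At amplitude zero the conformal map is a vertical shift and the complex potential is linear, so
    [Psi] is a function of the height. *)
Lemma laminar_water d A G Om dl jn : A = 0 -> (forall n, jn (S n) = 0) -> flow_ok (water_flow d A G Om dl jn) ->
  laminar_flow G d (wave_of (water_flow d A G Om dl jn)).
Proof.
  intros -> Hj HF. assert (Hd := ok_d _ HF). cbn [cd_ water_flow] in Hd.
  split; [apply (wave_solution _ HF); left; apply (water_injective d 0 G Om dl jn 0); [lra|auto]|]. split.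
  - exists 0. intros p. split.
    + intros [a <-]. rewrite trace_water, Zh_zero. simpl. ring.
    + intros Hp. exists (Re p). rewrite trace_water, Zh_zero. apply C_ext; unfold Re, Im in *; simpl; lra.
  - intros p q Hp Hq E. destruct (closure_cz _ p HF Hp) as [b [Hb <-]]. destruct (closure_cz _ q HF Hq) as [b' [Hb' <-]].
    rewrite !stream_cz by assumption. unfold Psi, potential. rewrite E. f_equal. f_equal.
    cbn [cz cj water_flow] in *. rewrite !Zh_zero in E. rewrite !(Lc_const _ _ _ _ Hj). unfold Im in *; simpl in *.
    replace (snd b) with (snd b') by lra. ring.
Qed.

Theorem theorem9 (theta : R) (htheta : 0 < theta < 1) :
  exists epsilon : R, 0 < epsilon /\
  forall G : R, - epsilon < G < epsilon ->
  exists H0 : R, 0 < H0 /\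
  forall H : R, H0 <= H ->
  exists w : R -> wave,
    continuous_curve theta G H w /\
    laminar_flow G H (w 0) /\
    touching_wave G H (w 1).
Proof.
  (* The second bound is chosen to give [22 * kap * S3 <= 1/2000], since 44000 = 22 * 2000. *)
  set (kap := Rmin (1/10000) (1 / (44000 * (S3 + 1)))).
  assert (S0 := S3_pos).
  assert (K0 : 0 < kap) by (apply Rmin_glb_lt; [lra|apply Rdiv_lt_0_compat; lra]).
  assert (K1 : kap <= 1/10000) by apply Rmin_l.
  assert (K2 : 22 * kap * S3 <= 1/2000).
  { assert (R := Rmin_r (1/10000) (1 / (44000 * (S3 + 1)))). fold kap in R.
    apply (Rmult_le_compat_r (44000 * (S3 + 1))) in R; [|lra]. unfold Rdiv in R. rewrite Rmult_assoc, Rinv_l in R by lra. nra. }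
  destruct (wave_coefs kap K0) as [t [T0 [T1 HW]]]. exists t. split; [assumption|]. intros G HG.
  (* [d1] serves [near_crapper], [d2] the smallness of [exp (-2 d)] in [wave_coefs]. The bound [t]
     on [G] is already fixed, so [epsilon] does not depend on the depth. *)
  destruct (small_exp kap K0) as [d1 [D1 E1]]. destruct (small_exp t T0) as [d2 [D2 E2]].
  exists (Rmax d1 d2). split; [eapply Rlt_le_trans; [exact D1|apply Rmax_l]|]. intros d Hd.
  assert (M1 := Rmax_l d1 d2). assert (M2 := Rmax_r d1 d2).
  destruct (HW (exp (-2 * d)) G) as [dl [j [Om [C [P1 [P2 [P3 [P4 [P5 [P6 [P7 P8]]]]]]]]]]].
  { split; [apply exp_pos|]. eapply Rle_trans; [|apply (E2 d); lra]. apply exp_le. lra. }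
  { apply Rabs_le. lra. }
  clear HW.
  assert (HF : family d dl kap).
  { split; [assumption|]. intros s. unfold near_crapper. repeat split; auto; try lra. apply E1. lra. }
  destruct (critical_amplitude d dl kap HF) as [As [A1 [A2 [A3 [a0 [A4 A5]]]]]].
  assert (PL := PI_low).
  set (jn := fun s n => j n (amp s)).
  set (fl := fun s => water_flow d (amp s) G (Om (amp s)) (dls dl s) (jn s)).
  assert (ADM : forall s, 0 < s <= As -> admissible d (amp s) (dls dl s) kap).
  { intros s Hs. split; [rewrite amp_id; lra|]. split; [apply (fam_near d dl kap), HF|]. intros al Hal.
    destruct (Req_dec s As) as [->|]; [apply A3, Hal|apply Rlt_le, A2; [lra|assumption]]. }
  assert (OK : forall s, 0 <= s <= As -> flow_ok (fl s)).
  { intros s Hs. apply (water_flow_ok _ _ _ _ _ _ kap).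
    - apply (fam_near d dl kap), HF.
    - exists C. intros k. apply P5.
    - destruct (Req_dec s 0) as [->|]; [left|right; apply ADM; lra]. rewrite amp_id by lra. split; [reflexivity|].
      intros n. unfold jn. rewrite amp_id by lra. apply P7.
    - intros al. exact (P8 (amp s) (amp_range s) al). }
  assert (TP : touching_profile (wave_of (fl As))).
  { destruct (touching_point d dl kap As a0 HF A1 A3 A4 A5) as [Q1 Q2].
    apply (water_touching _ _ _ _ _ _ kap a0 (OK As ltac:(lra)) (ADM As ltac:(lra))); [lra|exact A5|exact Q1|exact Q2]. }
  assert (SOL : forall s, 0 <= s <= As -> solution G d (wave_of (fl s))).
  { intros s Hs. apply (wave_solution _ (OK s Hs)). destruct (Req_dec s As) as [->|N]; [right; exact TP|left].
    apply (water_injective _ _ _ _ _ _ kap); [apply (fam_d d dl kap), HF|].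
    destruct (Req_dec s 0) as [->|]; [left; apply amp_id; lra|right]. split; [apply ADM; lra|].
    intros al Hal. apply Rgt_not_eq, (A2 s); [lra|assumption]. }
  assert (U : forall u, unit_interval u -> 0 <= u * As <= As) by (unfold unit_interval; intros u Hu; nra).
  (* [As] depends on [G] and the depth; the linear rescaling brings the curve onto the unit
     interval. *)
  exists (fun u => wave_of (fl (u * As))). split; [|split].
  - assert (EL : forall s, elevation (wave_of (fl s)) = cosine_series (elev d (amp s) (dls dl s))).
    { intros s. apply (elevation_water _ _ _ _ _ _ kap); [apply amp_range|apply (fam_near d dl kap), HF]. }
    split; [|split; [|split; [|split]]].
    + intros u Hu. split; [apply SOL, U, Hu|]. rewrite EL. apply cosine_holder_space; [assumption| |apply elev_0].
      apply (okc_geo _ 21). intros k. apply (elev_bound d dl kap), HF.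
    + intros u Hu. cbn [vorticity wave_of cOm fl water_flow]. eapply filterlim_filter_le_1; [apply (filter_le_within (F := locally u))|].
      apply (continuous_comp (fun u => amp (u * As)) Om); [|apply P3].
      apply (continuous_comp (fun u => u * As) amp); [|apply amp_bcont].
      apply (continuous_mult (K := R_AbsRing) (fun u => u) (fun _ => As)); [apply continuous_id|apply continuous_const].
    (* The Bernoulli constant is 1/2 and, in the next case, the conformal depth is [d] along the
       whole curve. *)
    + intros u Hu P HP. exists (mkposreal 1 Rlt_0_1). intros v _ _. exact (locally_singleton _ _ HP).
    + intros u Hu P HP. exists (mkposreal 1 Rlt_0_1). intros v _ _. exact (locally_singleton _ _ HP).
    + intros u Hu eps. destruct (elev_continuous d dl kap theta (u * As) eps HF htheta (cond_pos eps)) as [r [R0 HR]].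
      exists (mkposreal r R0). intros v Hv _. change (Rabs (v - u) < r) in Hv. rewrite !EL. apply HR.
      replace (v * As - u * As) with ((v - u) * As) by ring. rewrite Rabs_mult, (Rabs_pos_eq As) by lra.
      generalize (Rabs_pos (v - u)). nra.
  - rewrite Rmult_0_l. apply laminar_water; [apply amp_id; lra| |apply (OK 0); lra].
    intros n. unfold jn. rewrite amp_id by lra. apply P7.
  - rewrite Rmult_1_l. split; [apply SOL; lra|exact TP].
Qed.
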